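(* Let $\Gamma\subset SL(2,\mathbb Z)$ be a congruence subgroup. Then \[ \sum_{N\ge 0}\dim \mathscr D^{ch}(\mathbb H,\Gamma)_N\, q^N=\sum_{m=0}^\infty \sum_{n= 0}^\infty \dim M_{2m}(\Gamma)\, q^{2n+m}\prod_{i=1}^n \frac{1}{1-q^i} \prod_{j=1}^{m+n}\frac{1}{1-q^j}, \] where $\mathscr D^{ch}(\mathbb H,\Gamma)_N$ is the conformal weight $N$ subspace of $\mathscr D^{ch}(\mathbb H,\Gamma)$.
   Context: Let $\mathbb H=\{\tau\in\mathbb C:\operatorname{Im}\tau>0\}$ and $\mathcal O(\mathbb H)$ its ring of holomorphic functions. Let $V=\mathbb C[a_{-1},a_{-2},\dots,b_0,b_{-1},b_{-2},\dots]$ be the vacuum module of the Heisenberg Lie algebra with basis $a_n,b_n$ ($n\in\mathbb Z$) and central element $C$, $[a_m,b_n]=\delta_{m,-n}C$ (with $a_m1=0$ for $m\ge0$, $b_n1=0$ for $n>0$, $C=1$); it is a vertex algebra with fields $a(z)=\sum_n a_nz^{-n-1}$, $b(z)=\sum_n b_nz^{-n}$ and conformal vector $\omega=a_{-1}b_{-1}$. The vertex algebra of chiral differential operators on $\mathbb H$ (Malikov–Schechtman–Vaintrob) is $\mathscr D^{ch}(\mathbb H)=V\otimes_{\mathbb C[b_0]}\mathcal O(\mathbb H)$, where $b_0\mapsto\tau$; write $b=b_0$. For $f\in\mathcal O(\mathbb H)$, $Y(f,z)=\sum_{i\ge0}\frac{f^{(i)}(b)}{i!}\big(\sum_{n\ne0}b_nz^{-n}\big)^i$.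 Conformal weight: $a_{-n},b_{-n}$ have weight $n$, elements of $\mathcal O(\mathbb H)$ weight $0$. For a partition $\lambda=(\lambda_{(1)}\ge\dots\ge\lambda_{(d)}\ge1)$ let $p(\lambda)=d$, $|\lambda|=\sum_i\lambda_{(i)}$, $a_{-\lambda}=a_{-\lambda_{(1)}}\cdots a_{-\lambda_{(d)}}$, similarly $b_{-\mu}$ (empty partition allowed, $a_{-\emptyset}=b_{-\emptyset}=1$). Every element of $\mathscr D^{ch}(\mathbb H)$ is uniquely a finite sum $\sum a_{-\lambda}b_{-\mu}f_{\lambda,\mu}(b)$ with $f_{\lambda,\mu}\in\mathcal O(\mathbb H)$. The group $SL(2,\mathbb R)$ acts on the right on $\mathscr D^{ch}(\mathbb H)$ by vertex algebra automorphisms $\pi(g)$ (so $\pi(g_1g_2)=\pi(g_2)\pi(g_1)$), obtained by integrating the action of the zero modes of $E=-a_{-1}$, $F=a_{-1}b_0^2+2b_{-1}$, $H=-2a_{-1}b_0$ via $\pi(e^x)=\exp(-x_{(0)})$; for $g=\begin{pmatrix}\alpha&\beta\\\gamma&\delta\end{pmatrix}$ it satisfies $\pi(g)a_{-1}=a_{-1}(\gamma b+\delta)^2+2\gamma^2b_{-1}$ and $\pi(g)f(b)=f\big(\frac{\alpha b+\beta}{\gamma b+\delta}\big)$; it preserves conformal weight. Let $\Gamma\subset SL(2,\mathbb Z)$ be a congruence subgroup. For a $\Gamma$-invariant $v$ and a cusp $c\in\mathbb Q\cup\{\infty\}$ choose $\rho\in SL(2,\mathbb Z)$ with $\rho(c)=\infty$;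 then $\pi(\rho)v=\sum a_{-\lambda}b_{-\mu}\tilde f_{\lambda,\mu}$ is fixed by $\begin{pmatrix}1&N\\0&1\end{pmatrix}$ for some integer $N>0$, so each $\tilde f_{\lambda,\mu}$ has an expansion $\sum_m\tilde u_{\lambda,\mu}(m)e^{2\pi i m\tau/N}$; $v$ is holomorphic at $c$ if $\tilde u_{\lambda,\mu}(m)=0$ for all $m<0$ and all $(\lambda,\mu)$. $\mathscr D^{ch}(\mathbb H,\Gamma)$ denotes the set of $\Gamma$-invariant elements of $\mathscr D^{ch}(\mathbb H)$ holomorphic at all cusps. $M_k(\Gamma)$ is the space of holomorphic modular forms of weight $k$ for $\Gamma$ (holomorphic at all cusps). *)

(* Defs.v *)
From mathcomp Require Import all_boot all_order all_algebra.
From mathcomp Require Import all_classical all_reals all_analysis.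
From mathcomp Require Import complex.
From mathcomp Require Import Rstruct Rstruct_topology.
From Stdlib Require List.
Import Order.TTheory GRing.Theory Num.Theory numFieldNormedType.Exports.

Set Implicit Arguments.
Unset Strict Implicit.
Unset Printing Implicit Defensive.

Local Open Scope classical_set_scope.
Local Open Scope ring_scope.

Notation R := Rdefinitions.R.
Notation C := (R[i])^o.

Definition inH (z : C) : Prop := 0 < complex.Im z.
Definition fn := C -> C.
Definition holo (f : fn) : Prop := forall z, inH z -> derivable f z 1.
Definition der (f : fn) : fn := fun z => derive1 f z.
Definition dern (i : nat) (f : fn) : fn := iter i der f.

(** e^{2 pi i z / N} *)
Definition qN (N : nat) (z : C) : C :=
  let r := expR (- (2 * pi * complex.Im z / N%:R)) in
  let t := 2 * pi * complex.Re z / N%:R in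
  complex.Complex (r * cos t) (r * sin t).

Definition qexp_holo (N : nat) (f : fn) : Prop :=
  exists u : nat -> C, forall z, inH z ->
    \sum_(m < M) u m * qN N z ^+ m @[M --> \oo] --> f z.

Definition ga (g : 'M[int]_2) : int := g ord0 ord0.
Definition gb (g : 'M[int]_2) : int := g ord0 ord_max.
Definition gc (g : 'M[int]_2) : int := g ord_max ord0.
Definition gd (g : 'M[int]_2) : int := g ord_max ord_max.
Definition SL2Z (g : 'M[int]_2) : Prop := \det g = 1.
Definition mob (g : 'M[int]_2) : fn :=
  fun z => ((ga g)%:~R * z + (gb g)%:~R) / ((gc g)%:~R * z + (gd g)%:~R).
Definition Tmat (N : nat) : 'M[int]_2 :=
  \matrix_(i < 2, j < 2) (if i == j then 1 else if i == ord0 then N%:Z else 0).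
(** cusps Q u {oo}, None standing for oo;  maps_to_inf g c <-> g(c) = oo *)
Definition maps_to_inf (g : 'M[int]_2) (c : option rat) : Prop :=
  match c with
  | None => gc g = 0
  | Some x => (gc g)%:~R * x + (gd g)%:~R = 0 :> rat
  end.

Definition congruence_subgroup (G : 'M[int]_2 -> Prop) : Prop :=
  [/\ (forall g, G g -> SL2Z g), G 1%:M,
      (forall x y, G x -> G y -> G (x *m y)),
      (forall x, G x -> G (\adj x)) &
      exists N : nat, (0 < N)%N /\
        forall g, SL2Z g ->
          (forall i j, (N%:Z %| g i j - (i == j)%:Z)%Z) -> G g].

Definition slash (k : nat) (f : fn) (g : 'M[int]_2) : fn :=
  fun z => ((gc g)%:~R * z + (gd g)%:~R)^-1 ^+ k * f (mob g z).

Definition modform (k : nat) (G : 'M[int]_2 -> Prop) (f : fn) : Prop :=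
  [/\ holo f,
      (forall g, G g -> forall z, inH z ->
          f (mob g z) = ((gc g)%:~R * z + (gd g)%:~R) ^+ k * f z) &
      (forall (c : option rat) (r : 'M[int]_2), SL2Z r -> maps_to_inf r c ->
        forall N : nat, (0 < N)%N ->
          (forall z, inH z -> slash k f r (z + N%:R) = slash k f r z) ->
          qexp_holo N (slash k f r))].

(** ** The vertex algebra D^ch(H)
    An element is a finite formal sum of terms  a_{-lambda} b_{-mu} f(b),
    a term being ((lambda, mu), f) with lambda, mu partitions written as
    nonincreasing sequences of positive integers. *)
Definition part := seq nat.
Definition geq_rel := fun x y : nat => (y <= x)%N.
Definition is_part (l : part) : bool := sorted geq_rel l && all (fun x => 0 < x)%N l.
Definition ins (n : nat) (l : part) : part := sort geq_rel (n :: l).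

Definition term := ((part * part) * fn)%type.
Definition elt := seq term.

Definition lift (o : term -> elt) (v : elt) : elt := flatten (map o v).
Definition tscale (c : fn) (t : term) : term := (t.1, fun z => c z * t.2 z).

Definition amode (k : int) (t : term) : elt :=
  let: ((l, m), f) := t in
  match k with
  | Posz 0 => [:: ((l, m), der f)]                                  (* a_0 = d/db_0 *)
  | Posz n => [:: ((l, rem n m), fun z => (count_mem n m)%:R * f z)] (* a_n = d/db_{-n} *)
  | Negz n => [:: ((ins n.+1 l, m), f)]
  end.
Definition bmode (k : int) (t : term) : elt :=
  let: ((l, m), f) := t in
  match k with
  | Posz 0 => [:: ((l, m), fun z => z * f z)]
  | Posz n => [:: ((rem n l, m), fun z => - ((count_mem n l)%:R * f z))] (* b_n = -d/da_{-n} *)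
  | Negz n => [:: ((l, ins n.+1 m), f)]
  end.

Definition nzrange (B : nat) : seq int :=
  [seq Posz n.+1 | n <- iota 0 B] ++ [seq Negz n | n <- iota 0 B].
Fixpoint nzseqs (i B : nat) : seq (seq int) :=
  match i with
  | 0 => [:: [::]]
  | i'.+1 => flatten [seq [seq n :: s | s <- nzseqs i' B] | n <- nzrange B]
  end.
Definition bprod (s : seq int) (t : term) : elt :=
  foldr (fun n acc => lift (bmode n) acc) [:: t] s.

(** The k-th mode f_(k) of Y(f,z) = sum_i f^(i)(b)/i! (sum_{n<>0} b_n z^{-n})^i,
    i.e. sum over i and (n_1,...,n_i) nonzero with n_1+...+n_i = k+1.
    On a term a_{-lambda} b_{-mu} g all nonzero contributions have
    i <= B and |n_j| <= B where B = 2|lambda| + |k| + 1, so the sum is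
    truncated there (all other summands vanish). *)
Definition fmode (f : fn) (k : int) (t : term) : elt :=
  let B := (2 * sumn t.1.1 + `|k| + 1)%N in
  flatten [seq
    flatten [seq (if \sum_(n <- s) n == k + 1 then
                    [seq tscale (fun z => (i`!%:R)^-1 * dern i f z) u | u <- bprod s t]
                  else [::]) | s <- nzseqs i B]
  | i <- iota 0 B.+1].

(** pi(g) a_{-1} = a_{-1} h(b) + cc b_{-1},  h(b) = (c b + d)^2, cc = 2 c^2.
    Y(a_{-1} h, z) = :a(z) Y(h,z):  and  Y(b_{-1},z) = d/dz b(z), so
    (pi(g)a_{-1})_(k) = sum_{j<0} a_j h_(k-j-1) + sum_{j>=0} h_(k-j-1) a_j - k cc b_k.
    On a term a_{-lambda} b_{-mu} f only  -(|lambda|+|k|+1) <= j <= |mu|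
    can contribute, so the sums are truncated there. *)
Definition Amode (g : 'M[int]_2) (k : int) (t : term) : elt :=
  let h : fn := fun z => ((gc g)%:~R * z + (gd g)%:~R) ^+ 2 in
  let cc : C := 2 * ((gc g)%:~R) ^+ 2 in
  let L := (sumn t.1.1 + `|k| + 1)%N in
  let M := sumn t.1.2 in
  flatten [seq lift (amode j) (fmode h (k - j - 1) t) | j <- [seq Negz n | n <- iota 0 L]]
  ++ flatten [seq lift (fmode h (k - j - 1)) (amode j t) | j <- [seq Posz n | n <- iota 0 M.+1]]
  ++ [seq tscale (fun _ => cc * (- k)%:~R) u | u <- bmode k t].

(** pi(g) is the vertex algebra automorphism with pi(g) a_{-1} as above and
    pi(g) f(b) = f(g b); since a_{-n} = (a_{-1})_(-n) and b_{-n} = (b)_(-n-1),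
    pi(g)(a_{-l_1}..a_{-l_d} b_{-m_1}..b_{-m_e} f)
      = (pi(g)a_{-1})_(-l_1) .. (pi(g)a_{-1})_(-l_d)
        (pi(g)b)_(-m_1-1) .. (pi(g)b)_(-m_e-1) (f o g). *)
Definition pi_term (g : 'M[int]_2) (t : term) : elt :=
  let: ((l, m), f) := t in
  foldr (fun n acc => lift (Amode g (- n%:Z)) acc)
    (foldr (fun n acc => lift (fmode (mob g) (- n%:Z - 1)) acc)
       [:: (([::], [::]), fun z => f (mob g z))] m) l.
Definition piact (g : 'M[int]_2) (v : elt) : elt := lift (pi_term g) v.

(** coefficient f_{lambda,mu} of an element, and equality of elements
    (as elements of V (x)_{C[b_0]} O(H): coefficients agree on H) *)
Definition coefv (v : elt) (p : part * part) : fn :=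
  fun z => \sum_(t <- v | t.1 == p) t.2 z.
Definition eqv (v w : elt) : Prop :=
  forall p z, inH z -> coefv v p z = coefv w p z.
Definition lincomb (cs : seq C) (vs : seq elt) : elt :=
  flatten [seq [seq tscale (fun _ => cw.1) t | t <- cw.2] | cw <- zip cs vs].

Definition weight_elt (N : nat) (v : elt) : Prop :=
  all (fun t => [&& is_part t.1.1, is_part t.1.2 & sumn t.1.1 + sumn t.1.2 == N]%N) v
  /\ List.Forall (fun t => holo t.2) v.

Definition Dch_inv (G : 'M[int]_2 -> Prop) (N : nat) (v : elt) : Prop :=
  [/\ weight_elt N v,
      (forall g, G g -> eqv (piact g v) v) &
      (forall (c : option rat) (r : 'M[int]_2), SL2Z r -> maps_to_inf r c ->
        forall K : nat, (0 < K)%N ->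
          eqv (piact (Tmat K) (piact r v)) (piact r v) ->
          forall p, qexp_holo K (coefv (piact r v) p))].

(** ** Dimension of a space S (a subset, closed under linear combinations,
    of a complex vector space with equality eq, linear combinations lc and
    zero z): S has a basis of d elements. *)
Definition has_dim {V : Type} (eq : V -> V -> Prop) (lc : seq C -> seq V -> V)
    (z : V) (S : V -> Prop) (d : nat) : Prop :=
  exists vs : seq V, [/\ size vs = d,
    (forall i, (i < d)%N -> S (nth z vs i)),
    (forall cs : seq C, size cs = d -> eq (lc cs vs) z -> forall i, nth 0 cs i = 0) &
    (forall v, S v -> exists cs : seq C, size cs = d /\ eq v (lc cs vs))].

Definition dim_elt := has_dim eqv lincomb [::].
Definition eqH (f g : fn) : Prop := forall z, inH z -> f z = g z.
Definition lincomb_fn (cs : seq C) (fs : seq fn) : fn :=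
  fun z => \sum_(cf <- zip cs fs) cf.1 * cf.2 z.
Definition dim_fn := has_dim eqH lincomb_fn (fun _ => 0).

(** coefficient of q^N in q^(2n+m) prod_{i=1}^n 1/(1-q^i) prod_{j=1}^{m+n} 1/(1-q^j),
    computed with the geometric series truncated at degree N *)
Definition geomt (i N : nat) : {poly int} := \sum_(e < N.+1) 'X^(i * e).
Definition gf_coef (m n N : nat) : int :=
  ('X^(2 * n + m) * \prod_(1 <= i < n.+1) geomt i N
                  * \prod_(1 <= j < (m + n).+1) geomt j N)`_N.

(* Main.v *)
(** Filter D^ch(H) by the charge D = p(mu) - p(lambda) of the monomials a_{-lambda} b_{-mu}. The
    action of g on the lowest charge part of a vector multiplies the coefficient f of a monomial of
    charge D by the automorphy factor of weight 2D and substitutes g, so the lowest coefficients of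
    an invariant vector are modular forms of weight 2D; they vanish for D < 0.

    Conversely every modular form f of weight 2D, D >= 1, is the lowest coefficient of an invariant
    vector. The zero modes of E, F, H generate sl_2, and the recursion
    (j+1)(2D+j) m_{j+1} = T m_j + 2K m_{j-1}, m_0 = a_{-lambda} b_{-mu}, where T and K are the
    constant coefficient parts of F_(0) that raise the charge by 1 and 2, makes
    f |-> sum_j f^(j) m_j an sl_2-equivariant map on densities of weight 2D. Its failure to commute
    with g is a differential operator in f that kills all powers of b, hence zero. In charge 0 the
    monomial w itself is invariant up to the lift of -c/(c tau + d), which the quasi-modular form phi
    of weight 2 (a multiple of E_2) compensates; modular forms of weight 0 are constant.

    Hence the dimension in weight N is the sum of dim M_{2D} over the pairs (lambda, mu) of weight N
    with D >= 0, and counting those pairs by n = p(lambda), m = D gives the product formula.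

    On the analytic side, Goursat's lemma makes holomorphic functions smooth and gives Fourier
    expansions at the cusps; finite dimensionality follows because |f| y^D is bounded by half of its
    bound as soon as sufficiently many Fourier coefficients at all cusps vanish. The function phi is
    obtained from the absolutely convergent sum of 1/X^2 - 1/(X^2 - 1/4), X = c tau + d, over c <> 0,
    the correction term being telescoping in d. *)

(* The vertex algebra enters only through modes. Vectors are functions from pairs of partitions to a
   differential ring, and all operators are homogeneous in the weight, so infinite sums of modes are
   finite on each coefficient. The operator identities (products of fields, relations of affine
   sl_2, covariance under g) share one proof: both sides commute in the same way with the a_m and
   b_m or their transforms, which leaves the vacuum; there the difference in negative degree is
   killed by all positive modes, hence zero because the Fock space is irreducible, and degree zero
   is a direct computation. This also yields the group law. [pi_term] is given on monomials only; to
   compose two such maps one must know how the modes of J^2 transform, and the proof needs the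
   affine relations for all quadratic vector fields. The lift needs D >= 1 because its recursion
   divides by 2D + j, which vanishes for D = j = 0; hence the separate treatment of charge 0. All
   cusps are handled at once: every conjugate of T^N is congruent to 1 modulo N, so each translate
   of a form or invariant vector has period N, and holomorphy at the cusps becomes boundedness of
   all translates high up. *)
From Stdlib Require Reals Lra Classical ClassicalEpsilon.
From Coquelicot Require Coquelicot.

(** * Bisection of rectangles and real integrals *)

Module Goursat.
Import Stdlib.Reals.Reals Stdlib.micromega.Lra Coquelicot.Coquelicot.
Local Open Scope R_scope.

Section Bisection.
Variable P : R -> R -> R -> R -> Prop.
Hypothesis Psplit : forall a b c d m n, a <= m <= b -> c <= n <= d -> m - a = b - m -> n - c = d - n ->
  P a m c n -> P m b c n -> P a m n d -> P m b n d -> P a b c d.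

Record rect := Rect { rx : R; rw : R; ry : R; rz : R }.
Definition Pr (q : rect) := P (rx q) (rw q) (ry q) (rz q).
Definition quarter (q q' : rect) :=
  rx q <= rx q' /\ rw q' <= rw q /\ ry q <= ry q' /\ rz q' <= rz q /\
  rw q' - rx q' = (rw q - rx q) / 2 /\ rz q' - ry q' = (rz q - ry q) / 2.

Lemma quarter_ex q : rx q <= rw q -> ry q <= rz q -> ~ Pr q -> exists q', quarter q q' /\ ~ Pr q'.
Proof.
destruct q as [a b c d]; simpl; unfold Pr, quarter; simpl; intros ab cd nP.
set (m := (a + b) / 2); set (n := (c + d) / 2).
destruct (Classical_Prop.classic (P a m c n)) as [p1|n1]; [|exists (Rect a m c n); unfold m, n; simpl; repeat split; trivial; lra].
destruct (Classical_Prop.classic (P m b c n)) as [p2|n2]; [|exists (Rect m b c n); unfold m, n; simpl; repeat split; trivial; lra].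
destruct (Classical_Prop.classic (P a m n d)) as [p3|n3]; [|exists (Rect a m n d); unfold m, n; simpl; repeat split; trivial; lra].
destruct (Classical_Prop.classic (P m b n d)) as [p4|n4]; [|exists (Rect m b n d); unfold m, n; simpl; repeat split; trivial; lra].
exfalso; apply nP; apply (Psplit a b c d m n); trivial; unfold m, n; lra.
Qed.

(** Compactness by nested rectangles: if [P] fails on a rectangle it fails on one of its quarters,
    and repeated quartering shrinks to a point near which [P] holds. It serves for Goursat's lemma,
    for boundedness and, with a degenerate second side, for functions on a segment. *)
Lemma bisection a b c d : a <= b -> c <= d ->
  (forall x y, a <= x <= b -> c <= y <= d -> exists dl, 0 < dl /\ forall a' b' c' d',
     a <= a' -> a' <= x <= b' -> b' <= b -> c <= c' -> c' <= y <= d' -> d' <= d ->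
     b' - a' < dl -> d' - c' < dl -> P a' b' c' d') -> P a b c d.
Proof.
intros ab cd H; apply Classical_Prop.NNPP; intro nP.
(* A total choice of a bad quarter. The default keeps the rectangle; along the sequence it never
   occurs. *)
pose (step := fun q => match ClassicalEpsilon.excluded_middle_informative (exists q', quarter q q' /\ ~ Pr q') with
  | left e => proj1_sig (ClassicalEpsilon.constructive_indefinite_description _ e) | right _ => q end).
assert (Hst : forall q, rx q <= rw q -> ry q <= rz q -> ~ Pr q -> quarter q (step q) /\ ~ Pr (step q)).
{ intros q h1 h2 h3; unfold step; destruct ClassicalEpsilon.excluded_middle_informative as [e|e].
  - destruct ClassicalEpsilon.constructive_indefinite_description as [q' hq']; exact hq'.
  - exfalso; apply e; apply quarter_ex; trivial. }
pose (s := fun n => Nat.iter n step (Rect a b c d)).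
assert (inv : forall n, rx (s n) <= rw (s n) /\ ry (s n) <= rz (s n) /\ ~ Pr (s n) /\
   rw (s n) - rx (s n) = (b - a) / 2 ^ n /\ rz (s n) - ry (s n) = (d - c) / 2 ^ n).
{ induction n as [|n [i1 [i2 [i3 [i4 i5]]]]].
  - simpl; repeat split; trivial; field.
  - change (s (S n)) with (step (s n)).
    destruct (Hst (s n) i1 i2 i3) as [[q1 [q2 [q3 [q4 [q5 q6]]]]] q7].
    repeat split; trivial; try lra.
    + rewrite q5, i4; simpl; field; apply pow_nonzero; lra.
    + rewrite q6, i5; simpl; field; apply pow_nonzero; lra. }
assert (mon : forall n, quarter (s n) (s (S n))).
{ intro n; destruct (inv n) as [i1 [i2 [i3 _]]]; destruct (Hst (s n) i1 i2 i3); trivial. }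
assert (monm : forall n m, rx (s n) <= rx (s (n + m)%nat) /\ rw (s (n + m)%nat) <= rw (s n) /\
   ry (s n) <= ry (s (n + m)%nat) /\ rz (s (n + m)%nat) <= rz (s n)).
{ intros n m; induction m as [|m IH].
  - rewrite Nat.add_0_r; lra.
  - rewrite Nat.add_succ_r; destruct (mon (n + m)%nat) as [q1 [q2 [q3 [q4 _]]]]; lra. }
assert (cross : forall n m, rx (s n) <= rw (s m) /\ ry (s n) <= rz (s m)).
{ intros n m; destruct (monm n m) as [p1 [p2 [p3 p4]]]; destruct (monm m n) as [p5 [p6 [p7 p8]]].
  rewrite (Nat.add_comm m n) in p5, p6, p7, p8; destruct (inv (n + m)%nat) as [i1 [i2 _]]; lra. }
(* By [cross] every left end lies below every right end, so the supremum of the left ends is in all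
   the intervals. *)
assert (lubx : exists x, forall n, rx (s n) <= x <= rw (s n)).
{ destruct (completeness (fun r => exists n, r = rx (s n))) as [x [u l]].
  - exists b; intros r [n ->]; exact (proj1 (cross n O)).
  - exists a; exists O; trivial.
  - exists x; intro n; split; [apply u; exists n; trivial|apply l; intros r [m ->]; apply cross]. }
assert (luby : exists y, forall n, ry (s n) <= y <= rz (s n)).
{ destruct (completeness (fun r => exists n, r = ry (s n))) as [x [u l]].
  - exists d; intros r [n ->]; exact (proj2 (cross n O)).
  - exists c; exists O; trivial.
  - exists x; intro n; split; [apply u; exists n; trivial|apply l; intros r [m ->]; apply cross]. }
destruct lubx as [x hx]; destruct luby as [y hy].
destruct (H x y (hx O) (hy O)) as [dl [dl0 hdl]].
assert (big : exists n, (b - a) / 2 ^ n < dl /\ (d - c) / 2 ^ n < dl).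
{ destruct (Pow_x_infinity 2 ltac:(rewrite Rabs_right; lra) (Rmax ((b - a) / dl) ((d - c) / dl) + 1)) as [n hn].
  exists n; specialize (hn n (Nat.le_refl n)); rewrite Rabs_right in hn; [|apply Rle_ge, pow_le; lra].
  assert (p : 0 < 2 ^ n) by (apply pow_lt; lra).
  assert (h1 := Rmax_l ((b - a) / dl) ((d - c) / dl)); assert (h2 := Rmax_r ((b - a) / dl) ((d - c) / dl)).
  split; apply Rmult_lt_reg_r with (2 ^ n); trivial; unfold Rdiv; rewrite Rmult_assoc, Rinv_l; try lra.
  - apply Rmult_lt_reg_r with (/ dl); [apply Rinv_0_lt_compat; lra|].
    replace (dl * 2 ^ n * / dl) with (2 ^ n) by (field; lra); unfold Rdiv in *; lra.
  - apply Rmult_lt_reg_r with (/ dl); [apply Rinv_0_lt_compat; lra|].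
    replace (dl * 2 ^ n * / dl) with (2 ^ n) by (field; lra); unfold Rdiv in *; lra. }
destruct big as [n [n1 n2]]; destruct (inv n) as [i1 [i2 [i3 [i4 i5]]]]; apply i3.
destruct (monm O n) as [m1 [m2 [m3 m4]]]; simpl in m1, m2, m3, m4.
apply hdl; try lra; trivial; try apply hx; try apply hy.
Qed.
End Bisection.

(** The variable [y] ranges over the whole line, so continuity at the end points is two-sided. *)
Definition cts (h : R -> R) a b := forall x, a <= x <= b ->
  forall e, 0 < e -> exists d, 0 < d /\ forall y, Rabs (y - x) < d -> Rabs (h y - h x) < e.
Definition rint (h : R -> R) a b : R := RInt h a b.

Lemma cts_cont h a b x : cts h a b -> a <= x <= b -> continuous h x.
Proof.
intros H hx; apply continuity_pt_filterlim; intros e he; destruct (H x hx e he) as [d [d0 hd]].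
exists d; split; trivial; intros y [_ hy]; apply hd, hy.
Qed.

Lemma cts_ex h a b : a <= b -> cts h a b -> ex_RInt h a b.
Proof.
intros ab H; apply (ex_RInt_continuous (V := R_CompleteNormedModule)); intros x hx.
rewrite Rmin_left, Rmax_right in hx by trivial; apply cts_cont with a b; trivial.
Qed.

Lemma rint_ext h k a b : a <= b -> (forall x, a <= x <= b -> h x = k x) -> rint h a b = rint k a b.
Proof.
intros ab H; apply RInt_ext; intros x hx; rewrite Rmin_left, Rmax_right in hx by trivial; apply H; lra.
Qed.

Lemma rint_plus h k a b : a <= b -> cts h a b -> cts k a b ->
  rint (fun x => h x + k x) a b = rint h a b + rint k a b.
Proof. intros ab H K; apply (RInt_plus (V := R_CompleteNormedModule)); apply cts_ex; trivial. Qed.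

Lemma rint_scal h c a b : a <= b -> cts h a b -> rint (fun x => c * h x) a b = c * rint h a b.
Proof. intros ab H; apply (RInt_scal (V := R_CompleteNormedModule)); apply cts_ex; trivial. Qed.

Lemma rint_chasles h a m b : a <= m <= b -> cts h a b -> rint h a b = rint h a m + rint h m b.
Proof.
intros ab H; symmetry; apply (RInt_Chasles (V := R_CompleteNormedModule)); apply cts_ex; try lra;
  intros x hx; apply H; lra.
Qed.

Lemma rint_bound h a b M : a <= b -> cts h a b -> (forall x, a <= x <= b -> Rabs (h x) <= M) ->
  Rabs (rint h a b) <= M * (b - a).
Proof.
intros ab H hM; rewrite Rmult_comm; apply abs_RInt_le_const; trivial; apply cts_ex; trivial.
Qed.

Lemma rint_pos h a b : a < b -> cts h a b -> (forall x, a <= x <= b -> 0 < h x) -> 0 < rint h a b.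
Proof.
intros ab H hp; apply RInt_gt_0; trivial; intros x hx; [apply hp; lra|apply cts_cont with a b; trivial].
Qed.

Lemma rint_const c a b : rint (fun _ => c) a b = c * (b - a).
Proof. unfold rint; rewrite RInt_const; unfold scal; simpl; unfold mult; simpl; ring. Qed.
End Goursat.
Require Import Defs.
From HB Require Import structures.
From mathcomp Require Import all_boot all_order all_algebra.
From mathcomp Require Import all_classical all_reals all_analysis.
From mathcomp Require Import complex Rstruct Rstruct_topology.
From mathcomp Require Import zify ring lra.
Import Order.TTheory GRing.Theory Num.Theory numFieldNormedType.Exports.
Set Implicit Arguments.
Unset Strict Implicit.
Unset Printing Implicit Defensive.
Local Open Scope ring_scope.

(** * Partitions *)
Lemma geq_rel_trans : transitive geq_rel.
Proof. by move=> y x z /[swap]; apply: leq_trans. Qed.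

Lemma geq_rel_total : total geq_rel.
Proof. by move=> x y; exact: leq_total. Qed.

Lemma geq_rel_anti : antisymmetric geq_rel.
Proof. by move=> x y; rewrite /geq_rel andbC => /anti_leq. Qed.

Lemma perm_ins n l : perm_eq (ins n l) (n :: l).
Proof. by rewrite /ins perm_sort. Qed.

Lemma is_part_ins n l : is_part l -> is_part (ins n.+1 l).
Proof.
case/andP=> _ h; rewrite /is_part (perm_all _ (perm_ins _ _)) /= h andbT.
exact: (sort_sorted geq_rel_total).
Qed.

Lemma is_part_rem n l : is_part l -> is_part (rem n l).
Proof.
case/andP=> hs ha; apply/andP; split.
  exact: (subseq_sorted geq_rel_trans (rem_subseq _ _) hs).
by apply/allP=> x /mem_rem hx; apply: (allP ha).
Qed.

(** Partitions of [n] into [k] parts, enumerated by the recursion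
    p(n, k) = p(n - 1, k - 1) + p(n - k, k): either the last part is 1, or 1 can be
    subtracted from every part. *)
Fixpoint parts_rec (fuel k n : nat) : seq part :=
  if k is k'.+1 then
    if fuel is fu.+1 then
      if (k <= n)%N then
        [seq rcons l 1%N | l <- parts_rec fu k' n.-1] ++ [seq map S l | l <- parts_rec fu k (n - k)]
      else [::]
    else [::]
  else if n == 0%N then [:: [::]] else [::].
Definition parts k n := parts_rec n k n.

Lemma is_part_mapS l : is_part l -> is_part (map S l).
Proof.
case/andP=> hs _; apply/andP; split; last by apply/allP => x /mapP[y _ ->].
by rewrite sorted_map; apply: sub_sorted hs => x y.
Qed.

Lemma parts_recP fuel k n l : (n <= fuel)%N ->
  (l \in parts_rec fuel k n) = [&& is_part l, size l == k & sumn l == n].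
Proof.
have sum_ge s : is_part s -> (size s <= sumn s)%N.
  case/andP => _; elim: s => //= x s IH /andP[hx /IH]; lia.
have sumS s : sumn (map S s) = (sumn s + size s)%N.
  by elim: s => //= x s ->; lia.
elim: fuel k n l => [|fu IH] [|k] n l hn /=.
- by case: n hn => //= _; case: l => [|x l] //=; rewrite inE andbF.
- apply/esym/negP => /and3P[/sum_ge h1 /eqP h2 /eqP h3]; lia.
- case: n {hn} => [|n] /=; case: l => [|x l] //=; rewrite ?inE ?andbF //.
case: ifP => [kn|]; last first.
  move=> h; apply/esym/negP => /and3P[/sum_ge h1 /eqP h2 /eqP h3]; lia.
rewrite mem_cat; apply/orP/idP.
  case=> /mapP[l' + ->]; rewrite IH; try lia.
    case/and3P=> /andP[hs ha] /eqP hk /eqP hsum.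
    rewrite size_rcons hk eqxx sumn_rcons hsum /is_part all_rcons ha /=.
    rewrite andbT (_ : (n.-1 + 1 == n)%N) ?andbT; last by apply/eqP; lia.
    move: hs; rewrite !(sorted_pairwise geq_rel_trans) pairwise_rcons => ->.
    by rewrite andbT; exact: ha.
  case/and3P=> /is_part_mapS -> /eqP hk /eqP hsum.
  by rewrite size_map hk eqxx sumS hsum hk subnK ?eqxx.
case/and3P=> hp /eqP hk /eqP hs.
case/lastP: l hp hk hs => [//|l x]; rewrite size_rcons sumn_rcons => hp [hk] hs.
have [hs1 hs2] : all (fun y => geq_rel y x) l /\ is_part l.
  move: hp; rewrite /is_part all_rcons !(sorted_pairwise geq_rel_trans) pairwise_rcons.
  by case/andP=> /andP[-> ->] /andP[_ ->].
have [x1|x1] := eqVneq x 1%N.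
  left; apply/mapP; exists l; rewrite ?x1 // IH; last lia.
  by rewrite hk eqxx hs2 /=; apply/eqP; lia.
right.
have x2 : (2 <= x)%N.
  by case/andP: hp => _ /allP /(_ x); rewrite mem_rcons inE eqxx => /(_ isT); lia.
have h2 y : y \in rcons l x -> (2 <= y)%N.
  rewrite mem_rcons inE => /orP[/eqP -> //|yl].
  by apply: leq_trans x2 _; exact: (allP hs1).
have eS : rcons l x = map S (map predn (rcons l x)).
  rewrite -map_comp -[LHS]map_id; apply/eq_in_map => y /h2 /=; lia.
apply/mapP; exists (map predn (rcons l x)) => //.
have hsz : size (map predn (rcons l x)) = k.+1 by rewrite size_map size_rcons hk.
rewrite IH; last lia.
rewrite hsz eqxx /=; apply/andP; split; last first.
  have e : sumn (rcons l x) = (sumn (map predn (rcons l x)) + k.+1)%N by rewrite {1}eS sumS hsz.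
  by apply/eqP; rewrite -hs -sumn_rcons e addnK.
apply/andP; split; last by apply/allP => y /mapP[z /h2 hz ->] /=; lia.
by rewrite sorted_map; case/andP: hp => hp _; apply: sub_sorted hp => y z /=; rewrite /geq_rel /=; lia.
Qed.

Lemma mem_parts k n l : (l \in parts k n) = [&& is_part l, size l == k & sumn l == n].
Proof. exact: parts_recP. Qed.

Lemma parts_rec_uniq fuel k n : (n <= fuel)%N -> uniq (parts_rec fuel k n).
Proof.
elim: fuel k n => [|fu IH] [|k] n hn //=; try by case: eqP.
case: ifP => // kn; rewrite cat_uniq !map_inj_uniq ?IH //; try lia.
- rewrite andbT /=; apply/hasPn => x /mapP[l hl ->]; apply/negP => /mapP[l'].
  rewrite !parts_recP in hl *; try lia; case/and3P: hl => /andP[_ hl] _ _ _ e.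
  have : 1%N \in map S l by rewrite e mem_rcons inE eqxx.
  by case/mapP => y /(allP hl) hy; lia.
- by apply: inj_map => x y [].
- by move=> l l' /rcons_inj[].
Qed.

Lemma parts_uniq k n : uniq (parts k n).
Proof. exact: parts_rec_uniq. Qed.

Lemma size_parts_rec fu k n : (n <= fu)%N -> size (parts_rec fu k n) = size (parts k n).
Proof.
move=> h; apply/perm_size/uniq_perm; rewrite ?parts_rec_uniq // => l.
by rewrite !parts_recP.
Qed.

Lemma size_parts0 n : size (parts 0 n) = (n == 0%N).
Proof. by rewrite /parts; case: n. Qed.

Lemma size_partsS k n : size (parts k.+1 n) =
  if (k < n)%N then (size (parts k n.-1) + size (parts k.+1 (n - k.+1)))%N else 0%N.
Proof.
rewrite /parts; case: n => [|n] //=; case: ifP => // h.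
by rewrite size_cat !size_map !size_parts_rec //; lia.
Qed.

Lemma parts_eq0 k n : (n < k)%N -> size (parts k n) = 0%N.
Proof. by case: k => // k h; rewrite size_partsS ltnNge -ltnS h. Qed.

(** With Q_k the product on the left, Q_{k+1} (1 - X^{k+1}) equals X Q_k up to degrees above N, and
    on coefficients this is the recursion [size_partsS]. The bound n <= N keeps the effect of
    truncating the geometric series out of sight. *)
Lemma coef_parts k n N : (n <= N)%N ->
  ('X^k * \prod_(1 <= i < k.+1) geomt i N)`_n = (size (parts k n))%:Z.
Proof.
pose Q k := 'X^k * \prod_(1 <= i < k.+1) geomt i N.
have tele j : geomt j N * (1 - 'X^j) = 1 - 'X^(j * N.+1).
  rewrite /geomt mulrC; under eq_bigr => e _ do rewrite exprM.
  by rewrite -opprB mulNr -subrX1 opprB exprM.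
have rec j : Q j.+1 * (1 - 'X^(j.+1)) = 'X * Q j * (1 - 'X^(j.+1 * N.+1)).
  by rewrite /Q big_nat_recr //= -tele exprS; ring.
rewrite -/(Q k); elim: k n => [|k IH] n hn.
  by rewrite /Q expr0 mul1r big_nil coef1 size_parts0; case: n {hn}.
have lowQ j m : (m < j)%N -> (Q j)`_m = 0 by move=> h; rewrite /Q coefXnM h.
have [m] := ubnP n; elim: m n hn => // m IHm n hn hm.
have [kn|kn] := leqP n k; first by rewrite lowQ // parts_eq0.
have := congr1 (fun p : {poly int} => p`_n) (rec k).
rewrite mulrBr mulr1 coefB coefMXn ltnNge kn /= mulrBr mulr1 coefB.
rewrite coefMXn (_ : (n < k.+1 * N.+1)%N) ?subr0; last by nia.
rewrite coefXM; case: n kn hn hm => // n kn hn hm /=.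
rewrite IH ?(IHm (n.+1 - k.+1)%N); try lia.
by move=> e; rewrite size_partsS kn /= PoszD -e subrK.
Qed.

(** The power q^{2n+m} is shared out as q^n and q^{m+n}: each product then counts partitions into
    exactly n, respectively m + n, parts. *)
Lemma gf_coefE m n N : gf_coef m n N =
  \sum_(i < N.+1) (size (parts n i) * size (parts (m + n) (N - i)))%:Z.
Proof.
rewrite /gf_coef (_ : (2 * n + m = n + (m + n))%N); last lia.
set P := \prod_(_ <= _ < _) _; set P' := \prod_(_ <= _ < _) _.
rewrite (_ : 'X^(n + (m + n)) * P * P' = ('X^n * P) * ('X^(m + n) * P')); last by rewrite exprD; ring.
rewrite coefM {}/P {}/P'; apply: eq_bigr => i _; rewrite !coef_parts ?leq_subr ?PoszM //.
by rewrite -ltnS.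
Qed.

Definition allparts n := flatten [seq parts k n | k <- iota 0 n.+1].

Lemma is_part_size l : is_part l -> (size l <= sumn l)%N.
Proof. by case/andP => _; elim: l => //= x s IH /andP[hx /IH]; lia. Qed.

Lemma mem_allparts n l : (l \in allparts n) = is_part l && (sumn l == n).
Proof.
apply/flattenP/idP => [[s /mapP[k _ ->]]|/andP[hp /eqP hs]].
  by rewrite mem_parts => /and3P[-> _ ->].
exists (parts (size l) n); last by rewrite mem_parts hp hs !eqxx.
by apply/mapP; exists (size l) => //; rewrite mem_iota; move: (is_part_size hp); rewrite hs add0n ltnS.
Qed.

(** The map [g] recovers the block from an element, so distinct blocks are disjoint. *)
Lemma uniq_flatten_map (S' T : eqType) (g : T -> S') (f : S' -> seq T) (s : seq S') :
  uniq s -> (forall x, x \in s -> uniq (f x)) -> (forall x y, y \in f x -> g y = x) ->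
  uniq (flatten [seq f x | x <- s]).
Proof.
elim: s => //= x s IH /andP[xs us] hu hg; rewrite cat_uniq hu ?mem_head //=.
rewrite IH //; last by move=> y ys; apply: hu; rewrite inE ys orbT.
rewrite andbT; apply/hasPn => y /flattenP[_ /mapP[z zs ->] yz]; apply/negP => yx.
by move: xs; rewrite -(hg x y yx) (hg z y yz) zs.
Qed.

Lemma allparts_uniq n : uniq (allparts n).
Proof.
apply: (@uniq_flatten_map _ _ size); rewrite ?iota_uniq // => k; first by rewrite parts_uniq.
by move=> l; rewrite mem_parts => /and3P[_ /eqP].
Qed.

(** * The Fock space *)
Definition Ptn := {l : part | is_part l}.
Definition PP := (Ptn * Ptn)%type.
(** [(false, n)] indexes the variable a_{-n-1}, [(true, n)] the variable b_{-n-1}. *)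
Definition idx := (bool * nat)%type.

Lemma ptn_nil_proof : is_part [::]. Proof. by []. Qed.
Definition ptn0 : Ptn := exist _ [::] ptn_nil_proof.
Definition pins n (l : Ptn) : Ptn := exist _ (ins n.+1 (val l)) (is_part_ins n (valP l)).
Definition prem n (l : Ptn) : Ptn := exist _ (rem n.+1 (val l)) (is_part_rem n.+1 (valP l)).
Definition sel (s : bool) (p : PP) := if s then p.2 else p.1.
Definition upd (s : bool) (x : Ptn) (p : PP) : PP := if s then (p.1, x) else (x, p.2).
Definition pcnt (i : idx) (p : PP) : nat := count_mem i.2.+1 (val (sel i.1 p)).
Definition padd (i : idx) (p : PP) : PP := upd i.1 (pins i.2 (sel i.1 p)) p.
Definition psub (i : idx) (p : PP) : PP := upd i.1 (prem i.2 (sel i.1 p)) p.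
Definition pp0 : PP := (ptn0, ptn0).
Definition wts (s : bool) (p : PP) : nat := sumn (val (sel s p)).
Definition wt (p : PP) : nat := (wts false p + wts true p)%N.

Lemma ptn_eqP (l m : Ptn) :
  (forall n, count_mem n.+1 (val l) = count_mem n.+1 (val m)) -> l = m.
Proof.
move=> h; apply: val_inj; case: l m h => l /[dup] pl /andP[sl al] [m /[dup] pm /andP[sm am]] /= h.
apply: (sorted_eq geq_rel_trans geq_rel_anti) => //.
apply/allP=> -[|n] _ /=; last by rewrite h.
have z (s : part) : all (fun x => 0 < x)%N s -> count_mem 0%N s = 0%N.
  by move=> hs; apply/count_memPn/negP=> /(allP hs).
by rewrite !z.
Qed.

(** A pair of partitions is a finite multiset of variables. The identities between [padd] and [psub]
    are all checked on multiplicities. *)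
Lemma pcnt_inj p q : (forall i, pcnt i p = pcnt i q) -> p = q.
Proof.
case: p q => p1 p2 [q1 q2] h; congr pair; apply: ptn_eqP => n.
  exact: (h (false, n)).
exact: (h (true, n)).
Qed.

Lemma pcnt_add i j p : pcnt i (padd j p) = (pcnt i p + (i == j))%N.
Proof.
case: i j => [s n] [t m]; rewrite /pcnt /padd /upd /sel /=.
by case: s t => -[] //=; rewrite ?(permP (perm_ins _ _)) /= -?pair_eqE /= ?addn0 ?eqSS // addnC eq_sym.
Qed.

Lemma pcnt_sub i j p : pcnt i (psub j p) = (pcnt i p - (i == j))%N.
Proof.
have cr (l : seq nat) a b : count_mem a (rem b l) = (count_mem a l - (a == b))%N.
  have [bl|bl] := boolP (b \in l).
    by rewrite (permP (perm_to_rem bl)) /= eq_sym addKn.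
  rewrite rem_id //; case: eqP => [->|]; last by rewrite subn0.
  by rewrite (count_memPn bl).
case: i j => [s n] [t m]; rewrite /pcnt /psub /upd /sel /=.
by case: s t => -[] //=; rewrite ?cr /= -?pair_eqE /= ?subn0 ?eqSS // addnC eq_sym.
Qed.

Lemma paddK i p : psub i (padd i p) = p.
Proof. by apply: pcnt_inj => j; rewrite pcnt_sub pcnt_add addnK. Qed.

Lemma psubK i p : (0 < pcnt i p)%N -> padd i (psub i p) = p.
Proof.
by move=> h; apply: pcnt_inj => j; rewrite pcnt_add pcnt_sub; case: eqP => [->|_]; lia.
Qed.

Lemma paddC i j p : padd i (padd j p) = padd j (padd i p).
Proof. by apply: pcnt_inj => k; rewrite !pcnt_add addnAC. Qed.

Lemma psubC i j p : psub i (psub j p) = psub j (psub i p).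
Proof. by apply: pcnt_inj => k; rewrite !pcnt_sub subnAC. Qed.

Lemma psub_add i j p : i != j -> psub i (padd j p) = padd j (psub i p).
Proof.
move=> ij; apply: pcnt_inj => k; rewrite pcnt_sub !pcnt_add pcnt_sub.
have [->|_] := eqVneq k i; first by rewrite (negPf ij) !addn0.
by rewrite !subn0.
Qed.

Lemma wts_add s i p : wts s (padd i p) = (wts s p + (if i.1 == s then i.2.+1 else 0))%N.
Proof.
case: i => [t n]; rewrite /wts /padd /upd /sel /=; case: t s => -[] //=;
by rewrite ?addn0 // (perm_sumn (perm_ins _ _)) /= addnC.
Qed.

Lemma wt_add i p : wt (padd i p) = (wt p + i.2.+1)%N.
Proof. by rewrite /wt !wts_add; case: i => -[] n /=; lia. Qed.

Lemma wt_sub i p : (0 < pcnt i p)%N -> wt p = (wt (psub i p) + i.2.+1)%N.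
Proof. by move=> h; rewrite -wt_add psubK. Qed.

Lemma wts_sub s i p : (0 < pcnt i p)%N ->
  wts s p = (wts s (psub i p) + (if i.1 == s then i.2.+1 else 0))%N.
Proof. by move=> h; rewrite -wts_add psubK. Qed.

Lemma pp_ind (Q : PP -> Prop) : Q pp0 ->
  (forall i p, Q p -> Q (padd i p)) -> forall p, Q p.
Proof.
move=> h0 hS p; have [n] := ubnP (wt p); elim: n p => // n IH p hp.
have [[i hi]|no] := pselect (exists i, (0 < pcnt i p)%N).
  by rewrite -(psubK hi); apply/hS/IH; move: (wt_sub hi); lia.
suff -> : p = pp0 by [].
apply: pcnt_inj => i; rewrite [RHS](_ : _ = 0%N); last by case: i => -[] n'.
by apply/eqP; rewrite -leqn0 leqNgt; apply/negP => hi; apply: no; exists i.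
Qed.

(** A list that is not a partition is sent to the empty one; the well-formed terms considered later
    carry partitions only. *)
Definition to_pp (l : part * part) : PP := (insubd ptn0 l.1, insubd ptn0 l.2).
Definition rpps N : seq (part * part) :=
  flatten [seq [seq (l, m) | l <- allparts i, m <- allparts (N - i)] | i <- iota 0 N.+1].
Definition pps N : seq PP := map to_pp (rpps N).

Lemma mem_rpps N l m : ((l, m) \in rpps N) = [&& is_part l, is_part m & sumn l + sumn m == N]%N.
Proof.
apply/flattenP/idP.
  case=> _ /mapP[i hi ->] /allpairsP[[l' m'] /= [h1 h2 [-> ->]]].
  move: h1 h2 hi; rewrite !mem_allparts mem_iota => /andP[-> /eqP ->] /andP[-> /eqP ->] /=.
  by rewrite ltnS => h; rewrite subnKC.
case/and3P=> hl hm /eqP <-; exists [seq (l', m') | l' <- allparts (sumn l), m' <- allparts (sumn m)].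
  by apply/mapP; exists (sumn l); rewrite ?mem_iota ?addKn //; lia.
by apply/allpairsP; exists (l, m); rewrite /= !mem_allparts hl hm !eqxx.
Qed.

Lemma rpps_uniq N : uniq (rpps N).
Proof.
apply: (@uniq_flatten_map _ _ (fun l => sumn l.1)); rewrite ?iota_uniq // => i; last first.
  by move=> _ /allpairsP[[l m] /= [h1 _ ->]]; move: h1; rewrite mem_allparts => /andP[_ /eqP].
move=> _; apply: allpairs_uniq; rewrite ?allparts_uniq //.
by move=> [a b] [a' b'] _ _ /= [-> ->].
Qed.

Lemma to_ppK l : is_part l.1 -> is_part l.2 -> (val (to_pp l).1, val (to_pp l).2) = l.
Proof. by case: l => l m /= h1 h2; rewrite !insubdK. Qed.

Lemma to_pp_val (p : PP) : to_pp (val p.1, val p.2) = p.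
Proof. by case: p => p1 p2; rewrite /to_pp /= !valKd. Qed.

Lemma mem_pps N p : (p \in pps N) = (wt p == N).
Proof.
apply/mapP/idP => [[[l m]]|h].
  by rewrite mem_rpps => /and3P[hl hm e ->]; rewrite /wt /wts /sel /= !insubdK.
exists (val p.1, val p.2); last by rewrite to_pp_val.
by rewrite mem_rpps (valP p.1) (valP p.2).
Qed.

Lemma pps_uniq N : uniq (pps N).
Proof.
rewrite map_inj_in_uniq ?rpps_uniq // => -[l m] [l' m'].
rewrite !mem_rpps => /and3P[h1 h2 _] /and3P[h3 h4 _] e.
by rewrite -(@to_ppK (l, m)) // -(@to_ppK (l', m')) // e.
Qed.

(** * Heisenberg modes over a differential ring *)

Section Fock.
Variables (F : numFieldType) (O : comNzRingType) (io : {rmorphism F -> O}).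
Variables (d : O -> O) (beta : O).
Hypothesis dD : forall x y, d (x + y) = d x + d y.
Hypothesis dM : forall x y, d (x * y) = d x * y + x * d y.
Hypothesis d_io : forall c, d (io c) = 0.
Hypothesis d_beta : d beta = 1.

Lemma d1 : d 1 = 0. Proof. by rewrite -(rmorph1 io) d_io. Qed.
Lemma d0 : d 0 = 0. Proof. by rewrite -[X in d X](rmorph0 io) d_io. Qed.
Lemma dN x : d (- x) = - d x.
Proof. by apply: (addrI (d x)); rewrite -dD !subrr d0. Qed.
Lemma d_nat n : d n%:R = 0.
Proof. by rewrite -(rmorph_nat io) d_io. Qed.
Lemma d_natl n x : d (n%:R * x) = n%:R * d x.
Proof. by rewrite dM d_nat mul0r add0r. Qed.

Definition V := PP -> O.
(** Multiplication by the variable x_i and, in [an], the derivative by x_i, both read on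
    coefficients: the coefficient of p in dv/dx_i is the multiplicity of i in [padd i p] times the
    coefficient of [padd i p]. *)
Definition cr (i : idx) (v : V) : V :=
  fun p => if (0 < pcnt i p)%N then v (psub i p) else 0.
Definition an (i : idx) (v : V) : V := fun p => (pcnt i p).+1%:R * v (padd i p).
Definition mu (f : O) (v : V) : V := fun p => f * v p.
Definition dv (v : V) : V := fun p => d (v p).
Definition am (k : int) (v : V) : V :=
  match k with
  | Posz 0 => dv v
  | Posz n.+1 => an (true, n) v
  | Negz n => cr (false, n) v
  end.
Definition bm (k : int) (v : V) : V :=
  match k with
  | Posz 0 => mu beta v
  | Posz n.+1 => - an (false, n) v
  | Negz n => cr (true, n) v
  end.
Definition mono (p : PP) (f : O) : V := fun q => if q == p then f else 0.
Definition vac (f : O) : V := mono pp0 f.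

Lemma an_cr i j v : an i (cr j v) = cr j (an i v) + (if i == j then v else 0).
Proof.
apply/funext => p; rewrite /an /cr /= pcnt_add addrfctE.
have [->|ij] := eqVneq i j.
  rewrite addn1 ltnS leq0n paddK; case: ltnP => h.
    by rewrite psubK // pcnt_sub eqxx -addn1 -(subnK h) addnK natrD mulrDl mul1r addn1.
  by move: h; rewrite leqn0 => /eqP ->; rewrite mul1r add0r.
rewrite addn0 addr0; case: ifP => h; last by rewrite mulr0.
by rewrite pcnt_sub (negPf ij) subn0 psub_add // eq_sym.
Qed.

Lemma cr_cr i j v : cr i (cr j v) = cr j (cr i v).
Proof.
apply/funext => p; rewrite /cr !pcnt_sub psubC.
have [->|ij] := eqVneq i j; first by [].
by rewrite !subn0; case: ifP; case: ifP.
Qed.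

Lemma an_an i j v : an i (an j v) = an j (an i v).
Proof.
apply/funext => p; rewrite /an !pcnt_add paddC.
have [->|ij] := eqVneq i j; first by [].
by rewrite !addn0 mulrCA.
Qed.

Lemma crD i u v : cr i (u + v) = cr i u + cr i v.
Proof. by apply/funext => p; rewrite /cr !addrfctE; case: ifP => // _; rewrite addr0. Qed.
Lemma anD i u v : an i (u + v) = an i u + an i v.
Proof. by apply/funext => p; rewrite /an !addrfctE mulrDr. Qed.
Lemma muD f u v : mu f (u + v) = mu f u + mu f v.
Proof. by apply/funext => p; rewrite /mu !addrfctE mulrDr. Qed.
Lemma dvD u v : dv (u + v) = dv u + dv v.
Proof. by apply/funext => p; rewrite /dv !addrfctE dD. Qed.
Lemma anN i v : an i (- v) = - an i v.
Proof. by apply/funext => p; rewrite /an opprfctE mulrN. Qed.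
Lemma cr_mu i f v : cr i (mu f v) = mu f (cr i v).
Proof. by apply/funext => p; rewrite /cr /mu; case: ifP; rewrite ?mulr0. Qed.
Lemma an_mu i f v : an i (mu f v) = mu f (an i v).
Proof. by apply/funext => p; rewrite /an /mu mulrCA. Qed.
Lemma cr_dv i v : cr i (dv v) = dv (cr i v).
Proof. by apply/funext => p; rewrite /cr /dv; case: ifP; rewrite ?d0. Qed.
Lemma an_dv i v : an i (dv v) = dv (an i v).
Proof. by apply/funext => p; rewrite /an /dv d_natl. Qed.
Lemma mu_mu f g v : mu f (mu g v) = mu (f * g) v.
Proof. by apply/funext => p; rewrite /mu mulrA. Qed.
Lemma muDl f g v : mu (f + g) v = mu f v + mu g v.
Proof. by apply/funext => p; rewrite /mu mulrDl. Qed.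
Lemma mu0 v : mu 0 v = 0.
Proof. by apply/funext => p; rewrite /mu mul0r. Qed.
Lemma mu1 v : mu 1 v = v.
Proof. by apply/funext => p; rewrite /mu mul1r. Qed.
Lemma muN f v : mu (- f) v = - mu f v.
Proof. by apply/funext => p; rewrite /mu mulNr. Qed.
Lemma dv_mu f v : dv (mu f v) = mu (d f) v + mu f (dv v).
Proof. by apply/funext => p; rewrite /mu /dv dM. Qed.
Lemma am_mu k f v : k != 0 -> am k (mu f v) = mu f (am k v).
Proof. by case: k => [[|n]|n] //= _; rewrite ?an_mu ?cr_mu. Qed.
Lemma bm_mu k f v : bm k (mu f v) = mu f (bm k v).
Proof.
case: k => [[|n]|n] /=; rewrite ?an_mu ?cr_mu ?mu_mu // 1?mulrC //.
by apply/funext => p; rewrite /mu !opprfctE mulrN.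
Qed.

Lemma am_am k l v : am k (am l v) = am l (am k v).
Proof.
have h i j u : i != j -> an i (cr j u) = cr j (an i u).
  by move=> ij; rewrite an_cr (negPf ij) addr0.
by case: k l => [[|n]|n] [[|m]|m] //=; rewrite ?an_dv ?cr_dv ?(an_an (_, n)) ?(cr_cr (_, n)) ?h.
Qed.

Lemma crN i v : cr i (- v) = - cr i v.
Proof. by apply/funext => p; rewrite /cr !opprfctE; case: ifP; rewrite ?oppr0. Qed.

Lemma bm_bm k l v : bm k (bm l v) = bm l (bm k v).
Proof.
have h i j u : i != j -> an i (cr j u) = cr j (an i u).
  by move=> ij; rewrite an_cr (negPf ij) addr0.
have muN' f u : mu f (- u) = - mu f u.
  by apply/funext => p; rewrite /mu !opprfctE mulrN.
by case: k l => [[|n]|n] [[|m]|m] //=;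
  rewrite ?anN ?crN ?muN' ?an_mu ?cr_mu ?(an_an (_, n)) ?(cr_cr (_, n)) ?h.
Qed.

Lemma am_bm k l v : am k (bm l v) = bm l (am k v) + (if k + l == 0 then v else 0).
Proof.
have dvN u : dv (- u) = - dv u.
  by apply/funext => p; rewrite /dv !opprfctE dN.
case: k l => [[|n]|n] [[|m]|m] /=.
- by rewrite dv_mu d_beta mu1 addrC.
- by rewrite dvN an_dv addr0.
- by rewrite cr_dv addr0.
- by rewrite an_mu addr0.
- by rewrite anN an_an addr0.
- rewrite an_cr; congr (_ + _).
  by rewrite -pair_eqE /= (_ : (n.+1%:Z + Negz m == 0) = (n == m)) //; apply/eqP/eqP; lia.
- by rewrite cr_mu addr0.
- rewrite crN an_cr opprD -addrA -[LHS]addr0; congr (_ + _).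
  rewrite -pair_eqE /= (_ : (Negz n + m.+1%:Z == 0) = (m == n)); last by apply/eqP/eqP; lia.
  by case: eqP; rewrite ?addNr ?oppr0 ?addr0.
- by rewrite cr_cr addr0.
Qed.

Lemma vaddE (u v : V) p : u p + v p = (u + v) p. Proof. by []. Qed.
Lemma voppE (u : V) p : - u p = (- u) p. Proof. by []. Qed.

Lemma vaddx (u v : V) p : (u + v) p = u p + v p. Proof. by []. Qed.
Lemma voppx (u : V) p : (- u) p = - u p. Proof. by []. Qed.
Lemma vzerox p : (0 : V) p = 0. Proof. by []. Qed.
Definition vx := (vaddx, voppx, vzerox).
Ltac vab := let q := fresh "q" in apply/funext => q; rewrite ?vx; ring.

(** Additive operators that lower the weight by k. Only additivity is asked for, because the mode
    a_0 differentiates the coefficients and is not linear over [O]. *)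
Definition hop (k : int) (X : V -> V) :=
  (forall u v, X (u + v) = X u + X v) /\
  (forall u v p, (forall q, (wt q)%:Z = (wt p)%:Z + k -> u q = v q) -> X u p = X v p).

Section HopTheory.
Variables (k : int) (X : V -> V).
Hypothesis hX : hop k X.

Lemma hopD u v : X (u + v) = X u + X v. Proof. by case: hX. Qed.
Lemma hop0 : X 0 = 0.
Proof. by apply: (addrI (X 0)); rewrite -hopD !addr0. Qed.
Lemma hopN u : X (- u) = - X u.
Proof. by apply: (addrI (X u)); rewrite -hopD !subrr hop0. Qed.
Lemma hopB u v : X (u - v) = X u - X v.
Proof. by rewrite hopD hopN. Qed.
Lemma hop_sum (I : Type) (r : seq I) (P : pred I) (f : I -> V) :
  X (\sum_(i <- r | P i) f i) = \sum_(i <- r | P i) X (f i).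
Proof. exact: (big_morph X hopD hop0). Qed.
Lemma hopMn u n : X (u *+ n) = X u *+ n.
Proof. by elim: n => [|n IH]; rewrite ?mulr0n ?hop0 // !mulrS hopD IH. Qed.

Definition hv (N : nat) (v : V) := forall q, wt q != N -> v q = 0.

Lemma hop_hv N v M : hv N v -> N%:Z = M%:Z + k -> hv M (X v).
Proof.
case: hX => _ hl hN e q qM; rewrite (hl v 0) ?hop0 // => r er; apply: hN.
by apply/eqP => rN; move/eqP: qM; apply; lia.
Qed.

Lemma hop_hv0 N v : hv N v -> N%:Z < k -> X v = 0.
Proof.
case: hX => _ hl hN e; apply/funext => q; rewrite (hl v 0) ?hop0 // => r er; apply: hN.
by apply/eqP => rN; lia.
Qed.
End HopTheory.

Lemma hv_mono p f : hv (wt p) (mono p f).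
Proof. by move=> q; rewrite /mono; case: (eqVneq q p) => [->|//]; rewrite eqxx. Qed.

Lemma hop_comp k l X Y : hop k X -> hop l Y -> hop (k + l) (fun v => X (Y v)).
Proof.
move=> [aX hX] [aY hY]; split=> [u v|u v p h]; first by rewrite aY aX.
by apply: hX => q eq; apply: hY => r er; apply: h; lia.
Qed.

Lemma hop_eq k l X Y : hop k X -> k = l -> (forall v, X v = Y v) -> hop l Y.
Proof. by move=> h <- e; rewrite (_ : Y = X) //; apply/funext => v. Qed.

Lemma hop_add k X Y : hop k X -> hop k Y -> hop k (fun v => X v + Y v).
Proof.
move=> [aX hX] [aY hY]; split=> [u v|u v p h]; first by rewrite aY aX addrACA.
by rewrite !addrfctE (hX _ v) // (hY _ v).
Qed.

Lemma hop_opp k X : hop k X -> hop k (fun v => - X v).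
Proof.
move=> [aX hX]; split=> [u v|u v p h]; first by rewrite aX opprD.
by rewrite !opprfctE (hX _ v).
Qed.

Lemma hop_zero k : hop k (fun _ => 0).
Proof. by split=> // u v; rewrite addr0. Qed.

Lemma hop_id : hop 0 id.
Proof. by split=> // u v p; apply; rewrite addr0. Qed.

Lemma hop_Sum k (I : Type) (r : seq I) (X : I -> V -> V) :
  (forall i, hop k (X i)) -> hop k (fun v => \sum_(i <- r) X i v).
Proof.
move=> h; elim: r => [|i r IH].
  by apply: (hop_eq (hop_zero k)) => // v; rewrite big_nil.
by apply: (hop_eq (hop_add (h i) IH)) => // v; rewrite big_cons.
Qed.

Lemma hop_mu f : hop 0 (mu f).
Proof. by split=> [u v|u v p h]; rewrite ?muD // /mu h // addr0. Qed.

Lemma hop_cr i : hop (Negz i.2) (cr i).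
Proof.
split=> [u v|u v p h]; rewrite ?crD // /cr; case: ifP => // hp.
by apply: h; move: (wt_sub hp); lia.
Qed.

Lemma hop_an i : hop (Posz i.2.+1) (an i).
Proof. by split=> [u v|u v p h]; rewrite ?anD // /an h // wt_add; lia. Qed.

Lemma hop_dv : hop 0 dv.
Proof. by split=> [u v|u v p h]; rewrite ?dvD // /dv h // addr0. Qed.

Lemma hop_am k : hop k (am k).
Proof.
case: k => [[|n]|n].
- exact: hop_dv.
- exact: (hop_an (true, n)).
- exact: (hop_cr (false, n)).
Qed.

Lemma hop_bm k : hop k (bm k).
Proof.
case: k => [[|n]|n].
- exact: hop_mu.
- exact: (hop_opp (hop_an (false, n))).
- exact: (hop_cr (true, n)).
Qed.

(** * Powers of the nonzero modes of b, and the fields of functions *)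

Fixpoint Sop (B i : nat) (k : int) (v : V) : V :=
  match i with
  | 0 => if k == 0 then v else 0
  | i'.+1 => \sum_(n <- nzrange B) bm n (Sop B i' (k - n) v)
  end.

(** [Sop B i k] is the coefficient of z^{-k} in the i-th power of the sum of b_n z^{-n} over 0 < |n|
    <= B, whence the degree. *)
Lemma hop_Sop B i k : hop k (Sop B i k).
Proof.
elim: i k => [|i IH] k /=.
  by case: eqP => [->|_]; [exact: hop_id | exact: hop_zero].
apply: hop_Sum => n; apply: (hop_eq (hop_comp (hop_bm n) (IH (k - n)))) => //.
by rewrite addrC subrK.
Qed.

Lemma nzrangeE B (F' : int -> V) :
  \sum_(n <- nzrange B) F' n = \sum_(n < B) F' n.+1%:Z + \sum_(n < B) F' (Negz n).
Proof.
rewrite /nzrange big_cat /= !big_map /= -(big_mkord xpredT (fun n => F' n.+1%:Z)).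
by rewrite -(big_mkord xpredT (fun n => F' (Negz n))) /index_iota !subn0.
Qed.

Lemma ord_trunc (M : zmodType) (G : nat -> M) B C : (C <= B)%N ->
  (forall n, (C <= n)%N -> G n = 0) -> \sum_(n < B) G n = \sum_(n < C) G n.
Proof.
move=> /subnKC <- h; rewrite big_split_ord /= [X in _ + X]big1 ?addr0 // => i _.
by apply: h; rewrite leq_addr.
Qed.

Lemma nz_trunc (F' : int -> V) p B C : (C <= B)%N ->
  (forall n : int, (C < `|n|)%N -> F' n p = 0) ->
  (\sum_(n <- nzrange B) F' n) p = (\sum_(n <- nzrange C) F' n) p.
Proof.
move=> CB h; rewrite !nzrangeE !addrfctE !fct_sumE.
congr (_ + _).
  by apply: (@ord_trunc _ (fun n => F' n.+1%:Z p)) => // n hn; apply: h; lia.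
by apply: (@ord_trunc _ (fun n => F' (Negz n) p)) => // n hn; apply: h; lia.
Qed.

Lemma bm_neg n v p : bm (Negz n) v p = if (0 < pcnt (true, n) p)%N then v (psub (true, n) p) else 0.
Proof. by []. Qed.
Lemma bm_pos n v p : bm n.+1%:Z v p = - ((pcnt (false, n) p).+1%:R * v (padd (false, n) p)).
Proof. by []. Qed.

(** The creating factors produce part of the b-weight w of the output monomial, so their degrees sum
    to at least -w and so does the total. *)
Lemma Sop_van B i k v p : k < - (wts true p)%:Z -> Sop B i k v p = 0.
Proof.
elim: i k p => [|i IH] k p h /=.
  by case: eqP => // k0; move: h; rewrite k0; lia.
rewrite nzrangeE addrfctE !fct_sumE !big1 ?addr0 // => n _.
  rewrite bm_neg; case: ifP => // hp; apply: IH.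
  by move: (wts_sub true hp); rewrite /=; lia.
by rewrite bm_pos IH ?mulr0 ?oppr0 // wts_add /=; lia.
Qed.

(** With w = [wts true p], at most w factors create, and the annihilating ones have total degree at
    most k + w; so a nonzero product has at most 2w + k factors. *)
Lemma Sop_big B i k v p : 2 * (wts true p)%:Z + k < i%:Z -> Sop B i k v p = 0.
Proof.
elim: i k p => [|i IH] k p h /=.
  by case: eqP => // k0; move: h; rewrite k0; lia.
rewrite nzrangeE addrfctE !fct_sumE !big1 ?addr0 // => n _.
  rewrite bm_neg; case: ifP => // hp; apply: IH.
  by move: (wts_sub true hp); rewrite /=; lia.
by rewrite bm_pos IH ?mulr0 ?oppr0 // wts_add /=; lia.
Qed.

Lemma Sop_stab B B' i k v p : (wts true p)%:Z <= B%:Z -> k + (wts true p)%:Z <= B%:Z ->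
  (wts true p)%:Z <= B'%:Z -> k + (wts true p)%:Z <= B'%:Z ->
  Sop B i k v p = Sop B' i k v p.
Proof.
elim: i k p => [|i IH] k p h1 h2 h3 h4 //=.
(* The modes that matter at [p]: b_{-n} requires n <= w = [wts true p], and b_n requires n <= k + w
   because the remaining factors cannot have total degree below -w. *)
pose C := maxn (wts true p) `|Num.max 0 (k + (wts true p)%:Z)|.
have hvan A n : (C < `|n|)%N -> bm n (Sop A i (k - n) v) p = 0.
  case: n => [[|n]|n] hn.
  - by exfalso; move: hn; rewrite /C; lia.
  - by rewrite bm_pos Sop_van ?mulr0 ?oppr0 // wts_add /=; move: hn; rewrite /C; lia.
  - by rewrite bm_neg; case: ifP => // hp; exfalso; move: (wts_sub true hp) hn; rewrite /C /=; lia.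
rewrite (@nz_trunc _ _ B C) ?(@nz_trunc _ _ B' C); try exact: hvan; try (by rewrite /C; lia).
rewrite !fct_sumE; apply: eq_bigr => -[[|n]|n] _.
- rewrite /bm /mu; congr (_ * _); apply: IH; lia.
- by rewrite !bm_pos; congr (- (_ * _)); apply: IH; rewrite wts_add /=; lia.
- rewrite !bm_neg; case: ifP => // hp; move: (wts_sub true hp) => /= e.
  by apply: IH; lia.
Qed.

Lemma bm_sum k (I : Type) (r : seq I) (f : I -> V) :
  bm k (\sum_(i <- r) f i) = \sum_(i <- r) bm k (f i).
Proof. exact: (hop_sum (hop_bm k)). Qed.

Lemma Sop_bm B i k l v : Sop B i k (bm l v) = bm l (Sop B i k v).
Proof.
elim: i k => [|i IH] k /=; first by case: eqP => // _; rewrite (hop0 (hop_bm l)).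
by rewrite bm_sum; apply: eq_bigr => n _; rewrite IH bm_bm.
Qed.

Lemma Sop_mu B i k f v : Sop B i k (mu f v) = mu f (Sop B i k v).
Proof.
elim: i k => [|i IH] k /=; first by case: eqP => // _; rewrite (hop0 (hop_mu f)).
by rewrite (hop_sum (hop_mu f)); apply: eq_bigr => n _; rewrite IH bm_mu.
Qed.

Lemma nzrange_pick B (m : int) (f : int -> V) : (`|m| <= B)%N ->
  \sum_(n <- nzrange B | n == m) f n = if m == 0 then 0 else f m.
Proof.
move=> mB.
have um : uniq (nzrange B).
  rewrite /nzrange cat_uniq !map_inj_uniq ?iota_uniq; [| by move=> ? ? [] | by move=> ? ? []].
  by rewrite andbT /=; apply/hasPn => x /mapP[y _ ->]; apply/negP => /mapP[z].
have [->|m0] := eqVneq m 0.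
  rewrite big_seq_cond big1 // => n /andP[+ /eqP n0].
  by rewrite n0 /nzrange mem_cat => /orP[] /mapP[].
rewrite big_mkcond (bigD1_seq m) //=; last first.
  rewrite /nzrange mem_cat; case: m m0 mB => [[|m]|m] //= _ mB; apply/orP.
    by left; apply/mapP; exists m; rewrite ?mem_iota.
  by right; apply/mapP; exists m; rewrite ?mem_iota.
by rewrite eqxx big1 ?addr0 // => n /negPf ->.
Qed.

(** The commutator with a_m is a derivation sending b_{-m} to 1 and the other b_n to 0. The bound on
    m says that b_{-m} occurs in the truncated sum. *)
Lemma am_Sop B i k m v : m != 0 -> (`|m| <= B)%N ->
  am m (Sop B i k v) = Sop B i k (am m v) + Sop B i.-1 (k + m) v *+ i.
Proof.
move=> m0 mB; elim: i k => [|i IH] k /=.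
  by rewrite mulr0n addr0; case: eqP => // _; rewrite (hop0 (hop_am m)).
rewrite (hop_sum (hop_am m)) /=.
under eq_bigr => n _ do rewrite am_bm IH (hopD (hop_bm n)) (hopMn (hop_bm n)) -addrA.
rewrite big_split /=; congr (_ + _); rewrite big_split /= mulrSr; congr (_ + _).
  case: i {IH} => [|i]; first by rewrite mulr0n big1 // => n _; rewrite mulr0n.
  by rewrite sumrMnl; congr (_ *+ _) => /=; apply: eq_bigr => n _; congr (bm _ (Sop _ _ _ _)); lia.
have e (n : int) : (m + n == 0) = (n == - m) by apply/eqP/eqP; lia.
under eq_bigr => n _ do rewrite e.
rewrite -big_mkcond /=.
by rewrite nzrange_pick ?abszN // oppr_eq0 (negPf m0) opprK.
Qed.

Lemma dv_Sop B i k v : dv (Sop B i k v) = Sop B i k (dv v).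
Proof.
elim: i k => [|i IH] k /=; first by case: eqP => // _; rewrite (hop0 hop_dv).
rewrite (hop_sum hop_dv) /nzrange !big_cat !big_map /=; congr (_ + _); apply: eq_bigr => n _.
  by rewrite (hopN hop_dv) -an_dv IH.
by rewrite -cr_dv IH.
Qed.

Fact fock_key : unit. Proof. exact: tt. Qed.
Definition ifact i : O := io (i`!%:R^-1).
Definition fmt (B : nat) (f : O) (k : int) (v : V) : V :=
  \sum_(i < B) mu (ifact i * iter i d f) (Sop B i k v).
(** Mode f_[k] := f_(k-1) of the field Y(f, z), i.e. the coefficient of z^{-k}; its
    truncation order depends on the output monomial. *)
Definition fm := locked_with fock_key (fun (f : O) (k : int) (v : V) =>
  (fun p => fmt (2 * wt p + `|k| + 1) f k v p) : V).

Lemma fmU f k v p : fm f k v p = fmt (2 * wt p + `|k| + 1) f k v p.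
Proof. by rewrite /fm unlock. Qed.

Lemma hop_fmt B f k : hop k (fmt B f k).
Proof.
apply: hop_Sum => i; apply: (hop_eq (hop_comp (hop_mu _) (hop_Sop B i k))) => //.
by rewrite add0r.
Qed.

Lemma fmE f k v p B : (2 * wt p + `|k| < B)%N -> fm f k v p = fmt B f k v p.
Proof.
move=> hB; rewrite !fmU /fmt !fct_sumE.
have wp : (wts true p <= wt p)%N by rewrite /wt; lia.
rewrite [RHS](@ord_trunc _ (fun i => mu (ifact i * iter i d f) (Sop B i k v) p) _
  (2 * wt p + `|k| + 1)); last first.
- by move=> n hn; rewrite /mu Sop_big ?mulr0 //; lia.
- lia.
by apply: eq_bigr => i _; rewrite /mu; congr (_ * _); apply: Sop_stab; lia.
Qed.

Lemma fm_in X l f k v p B : hop l X -> (2 * (wt p + `|l|) + `|k| < B)%N ->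
  X (fm f k v) p = X (fmt B f k v) p.
Proof. by move=> [_ hX] hB; apply: hX => q eq; apply: fmE; lia. Qed.

Lemma hop_fm f k : hop k (fm f k).
Proof.
split=> [u v|u v p h]; last first.
  by rewrite !fmU; case: (hop_fmt (2 * wt p + `|k| + 1) f k) => _; apply.
by apply/funext => p; rewrite vaddx !fmU (hopD (hop_fmt _ _ _)).
Qed.

Lemma fmt_bm B f k l v : fmt B f k (bm l v) = bm l (fmt B f k v).
Proof. by rewrite /fmt bm_sum; apply: eq_bigr => i _; rewrite Sop_bm bm_mu. Qed.

Lemma fm_bm f k l v : fm f k (bm l v) = bm l (fm f k v).
Proof.
apply/funext => p; pose B := (2 * (wt p + `|l|) + `|k| + 1)%N.
by rewrite (@fmE _ _ _ _ B) ?fmt_bm ?(@fm_in _ _ f k v p B (hop_bm l)) /B //; lia.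
Qed.

Lemma fmt_mu B f k g v : fmt B f k (mu g v) = mu g (fmt B f k v).
Proof.
rewrite /fmt (hop_sum (hop_mu g)); apply: eq_bigr => i _.
by rewrite Sop_mu !mu_mu mulrC.
Qed.

Lemma fm_mu f k g v : fm f k (mu g v) = mu g (fm f k v).
Proof. by apply/funext => p; rewrite /mu !fmU fmt_mu. Qed.

Lemma Sop_fm B i k f l v : Sop B i k (fm f l v) = fm f l (Sop B i k v).
Proof.
elim: i k => [|i IH] k /=; first by case: eqP => // _; rewrite (hop0 (hop_fm f l)).
by rewrite (hop_sum (hop_fm f l)); apply: eq_bigr => n _; rewrite IH fm_bm.
Qed.

Lemma fm_fm f k g l v : fm f k (fm g l v) = fm g l (fm f k v).
Proof.
apply/funext => p; pose B := (2 * (wt p + `|l|) + `|k| + 1)%N.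
rewrite (@fmE _ _ _ _ B) ?(@fm_in _ _ f k v p B (hop_fm g l)) /B; try lia.
rewrite /fmt (hop_sum (hop_fm g l)); congr (_ p); apply: eq_bigr => i _.
by rewrite Sop_fm fm_mu.
Qed.

Lemma ifactS i : ifact i.+1 *+ i.+1 = ifact i.
Proof.
rewrite /ifact -rmorphMn /= factS natrM invfM -mulr_natl mulrA divff ?mul1r //.
Qed.

Lemma iter_d0 i : iter i d 0 = 0.
Proof. by elim: i => //= i ->; rewrite d0. Qed.

Lemma iter_dD i f g : iter i d (f + g) = iter i d f + iter i d g.
Proof. by elim: i => //= i ->; rewrite dD. Qed.

Lemma d_iter i f : d f = 0 -> d (iter i d f) = 0.
Proof. by move=> df; rewrite -iterS iterSr df iter_d0. Qed.

Lemma d_ifact i f : d (ifact i * f) = ifact i * d f.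
Proof. by rewrite dM d_io mul0r add0r. Qed.

Lemma muMnl f u n : mu (f *+ n) u = mu f u *+ n.
Proof. by elim: n => [|n IH]; rewrite ?mulr0n ?mu0 // !mulrS muDl IH. Qed.

(** For m <> 0 the commutator lowers the exponent, and i f^(i) / i! is the Taylor coefficient of
    index i - 1 of f'. For m = 0 the mode differentiates the coefficient functions and commutes with
    the nonzero b_n. *)
Lemma fm_am f k m v : am m (fm f k v) = fm f k (am m v) + fm (d f) (k + m) v.
Proof.
apply/funext => p; pose B := (2 * (wt p + `|m|) + `|k| + `|(k + m)%R| + 2)%N.
rewrite (@fm_in _ _ f k v p B.+1 (hop_am m)) ?addrfctE; last by rewrite /B; lia.
rewrite !(@fmE _ _ _ _ B.+1); try (by rewrite /B; lia).
rewrite /fmt (hop_sum (hop_am m)).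
have [->|m0] := eqVneq m 0.
  rewrite addr0 !fct_sumE -big_split /=; apply: eq_bigr => i _.
  by rewrite dv_mu d_ifact dv_Sop -iterS iterSr addrfctE addrC.
have mB : (`|m| <= B.+1)%N by rewrite /B; lia.
under eq_bigr => i _ do rewrite am_mu // (am_Sop _ _ _ m0 mB) (hopD (hop_mu _)) (hopMn (hop_mu _)).
rewrite big_split /= addrfctE; congr (_ + _).
rewrite big_ord_recl mulr0n add0r [in RHS]big_ord_recr /= addrfctE.
(* Lowering the exponent shifts one sum against the other; the surplus top term vanishes for degree
   reasons. *)
rewrite [X in _ = _ + X](_ : _ = 0) ?addr0; last first.
  by rewrite /mu Sop_big ?mulr0 // /B /wt; lia.
congr (_ p); apply: eq_bigr => i _; rewrite /bump /= add1n.
by rewrite -iterSr -(ifactS i) -muMnl mulrnAl iterS.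
Qed.

Lemma fmD f g k v : fm (f + g) k v = fm f k v + fm g k v.
Proof.
apply/funext => p; rewrite addrfctE !fmU /fmt !fct_sumE -big_split /=.
by apply: eq_bigr => i _; rewrite iter_dD mulrDr muDl.
Qed.

Lemma fm_const c k v : d c = 0 -> fm c k v = if k == 0 then mu c v else 0.
Proof.
move=> dc; apply/funext => p; rewrite !fmU /fmt addn1 big_ord_recl big1 ?addr0 /=.
  by case: eqP => _; rewrite /ifact fact0 invr1 rmorph1 mul1r // (hop0 (hop_mu c)).
by move=> i _; rewrite d_iter // mulr0 mu0.
Qed.

Lemma fm0 k v : fm 0 k v = 0.
Proof. by rewrite fm_const ?d0 // mu0; case: eqP. Qed.

Lemma fm_beta k v : fm beta k v = bm k v.
Proof.
apply/funext => p; rewrite (@fmE _ _ _ _ (2 * wt p + `|k|).+2) ?leqnSn //.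
rewrite /fmt !big_ord_recl big1 ?addr0; last first.
  have e j : iter j.+2 d beta = 0 by rewrite iterSr d_beta iterSr d1 iter_d0.
  by move=> i _; rewrite (e i : iter (lift ord0 (lift ord0 i)) d beta = 0) mulr0 mu0.
rewrite /= /ifact fact0 factS fact0 invr1 rmorph1 !mul1r d_beta mu1.
set S := \sum_(n <- _) _.
have -> : S = if k == 0 then 0 else bm k v.
  rewrite /S; under eq_bigr => n _ do rewrite subr_eq0.
  have h n : bm n (if k == n then v else 0) = if k == n then bm n v else 0.
    by case: eqP => // _; rewrite (hop0 (hop_bm n)).
  under eq_bigr => n _ do rewrite h eq_sym.
  rewrite -big_mkcond /= nzrange_pick //; lia.
by case: eqP => [->|_]; rewrite ?addr0 // (hop0 (hop_mu _)) add0r.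
Qed.

Lemma fm_vac0 f e : fm f 0 (vac e) = vac (f * e).
Proof.
apply/funext => p; have [p0|p0] := eqVneq (wt p) 0%N; last first.
  rewrite (@hop_hv _ _ (hop_fm f 0) _ _ 0%N (@hv_mono pp0 e)) //.
  by rewrite /vac (@hv_mono pp0 _ p p0).
have -> : p = pp0.
  apply: pcnt_inj => i; rewrite [RHS](_ : _ = 0%N); last by case: i => -[] n'.
  by apply/eqP; rewrite -leqn0 leqNgt; apply/negP => /wt_sub; lia.
rewrite !fmU /fmt addn1 big_ord_recl addrfctE fct_sumE big1 ?addr0 => [|i _]; last first.
  by rewrite /mu Sop_big ?mulr0 //=.
by rewrite /= /mu /vac /mono eqxx /ifact fact0 invr1 rmorph1 mul1r.
Qed.

Lemma fm_vac_pos f (k : int) e : 0 < k -> fm f k (vac e) = 0.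
Proof. by move=> k0; apply: (hop_hv0 (hop_fm f k) (@hv_mono pp0 e)). Qed.

Lemma monoD p f g : mono p (f + g) = mono p f + mono p g.
Proof. by apply/funext => q; rewrite addrfctE /mono; case: eqP; rewrite ?addr0. Qed.
Lemma mono0 p : mono p 0 = 0.
Proof. by apply/funext => q; rewrite /mono; case: eqP. Qed.
Lemma mu_mono f p g : mu f (mono p g) = mono p (f * g).
Proof. by apply/funext => q; rewrite /mu /mono; case: eqP; rewrite ?mulr0. Qed.
Lemma dv_mono p f : dv (mono p f) = mono p (d f).
Proof. by apply/funext => q; rewrite /dv /mono; case: eqP; rewrite ?d0. Qed.

Lemma cr_mono i p f : cr i (mono p f) = mono (padd i p) f.
Proof.
apply/funext => q; rewrite /cr /mono; case: ifP => h.
  by congr (if _ then _ else _); apply/eqP/eqP => [<-|->]; rewrite ?psubK ?paddK.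
by case: eqP h => // ->; rewrite pcnt_add eqxx addn1.
Qed.

Lemma an_mono i p f : an i (mono p f) =
  if (0 < pcnt i p)%N then mono (psub i p) ((pcnt i p)%:R * f) else 0.
Proof.
apply/funext => q; rewrite /an /mono; have [e|e] := eqVneq (padd i q) p.
  by rewrite -e pcnt_add eqxx addn1 /= paddK eqxx.
rewrite mulr0; case: ifP => // h; case: eqP => // qe.
by move: e; rewrite qe psubK // eqxx.
Qed.

Lemma mono_ind (Q : V -> Prop) : (forall f, Q (vac f)) ->
  (forall n w, Q w -> Q (am (Negz n) w)) -> (forall n w, Q w -> Q (bm (Negz n) w)) ->
  forall p f, Q (mono p f).
Proof.
move=> h0 ha hb p f; elim/pp_ind: p => [|[[] n] p IH]; first exact: h0.
  by rewrite -cr_mono; exact: (hb n).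
by rewrite -cr_mono; exact: (ha n).
Qed.

Lemma hv_sum N v : hv N v -> v = \sum_(p <- pps N) mono p (v p).
Proof.
move=> h; apply/funext => q; rewrite fct_sumE /mono.
have [qN|qN] := eqVneq (wt q) N; last first.
  rewrite h // big_seq_cond big1 // => p /andP[pN _]; case: eqP => // qp.
  by move: qN; rewrite qp -mem_pps pN.
rewrite (bigD1_seq q) ?pps_uniq ?mem_pps ?qN //= eqxx big1 ?addr0 // => p pq.
by rewrite eq_sym (negPf pq).
Qed.

(** At a given [p] only one weight of the argument enters, and there a vector is a finite sum of
    monomials. *)
Lemma hop_ext k X Y : hop k X -> hop k Y ->
  (forall p f, X (mono p f) = Y (mono p f)) -> forall v, X v = Y v.
Proof.
move=> hX hY e v; apply/funext => p.
have [N hN] : exists N : nat, forall q, (wt q)%:Z = (wt p)%:Z + k -> wt q = N.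
  by exists `|((wt p)%:Z + k)%R|%N => q hq; lia.
pose v' : V := fun q => if wt q == N then v q else 0.
have hv' : hv N v' by move=> q; rewrite /v' => /negPf ->.
have l Z : hop k Z -> Z v p = Z v' p.
  by case=> _ hZ; apply: hZ => q /hN e'; rewrite /v' e' eqxx.
rewrite (l X) // (l Y) // (hv_sum hv') (hop_sum hX) (hop_sum hY).
by congr (_ p); apply: eq_bigr => q _; rewrite e.
Qed.

(** Irreducibility of the Fock space. *)
Lemma hw0 N v : (0 < N)%N -> hv N v -> (forall m, am m.+1%:Z v = 0) ->
  (forall m, bm m.+1%:Z v = 0) -> v = 0.
Proof.
move=> N0 hN ha hb; apply/funext => p; have [pN|/hN //] := eqVneq (wt p) N.
have key i : (0 < pcnt i p)%N -> an i v = 0 -> v p = 0.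
  move=> hi /(congr1 (fun u : V => u (psub i p))); rewrite /an psubK // pcnt_sub eqxx subn1 prednK //.
  move/(congr1 (fun x => io ((pcnt i p)%:R^-1) * x)); rewrite mulrA -(rmorph_nat io) -rmorphM /=.
  by rewrite mulVf ?rmorph1 ?mul1r ?mulr0 // pnatr_eq0 -lt0n.
have [[[[] n] hi]|no] := pselect (exists i, (0 < pcnt i p)%N).
- exact: (key _ hi (ha n)).
- by apply: (key _ hi); have := hb n => /(congr1 -%R); rewrite /= opprK oppr0.
suff p0 : p = pp0 by move: N0; rewrite -pN p0.
apply: pcnt_inj => i; rewrite [RHS](_ : _ = 0%N); last by case: i => -[] n'.
by apply/eqP; rewrite -leqn0 leqNgt; apply/negP => hi; apply: no; exists i.
Qed.

(** * Currents of affine sl_2 *)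

Lemma hop_neg k X v p : hop k X -> (wt p)%:Z + k < 0 -> X v p = 0.
Proof.
by move=> hX h; rewrite ((proj2 hX) v 0) ?(hop0 hX) // => q; lia.
Qed.

(** Summation over -L <= j < L, as [Negz j] is -j-1. *)
Definition Zs (L : nat) (F' : int -> V) : V :=
  \sum_(j < L) F' (Posz j) + \sum_(j < L) F' (Negz j).

Lemma Zs_trunc F' p L C : (C <= L)%N ->
  (forall j : int, (C <= `|j|)%N -> F' j p = 0) -> Zs L F' p = Zs C F' p.
Proof.
move=> CL h; rewrite /Zs !addrfctE !fct_sumE; congr (_ + _).
  by apply: (@ord_trunc _ (fun n => F' (Posz n) p)) => // n hn; apply: h; lia.
by apply: (@ord_trunc _ (fun n => F' (Negz n) p)) => // n hn; apply: h; lia.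
Qed.

Lemma eq_Zs L F1 F2 : F1 =1 F2 -> Zs L F1 = Zs L F2.
Proof. by move=> e; rewrite /Zs; congr (_ + _); apply: eq_bigr => i _; rewrite e. Qed.

Lemma ZsD L F1 F2 : Zs L (fun j => F1 j + F2 j) = Zs L F1 + Zs L F2.
Proof. by rewrite /Zs !big_split /= addrACA. Qed.

Lemma ZsN L F1 : Zs L (fun j => - F1 j) = - Zs L F1.
Proof. by rewrite /Zs !sumrN opprD. Qed.

Lemma hop_Zs k X L F' : hop k X -> X (Zs L F') = Zs L (fun j => X (F' j)).
Proof. by move=> hX; rewrite /Zs (hopD hX) !(hop_sum hX). Qed.

Lemma Zs_pick L F' j0 : (`|j0| < L)%N -> (forall j, j != j0 -> F' j = 0) -> Zs L F' = F' j0.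
Proof.
move=> hL h; rewrite /Zs; case: j0 hL h => n hn h.
  rewrite (bigD1 (Ordinal hn)) //= [X in _ + X + _]big1 ?addr0; last first.
    by move=> i ni; apply: h; apply: contra ni => /eqP[e]; apply/eqP/val_inj.
  by rewrite [X in _ + X]big1 ?addr0 // => i _; apply: h.
have {}hn : (n < L)%N by lia.
rewrite [X in X + _]big1 ?add0r; last by move=> i _; apply: h.
rewrite (bigD1 (Ordinal hn)) //= big1 ?addr0 // => i ni; apply: h.
by apply: contra ni => /eqP[e]; apply/eqP/val_inj.
Qed.

(** The coefficient of z^{-(n+l)} in Y(f,z) Y(g,z). The splitting of the degree into n and l is kept
    so that a commutator with a_k shifts just one of the two. At a monomial the sum is finite since
    the two fields commute, so whichever mode creates more than the weight can be moved to the
    left. *)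
Definition conv := locked_with fock_key (fun (f g : O) (n l : int) (v : V) =>
  (fun p => Zs (wt p + `|n| + `|l| + 1) (fun j => fm f (n - j) (fm g (l + j) v)) p) : V).

Lemma convU f g n l v p : conv f g n l v p =
  Zs (wt p + `|n| + `|l| + 1) (fun j => fm f (n - j) (fm g (l + j) v)) p.
Proof. by rewrite /conv unlock. Qed.

Lemma convE f g n l v p L : (wt p + `|n| + `|l| < L)%N ->
  conv f g n l v p = Zs L (fun j => fm f (n - j) (fm g (l + j) v)) p.
Proof.
move=> hL; rewrite !convU [RHS](@Zs_trunc _ _ _ (wt p + `|n| + `|l| + 1)); [by [] | lia |].
move=> j hj; have [h|h] := leP 0 j.
  by rewrite (hop_neg _ (hop_fm f _)) //; lia.
by rewrite fm_fm (hop_neg _ (hop_fm g _)) //; lia.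
Qed.

Lemma hop_conv f g n l : hop (n + l) (conv f g n l).
Proof.
have h j : hop (n + l) (fun v => fm f (n - j) (fm g (l + j) v)).
  by apply: (hop_eq (hop_comp (hop_fm f (n - j)) (hop_fm g (l + j)))) => //; lia.
have hZ L : hop (n + l) (fun v => Zs L (fun j => fm f (n - j) (fm g (l + j) v))).
  by apply: hop_add; apply: hop_Sum => i; apply: h.
split=> [u v|u v p e]; last by rewrite !convU; case: (hZ (wt p + `|n| + `|l| + 1)%N) => _; apply.
by apply/funext => p; rewrite vaddx !convU (hopD (hZ _)).
Qed.

Lemma conv_in X k f g n l v p L : hop k X -> (wt p + `|k| + `|n| + `|l| < L)%N ->
  X (conv f g n l v) p = Zs L (fun j => X (fm f (n - j) (fm g (l + j) v))) p.
Proof.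
move=> hX hL; rewrite -(hop_Zs _ _ hX); case: hX => _; apply => q e.
by apply: convE; lia.
Qed.

Lemma conv_bm f g n l k v : bm k (conv f g n l v) = conv f g n l (bm k v).
Proof.
apply/funext => p; pose L := (wt p + `|k| + `|n| + `|l| + 1)%N.
rewrite (@conv_in _ k _ _ _ _ _ _ L (hop_bm k)) ?(@convE _ _ _ _ _ _ L) /L; try lia.
by congr (_ p); apply: eq_Zs => j; rewrite -!fm_bm.
Qed.

Lemma conv_am f g n l k v : am k (conv f g n l v) =
  conv f g n l (am k v) + (conv (d f) g (n + k) l v + conv f (d g) n (l + k) v).
Proof.
apply/funext => p; pose L := (wt p + `|k| + `|n| + `|l| + `|(n + k)%R| + `|(l + k)%R| + 1)%N.
rewrite (@conv_in _ k _ _ _ _ _ _ L (hop_am k)) ?addrfctE; last by rewrite /L; lia.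
rewrite !(@convE _ _ _ _ _ _ L); try (by rewrite /L; lia).
rewrite !vaddE -!ZsD; congr (_ p); apply: eq_Zs => j.
rewrite !fm_am (hopD (hop_fm _ _)) -addrA; congr (_ + _).
by rewrite addrC; congr (fm _ _ _ + fm _ _ (fm _ _ _)); lia.
Qed.

Lemma hv_vac e : hv 0 (vac e).
Proof. exact: (@hv_mono pp0 e). Qed.

Lemma vac_pos k X e : hop k X -> 0 < k -> X (vac e) = 0.
Proof. by move=> hX k0; apply: (hop_hv0 hX (hv_vac e)). Qed.

Lemma vac_irr k X e : hop k X -> k < 0 -> (forall m, am m.+1%:Z (X (vac e)) = 0) ->
  (forall m, bm m.+1%:Z (X (vac e)) = 0) -> X (vac e) = 0.
Proof.
move=> hX k0; apply: (@hw0 `|k|); first lia.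
by apply: (hop_hv hX (hv_vac e)); lia.
Qed.

Lemma fm_amr f k m v : fm f k (am m v) = am m (fm f k v) - fm (d f) (k + m) v.
Proof. by rewrite fm_am addrK. Qed.

(** Induction on how negative the degree is. The difference of the two sides is killed by b_m for m
    > 0, and by a_m because the commutator has a degree closer to 0; irreducibility finishes. In
    degree 0 just the term j = n survives. *)
Lemma conv_vac f g n l e : conv f g n l (vac e) = fm (f * g) (n + l) (vac e).
Proof.
have [s] := ubnP `|Num.min 0 (n + l)|; elim: s f g n l e => // s IH f g n l e hs.
have hc := hop_conv f g n l; have hf := hop_fm (f * g) (n + l).
have [k0|k0|k0] := ltgtP (n + l) 0.
- have hB : hop (n + l) (fun v => conv f g n l v - fm (f * g) (n + l) v).
    exact: hop_add hc (hop_opp hf).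
  apply/eqP; rewrite -subr_eq0; apply/eqP.
  apply: (vac_irr hB) => // m.
    rewrite (hopB (hop_am _)) conv_am fm_am (vac_pos _ (hop_am _)) //.
    rewrite (hop0 hc) (hop0 hf) !add0r dM fmD !IH; try lia.
    rewrite (_ : n + m.+1%:Z + l = n + l + m.+1%:Z) ?(addrA n) ?subrr //; lia.
  rewrite (hopB (hop_bm _)) conv_bm -fm_bm (vac_pos _ (hop_bm _)) //.
  by rewrite (hop0 hc) (hop0 hf) subrr.
- by rewrite (vac_pos _ hc) ?(vac_pos _ hf).
- apply/funext => p; rewrite !convU (@Zs_pick _ _ n); [| lia |].
    by rewrite subrr addrC k0 fm_vac0 !fm_vac0 mulrA.
  move=> j jn; have [h|h] := ltP 0 (l + j); first by rewrite (fm_vac_pos _ _ h) (hop0 (hop_fm _ _)).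
  by rewrite fm_fm (@fm_vac_pos f) ?(hop0 (hop_fm _ _)) //; lia.
Qed.

(** Multiplicativity Y(fg,z) = Y(f,z) Y(g,z). By the Leibniz rule the commutators with a_m and b_m
    match, so the identity spreads from the vacuum to all monomials. *)
Lemma fmM f g n l v : conv f g n l v = fm (f * g) (n + l) v.
Proof.
apply: (hop_ext (hop_conv f g n l) (hop_fm _ _)) => p e.
suff: forall f g n l, conv f g n l (mono p e) = fm (f * g) (n + l) (mono p e) by apply.
elim/mono_ind: {v f g n l p e}(mono p e) => [e|n w IH|n w IH] f g k l.
- exact: conv_vac.
- have -> : conv f g k l (am (Negz n) w) = am (Negz n) (conv f g k l w)
     - (conv (d f) g (k + Negz n) l w + conv f (d g) k (l + Negz n) w).
    by rewrite conv_am addrK.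
  by rewrite !IH fm_amr dM fmD (addrAC k) -(addrA k).
- by rewrite -conv_bm IH fm_bm.
Qed.

(** The terms of the normally ordered product :a(z) Y(h,z):, with a_0 placed on the right among the
    annihilating modes. *)
Definition nord (h : O) (n j : int) (v : V) : V :=
  if j < 0 then am j (fm h (n - j) v) else fm h (n - j) (am j v).
Definition Xmt (L : nat) (h : O) (n : int) (v : V) : V :=
  Zs L (fun j => nord h n j v) - mu n%:~R (fm (d h) n v).
(** Mode [n] of the field of a_{-1} h, shifted by [- n h'_[n]]: for quadratic [h] these are
    the currents of the Wakimoto realization of affine sl_2 at the critical level. *)
Definition Xm := locked_with fock_key (fun (h : O) (n : int) (v : V) =>
  (fun p => Xmt (wt p + `|n| + 1) h n v p) : V).

Lemma XmU h n v p : Xm h n v p = Xmt (wt p + `|n| + 1) h n v p.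
Proof. by rewrite /Xm unlock. Qed.

Lemma hop_nord h n j : hop n (nord h n j).
Proof.
rewrite /nord; case: (j < 0).
  by apply: (hop_eq (hop_comp (hop_am j) (hop_fm h (n - j)))) => //; lia.
by apply: (hop_eq (hop_comp (hop_fm h (n - j)) (hop_am j))) => //; lia.
Qed.

Lemma hop_Xmt L h n : hop n (Xmt L h n).
Proof.
apply: hop_add; first by apply: hop_add; apply: hop_Sum => i; apply: hop_nord.
apply: hop_opp; apply: (hop_eq (hop_comp (hop_mu _) (hop_fm (d h) n))) => //.
by rewrite add0r.
Qed.

Lemma XmE h n v p L : (wt p + `|n| < L)%N -> Xm h n v p = Xmt L h n v p.
Proof.
move=> hL; rewrite !XmU /Xmt !addrfctE; congr (_ + _).
rewrite [RHS](@Zs_trunc _ _ _ (wt p + `|n| + 1)); [by [] | lia |].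
move=> j hj; rewrite /nord; case: ifP => j0.
  case: j hj j0 => // j hj _; rewrite /= /cr; case: ifP => // /wt_sub /=; lia.
by rewrite (hop_neg _ (hop_fm h _)) //; lia.
Qed.

Lemma Xm_in X k h n v p L : hop k X -> (wt p + `|k| + `|n| < L)%N ->
  X (Xm h n v) p = X (Xmt L h n v) p.
Proof. by move=> [_ hX] hL; apply: hX => q e; apply: XmE; lia. Qed.

Lemma hop_Xm h n : hop n (Xm h n).
Proof.
split=> [u v|u v p e].
  by apply/funext => p; rewrite vaddx !XmU (hopD (hop_Xmt _ _ _)).
by rewrite !XmU; case: (hop_Xmt (wt p + `|n| + 1) h n) => _; apply.
Qed.

Lemma d_int (n : int) : d n%:~R = 0.
Proof. by case: n => n; rewrite ?NegzE ?mulrNz ?dN d_nat ?oppr0. Qed.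

Lemma am_mu_const l c v : d c = 0 -> am l (mu c v) = mu c (am l v).
Proof.
move=> dc; have [->|l0] := eqVneq l 0; last by rewrite am_mu.
by rewrite /= dv_mu dc mu0 add0r.
Qed.

Lemma nord_fm h n j f l v : nord h n j (fm f l v) =
  fm f l (nord h n j v) + fm h (n - j) (fm (d f) (l + j) v).
Proof.
rewrite /nord; case: ifP => _; first by rewrite (fm_fm h) fm_am [in X in _ + X]fm_fm.
by rewrite fm_am (hopD (hop_fm _ _)) (fm_fm h).
Qed.

Lemma nord_am h n j l v : nord h n j (am l v) = am l (nord h n j v) - nord (d h) (n + l) j v.
Proof.
rewrite /nord; case: ifP => _.
  by rewrite (am_am l) fm_amr (hopB (hop_am j)) (_ : n + l - j = n - j + l) //; lia.
by rewrite am_am fm_amr (_ : n + l - j = n - j + l) //; lia.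
Qed.

(** Only the modes of a fail to commute with a function; they turn f into f', and [fmM] collects the
    sum into a mode of h f'. Thus X^h acts on functions through the vector field h d/db. *)
Lemma Xm_fm h n f l v : Xm h n (fm f l v) = fm f l (Xm h n v) + fm (h * d f) (n + l) v.
Proof.
rewrite -fmM; apply/funext => p; pose L := (wt p + `|l| + `|n| + 1)%N.
rewrite addrfctE (@Xm_in _ l h n v p L (hop_fm f l)) ?(@XmE _ _ _ _ L) ?(@convE _ _ _ _ _ _ L);
  try (by rewrite /L; lia).
rewrite vaddE; congr (_ p); rewrite /Xmt (hopB (hop_fm f l)) (hop_Zs _ _ (hop_fm f l)).
rewrite fm_mu (fm_fm f); under eq_Zs => j do rewrite nord_fm.
by rewrite ZsD; vab.
Qed.

Lemma Xm_am h n l v : Xm h n (am l v) =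
  am l (Xm h n v) - Xm (d h) (n + l) v - mu l%:~R (fm (d (d h)) (n + l) v).
Proof.
apply/funext => p; pose L := (wt p + `|l| + `|n| + `|(n + l)%R| + 1)%N.
rewrite 2!addrfctE !opprfctE (@Xm_in _ l h n v p L (hop_am l)) ?(@XmE _ _ _ _ L);
  try (by rewrite /L; lia).
rewrite !voppE !vaddE; congr (_ p); rewrite /Xmt (hopB (hop_am l)) (hop_Zs _ _ (hop_am l)).
rewrite am_mu_const ?d_int // fm_am (hopD (hop_mu _)).
under eq_Zs => j do rewrite nord_am.
rewrite ZsD ZsN intrD muDl; set A := Zs _ _; set B := Zs _ _.
set x := mu n%:~R _; set y := mu n%:~R _; set z := mu l%:~R _.
by vab.
Qed.

Lemma nord_vac h n j e : nord h n j (vac e) =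
  if j < 0 then (if j < n then 0 else am j (fm h (n - j) (vac e)))
  else (if j == 0 then fm h n (vac (d e)) else 0).
Proof.
rewrite /nord; case: ifP => j0.
  by case: ifP => jn //; rewrite fm_vac_pos ?(hop0 (hop_am j)) //; lia.
case: eqP => [->|j1]; first by rewrite subr0 /= dv_mono.
by rewrite (vac_pos _ (hop_am j)) ?(hop0 (hop_fm _ _)) //; lia.
Qed.

Lemma Xm_vac0 h e : Xm h 0 (vac e) = vac (h * d e).
Proof.
apply/funext => p; rewrite !XmU /Xmt mu0 subr0 (@Zs_pick _ _ 0) ?nord_vac ?fm_vac0 //; last first.
  by move=> j j0; rewrite nord_vac (negPf j0); case: ifP => // ->.
lia.
Qed.

Lemma Xm_vac_pos h (n : int) e : 0 < n -> Xm h n (vac e) = 0.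
Proof. exact: (vac_pos _ (hop_Xm h n)). Qed.

Lemma Xm_vac_neg h s e : Xm h (Negz s) (vac e) =
  \sum_(j < s.+1) am (Negz j) (fm h (Negz s - Negz j) (vac e)) +
  fm h (Negz s) (vac (d e)) + mu s.+1%:R (fm (d h) (Negz s) (vac e)).
Proof.
apply/funext => p; rewrite (@XmE _ _ _ _ (wt p + s.+2)); last lia.
congr (_ p); rewrite /Xmt NegzE mulrNz muN opprK -NegzE; congr (_ + _).
rewrite /Zs addrC; congr (_ + _).
  rewrite (@ord_trunc _ (fun j => nord h (Negz s) (Negz j) (vac e)) _ s.+1); [|lia|].
    by apply: eq_bigr => j _; rewrite nord_vac /= (_ : (Negz j < Negz s) = false) //; have := ltn_ord j; lia.
  by move=> j hj; rewrite nord_vac /= (_ : (Negz j < Negz s) = true) //; lia.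
rewrite addnS big_ord_recl big1 ?addr0 ?nord_vac //= => i _.
by rewrite nord_vac.
Qed.

Lemma XmD h k n v : Xm (h + k) n v = Xm h n v + Xm k n v.
Proof.
apply/funext => p; rewrite vx !XmU vaddE; congr (_ p); rewrite /Xmt dD fmD muD.
under eq_Zs => j.
  have -> : nord (h + k) n j v = nord h n j v + nord k n j v.
    by rewrite /nord; case: (j < 0); rewrite fmD ?(hopD (hop_am j)).
  over.
by rewrite ZsD; vab.
Qed.

Lemma Xm0 n v : Xm 0 n v = 0.
Proof. by apply: (addrI (Xm 0 n v)); rewrite -XmD !addr0. Qed.

Lemma XmN h n v : Xm (- h) n v = - Xm h n v.
Proof. by apply: (addrI (Xm h n v)); rewrite -XmD !subrr Xm0. Qed.

Lemma monoN p f : mono p (- f) = - mono p f.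
Proof. by apply: (addrI (mono p f)); rewrite -monoD !subrr mono0. Qed.
Lemma monoMn p f n : mono p (f *+ n) = mono p f *+ n.
Proof. by elim: n => [|n IH]; rewrite ?mulr0n ?mono0 // !mulrS monoD IH. Qed.

Section Affine.
(** A vector field [h d/db] with [h] quadratic. *)
Definition quad (h : O) := d (d (d h)) = 0.
Definition vbr (h k : O) := h * d k - d h * k.
(** For quadratic fields this symmetric form is constant, and [kap h h] is minus the discriminant of
    h. It is the invariant form in the central term; it vanishes on perfect squares, which is what
    makes the transformed modes of a commute. *)
Definition kap (h k : O) := d (d h) * k - d h * d k + h * d (d k).

Lemma quad_d h : quad h -> quad (d h).
Proof. by rewrite /quad => ->; rewrite d0. Qed.

Lemma quad_vbr h k : quad h -> quad k -> quad (vbr h k).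
Proof.
by rewrite /quad /vbr => hh hk; rewrite !(dD, dN, dM) hh hk d0 !mul0r !mulr0; ring.
Qed.

Lemma d_kap h k : quad h -> quad k -> d (kap h k) = 0.
Proof. by rewrite /quad => hh hk; rewrite /kap !(dD, dN, dM) hh hk; ring. Qed.

Lemma kapC h k : kap h k = kap k h. Proof. by rewrite /kap; ring. Qed.
Lemma vbrC h k : vbr h k = - vbr k h. Proof. by rewrite /vbr; ring. Qed.

Lemma Xm_am_quad h n l v : quad h -> Xm h n (am l v) =
  am l (Xm h n v) - Xm (d h) (n + l) v + (if n + l == 0 then mu (n%:~R * d (d h)) v else 0).
Proof.
move=> qh; rewrite Xm_am fm_const //; congr (_ + _); case: eqP => e.
  by rewrite mu_mu (_ : l = - n) ?mulrNz ?mulNr ?muN ?opprK //; lia.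
by rewrite (hop0 (hop_mu _)) oppr0.
Qed.

Definition Zop h k n m (v : V) : V := Xm h n (Xm k m v) - Xm k m (Xm h n v)
  - Xm (vbr h k) (n + m) v - (if n + m == 0 then mu (n%:~R * kap h k) v else 0).

Lemma hop_Zop h k n m : hop (n + m) (Zop h k n m).
Proof.
apply: hop_add; first (apply: hop_add; first apply: hop_add).
- exact: (hop_comp (hop_Xm h n) (hop_Xm k m)).
- by apply: hop_opp; apply: (hop_eq (hop_comp (hop_Xm k m) (hop_Xm h n))) => //; rewrite addrC.
- exact: hop_opp (hop_Xm _ _).
- by apply: hop_opp; case: eqP => [->|_]; [exact: hop_mu | exact: hop_zero].
Qed.

Lemma Zop_bm h k n m l v : Zop h k n m (bm l v) = bm l (Zop h k n m v).
Proof.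
rewrite -!fm_beta /Zop !Xm_fm !(hopD (hop_Xm _ _)) !Xm_fm !(hopB (hop_fm _ _)).
have -> : (if n + m == 0 then mu (n%:~R * kap h k) (fm beta l v) else 0) =
   fm beta l (if n + m == 0 then mu (n%:~R * kap h k) v else 0).
  by case: eqP => _; rewrite ?fm_mu ?(hop0 (hop_fm _ _)).
have -> : fm (vbr h k * d beta) (n + m + l) v =
    fm (h * d (k * d beta)) (n + (m + l)) v - fm (k * d (h * d beta)) (m + (n + l)) v.
  rewrite d_beta !mulr1 addrA (addrCA m) addrA.
  by apply: (addIr (fm (k * d h) (n + m + l) v)); rewrite subrK -fmD; congr fm; rewrite /vbr; ring.
by vab.
Qed.

(** The defect of the affine relation moves past a_l up to the defects of the pairs h', k and h, k'.
    Derivatives of quadratic fields are quadratic, so vanishing propagates inductively for all pairs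
    at once. The leftover central terms cancel since they occur for l = -n - m only. *)
Lemma Zop_am h k n m l v : quad h -> quad k -> Zop h k n m (am l v) = am l (Zop h k n m v)
  - Zop (d h) k (n + l) m v - Zop h (d k) n (m + l) v.
Proof.
move=> qh qk; have qhk := quad_vbr qh qk.
rewrite /Zop !Xm_am_quad // !(hopD (hop_Xm _ _)) !(hopN (hop_Xm _ _)) !Xm_am_quad //.
rewrite !(hopB (hop_am _)).
have XmMu c g n' u : d c = 0 -> Xm g n' (mu c u) = mu c (Xm g n' u).
  by move=> dc; have := Xm_fm g n' c 0 u; rewrite dc mulr0 fm0 addr0 !fm_const.
have Xif (b : bool) c g n' : d c = 0 -> Xm g n' (if b then mu c v else 0) = if b then mu c (Xm g n' v) else 0.
  by move=> dc; case: b; rewrite ?XmMu // (hop0 (hop_Xm _ _)).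
have dc (z : int) x : d x = 0 -> d (z%:~R * x) = 0 by move=> dx; rewrite dM d_int mul0r add0r dx mulr0.
rewrite !Xif ?dc //.
have Xd : Xm (d (vbr h k)) (n + m + l) v =
    Xm (vbr (d h) k) (n + m + l) v + Xm (vbr h (d k)) (n + m + l) v.
  by rewrite -XmD; congr (Xm _ _ _); rewrite /vbr !(dD, dN, dM); ring.
rewrite Xd.
have aif : am l (if n + m == 0 then mu (n%:~R * kap h k) v else 0) =
  if n + m == 0 then mu (n%:~R * kap h k) (am l v) else 0.
  by case: eqP => _; rewrite ?am_mu_const ?dc ?d_kap // (hop0 (hop_am _)).
have e1 : n + l + m = n + m + l by lia.
have e2 : n + (m + l) = n + m + l by lia.
rewrite aif e1 e2.
have kk : (if n + m + l == 0 then mu ((n + m)%:~R * d (d (vbr h k))) v else 0) +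
   ((if n + m + l == 0 then mu ((n + l)%:~R * kap (d h) k) v else 0) +
   (if n + m + l == 0 then mu (n%:~R * kap h (d k)) v else 0)) = 0.
  case: eqP => e; last by rewrite !addr0.
  rewrite -!muDl (_ : l = - n - m); last lia.
  rewrite [X in mu X _](_ : _ = 0) ?mu0 // /vbr /kap !(dD, dN, dM) qh qk.
  by rewrite !intrD !mulrNz; ring.
move/eqP: kk; rewrite addr_eq0 => /eqP ->.
by vab.
Qed.

(** The origin of the central term. Each of the s + 1 summands a_{-j-1} k_[.] contributes -h'k', the
    last one also (s + 1) h''k, and the shift term of X^k contributes (s + 1) h k''; together (s +
    1) [kap h k]. *)
Lemma Zop_vac0 h k (n : nat) e : quad h -> quad k -> Zop h k n%:Z (- n%:Z) (vac e) = 0.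
Proof.
move=> qh qk; rewrite /Zop subrr eqxx; case: n => [|s].
  rewrite oppr0 !Xm_vac0 mul0r mu0 subr0 /vbr /vac -!monoN -!monoD -[RHS](mono0 pp0).
  by congr mono; rewrite !dM; ring.
have Xv g (j : int) u : 0 < j -> Xm g j (vac u) = 0 by exact: Xm_vac_pos.
rewrite (Xv h) // (hop0 (hop_Xm _ _)) subr0 -NegzE Xm_vac_neg.
rewrite !(hopD (hop_Xm _ _)) (hop_sum (hop_Xm _ _)).
have XmMu c g n' u : d c = 0 -> Xm g n' (mu c u) = mu c (Xm g n' u).
  by move=> dc; have := Xm_fm g n' c 0 u; rewrite dc mulr0 fm0 addr0 !fm_const.
have nn : s.+1%:Z + Negz s = 0 by lia.
have T1 : Xm h s.+1 (fm k (Negz s) (vac (d e))) = vac (h * d k * d e).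
  by rewrite Xm_fm Xv // (hop0 (hop_fm _ _)) add0r nn fm_vac0.
have T2 : Xm h s.+1 (mu s.+1%:R (fm (d k) (Negz s) (vac e))) = vac (s.+1%:R * (h * d (d k) * e)).
  by rewrite XmMu ?d_nat // Xm_fm Xv // (hop0 (hop_fm _ _)) add0r nn fm_vac0 /vac mu_mono.
have T3 (j : 'I_s.+1) : Xm h s.+1 (am (Negz j) (fm k (Negz s - Negz j) (vac e))) =
    vac (- (d h * d k * e)) + (if j == ord_max then vac (s.+1%:R * (d (d h) * k * e) - d h * k * d e) else 0).
  rewrite Xm_am_quad // Xm_fm Xv // (hop0 (hop_fm _ _)) add0r.
  rewrite fm_vac_pos; last by have := ltn_ord j; lia.
  rewrite (hop0 (hop_am _)) sub0r Xm_fm.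
  have -> : s.+1%:Z + Negz j + (Negz s - Negz j) = 0 by lia.
  rewrite fm_vac0; have [jm|jm] := eqVneq j ord_max.
    rewrite jm /= nn subrr Xm_vac0 fm_vac0 eqxx /vac fm_vac0 mu_mono -!monoD -!monoN -!monoD.
    by congr mono; ring.
  have jn : (j < s)%N by move: jm; rewrite -val_eqE /=; have := ltn_ord j; lia.
  rewrite Xv ?(hop0 (hop_fm _ _)) ?add0r; last by lia.
  rewrite (_ : (s.+1%:Z + Negz j == 0) = false) ?addr0 /vac ?monoN //.
  by apply/eqP; lia.
rewrite T1 T2; under eq_bigr => j _ do rewrite T3.
rewrite big_split /= sumr_const card_ord -big_mkcond /= big_pred1_eq.
rewrite Xm_vac0 /vac mu_mono -monoMn -!monoD -!monoN -!monoD -[RHS](mono0 pp0); congr mono.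
by rewrite /vbr /kap -mulr_natl; ring.
Qed.

Lemma Zop_anti h k n m v : Zop h k n m v = - Zop k h m n v.
Proof.
rewrite /Zop (vbrC h) (kapC h) XmN addrC [m + n]addrC; case: eqP => e.
  by rewrite (_ : m = - n) ?mulrNz ?mulNr ?muN; [vab | lia].
by vab.
Qed.

(** The same scheme as for products of fields: positive modes reduce negative degree to degrees
    closer to 0. In degree 0 the case of negative n follows from antisymmetry. *)
Lemma Zop_vac h k n m e : quad h -> quad k -> Zop h k n m (vac e) = 0.
Proof.
move=> qh qk; have [s] := ubnP `|Num.min 0 (n + m)|.
elim: s h k n m e qh qk => // s IH h k n m e qh qk hs.
have hZ := hop_Zop h k n m.
have [k0|k0|k0] := ltgtP (n + m) 0.
- apply: (vac_irr hZ) => // l.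
    have Z1 : Zop (d h) k (n + l.+1%:Z) m (vac e) = 0 by apply: IH => //; [exact: quad_d | lia].
    have Z2 : Zop h (d k) n (m + l.+1%:Z) (vac e) = 0 by apply: IH => //; [exact: quad_d | lia].
    have := Zop_am n m l.+1%:Z (vac e) qh qk.
    by rewrite (vac_pos _ (hop_am _)) // (hop0 hZ) Z1 Z2 !subr0 => <-.
  by rewrite -Zop_bm (vac_pos _ (hop_bm _)) ?(hop0 hZ).
- exact: (vac_pos _ hZ).
- case: n k0 {hZ hs} => n k0; first by rewrite (_ : m = - n%:Z) ?Zop_vac0 //; lia.
  have em : m = n.+1%:Z by lia.
  by rewrite Zop_anti em NegzE Zop_vac0 ?oppr0.
Qed.

(** The relations of affine sl_2 at the critical level. *)
Lemma Zop0 h k n m v : quad h -> quad k -> Zop h k n m v = 0.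
Proof.
move=> qh qk; apply: (hop_ext (hop_Zop h k n m) (hop_zero _)) => p e.
suff: forall h k n m, quad h -> quad k -> Zop h k n m (mono p e) = 0 by apply.
elim/mono_ind: {v h k n m qh qk p e}(mono p e) => [e|l w IH|l w IH] h k n m qh qk.
- exact: Zop_vac.
- by rewrite Zop_am // !IH // ?(hop0 (hop_am _)) ?subr0 //; apply: quad_d.
- by rewrite Zop_bm IH // (hop0 (hop_bm _)).
Qed.

Lemma Xm_Xm h k n m v : quad h -> quad k -> Xm h n (Xm k m v) = Xm k m (Xm h n v)
  + Xm (vbr h k) (n + m) v + (if n + m == 0 then mu (n%:~R * kap h k) v else 0).
Proof.
move=> qh qk; have /eqP := Zop0 n m v qh qk; rewrite /Zop subr_eq0 => /eqP <-.
by vab.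
Qed.
End Affine.

(** * The action of a Moebius transformation *)

Lemma foldr_rem (X : nat -> V -> V) (s : seq nat) n v :
  (forall a b u, X a (X b u) = X b (X a u)) -> n \in s ->
  foldr X v s = X n (foldr X v (rem n s)).
Proof.
move=> C; elim: s => //= x s IH; rewrite inE.
have [<- //|nx /= ns] := eqVneq x n.
by rewrite IH // C.
Qed.

Lemma foldr_comm (X : nat -> V -> V) (Y : V -> V) (s : seq nat) v :
  (forall a u, Y (X a u) = X a (Y u)) -> Y (foldr X v s) = foldr X (Y v) s.
Proof. by move=> C; elim: s => //= x s IH; rewrite C IH. Qed.

Lemma Sop_ann B i k v : (forall m, bm m.+1%:Z v = 0) -> 0 < k \/ k = 0 /\ (0 < i)%N ->
  Sop B i k v = 0.
Proof.
move=> hb; elim: i k => [|i IH] k hk /=.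
  by case: eqP => // k0; case: hk => [|[]] //; rewrite k0.
rewrite nzrangeE !big1 ?addr0 // => n _.
  by rewrite IH ?(hop0 (hop_bm _)) //; left; case: hk => [|[]]; lia.
by rewrite -Sop_bm hb (hop0 (hop_Sop _ _ _)).
Qed.

Lemma fm_ann f k v : (forall m, bm m.+1%:Z v = 0) -> 0 < k -> fm f k v = 0.
Proof.
move=> hb k0; apply/funext => p; rewrite fmU /fmt fct_sumE big1 // => i _.
by rewrite Sop_ann ?(hop0 (hop_mu _)) //; left.
Qed.

Lemma fm_ann0 f v : (forall m, bm m.+1%:Z v = 0) -> fm f 0 v = mu f v.
Proof.
move=> hb; apply/funext => p; rewrite fmU /fmt addn1 big_ord_recl vaddx fct_sumE big1 ?addr0.
  by rewrite /= /ifact fact0 invr1 rmorph1 mul1r.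
by move=> i _; rewrite Sop_ann ?(hop0 (hop_mu _)) //; right.
Qed.

(** On a vector killed by all b_m and by the a_j with j > m, the mode X^h_m acts as h a_m. As h is
    invertible, the a_m are eliminated from the highest down, which reduces the claim to [hw0]. *)
Lemma hwX N v h hi : h * hi = 1 -> (0 < N)%N -> hv N v ->
  (forall m, Xm h m.+1%:Z v = 0) -> (forall m, bm m.+1%:Z v = 0) -> v = 0.
Proof.
move=> hhi N0 hN hX hb; apply: (hw0 N0 hN) => // m.
have hba (j m' : nat) : bm m'.+1%:Z (am j v) = 0.
  have := am_bm j m'.+1%:Z v; rewrite hb (hop0 (hop_am _)) (_ : (_ == 0) = false).
    by rewrite addr0 => <-.
  by apply/eqP; lia.
have [s] := ubnP (N - m); elim: s m => // s IH m hs.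
have [Nm|Nm] := ltnP N m.+1; first by rewrite (hop_hv0 (hop_am _) hN).
have big j : (m.+1 < j)%N -> am j v = 0.
  by case: j => // j hj; apply: IH; lia.
suff: mu h (am m.+1 v) = 0.
  by move/(congr1 (mu hi)); rewrite mu_mu mulrC hhi mu1 (hop0 (hop_mu _)).
rewrite -(fm_ann0 _ (hba m.+1)) -[RHS](hX m); apply/funext => p.
rewrite XmU /Xmt (fm_ann (d h) hb) // (hop0 (hop_mu _)) subr0 (@Zs_pick _ _ m.+1%:Z); first by rewrite /nord subrr.
  by rewrite /= ; lia.
move=> j jm; rewrite /nord; case: ifP => j0; first by rewrite fm_ann ?(hop0 (hop_am _)) //; lia.
case: j j0 jm => // j _ jm; have [jl|jl] := ltnP m.+1 j.
  by rewrite big // (hop0 (hop_fm _ _)).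
by rewrite fm_ann //; lia.
Qed.

(** The data of a Moebius transformation [g] acting on functions by [sg f = f o g],
    with [Jf = c b + d]. *)
Record mact := Mact {
  sg : {rmorphism O -> O}; sgi : O -> O; Jf : O; Jfi : O;
  JJi : Jf * Jfi = 1; dJ2 : d (d Jf) = 0;
  dsg : forall f, d (sg f) = Jfi ^+ 2 * sg (d f);
  sg_io : forall c, sg (io c) = io c;
  sgK : cancel sg sgi; sgiK : cancel sgi sg }.

Definition pimono (a : mact) (q : PP) (f : O) : V :=
  foldr (fun n acc => Xm (Jf a ^+ 2) (- n%:Z) acc)
    (foldr (fun n acc => fm (sg a beta) (- n%:Z) acc) (vac (sg a f)) (val q.2)) (val q.1).
(** The monomial formula preserves the weight, so the monomials of the weight of the output are the
    ones to be summed. *)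
Definition piv := locked_with fock_key (fun (a : mact) (v : V) =>
  (fun p => (\sum_(q <- pps (wt p)) pimono a q (v q)) p) : V).

Lemma pivU a v p : piv a v p = (\sum_(q <- pps (wt p)) pimono a q (v q)) p.
Proof. by rewrite /piv unlock. Qed.

Section Act.
Variable a : mact.
Notation h := (Jf a ^+ 2).
Notation Bt := (sg a beta).

Lemma JJi2 : h * Jfi a ^+ 2 = 1.
Proof. by rewrite -exprMn JJi expr1n. Qed.

Lemma h_dsg f : h * d (sg a f) = sg a (d f).
Proof. by rewrite dsg mulrA JJi2 mul1r. Qed.

Lemma dh : d h = Jf a * d (Jf a) *+ 2.
Proof. by rewrite expr2 dM mulrC -mulr2n. Qed.

Lemma ddh : d (d h) = d (Jf a) ^+ 2 *+ 2.
Proof. by rewrite dh mulr2n dD dM dJ2 mulr0 addr0 -expr2 -mulr2n. Qed.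

Lemma quad_h : quad h.
Proof. by rewrite /quad ddh mulr2n dD expr2 dM dJ2; ring. Qed.

(** The field h = J^2 is a perfect square: its bracket with itself and its discriminant vanish. *)
Lemma A_A n m v : Xm h n (Xm h m v) = Xm h m (Xm h n v).
Proof.
rewrite (Xm_Xm _ _ _ quad_h quad_h) (_ : vbr h h = 0) ?Xm0 ?addr0; last by rewrite /vbr; ring.
rewrite (_ : kap h h = 0) ?mulr0 ?mu0; first by case: ifP; rewrite addr0.
by rewrite /kap ddh dh; ring.
Qed.

(** Since h times the derivative of b o g is 1, the transformed modes satisfy the Heisenberg
    relations. *)
Lemma A_B n m v : Xm h n (fm Bt m v) = fm Bt m (Xm h n v) + (if n + m == 0 then v else 0).
Proof. by rewrite Xm_fm h_dsg d_beta rmorph1 (fm_const _ _ d1) mu1. Qed.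

Lemma pimonoD q f g : pimono a q (f + g) = pimono a q f + pimono a q g.
Proof.
rewrite /pimono rmorphD /vac monoD.
have fD (X : nat -> V -> V) s u v : (forall n u v, X n (u + v) = X n u + X n v) ->
    foldr X (u + v) s = foldr X u s + foldr X v s.
  by move=> hD; elim: s => //= n s ->.
rewrite fD; last by move=> n u v; exact: (hopD (hop_fm _ _)).
by rewrite fD //; move=> n u v; exact: (hopD (hop_Xm _ _)).
Qed.

Lemma pimono0 q : pimono a q 0 = 0.
Proof. by apply: (addrI (pimono a q 0)); rewrite -pimonoD !addr0. Qed.

Lemma hv_pimono q f : hv (wt q) (pimono a q f).
Proof.
have fH (X : nat -> V -> V) s N v : (forall n, hop (- n%:Z) (X n)) -> hv N v ->
    hv (sumn s + N) (foldr X v s).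
  move=> hX hN; elim: s => //= n s IH.
  by apply: (hop_hv (hX n) IH); lia.
rewrite /wt /pimono; apply: (fH) => [n|]; first exact: hop_Xm.
rewrite -[wts true q]addn0; apply: (fH) => [n|]; first exact: hop_fm.
exact: hv_vac.
Qed.

Lemma piv_mono q f : piv a (mono q f) = pimono a q f.
Proof.
apply/funext => p; rewrite pivU; have [e|ne] := eqVneq (wt q) (wt p).
  rewrite (bigD1_seq q) ?pps_uniq ?mem_pps ?e //= {1}/mono eqxx big1 ?addr0 // => r rq.
  by rewrite /mono (negPf rq) pimono0.
rewrite hv_pimono; last by rewrite eq_sym.
rewrite big_seq_cond big1 // => r /andP[]; rewrite mem_pps => er _.
have [rq|rq] := eqVneq r q; first by move: ne; rewrite -rq er.
by rewrite /mono (negPf rq) pimono0.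
Qed.

Lemma hop_piv : hop 0 (piv a).
Proof.
split=> [u v|u v p e]; last first.
  rewrite !pivU; congr (_ p); apply: eq_big_seq => q; rewrite mem_pps => /eqP eq.
  by rewrite e // eq addr0.
apply/funext => p; rewrite vaddx !pivU vaddE -big_split /=; congr (_ p).
by apply: eq_bigr => q _; rewrite vaddx pimonoD.
Qed.

Lemma piv_vac f : piv a (vac f) = vac (sg a f).
Proof. by rewrite /vac piv_mono. Qed.

Lemma piv_am_neg n v : piv a (am (Negz n) v) = Xm h (Negz n) (piv a v).
Proof.
apply: (@hop_ext (Negz n) (fun v => piv a (am (Negz n) v)) (fun v => Xm h (Negz n) (piv a v))).
- by apply: (hop_eq (hop_comp hop_piv (hop_am _))) => //; rewrite add0r.
- by apply: (hop_eq (hop_comp (hop_Xm _ _) hop_piv)) => //; rewrite addr0.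
move=> q f; rewrite /= cr_mono !piv_mono /pimono.
rewrite (@foldr_rem _ _ n.+1) => [|m m' u|]; last 2 first.
- exact: A_A.
- by rewrite /= (perm_mem (perm_ins _ _)) mem_head.
rewrite NegzE; congr (Xm _ _ (foldr _ _ _)).
by have := congr1 (fun p : PP => val p.1) (paddK (false, n) q).
Qed.

Lemma piv_bm_neg n v : piv a (bm (Negz n) v) = fm Bt (Negz n) (piv a v).
Proof.
apply: (@hop_ext (Negz n) (fun v => piv a (bm (Negz n) v)) (fun v => fm Bt (Negz n) (piv a v))).
- by apply: (hop_eq (hop_comp hop_piv (hop_bm _))) => //; rewrite add0r.
- by apply: (hop_eq (hop_comp (hop_fm _ _) hop_piv)) => //; rewrite addr0.
move=> q f; rewrite /= cr_mono !piv_mono /pimono.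
rewrite (@foldr_comm _ (fm Bt (Negz n))) => [|m u]; last first.
  by rewrite A_B (_ : (_ == 0) = false) ?addr0 //; apply/eqP; lia.
rewrite [in LHS](@foldr_rem _ (val (padd (true, n) q).2) n.+1) => [|m m' u|]; last 2 first.
- exact: fm_fm.
- by rewrite /= (perm_mem (perm_ins _ _)) mem_head.
rewrite NegzE; congr (foldr _ (fm _ _ (foldr _ _ _)) _).
by have := congr1 (fun p : PP => val p.2) (paddK (true, n) q).
Qed.

(** For negative modes this is the definition of [pimono] together with commutativity. A mode of
    nonnegative index is moved through the creating modes, where both sides produce the same
    commutators, down to the vacuum. *)
Lemma piv_ab k v : piv a (am k v) = Xm h k (piv a v) /\ piv a (bm k v) = fm Bt k (piv a v).
Proof.
have [k0|k0] := ltP k 0.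
  by case: k k0 => // k _; rewrite piv_am_neg piv_bm_neg.
have h1 : hop k (fun v => piv a (am k v)).
  by apply: (hop_eq (hop_comp hop_piv (hop_am _))) => //; rewrite add0r.
have h2 : hop k (fun v => Xm h k (piv a v)).
  by apply: (hop_eq (hop_comp (hop_Xm _ _) hop_piv)) => //; rewrite addr0.
have h3 : hop k (fun v => piv a (bm k v)).
  by apply: (hop_eq (hop_comp hop_piv (hop_bm _))) => //; rewrite add0r.
have h4 : hop k (fun v => fm Bt k (piv a v)).
  by apply: (hop_eq (hop_comp (hop_fm _ _) hop_piv)) => //; rewrite addr0.
suff Q p f : piv a (am k (mono p f)) = Xm h k (piv a (mono p f)) /\
    piv a (bm k (mono p f)) = fm Bt k (piv a (mono p f)).
  by split; [apply: (hop_ext h1 h2) | apply: (hop_ext h3 h4)] => p f; case: (Q p f).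
have pif (b : bool) w : piv a (if b then w else 0) = if b then piv a w else 0.
  by case: b; rewrite // (hop0 hop_piv).
elim/mono_ind: (mono p f) => [e|n w [IHa IHb]|n w [IHa IHb]].
- rewrite piv_vac; case: k k0 {h1 h2 h3 h4} => // -[|k] _; split.
  + by rewrite Xm_vac0 h_dsg /= dv_mono piv_vac.
  + by rewrite fm_vac0 /= /vac mu_mono piv_vac rmorphM.
  + by rewrite (vac_pos _ (hop_am _)) // (hop0 hop_piv) Xm_vac_pos.
  + by rewrite (vac_pos _ (hop_bm _)) // (hop0 hop_piv) fm_vac_pos.
- split; first by rewrite am_am !piv_am_neg IHa A_A.
  rewrite piv_am_neg; have := am_bm (Negz n) k w => /eqP; rewrite addrC -subr_eq => /eqP e.
  have -> : bm k (am (Negz n) w) = am (Negz n) (bm k w) - (if Negz n + k == 0 then w else 0).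
    by rewrite am_bm addrK.
  by rewrite (hopB hop_piv) piv_am_neg IHb A_B pif addrK.
- split; last by rewrite bm_bm !piv_bm_neg IHb fm_fm.
  by rewrite am_bm (hopD hop_piv) !piv_bm_neg IHa A_B pif.
Qed.

Lemma piv_am k v : piv a (am k v) = Xm h k (piv a v). Proof. by case: (piv_ab k v). Qed.
Lemma piv_bm k v : piv a (bm k v) = fm Bt k (piv a v). Proof. by case: (piv_ab k v). Qed.

(** A vector killed by the positive modes of b contains no a-variable. Its image is built from
    function fields alone, and these commute with b. This supplies the hypothesis on b in [hwX]. *)
Lemma bm_piv_ann N v : hv N v -> (forall m, bm m.+1%:Z v = 0) -> forall m, bm m.+1%:Z (piv a v) = 0.
Proof.
move=> hN hb m; rewrite (hv_sum hN) (hop_sum hop_piv) (hop_sum (hop_bm _)) big1 // => q _.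
rewrite piv_mono; have [/eqP e|] := boolP (wts false q == 0%N).
  have e1 : val q.1 = [::].
    move: e (valP q.1); rewrite /wts /sel; case: (val q.1) => //= x s; rewrite /is_part /=.
    by move=> e /and3P[_ + _]; lia.
  rewrite /pimono e1 [foldr _ _ [::]]/= (@foldr_comm _ (bm m.+1%:Z)) => [|n u]; last by rewrite fm_bm.
  rewrite (vac_pos _ (hop_bm _)) //; elim: (val q.2) => //= n s ->.
  by rewrite (hop0 (hop_fm _ _)).
move=> q0; suff -> : v q = 0 by rewrite pimono0 (hop0 (hop_bm _)).
have [n hn] : exists n, (0 < pcnt (false, n) q)%N.
  move: q0 (valP q.1); rewrite /wts /sel /pcnt /=; case: (val q.1) => //= -[|x] s.
    by move=> _; rewrite /is_part /= andbF.
  by exists x; rewrite eqxx.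
have := congr1 (fun u : V => - u (psub (false, n) q)) (hb n).
rewrite /= !vx opprK oppr0 /an psubK // pcnt_sub eqxx subn1 prednK //.
move/(congr1 (fun x => io ((pcnt (false, n) q)%:R^-1) * x)); rewrite mulrA -(rmorph_nat io) -rmorphM /=.
by rewrite mulVf ?rmorph1 ?mul1r ?mulr0 // pnatr_eq0 -lt0n.
Qed.

(** The positive transformed modes X^h_m and b_m kill the difference of both sides, the first by
    induction on the degree; [hwX] then replaces [hw0]. *)
Lemma piv_fm_vac f k e : piv a (fm f k (vac e)) = fm (sg a f) k (vac (sg a e)).
Proof.
have [s] := ubnP `|Num.min 0 k|; elim: s f k e => // s IH f k e hs.
have [k0|k0|->] := ltgtP k 0; last by rewrite !fm_vac0 piv_vac rmorphM.
  have hh : hop k (fun v => piv a (fm f k v)).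
    by apply: (hop_eq (hop_comp hop_piv (hop_fm f k))) => //; rewrite add0r.
  have hv1 : hv `|k| (piv a (fm f k (vac e))) by apply: (hop_hv hh (hv_vac e)); lia.
  have hv2 : hv `|k| (fm (sg a f) k (vac (sg a e))).
    by apply: (hop_hv (hop_fm _ k) (hv_vac _)); lia.
  have hv3 : hv `|k| (fm f k (vac e)) by apply: (hop_hv (hop_fm _ k) (hv_vac _)); lia.
  apply/eqP; rewrite -subr_eq0; apply/eqP; apply: (hwX JJi2 (N := `|k|)); first lia.
  - by move=> q hq; rewrite !vx hv1 // hv2 // subrr.
  - move=> m; rewrite (hopB (hop_Xm _ _)) -piv_am fm_am (vac_pos _ (hop_am _)) //.
    rewrite (hop0 (hop_fm _ _)) add0r IH; last lia.
    by rewrite Xm_fm Xm_vac_pos // (hop0 (hop_fm _ _)) add0r h_dsg (addrC k) subrr.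
  - move=> m; rewrite (hopB (hop_bm _)) (bm_piv_ann hv3) => [|l].
      by rewrite -fm_bm (vac_pos _ (hop_bm _)) // (hop0 (hop_fm _ _)) subrr.
    by rewrite -fm_bm (vac_pos _ (hop_bm _)) // (hop0 (hop_fm _ _)).
by rewrite !fm_vac_pos // (hop0 hop_piv).
Qed.

Lemma piv_fm f k v : piv a (fm f k v) = fm (sg a f) k (piv a v).
Proof.
apply: (@hop_ext k (fun v => piv a (fm f k v)) (fun v => fm (sg a f) k (piv a v))).
- by apply: (hop_eq (hop_comp hop_piv (hop_fm _ _))) => //; rewrite add0r.
- by apply: (hop_eq (hop_comp (hop_fm _ _) hop_piv)) => //; rewrite addr0.
move=> p e; suff: forall f k, piv a (fm f k (mono p e)) = fm (sg a f) k (piv a (mono p e)) by apply.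
elim/mono_ind: {v f k p e}(mono p e) => [e|n w IH|n w IH] f k.
- by rewrite piv_fm_vac piv_vac.
- rewrite fm_amr (hopB hop_piv) !piv_am !IH.
  by rewrite Xm_fm h_dsg (addrC k) addrK.
- by rewrite fm_bm !piv_bm IH fm_fm.
Qed.

Lemma piv_mu_const c v : d c = 0 -> piv a (mu c v) = mu (sg a c) (piv a v).
Proof.
move=> dc; have := piv_fm c 0 v; rewrite !fm_const //=.
by rewrite dsg dc rmorph0 mulr0.
Qed.

Lemma dJfi : d (Jfi a) = - (Jfi a ^+ 2 * d (Jf a)).
Proof.
have e : d (Jf a) * Jfi a + Jf a * d (Jfi a) = 0 by rewrite -dM JJi d1.
rewrite -[d (Jfi a)]mul1r -(JJi a) mulrAC.
have -> : Jf a * d (Jfi a) = - (d (Jf a) * Jfi a) by apply/eqP; rewrite -addr_eq0 addrC e.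
by ring.
Qed.

Lemma dAd k : d (h * sg a k) = Jf a * d (Jf a) *+ 2 * sg a k + sg a (d k).
Proof. by rewrite dM dh dsg mulrA JJi2 mul1r. Qed.

Lemma ddAd k : d (d (h * sg a k)) = d (Jf a) ^+ 2 *+ 2 * sg a k
   + d (Jf a) * Jfi a * sg a (d k) *+ 2 + Jfi a ^+ 2 * sg a (d (d k)).
Proof.
rewrite dAd dD dM -dh ddh dh !dsg; congr (_ + _ + _).
transitivity ((Jf a * Jfi a) * (d (Jf a) * Jfi a * sg a (d k) *+ 2)); first ring.
by rewrite JJi mul1r.
Qed.

Lemma quad_Ad k : quad k -> quad (h * sg a k).
Proof.
rewrite /quad => qk; rewrite ddAd !(dD, dM, mulr2n, expr2) dJ2 !dsg dJfi qk rmorph0; ring.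
Qed.

Lemma piv_if (b : bool) w : piv a (if b then w else 0) = if b then piv a w else 0.
Proof. by case: b; rewrite // (hop0 hop_piv). Qed.

Lemma vbr_Ad k : vbr (h * sg a k) h = - (h * sg a (d k)).
Proof. by rewrite /vbr dAd dh; ring. Qed.

Lemma kap_Ad k : kap (h * sg a k) h = sg a (d (d k)).
Proof.
rewrite /kap ddAd dAd ddh dh.
transitivity ((Jf a * Jfi a) ^+ 2 * sg a (d (d k))
  + ((Jf a * Jfi a) - 1) * (Jf a * d (Jf a) * sg a (d k) *+ 2)); first ring.
by rewrite JJi; ring.
Qed.

(** The defect of covariance. The vector field k d/db pulled back by g is J^2 (k o g) d/db, because
    g' = J^{-2}. *)
Definition Zpi k n (w : V) := piv a (Xm k n w) - Xm (h * sg a k) n (piv a w).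

Lemma hop_Zpi k n : hop n (Zpi k n).
Proof.
apply: hop_add; first by apply: (hop_eq (hop_comp hop_piv (hop_Xm _ _))) => //; rewrite add0r.
by apply: hop_opp; apply: (hop_eq (hop_comp (hop_Xm _ _) hop_piv)) => //; rewrite addr0.
Qed.

Lemma Zpi_am k n l w : quad k -> Zpi k n (am l w) = Xm h l (Zpi k n w) - Zpi (d k) (n + l) w.
Proof.
move=> qk; rewrite /Zpi Xm_am_quad // (hopD hop_piv) (hopB hop_piv) !piv_am.
rewrite (Xm_Xm _ _ _ (quad_Ad qk) quad_h) (hopB (hop_Xm _ _)) vbr_Ad kap_Ad XmN piv_if.
rewrite piv_mu_const; last by rewrite dM d_int qk mulr0 mul0r addr0.
have -> : sg a (n%:~R * d (d k)) = n%:~R * sg a (d (d k)) by rewrite rmorphM rmorph_int.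
by vab.
Qed.

Lemma Zpi_fm k n f l w : Zpi k n (fm f l w) = fm (sg a f) l (Zpi k n w).
Proof.
rewrite /Zpi Xm_fm (hopD hop_piv) !piv_fm Xm_fm (hopB (hop_fm _ _)).
rewrite rmorphM -mulrA dsg.
have -> : h * (sg a k * (Jfi a ^+ 2 * sg a (d f))) = sg a k * sg a (d f).
  by transitivity (h * Jfi a ^+ 2 * (sg a k * sg a (d f))); [ring | rewrite JJi2 mul1r].
by vab.
Qed.

Lemma Zpi_vac k n e : quad k -> Zpi k n (vac e) = 0.
Proof.
(* The defect commutes with function fields up to composition with g, so the constant vacuum is the
   one case left. *)
move=> qk; have -> : vac e = fm e 0 (vac 1) by rewrite fm_vac0 mulr1.
rewrite Zpi_fm; suff -> : Zpi k n (vac 1) = 0 by rewrite (hop0 (hop_fm _ _)).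
have [s] := ubnP `|Num.min 0 n|; elim: s k n qk => // s IH k n qk hs.
have [k0|k0|->] := ltgtP n 0.
- apply: (hwX JJi2 (N := `|n|)); first lia.
  + by apply: (hop_hv (hop_Zpi k n) (hv_vac _)); lia.
  + move=> m; have := Zpi_am n m.+1%:Z (vac 1) qk; rewrite (vac_pos _ (hop_am _)) //.
    have Z1 : Zpi (d k) (n + m.+1%:Z) (vac 1) = 0 by apply: IH; [exact: quad_d | lia].
    by rewrite (hop0 (hop_Zpi _ _)) Z1 subr0.
  + move=> m; have := Zpi_fm k n (sgi a beta) m.+1%:Z (vac 1).
    by rewrite fm_vac_pos // (hop0 (hop_Zpi _ _)) sgiK fm_beta.
- exact: (vac_pos _ (hop_Zpi k n)).
- by rewrite /Zpi Xm_vac0 !piv_vac Xm_vac0 d1 rmorph1 d1 !mulr0 rmorph0 subrr.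
Qed.

Lemma piv_Xm k n v : quad k -> piv a (Xm k n v) = Xm (h * sg a k) n (piv a v).
Proof.
move=> qk; apply/eqP; rewrite -subr_eq0; apply/eqP; rewrite -/(Zpi k n v).
apply: (hop_ext (hop_Zpi k n) (hop_zero _)) => p e.
suff: forall k n, quad k -> Zpi k n (mono p e) = 0 by apply.
elim/mono_ind: {v k n qk p e}(mono p e) => [e|l w IH|l w IH] k n qk.
- exact: Zpi_vac.
- by rewrite Zpi_am // !IH // ?(hop0 (hop_Xm _ _)) ?subr0 //; apply: quad_d.
- by rewrite -fm_beta Zpi_fm IH // (hop0 (hop_fm _ _)).
Qed.
End Act.

(** The image of a monomial is a product of modes of J_1^2 and of functions. By covariance the
    second transformation turns them into modes of J_2^2 (J_1^2 o g_2) = J_3^2 and of composed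
    functions. *)
Lemma piv_comp a1 a2 a3 v : (forall f, sg a3 f = sg a2 (sg a1 f)) ->
  Jf a3 = Jf a2 * sg a2 (Jf a1) -> piv a2 (piv a1 v) = piv a3 v.
Proof.
move=> es eJ; apply: (@hop_ext 0 (fun v => piv a2 (piv a1 v)) (piv a3)).
- by apply: (hop_eq (hop_comp (hop_piv a2) (hop_piv a1))).
- exact: hop_piv.
move=> p e; rewrite !piv_mono /pimono.
elim: (val p.1) => [|n l IH] /=; last first.
  by rewrite piv_Xm ?IH; [rewrite rmorphXn -exprMn -eJ | exact: quad_h].
elim: (val p.2) => [|n l IH] /=; first by rewrite piv_vac es.
by rewrite piv_fm IH es.
Qed.

(** * Lifts of functions to equivariant vectors *)

Definition Dg (p : PP) : int := (size (val p.2))%:Z - (size (val p.1))%:Z.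

Lemma Dg_add i p : Dg (padd i p) = Dg p + (if i.1 then 1 else -1).
Proof.
by case: i => -[] n; rewrite /Dg /padd /upd /sel /= (perm_size (perm_ins _ _)) /=; lia.
Qed.

Lemma Dg_sub i p : (0 < pcnt i p)%N -> Dg (psub i p) = Dg p - (if i.1 then 1 else -1).
Proof. by move=> h; rewrite -[in RHS](psubK h) Dg_add addrK. Qed.

Lemma Dg_le p : Dg p <= (wt p)%:Z.
Proof. by rewrite /Dg /wt /wts /sel; have := is_part_size (valP p.2); lia. Qed.

Lemma Xm1 n v : Xm 1 n v = am n v.
Proof.
have n1 j u : nord 1 n j u = if j == n then am n u else 0.
  rewrite /nord !(fm_const _ _ d1) subr_eq0 eq_sym; case: eqP => [->|_].
    by rewrite !mu1; case: ifP.
  by rewrite (hop0 (hop_am j)); case: ifP.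
apply/funext => p; rewrite XmU /Xmt d1 fm0 (hop0 (hop_mu _)) subr0 (@Zs_pick _ _ n).
- by rewrite n1 eqxx.
- lia.
- by move=> j jn; rewrite n1 (negPf jn).
Qed.

Lemma Xm_const c h n v : d c = 0 -> Xm (c * h) n v = mu c (Xm h n v).
Proof.
move=> dc.
have fc g k u : fm (c * g) k u = mu c (fm g k u).
  apply/funext => p; rewrite /mu !fmU /fmt !fct_sumE mulr_sumr; apply: eq_bigr => i _.
  have -> : iter i d (c * g) = c * iter i d g.
    by elim: (nat_of_ord i) => //= j ->; rewrite dM dc mul0r add0r.
  by rewrite /mu; ring.
apply/funext => p; rewrite /mu !XmU /Xmt dM dc mul0r add0r fc.
have nc j : nord (c * h) n j v = mu c (nord h n j v).
  by rewrite /nord; case: ifP => _; rewrite fc // am_mu_const.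
under eq_Zs => j do rewrite nc.
by rewrite -(hop_Zs _ _ (hop_mu c)) /mu !vx; ring.
Qed.

Lemma Xm_mu h n f v : Xm h n (mu f v) = mu f (Xm h n v) + mu (d f) (fm h n v).
Proof.
have nm j : nord h n j (mu f v) = mu f (nord h n j v) + (if j == 0 then mu (d f) (fm h n v) else 0).
  rewrite /nord; case: ifP => j0.
    have j1 : j != 0 by apply/eqP; lia.
    by rewrite fm_mu am_mu // (negPf j1) addr0.
  have [->|j1] := eqVneq j 0; last by rewrite am_mu // fm_mu addr0.
  by rewrite subr0 /= dv_mu (hopD (hop_fm _ _)) !fm_mu addrC.
apply/funext => p; rewrite vx {2}/mu !XmU /Xmt fm_mu.
under eq_Zs => j do rewrite nm.
rewrite ZsD -(hop_Zs _ _ (hop_mu f)) (@Zs_pick _ (fun j => if j == 0 then mu (d f) (fm h n v) else 0) 0).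
- by rewrite /mu !vx /=; ring.
- by rewrite /=; lia.
- by move=> j /negPf ->.
Qed.

(** The zero mode X^b_0 is b d/db + D, with D the charge operator. *)
Definition Dh := locked_with fock_key (fun v : V => Xm beta 0 v - mu beta (dv v)).
Definition K2 := locked_with fock_key (fun v : V => fm (beta ^+ 2) 0 v - mu (beta ^+ 2) v).
(** [X^{b^2}_0 = b^2 d/db + 2 b D + T + (2 K) d/db]; [K2] is 2 K. *)
Definition Tv := locked_with fock_key (fun v : V =>
  Xm (beta ^+ 2) 0 v - mu (beta ^+ 2) (dv v) - mu (beta *+ 2) (Dh v) - K2 (dv v)).

Lemma DhU v : Dh v = Xm beta 0 v - mu beta (dv v).
Proof. by rewrite /Dh unlock. Qed.
Lemma K2U v : K2 v = fm (beta ^+ 2) 0 v - mu (beta ^+ 2) v.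
Proof. by rewrite /K2 unlock. Qed.
Lemma TvU v : Tv v = Xm (beta ^+ 2) 0 v - mu (beta ^+ 2) (dv v) - mu (beta *+ 2) (Dh v) - K2 (dv v).
Proof. by rewrite /Tv unlock. Qed.
Lemma mux f v p : mu f v p = f * v p. Proof. by []. Qed.
Ltac vabm := let q := fresh "q" in apply/funext => q; rewrite ?(vx, mux); ring.

Lemma dbeta2 : d (beta ^+ 2) = beta *+ 2.
Proof. by rewrite expr2 dM d_beta mul1r mulr1 -mulr2n. Qed.
Lemma ddbeta2 : d (beta *+ 2) = 2%:R.
Proof. by rewrite mulr2n dD d_beta. Qed.
Lemma quad_beta : quad beta. Proof. by rewrite /quad d_beta d1 d0. Qed.
Lemma quad_beta2 : quad (beta ^+ 2).
Proof. by rewrite /quad dbeta2 ddbeta2 d_nat. Qed.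

Lemma hop_Dh : hop 0 Dh.
Proof.
apply: (@hop_eq 0 _ (fun v => Xm beta 0 v - mu beta (dv v))) => [||v]; last by rewrite DhU.
  apply: hop_add; first exact: hop_Xm.
  by apply: hop_opp; apply: (hop_eq (hop_comp (hop_mu _) hop_dv)); rewrite ?addr0.
by [].
Qed.

Lemma hop_K2 : hop 0 K2.
Proof.
apply: (@hop_eq 0 _ (fun v => fm (beta ^+ 2) 0 v - mu (beta ^+ 2) v)) => [||v]; last by rewrite K2U.
  by apply: hop_add; [exact: hop_fm | apply: hop_opp; exact: hop_mu].
by [].
Qed.

Lemma hop_Tv : hop 0 Tv.
Proof.
apply: (@hop_eq 0 _ (fun v => Xm (beta ^+ 2) 0 v - mu (beta ^+ 2) (dv v)
  - mu (beta *+ 2) (Dh v) - K2 (dv v))) => [||v]; last by rewrite TvU.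
  apply: hop_add; [apply: hop_add; [apply: hop_add|]|].
  - exact: hop_Xm.
  - by apply: hop_opp; apply: (hop_eq (hop_comp (hop_mu _) hop_dv)); rewrite ?addr0.
  - by apply: hop_opp; apply: (hop_eq (hop_comp (hop_mu _) hop_Dh)); rewrite ?addr0.
  - by apply: hop_opp; apply: (hop_eq (hop_comp hop_K2 hop_dv)); rewrite ?addr0.
by [].
Qed.

Lemma Dh_vac f : Dh (vac f) = 0.
Proof. by rewrite !DhU Xm_vac0 dv_mono mu_mono subrr. Qed.

Lemma Dh_am l v : l != 0 -> Dh (am l v) = am l (Dh v) - am l v.
Proof.
move=> l0; rewrite !DhU Xm_am d_beta d1 fm0 (hop0 (hop_mu _)) subr0 Xm1 add0r.
by rewrite (hopB (hop_am _)) am_mu // (am_am l 0 v : am l (dv v) = dv (am l v)); vab.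
Qed.

Lemma Dh_fm f k v : Dh (fm f k v) = fm f k (Dh v) + fm (beta * d f) k v - mu beta (fm (d f) k v).
Proof.
rewrite !DhU Xm_fm add0r (hopB (hop_fm _ _)) fm_mu.
have := fm_am f k 0 v; rewrite /= addr0 => ->.
by rewrite (hopD (hop_mu _)); vab.
Qed.

Lemma Dh_bm l v : l != 0 -> Dh (bm l v) = bm l (Dh v) + bm l v.
Proof.
move=> l0; rewrite -!fm_beta Dh_fm d_beta mulr1 (fm_const _ _ d1) (negPf l0).
by rewrite (hop0 (hop_mu _)) subr0.
Qed.

Lemma Dh_mono p f : Dh (mono p f) = mono p ((Dg p)%:~R * f).
Proof.
elim/pp_ind: p => [|[[] n] p IH].
- by rewrite -/(vac _) Dh_vac mul0r mono0.
- have := Dh_bm (mono p f) (isT : Negz n != 0); rewrite /= IH !cr_mono -monoD => ->.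
  by rewrite Dg_add intrD mulrDl mul1r.
- have := Dh_am (mono p f) (isT : Negz n != 0); rewrite /= IH !cr_mono -monoN -monoD => ->.
  by rewrite Dg_add intrD mulrDl mulrNz mulN1r.
Qed.

Lemma DhE v p : Dh v p = (Dg p)%:~R * v p.
Proof.
have h : hop 0 (fun v : V => (fun p => (Dg p)%:~R * v p) : V).
  split=> [u w|u w q e]; first by apply/funext => q; rewrite !vx mulrDr.
  by rewrite e // addr0.
rewrite (hop_ext hop_Dh h) // => q f; rewrite Dh_mono; apply/funext => r.
by rewrite /mono; case: eqP => [->|]; rewrite ?mulr0.
Qed.

Lemma Dh_mu f v : Dh (mu f v) = mu f (Dh v).
Proof. by apply/funext => p; rewrite /mu !DhE; ring. Qed.
Lemma Dh_dv v : Dh (dv v) = dv (Dh v).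
Proof. by apply/funext => p; rewrite /dv !DhE dM d_int mul0r add0r. Qed.

Lemma X1E v : Xm beta 0 v = mu beta (dv v) + Dh v.
Proof. by rewrite !DhU addrC subrK. Qed.
Lemma X2E v : Xm (beta ^+ 2) 0 v = mu (beta ^+ 2) (dv v) + mu (beta *+ 2) (Dh v) + K2 (dv v) + Tv v.
Proof. by rewrite !TvU; vab. Qed.

Lemma K2_mu f v : K2 (mu f v) = mu f (K2 v).
Proof. by rewrite !K2U fm_mu (hopB (hop_mu _)) !mu_mu mulrC. Qed.

Lemma K2_dv v : dv (K2 v) = K2 (dv v).
Proof.
rewrite !K2U (hopB hop_dv) dv_mu dbeta2.
have := fm_am (beta ^+ 2) 0 0 v; rewrite /= addr0 => ->; rewrite dbeta2.
have -> : fm (beta *+ 2) 0 v = mu (beta *+ 2) v by rewrite mulr2n fmD muDl fm_beta.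
by vab.
Qed.

Lemma Tv_mu f v : Tv (mu f v) = mu f (Tv v).
Proof.
rewrite !TvU Xm_mu dv_mu Dh_mu (hopD hop_K2) !K2_mu (K2U v).
by vabm.
Qed.

Lemma Tv_dv v : dv (Tv v) = Tv (dv v).
Proof.
rewrite !TvU !(hopB hop_dv) !dv_mu dbeta2 ddbeta2 K2_dv Dh_dv.
have := Xm_am (beta ^+ 2) 0 0 v; rewrite /= !addr0 dbeta2 mu0 subr0 => ->.
have -> : Xm (beta *+ 2) 0 v = Xm beta 0 v + Xm beta 0 v by rewrite mulr2n XmD.
rewrite X1E.
by vabm.
Qed.

Lemma K2_Dh v : Dh (K2 v) = K2 (Dh v) + K2 v + K2 v.
Proof.
rewrite !K2U (hopB hop_Dh) Dh_mu Dh_fm dbeta2.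
have -> : fm (beta * (beta *+ 2)) 0 v = fm (beta ^+ 2) 0 v + fm (beta ^+ 2) 0 v.
  by rewrite -fmD; congr fm; ring.
have -> : fm (beta *+ 2) 0 v = mu beta v + mu beta v by rewrite mulr2n fmD fm_beta.
by rewrite (hopD (hop_mu _)) mu_mu -expr2; vab.
Qed.

(** From the bracket of X^b_0 and X^{b^2}_0, which is X^{b^2}_0 again, by removing the parts of
    X^{b^2}_0 whose charge is known: T raises the charge by 1. *)
Lemma Tv_Dh v : Dh (Tv v) = Tv (Dh v) + Tv v.
Proof.
have e : Xm beta 0 (Xm (beta ^+ 2) 0 v) = Xm (beta ^+ 2) 0 (Xm beta 0 v) + Xm (beta ^+ 2) 0 v.
  rewrite (Xm_Xm _ _ _ quad_beta quad_beta2) addr0 eqxx mul0r mu0 addr0; congr (_ + Xm _ _ _).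
  by rewrite /vbr dbeta2 d_beta; ring.
move: e; rewrite !X1E (hopD (hop_Xm _ _)) Xm_mu d_beta mu1.
have := Xm_am (beta ^+ 2) 0 0 v; rewrite /= !addr0 dbeta2 mu0 subr0 => ->.
have -> : Xm (beta *+ 2) 0 v = Xm beta 0 v + Xm beta 0 v by rewrite mulr2n XmD.
move/eqP; rewrite addrC -subr_eq => /eqP e.
have {}e : Dh (Xm (beta ^+ 2) 0 v) = Xm (beta ^+ 2) 0 (Dh v) + Xm (beta ^+ 2) 0 v
   + fm (beta ^+ 2) 0 (dv v) - mu beta (Xm beta 0 v + Xm beta 0 v).
  apply/eqP; rewrite -subr_eq0; apply/eqP; move/eqP: e; rewrite -subr_eq0 => /eqP e.
  by rewrite -[RHS]e; vabm.
rewrite !TvU !(hopB hop_Dh) !Dh_mu e K2_Dh !Dh_dv X1E (K2U (dv v)).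
by vabm.
Qed.

(** * The charge filtration and leading terms *)

Definition eqD (D : int) (v w : V) := forall q, Dg q <= D -> v q = w q.
Definition fil (D : int) (v : V) := forall q, Dg q < D -> v q = 0.

Lemma filW D D' v : D' <= D -> fil D v -> fil D' v.
Proof. by move=> h f q hq; apply: f; lia. Qed.

Lemma fil_sum D (I : Type) (r : seq I) (f : I -> V) :
  (forall i, fil D (f i)) -> fil D (\sum_(i <- r) f i).
Proof. by move=> h q hq; rewrite fct_sumE big1 // => i _; apply: h. Qed.

Lemma filD D u v : fil D u -> fil D v -> fil D (u + v).
Proof. by move=> hu hv q hq; rewrite vx hu // hv // addr0. Qed.

Lemma fil_am D k v : k != 0 -> fil D v -> fil (D - 1) (am k v).
Proof.
case: k => [[|n]|n] // _ h q hq /=.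
  by rewrite /an h ?mulr0 // Dg_add /=; lia.
by rewrite /cr; case: ifP => // hp; apply: h; rewrite Dg_sub //=; lia.
Qed.

Lemma fil_bm D k v : k != 0 -> fil D v -> fil (D + 1) (bm k v).
Proof.
case: k => [[|n]|n] // _ h q hq /=.
  by rewrite vx /an h ?mulr0 ?oppr0 // Dg_add /=; lia.
by rewrite /cr; case: ifP => // hp; apply: h; rewrite Dg_sub //=; lia.
Qed.

Lemma fil_mu D f v : fil D v -> fil D (mu f v).
Proof. by move=> h q hq; rewrite mux h ?mulr0. Qed.
Lemma fil_dv D v : fil D v -> fil D (dv v).
Proof. by move=> h q hq; rewrite /dv h ?d0. Qed.

Lemma fil_Sop D B i k v : fil D v -> fil (D + i%:Z) (Sop B i k v).
Proof.
move=> h; elim: i k => [|i IH] k /=; first by rewrite addr0; case: eqP.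
rewrite nzrangeE; apply: filD; apply: fil_sum => n.
  by apply: (@filW (D + i%:Z + 1)); [lia | apply: fil_bm].
by apply: (@filW (D + i%:Z + 1)); [lia | apply: fil_bm].
Qed.

(** Every nonzero mode of b raises the charge by 1, so the Taylor term of order i is visible from
    charge D + i on. *)
Lemma fm_trunc D f k v p r B : fil D v -> Dg p < D + r%:Z -> (r <= B)%N -> (2 * wt p + `|k| < B)%N ->
  fm f k v p = (\sum_(i < r) mu (ifact i * iter i d f) (Sop B i k v)) p.
Proof.
move=> h hp rB hB; rewrite (fmE _ _ hB) /fmt !fct_sumE.
rewrite (@ord_trunc _ (fun i => mu (ifact i * iter i d f) (Sop B i k v) p) B r) // => n rn.
by rewrite mux (@fil_Sop D B n k v h) ?mulr0 //; lia.
Qed.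

Lemma fil_fm D f k v : fil D v -> fil D (fm f k v).
Proof.
move=> h q hq; rewrite (@fm_trunc D _ _ _ _ 0 (2 * wt q + `|k| + 1)) //; try lia.
by rewrite big_ord0.
Qed.

Lemma fil_fm1 D f k v : k != 0 -> fil D v -> fil (D + 1) (fm f k v).
Proof.
move=> k0 h q hq; rewrite (@fm_trunc D _ _ _ _ 1 (2 * wt q + `|k| + 1)) //; try lia.
by rewrite big_ord1 /= (negPf k0) (hop0 (hop_mu _)).
Qed.

Lemma fm_lead0 D f v : fil D v -> eqD D (fm f 0 v) (mu f v).
Proof.
move=> h q hq; rewrite (@fm_trunc D _ _ _ _ 1 (2 * wt q + 1)) //; try lia.
by rewrite big_ord1 /= /ifact fact0 invr1 rmorph1 mul1r.
Qed.

Lemma fm_lead1 D f k v : k != 0 -> fil D v -> eqD (D + 1) (fm f k v) (mu (d f) (bm k v)).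
Proof.
move=> k0 h q hq; rewrite (@fm_trunc D _ _ _ _ 2 (2 * wt q + `|k| + 2)) //; try lia.
have := fm_beta k v => /(congr1 (fun u : V => u q)).
rewrite (@fm_trunc D _ _ _ _ 2 (2 * wt q + `|k| + 2)) //; try lia.
rewrite !big_ord_recl !big_ord0 /= (negPf k0) !(hop0 (hop_mu _)) d_beta !add0r !addr0.
by rewrite !mux /ifact factS fact0 invr1 rmorph1 !mul1r => <-.
Qed.

Definition lead D v w := eqD D v w /\ fil D w.

Lemma lead_fil D v w : lead D v w -> fil D v.
Proof. by case=> e f q hq; rewrite e ?f //; lia. Qed.

Lemma eqD_am D k v w : k != 0 -> eqD D v w -> eqD (D - 1) (am k v) (am k w).
Proof.
move=> k0 e q hq; apply/eqP; rewrite -subr_eq0; apply/eqP.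
rewrite voppE vaddE -(hopB (hop_am k)); apply: (@fil_am (D + 1)) => //; last lia.
by move=> r hr; rewrite !vx e ?subrr //; lia.
Qed.

Lemma eqD_bm D k v w : k != 0 -> eqD D v w -> eqD (D + 1) (bm k v) (bm k w).
Proof.
move=> k0 e q hq; apply/eqP; rewrite -subr_eq0; apply/eqP.
rewrite voppE vaddE -(hopB (hop_bm k)); apply: (@fil_bm (D + 1)) => //; last lia.
by move=> r hr; rewrite !vx e ?subrr //; lia.
Qed.

Lemma lead_fm D f k v w : k != 0 -> lead D v w -> lead (D + 1) (fm f k v) (mu (d f) (bm k w)).
Proof.
move=> k0 l; have fv := lead_fil l; case: l => e fw; split; last by apply: fil_mu; apply: fil_bm.
by move=> q hq; rewrite (fm_lead1 f k0 fv) // !mux; congr (_ * _); apply: (eqD_bm k0 e).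
Qed.

(** The one summand that lowers the charge is a_{-n-1} h_[0]. In all others either the mode of h has
    nonzero index and raises the charge by at least 1, or the mode of a is a_0; the derivative term
    has no mode of a. *)
Lemma lead_Xm D h n v w : lead D v w -> lead (D - 1) (Xm h (Negz n) v) (mu h (am (Negz n) w)).
Proof.
move=> l; have fv := lead_fil l; case: l => e fw; split; last by apply: fil_mu; apply: fil_am.
move=> q hq; rewrite (@XmE _ _ _ _ (wt q + n.+2)); last lia.
have fN j : j != Negz n -> fil D (nord h (Negz n) j v).
  move=> jn; rewrite /nord; case: ifP => j0.
    apply: (@filW (D + 1 - 1)); first lia.
    by apply: fil_am; [apply/eqP; lia | apply: fil_fm1 => //; apply/eqP; lia].
  have [j00|j00] := eqVneq j 0.
    by apply: fil_fm; rewrite j00; apply: fil_dv.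
  apply: (@filW (D - 1 + 1)); first lia.
  by apply: fil_fm1; [apply/eqP; lia | apply: fil_am].
have fS : fil D (mu (Negz n)%:~R (fm (d h) (Negz n) v)) by apply/fil_mu/fil_fm.
have Zf : (Zs (wt q + n.+2) (fun j => nord h (Negz n) j v - (if j == Negz n then nord h (Negz n) (Negz n) v else 0))) q = 0.
  have f' : fil D (Zs (wt q + n.+2) (fun j => nord h (Negz n) j v
     - (if j == Negz n then nord h (Negz n) (Negz n) v else 0))).
    by apply: filD; apply: fil_sum => i; case: eqP => [->|/eqP hi];
      rewrite ?subrr ?subr0 //; apply: fN.
  by apply: f'; lia.
move: Zf; rewrite ZsD ZsN (@Zs_pick _ (fun j => if j == Negz n then _ else 0) (Negz n)); last 2 first.
- by rewrite /=; lia.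
- by move=> j /negPf ->.
rewrite eqxx !vx => /eqP; rewrite subr_eq0 => /eqP Zf.
rewrite /Xmt !vx Zf fS ?subr0; last lia.
have -> : nord h (Negz n) (Negz n) v = am (Negz n) (fm h 0 v) by rewrite /nord subrr.
have e1 : eqD D (fm h 0 v) (mu h w).
  by move=> r hr; rewrite (fm_lead0 h fv) // !mux e.
by rewrite (@eqD_am D (Negz n) _ _ isT e1) // am_mu.
Qed.

Section Lead.
Variable a : mact.
(** The automorphy factor of a monomial: J^2 for each a and J^{-2} for each b, hence J^{-2D} in
    charge D. *)
Definition jfac (p : PP) : O := Jf a ^+ (2 * size (val p.1)) * Jfi a ^+ (2 * size (val p.2)).

Lemma dsg_beta : d (sg a beta) = Jfi a ^+ 2.
Proof. by rewrite dsg d_beta rmorph1 mulr1. Qed.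

Lemma lead_pimono p f : lead (Dg p) (pimono a p f) (mono p (jfac p * sg a f)).
Proof.
rewrite /pimono.
have L1 (m : Ptn) : lead (Dg (ptn0, m))
    (foldr (fun n acc => fm (sg a beta) (- n%:Z) acc) (vac (sg a f)) (val m))
    (mono (ptn0, m) (Jfi a ^+ (2 * size (val m)) * sg a f)).
  case: m => m hm /=; elim: m hm => [|n m IH] hm.
    have -> : (ptn0, exist (fun l : part => is_true (is_part l)) [::] hm) = pp0 by congr pair; apply: val_inj.
    rewrite muln0 expr0 mul1r; split=> // q hq; rewrite /vac /mono; case: eqP hq => // ->.
    by rewrite /Dg.
  have hm' : is_part m.
    by case/andP: hm => /= h1 /andP[_ h2]; rewrite /is_part h2 (path_sorted h1).
  case: n hm => [|n] hm; first by exfalso; case/andP: (hm).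
  have ep : (ptn0, exist (fun l : part => is_true (is_part l)) (n.+1 :: m) hm) = padd (true, n) (ptn0, exist _ m hm').
    congr pair; apply: val_inj => /=; apply: (sorted_eq geq_rel_trans geq_rel_anti).
    - by case/andP: hm.
    - by have /andP[] := is_part_ins n hm'.
    - by rewrite perm_sym perm_ins.
  have := lead_fm (sg a beta) (isT : Negz n != 0) (IH hm').
  rewrite /= cr_mono mu_mono ep Dg_add /= NegzE dsg_beta mulrA -exprD.
  by rewrite (_ : (2 + 2 * size m = 2 * (size m).+1)%N) //; lia.
case: p => l m; rewrite /jfac /=.
have {}L1 := L1 m; set w := foldr _ _ (val m) in L1 *.
case: l => l hl /=; elim: l hl => [|n l IH] hl.
  rewrite muln0 expr0 mul1r /=.
  by have -> : (exist (fun l : part => is_true (is_part l)) [::] hl, m) = (ptn0, m) by congr pair; apply: val_inj.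
have hl' : is_part l.
  by case/andP: hl => /= h1 /andP[_ h2]; rewrite /is_part h2 (path_sorted h1).
case: n hl => [|n] hl; first by exfalso; case/andP: (hl).
have ep : (exist (fun l : part => is_true (is_part l)) (n.+1 :: l) hl, m) = padd (false, n) (exist _ l hl', m).
  congr pair; apply: val_inj => /=; apply: (sorted_eq geq_rel_trans geq_rel_anti).
  - by case/andP: hl.
  - by have /andP[] := is_part_ins n hl'.
  - by rewrite perm_sym perm_ins.
have := lead_Xm (Jf a ^+ 2) n (IH hl').
rewrite /= cr_mono mu_mono ep Dg_add /= NegzE !mulrA -exprD.
by rewrite (_ : (2 + 2 * size l = 2 * (size l).+1)%N) //; lia.
Qed.

Lemma piv_lead N v D q : hv N v -> fil D v -> Dg q <= D -> piv a v q = jfac q * sg a (v q).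
Proof.
move=> hN f hq; have [qN|qN] := eqVneq (wt q) N; last first.
  by rewrite (hop_hv (hop_piv a) hN _ qN) ?addr0 // hN // rmorph0 mulr0.
rewrite {1}(hv_sum hN) (hop_sum (hop_piv a)) fct_sumE.
rewrite (bigD1_seq q) ?pps_uniq ?mem_pps ?qN //= big1 ?addr0 => [|r rq].
  by rewrite piv_mono; case: (lead_pimono q (v q)) => -> // _; rewrite /mono eqxx.
have [rD|rD] := ltP (Dg r) D; first by rewrite f // mono0 (hop0 (hop_piv a)).
rewrite piv_mono; case: (lead_pimono r (v r)) => e _; rewrite e; last lia.
by rewrite /mono eq_sym (negPf rq).
Qed.
End Lead.

(** * Vector-valued differential operators in a function *)

Definition dop (Phi : O -> V) := exists (n : nat) (c : nat -> V),
  (forall j, (n <= j)%N -> c j = 0) /\ forall f, Phi f = \sum_(j < n) mu (iter j d f) (c j).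

Lemma dop_eq Phi Psi : dop Phi -> (forall f, Psi f = Phi f) -> dop Psi.
Proof. by case=> n [c [h0 h]] e; exists n, c; split=> // f; rewrite e. Qed.

Lemma dop0 : dop (fun _ => 0).
Proof. by exists 0%N, (fun=> 0); split=> // f; rewrite big_ord0. Qed.

Lemma dop_mu1 c : dop (fun f => mu f c).
Proof.
by exists 1%N, (fun j => if j == 0%N then c else 0); split=> [[]//|f]; rewrite big_ord1.
Qed.

Lemma dop_add Phi Psi : dop Phi -> dop Psi -> dop (fun f => Phi f + Psi f).
Proof.
move=> [n [c [h0 h]]] [m [e [g0 g]]]; exists (n + m)%N, (fun j => c j + e j); split=> [j hj|f].
  by rewrite h0 ?g0 ?addr0 //; lia.
under eq_bigr => j _ do rewrite (hopD (hop_mu _)).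
rewrite big_split /= h g; congr (_ + _).
  rewrite (@ord_trunc _ (fun j => mu (iter j d f) (c j)) (n + m) n) ?leq_addr // => j hj.
  by rewrite h0 // (hop0 (hop_mu _)).
rewrite (@ord_trunc _ (fun j => mu (iter j d f) (e j)) (n + m) m) ?leq_addl // => j hj.
by rewrite g0 // (hop0 (hop_mu _)).
Qed.

Lemma dop_sum (I : Type) (r : seq I) (Phi : I -> O -> V) :
  (forall i, dop (Phi i)) -> dop (fun f => \sum_(i <- r) Phi i f).
Proof.
move=> h; elim: r => [|i r IH]; first by apply: (dop_eq dop0) => f; rewrite big_nil.
by apply: (dop_eq (dop_add (h i) IH)) => f; rewrite big_cons.
Qed.

Lemma dop_d Phi : dop Phi -> dop (fun f => Phi (d f)).
Proof.
case=> n [c [h0 h]]; exists n.+1, (fun j => if j is j'.+1 then c j' else 0); split=> [[]//|f].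
rewrite big_ord_recl (hop0 (hop_mu _)) add0r h; apply: eq_bigr => j _.
by rewrite -iterSr.
Qed.

Lemma dop_iter Phi i : dop Phi -> dop (fun f => Phi (iter i d f)).
Proof.
move=> h; elim: i => [|i IH]; first exact: (dop_eq h).
by apply: (dop_eq (dop_d IH)) => f; rewrite -iterSr.
Qed.

Lemma dop_mul1 i u c : dop (fun f => mu (iter i d (u * f)) c).
Proof.
elim: i u => [|i IH] u.
  by apply: (dop_eq (dop_mu1 (mu u c))) => f; rewrite /= mu_mu mulrC.
apply: (dop_eq (dop_add (IH (d u)) (dop_d (IH u)))) => f.
by rewrite iterSr dM iter_dD muDl.
Qed.

Lemma dop_mul Phi u : dop Phi -> dop (fun f => Phi (u * f)).
Proof.
case=> n [c [h0 h]].
by apply: (dop_eq (dop_sum (index_enum 'I_n) (fun j : 'I_n => dop_mul1 j u (c j)))) => f; rewrite h.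
Qed.

Lemma dop_fm f k Phi : dop Phi -> dop (fun g => fm f k (Phi g)).
Proof.
case=> n [c [h0 h]]; exists n, (fun j => fm f k (c j)); split=> [j hj|g].
  by rewrite h0 // (hop0 (hop_fm _ _)).
by rewrite h (hop_sum (hop_fm _ _)); apply: eq_bigr => j _; rewrite fm_mu.
Qed.

Lemma dop_Xm f k Phi : dop Phi -> dop (fun g => Xm f k (Phi g)).
Proof.
case=> n [c [h0 h]].
have h1 (j : 'I_n) : dop (fun g => Xm f k (mu (iter j d g) (c j))).
  apply: (dop_eq (dop_iter j (dop_add (dop_mu1 (Xm f k (c j))) (dop_d (dop_mu1 (fm f k (c j))))))).
  by move=> g; rewrite Xm_mu.
apply: (dop_eq (dop_sum (index_enum 'I_n) h1)) => g.
by rewrite h (hop_sum (hop_Xm _ _)).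
Qed.

Lemma iter_d_beta j i : iter j d (beta ^+ i) = if (j <= i)%N then (i ^_ j)%:R * beta ^+ (i - j) else 0.
Proof.
have dX n : d (beta ^+ n) = n%:R * beta ^+ n.-1.
  elim: n => [|n IH]; first by rewrite expr0 d1 mul0r.
  rewrite exprS dM d_beta mul1r IH mulrCA; case: n {IH} => [|n]; first by rewrite mul0r addr0 mul1r.
  by rewrite -exprS [n.+2%:R]mulrS mulrDl mul1r.
elim: j => [|j IH]; first by rewrite leq0n ffactn0 subn0 mul1r.
rewrite iterS IH; case: ltnP => h.
  rewrite ltnW // d_natl dX mulrA -natrM ffactnSr.
  by rewrite (_ : (i - j).-1 = (i - j.+1)%N) //; lia.
have [ji|ji] := leqP j i; last by rewrite d0.
have -> : i = j by lia.
by rewrite subnn expr0 d_natl d1 mulr0.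
Qed.

Lemma io_unit_mu (n : nat) v : n != 0%N -> mu n%:R v = 0 -> v = 0.
Proof.
move=> n0 /(congr1 (mu (io n%:R^-1))); rewrite mu_mu (hop0 (hop_mu _)) -(rmorph_nat io) -rmorphM.
by rewrite /= mulVf ?rmorph1 ?mu1 // pnatr_eq0.
Qed.

(** A triangular system: on b^i the operator gives i! c_i plus terms with c_j for j < i, so the
    coefficients vanish one after the other. *)
Lemma dop_uniq Phi : dop Phi -> (forall i, Phi (beta ^+ i) = 0) -> forall f, Phi f = 0.
Proof.
case=> n [c [h0 h]] hb.
suff c0 i : c i = 0 by move=> f; rewrite h big1 // => j _; rewrite c0 (hop0 (hop_mu _)).
have [s] := ubnP i; elim: s i => // s IH i hi.
have [ni|ni] := leqP n i; first exact: h0.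
have := hb i; rewrite h (bigD1 (Ordinal ni)) //= big1 ?addr0 => [|j ji].
  rewrite iter_d_beta leqnn subnn expr0 mulr1 ffactnn; apply: io_unit_mu.
  by rewrite -lt0n fact_gt0.
have [ij|ij] := ltnP i j.
  by rewrite iter_d_beta leqNgt ij /= mu0.
have ne : nat_of_ord j <> i by move=> e; move/eqP: ji; apply; apply: val_inj.
by rewrite IH ?(hop0 (hop_mu _)) //; lia.
Qed.

Lemma quad_dec k : quad k -> exists k0 k1 k2, [/\ d k0 = 0, d k1 = 0, d k2 = 0,
  k = k0 * 1 + k1 * beta + k2 * beta ^+ 2 & io (2%:R^-1) * d (d k) = k2 /\ d k = k1 + k2 * beta *+ 2].
Proof.
move=> qk.
have half : 2%:R * io (2%:R^-1) = 1.
  by rewrite -(rmorph_nat io) -rmorphM /= divff ?rmorph1 // pnatr_eq0.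
have [k2 dk2 ddk] : exists2 k2, d k2 = 0 & d (d k) = 2%:R * k2.
  exists (io (2%:R^-1) * d (d k)); first by rewrite dM d_io qk mul0r mulr0 addr0.
  by rewrite mulrA half mul1r.
have [k1 dk1 edk] : exists2 k1, d k1 = 0 & d k = k1 + k2 * beta *+ 2.
  exists (d k - k2 * beta *+ 2); last by rewrite subrK.
  by rewrite dD dN ddk mulr2n dD dM dk2 d_beta; ring.
have [k0 dk0 ek] : exists2 k0, d k0 = 0 & k = k0 * 1 + k1 * beta + k2 * beta ^+ 2.
  exists (k - k1 * beta - k2 * beta ^+ 2); last by ring.
  by rewrite !dD !dN !dM edk dk1 dk2 d_beta; ring.
by exists k0, k1, k2; split=> //; split=> //; rewrite ddk mulrA (mulrC (io _)) half mul1r.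
Qed.

Hypothesis ker_d : forall f, d f = 0 -> exists c, f = io c.

(** * The equivariant lift of densities of weight 2D *)

Section Lift.
Variables (N D' : nat) (w : V).
Notation D := D'.+1.
Hypothesis w_const : dv w = 0.
Hypothesis w_charge : Dh w = mu D%:R w.
Hypothesis w_wt : hv N w.

(** The weight D is a successor, which keeps 2D + j away from 0. Below, [mpair] carries (m_{j-1},
    m_j) through the two-step recursion, starting from m_{-1} = 0. *)
Definition lcoef (j : nat) : O := io ((j.+1 * (2 * D + j))%:R^-1).
Fixpoint mpair (j : nat) : V * V :=
  if j is j'.+1 then
    let: (x, y) := mpair j' in (y, mu (lcoef j') (Tv y + K2 x))
  else (0, w).
Definition mj j := (mpair j).2.

Lemma mj0 : mj 0 = w. Proof. by []. Qed.
Lemma mpairS j : (mpair j.+1).1 = mj j.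
Proof. by rewrite /mj /=; case: (mpair j). Qed.
Lemma mjS j : mj j.+1 = mu (lcoef j) (Tv (mj j) + K2 (mpair j).1).
Proof. by rewrite /mj /=; case: (mpair j). Qed.

Lemma d_lcoef j : d (lcoef j) = 0. Proof. exact: d_io. Qed.

Lemma lcoefK j : (j.+1 * (2 * D + j))%:R * lcoef j = 1.
Proof.
rewrite /lcoef -(rmorph_nat io) -rmorphM /= divff ?rmorph1 // pnatr_eq0.
Qed.

Lemma mj_rec j : Tv (mj j) + K2 (mpair j).1 = mu (j.+1 * (2 * D + j))%:R (mj j.+1).
Proof. by rewrite mjS mu_mu lcoefK mu1. Qed.

Lemma mj_props j : [/\ dv (mj j) = 0, Dh (mj j) = mu (D + j)%:R (mj j), hv N (mj j) &
  [/\ dv (mpair j).1 = 0, Dh (mpair j).1 = mu ((D + j)%:R - 1) (mpair j).1 & hv N (mpair j).1]].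
Proof.
elim: j => [|j [h1 h2 h3 [g1 g2 g3]]].
  split=> //; first by rewrite addn0.
  by split=> //; rewrite ?(hop0 hop_dv) ?(hop0 hop_Dh) ?(hop0 (hop_mu _)).
split; last first.
- by rewrite mpairS; split=> //; rewrite h2 addnS -natr1 addrK.
- rewrite mjS; apply: (hop_hv (hop_mu _)); last by rewrite addr0.
  by move=> q hq; rewrite vx (hop_hv hop_Tv h3 _ hq) ?(hop_hv hop_K2 g3 _ hq) ?addr0.
- rewrite mjS Dh_mu (hopD hop_Dh) Tv_Dh K2_Dh h2 g2 Tv_mu K2_mu addnS -natr1.
  by vabm.
- rewrite mjS (am_mu_const 0 _ (d_lcoef j) : dv (mu _ _) = mu _ (dv _)).
  by rewrite (hopD hop_dv) Tv_dv K2_dv h1 g1 (hop0 hop_Tv) (hop0 hop_K2) addr0 (hop0 (hop_mu _)).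
Qed.

Lemma charge_eq0 (z : int) v p : Dh v = mu z%:~R v -> Dg p != z -> v p = 0.
Proof.
move=> e ne; have := congr1 (fun u : V => u p) e; rewrite DhE mux.
move/eqP; rewrite -subr_eq0 -mulrBl => /eqP.
move/(congr1 (fun x => io ((Dg p - z)%:~R^-1) * x)); rewrite mulr0 mulrA -intrB -(rmorph_int io) -rmorphM.
by rewrite /= mulVf ?rmorph1 ?mul1r // intr_eq0 subr_eq0.
Qed.

(** The vector m_j has charge D + j, and the charge of a monomial never exceeds its weight N. *)
Lemma mj_big j : (N <= j)%N -> mj j = 0.
Proof.
move=> hj; case: (mj_props j) => _ h2 h3 _; apply/funext => p.
have [pN|pN] := eqVneq (wt p) N; last by rewrite h3.
apply: (@charge_eq0 (D + j)%N%:Z) => //.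
by apply/eqP => e; have := Dg_le p; rewrite e pN; lia.
Qed.

Definition Lft (f : O) : V := \sum_(j < N.+2) mu (iter j d f) (mj j).

Lemma LftE J f : (N <= J)%N -> Lft f = \sum_(j < J) mu (iter j d f) (mj j).
Proof.
move=> hJ; have t K : (N <= K)%N -> \sum_(j < K) mu (iter j d f) (mj j) = \sum_(j < N) mu (iter j d f) (mj j).
  move=> hK; apply: (@ord_trunc _ (fun j => mu (iter j d f) (mj j))) => // j hj.
  by rewrite mj_big // (hop0 (hop_mu _)).
by rewrite /Lft !t // ltnW // ltnW.
Qed.

Lemma hv_Lft f : hv N (Lft f).
Proof.
move=> q hq; rewrite /Lft fct_sumE big1 // => j _; rewrite mux.
by case: (mj_props j) => _ _ h _; rewrite h ?mulr0.
Qed.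

Lemma LftD f g : Lft (f + g) = Lft f + Lft g.
Proof. by rewrite /Lft -big_split; apply: eq_bigr => j _; rewrite iter_dD muDl. Qed.

Lemma Lft0 : Lft 0 = 0.
Proof. by rewrite /Lft big1 // => j _; rewrite iter_d0 mu0. Qed.

Lemma iter_dM_const c j f : d c = 0 -> iter j d (c * f) = c * iter j d f.
Proof. by move=> dc; elim: j => //= j ->; rewrite dM dc mul0r add0r. Qed.

Lemma Lft_const c f : d c = 0 -> Lft (c * f) = mu c (Lft f).
Proof.
move=> dc; rewrite /Lft (hop_sum (hop_mu _)); apply: eq_bigr => j _.
by rewrite iter_dM_const // mu_mu.
Qed.

Lemma Lft1 : Lft 1 = w.
Proof.
rewrite /Lft big_ord_recl big1 ?addr0 => [|j _]; first by rewrite /= mu1 mj0.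
by rewrite [iter _ _ _]iterSr d1 iter_d0 mu0.
Qed.

Lemma Lft_lead f q : Dg q <= D%:Z -> Lft f q = f * w q.
Proof.
move=> hq; rewrite /Lft big_ord_recl vx fct_sumE big1 ?addr0 // => j _.
case: (mj_props (lift ord0 j)) => _ h _ _; rewrite mux (@charge_eq0 (D + lift ord0 j)%N%:Z) ?mulr0 //.
by apply/eqP; rewrite /= /bump /=; lia.
Qed.

Lemma dv_Lft f : dv (Lft f) = Lft (d f).
Proof.
rewrite /Lft (hop_sum hop_dv); apply: eq_bigr => j _; case: (mj_props j) => h _ _ _.
by rewrite dv_mu h (hop0 (hop_mu _)) addr0 -iterSr.
Qed.

Lemma iter_d_betaM j f : iter j d (beta * f) = beta * iter j d f + iter j.-1 d f *+ j.
Proof.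
elim: j => [|j IH]; first by rewrite mulr0n addr0.
rewrite iterS IH dD dM d_beta mul1r; case: j {IH} => [|j]; first by rewrite !mulr0n d0 addr0 addrC.
rewrite -mulr_natl d_natl mulr_natl /= [in RHS]mulrS; ring.
Qed.

Lemma X1_Lft f : Xm beta 0 (Lft f) = Lft (beta * d f + D%:R * f).
Proof.
rewrite /Lft (hop_sum (hop_Xm _ _)); apply: eq_bigr => j _; case: (mj_props j) => h1 h2 _ _.
rewrite X1E dv_mu h1 (hop0 (hop_mu _)) addr0 Dh_mu h2 iter_dD iter_d_betaM iter_dM_const ?d_nat //.
have sw k : iter k d (d f) = d (iter k d f) by rewrite -iterSr.
rewrite !mu_mu -muDl !sw; congr mu; case: (nat_of_ord j) => [|i].
  by rewrite mulr0n addn0; ring.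
by rewrite /= natrD -[_ *+ i.+1]mulr_natl; ring.
Qed.

(** After the parts b^2 d/db and 2bD are matched, the left side has f^(j) (T m_j + 2K m_{j-1}) and
    the right side (j+1)(2D+j) f^(j) m_{j+1}: the recursion of m is made for this. The top terms
    vanish by [mj_big]. *)
Lemma X2_Lft f : Xm (beta ^+ 2) 0 (Lft f) = Lft (beta ^+ 2 * d f + (2 * D)%:R * (beta * f)).
Proof.
pose g j := iter j d f.
pose J := N.+1.
rewrite (@LftE J.+1) ?(@LftE J.+1 (_ + _)) /J; try lia.
rewrite (hop_sum (hop_Xm _ _)).
have lhs (j : 'I_J.+1) : Xm (beta ^+ 2) 0 (mu (iter j d f) (mj j)) =
    mu (beta ^+ 2 * g j.+1 + (D + j)%:R * (beta *+ 2) * g j) (mj j)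
    + (mu (g j) (Tv (mj j)) + mu (g j.+1) (K2 (mj j))).
  case: (mj_props j) => h1 h2 _ _.
  rewrite X2E dv_mu h1 (hop0 (hop_mu _)) addr0 Dh_mu h2 Tv_mu K2_mu /g -iterS.
  by vabm.
have rhs (j : 'I_J.+1) : mu (iter j d (beta ^+ 2 * d f + (2 * D)%:R * (beta * f))) (mj j) =
    mu (beta ^+ 2 * g j.+1 + (D + j)%:R * (beta *+ 2) * g j) (mj j)
    + mu ((j * (2 * D + j.-1))%:R * g j.-1) (mj j).
  rewrite -muDl; congr mu; rewrite expr2 -mulrA iter_dD !iter_d_betaM iter_dM_const ?d_nat //.
  rewrite !iter_d_betaM /g -!iterSr; case: (nat_of_ord j) => [|[|i]] /=.
  - by rewrite ?(mulr0n, mul0r, mul0n, addn0); ring.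
  - by rewrite ?natrM ?natrD; ring.
  - by ring.
under eq_bigr => j _ do rewrite lhs.
under [RHS]eq_bigr => j _ do rewrite rhs.
rewrite !big_split /=; congr (_ + _).
rewrite [in RHS]big_ord_recl /= mul0n mul0r mu0 add0r.
have z1 : mj N.+1 = 0 by apply: mj_big; lia.
have z2 : mj N = 0 by apply: mj_big; lia.
rewrite big_ord_recr /= z1 (hop0 hop_Tv) (hop0 (hop_mu _)) addr0.
rewrite [X in _ + X]big_ord_recr /= z1 (hop0 hop_K2) (hop0 (hop_mu _)) addr0.
rewrite [X in _ + X]big_ord_recr /= z2 (hop0 hop_K2) (hop0 (hop_mu _)) addr0.
have sh : \sum_(j < N.+1) mu (g j) (K2 (mpair j).1) = \sum_(j < N) mu (g j.+1) (K2 (mj j)).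
  rewrite big_ord_recl /= (hop0 hop_K2) (hop0 (hop_mu _)) add0r.
  by apply: eq_bigr => j _; rewrite -mpairS.
rewrite -sh -big_split /=; apply: eq_bigr => j _.
by rewrite -(hopD (hop_mu _)) mj_rec mu_mu mulrC.
Qed.

Lemma LftN f : Lft (- f) = - Lft f.
Proof. by rewrite -[- f]mulN1r Lft_const ?muN ?mu1 // dN d1 oppr0. Qed.

Lemma dop_Lft u : dop (fun F => Lft (u * F)).
Proof. by apply: (@dop_mul Lft); apply: dop_sum => j; exact: (dop_iter j (dop_mu1 (mj j))). Qed.

Section LiftAct.
Variable a : mact.
Definition sl (D0 : nat) (f : O) : O := Jfi a ^+ (2 * D0) * sg a f.

Lemma dop_sg j c : dop (fun F => mu (iter j (fun F => Jf a ^+ 2 * d F) F) c).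
Proof.
elim: j => [|j IH]; first exact: (dop_eq (dop_mu1 c)).
by apply: (dop_eq (dop_d (dop_mul (Jf a ^+ 2) IH))) => F'; rewrite iterSr.
Qed.

Lemma iter_sg j f : sg a (iter j d f) = iter j (fun F => Jf a ^+ 2 * d F) (sg a f).
Proof. by elim: j => //= j <-; rewrite h_dsg. Qed.

Lemma dop_pimono (p : PP) (Phi : O -> O) : (forall c, dop (fun F => mu (Phi F) c)) ->
  dop (fun F => foldr (fun n acc => Xm (Jf a ^+ 2) (- n%:Z) acc)
    (foldr (fun n acc => fm (sg a beta) (- n%:Z) acc) (vac (Phi F)) (val p.2)) (val p.1)).
Proof.
move=> hP; elim: (val p.1) => [|n l IH] /=; last exact: dop_Xm.
elim: (val p.2) => [|n l IH] /=; last exact: dop_fm.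
by apply: (dop_eq (hP (vac 1))) => F'; rewrite /vac mu_mono mulr1.
Qed.

(** In the variable F = f o g the derivatives of f become iterates of J^2 d/db applied to F, so the
    transformed lift is a differential operator in F. *)
Lemma dop_piv_Lft : dop (fun F => piv a (Lft (sgi a F))).
Proof.
apply: (@dop_eq (fun F => \sum_(j < N.+2) \sum_(p <- pps N) piv a (mono p (iter j d (sgi a F) * mj j p)))).
  apply: dop_sum => j; apply: dop_sum => p.
  pose Phi (F' : O) := iter j (fun F => Jf a ^+ 2 * d F) F' * sg a (mj j p).
  have hP c : dop (fun F' => mu (Phi F') c).
    by apply: (dop_eq (dop_sg j (mu (sg a (mj j p)) c))) => F'; rewrite mu_mu.
  apply: (dop_eq (dop_pimono p hP)) => F'.
  by rewrite piv_mono /pimono rmorphM iter_sg sgiK.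
move=> F'; rewrite /Lft (hop_sum (hop_piv a)); apply: eq_bigr => j _.
have hN : hv N (mu (iter j d (sgi a F')) (mj j)).
  by move=> q hq; rewrite mux; case: (mj_props j) => _ _ h _; rewrite h ?mulr0.
by rewrite {1}(hv_sum hN) (hop_sum (hop_piv a)).
Qed.

Lemma JfiK n : Jfi a ^+ n * Jf a ^+ n = 1.
Proof. by rewrite -exprMn mulrC JJi expr1n. Qed.

Lemma sl_sgi F' : sl D (sgi a (Jf a ^+ (2 * D) * F')) = F'.
Proof. by rewrite /sl sgiK mulrA JfiK mul1r. Qed.

Lemma sl_inj f : sgi a (Jf a ^+ (2 * D) * sl D f) = f.
Proof. by rewrite /sl mulrA (mulrC (Jf a ^+ _)) JfiK mul1r sgK. Qed.

Lemma dJfiX n : d (Jfi a ^+ n) = - (n%:R * d (Jf a) * Jfi a ^+ n.+1).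
Proof.
elim: n => [|n IH]; first by rewrite expr0 d1 !mul0r oppr0.
by rewrite exprS dM IH dJfi [Jfi a ^+ n.+2]exprS [Jfi a ^+ n.+1]exprS -[n.+1%:R]natr1; ring.
Qed.

Lemma sl_vf k f : sl D (k * d f + D%:R * d k * f) =
  Jf a ^+ 2 * sg a k * d (sl D f) + D%:R * d (Jf a ^+ 2 * sg a k) * sl D f.
Proof.
rewrite /sl dAd dM dJfiX dsg !(rmorphD, rmorphM, rmorph_nat).
have e : Jf a ^+ 2 * Jfi a ^+ (2 * D).+1 = Jf a * Jfi a ^+ (2 * D).
  by rewrite [_ ^+ (2 * D).+1]exprS expr2 -mulrA mulrA -mulrA [X in Jf a * X]mulrA JJi mul1r.
transitivity (sg a k * (- ((2 * D)%:R * d (Jf a) * (Jf a ^+ 2 * Jfi a ^+ (2 * D).+1))) * sg a f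
  + sg a k * Jfi a ^+ (2 * D) * (Jf a ^+ 2 * Jfi a ^+ 2) * sg a (d f)
  + D%:R * (Jf a * d (Jf a) *+ 2 * sg a k + sg a (d k)) * (Jfi a ^+ (2 * D) * sg a f)); last by ring.
by rewrite e JJi2 natrM; ring.
Qed.

Definition Psi (f : O) : V := piv a (Lft f) - Lft (sl D f).
(** The field whose pull-back by g is b^r d/db. Through it the zero modes X^{b^r}_0 act after the
    transformation as they do on [Lft] before it. *)
Definition kf (r : nat) : O := sgi a (Jfi a ^+ 2 * beta ^+ r).

Lemma kfE r : Jf a ^+ 2 * sg a (kf r) = beta ^+ r.
Proof. by rewrite /kf sgiK mulrA JJi2 mul1r. Qed.

Lemma sgd f : sg a (d f) = Jf a ^+ 2 * d (sg a f).
Proof. by rewrite h_dsg. Qed.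

Lemma sg_inj f g : sg a f = sg a g -> f = g.
Proof. exact: (can_inj (sgK a)). Qed.

Lemma sg_dkf r : sg a (d (kf r)) = d (beta ^+ r) - 2%:R * d (Jf a) * Jfi a * beta ^+ r.
Proof.
rewrite sgd /kf sgiK dM dJfiX; transitivity ((Jf a * Jfi a) ^+ 2 * d (beta ^+ r)
  - 2%:R * d (Jf a) * (Jf a * Jfi a) ^+ 2 * Jfi a * beta ^+ r); first ring.
by rewrite JJi; ring.
Qed.

Lemma sg_ddkf r : sg a (d (d (kf r))) = Jf a ^+ 2 * d (d (beta ^+ r))
  - 2%:R * d (Jf a) * Jf a * d (beta ^+ r) + 2%:R * d (Jf a) ^+ 2 * beta ^+ r.
Proof.
rewrite sgd sg_dkf dD dN !dM dJfi dJ2 d_nat.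
transitivity (Jf a ^+ 2 * d (d (beta ^+ r)) - 2%:R * d (Jf a) * (Jf a * Jfi a) * Jf a * d (beta ^+ r)
 + 2%:R * d (Jf a) ^+ 2 * (Jf a * Jfi a) ^+ 2 * beta ^+ r); first ring.
by rewrite JJi; ring.
Qed.

Lemma quad_kf r : (r <= 2)%N -> quad (kf r).
Proof.
move=> r2; rewrite /quad; apply: sg_inj; rewrite rmorph0 sgd sg_ddkf.
have e3 : d (d (d (beta ^+ r))) = 0.
  by have := iter_d_beta 3 r; rewrite /= => ->; case: r r2 => [|[|[|]]].
rewrite !(dD, dN, dM, expr2) dJ2 d1 e3; ring.
Qed.

Lemma Xm_Lft k f : quad k -> Xm k 0 (Lft f) = Lft (k * d f + D%:R * d k * f).
Proof.
move=> /quad_dec[k0 [k1 [k2 [dk0 dk1 dk2 ek [_ edk]]]]].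
rewrite {1}ek !XmD (Xm_const _ _ _ dk0) (Xm_const _ _ _ dk1) (Xm_const _ _ _ dk2).
rewrite Xm1 X1_Lft X2_Lft [am 0 _]dv_Lft.
rewrite -(Lft_const _ dk0) -(Lft_const _ dk1) -(Lft_const _ dk2) -!LftD; congr Lft.
by rewrite edk [X in _ = X * _ + _]ek natrM; ring.
Qed.

Lemma Psi_vf r f : (r <= 2)%N -> Xm (beta ^+ r) 0 (Psi f) = Psi (kf r * d f + D%:R * d (kf r) * f).
Proof.
move=> r2; have q := quad_kf r2; rewrite /Psi (hopB (hop_Xm _ _)) sl_vf kfE.
rewrite -[Lft (beta ^+ r * _ + _)]Xm_Lft; last by rewrite -kfE; exact: quad_Ad.
by rewrite -[in X in X - _](kfE r) -piv_Xm // Xm_Lft.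
Qed.

Lemma Psi0 : Psi 0 = 0.
Proof. by rewrite /Psi Lft0 (hop0 (hop_piv a)) /sl rmorph0 mulr0 Lft0 subr0. Qed.

Lemma Psi_const c f : d c = 0 -> sg a c = c -> Psi (c * f) = mu c (Psi f).
Proof.
move=> dc sc; rewrite /Psi Lft_const // piv_mu_const // /sl rmorphM sc.
by rewrite (mulrCA _ c) (Lft_const _ dc) (hopB (hop_mu c)).
Qed.

Lemma fil_w : fil D%:Z w.
Proof. by move=> q hq; apply: (@charge_eq0 D%:Z) => //; apply/eqP; lia. Qed.

(** In charge D the transformation multiplies by J^{-2D} and composes with g, which is the slash
    action; below D both sides vanish. The coefficients of w are constants by [ker_d], so g fixes
    them. *)
Lemma Psi_lead f q : Dg q <= D%:Z -> Psi f q = 0.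
Proof.
move=> hq; rewrite /Psi !vx Lft_lead //.
have fL : fil D%:Z (Lft f).
  by move=> p hp; rewrite Lft_lead ?fil_w ?mulr0 //; lia.
rewrite (piv_lead a (hv_Lft f) fL hq) Lft_lead //.
have [e|ne] := eqVneq (Dg q) D%:Z; last first.
  by rewrite (@charge_eq0 D%:Z w q) // !mulr0 rmorph0 mulr0 subrr.
have dw : d (w q) = 0 by have := congr1 (fun u : V => u q) w_const.
have [c wc] := ker_d dw; rewrite wc rmorphM sg_io /sl /jfac.
have -> : (2 * size (val q.2) = 2 * size (val q.1) + 2 * D)%N by move: e; rewrite /Dg; lia.
by rewrite exprD [X in X * _ - _]mulrA -exprMn JJi expr1n mul1r mulrA subrr.
Qed.

(** The argument is the function whose image under the slash action is b^i. For i = 0 the defect is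
    killed by d/db and by b d/db + D - D, so it lives in charge D, where it vanishes by [Psi_lead].
    The mode X^{b^2}_0 then leads from b^i to (i + 2D) b^{i+1}, and the factor is nonzero. *)
Lemma Psi_beta i : Psi (sgi a (Jf a ^+ (2 * D) * beta ^+ i)) = 0.
Proof.
pose fi i := sgi a (Jf a ^+ (2 * D) * beta ^+ i).
have G r j : kf r * d (fi j) + D%:R * d (kf r) * fi j =
    sgi a (Jf a ^+ (2 * D) * (beta ^+ r * d (beta ^+ j) + D%:R * d (beta ^+ r) * beta ^+ j)).
  rewrite -[LHS]sl_inj; congr (sgi _ (_ * _)).
  by rewrite sl_vf kfE sl_sgi.
have sgi0 : sgi a 0 = 0 by apply: sg_inj; rewrite sgiK rmorph0.
have sgi_nat n f : sgi a (n%:R * f) = n%:R * sgi a f.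
  by apply: sg_inj; rewrite sgiK rmorphM rmorph_nat sgiK.
rewrite -/(fi i); elim: i => [|i IH].
  apply/funext => q; have [hq|hq] := leP (Dg q) D%:Z; first exact: Psi_lead.
  have e0 : dv (Psi (fi 0%N)) = 0.
    have := Psi_vf (fi 0%N) (isT : (0 <= 2)%N); rewrite expr0 Xm1 /= G.
    by rewrite expr0 d1 !(mulr0, mul0r) addr0 mulr0 sgi0 Psi0.
  have e1 : Dh (Psi (fi 0%N)) = mu D%:R (Psi (fi 0%N)).
    rewrite DhU e0 (hop0 (hop_mu _)) subr0.
    have := Psi_vf (fi 0%N) (isT : (1 <= 2)%N); rewrite expr1 => ->; rewrite G expr0 d1 mulr0 add0r.
    rewrite expr1 d_beta !mulr1 mulrC sgi_nat Psi_const ?d_nat ?rmorph_nat //.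
    by rewrite /fi expr0 mulr1.
  by apply: (@charge_eq0 D%:Z) => //; apply/eqP; lia.
have := Psi_vf (fi i) (isT : (2 <= 2)%N); rewrite IH (hop0 (hop_Xm _ _)) G.
have -> : Jf a ^+ (2 * D) * (beta ^+ 2 * d (beta ^+ i) + D%:R * d (beta ^+ 2) * beta ^+ i) =
    (i + 2 * D)%:R * (Jf a ^+ (2 * D) * beta ^+ i.+1).
  have := iter_d_beta 1 i; rewrite /= => ->; rewrite ffactn1 dbeta2; case: i {IH} => [|i] /=.
    by rewrite expr0 expr1; ring.
  by rewrite subn1 /= !exprS; ring.
rewrite sgi_nat Psi_const ?d_nat ?rmorph_nat // => /esym; apply: io_unit_mu.
by lia.
Qed.

(** The defect, written as a function of F = [sl D f], is a differential operator that kills all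
    powers of b. *)
Theorem piv_Lft f : piv a (Lft f) = Lft (sl D f).
Proof.
apply/eqP; rewrite -subr_eq0; apply/eqP; rewrite -/(Psi f).
have hd : dop (fun F => Psi (sgi a (Jf a ^+ (2 * D) * F))).
  apply: (dop_eq (dop_add (dop_mul (Jf a ^+ (2 * D)) dop_piv_Lft) (dop_Lft (- 1)))) => F'.
  by rewrite /Psi sl_sgi mulN1r LftN.
have := dop_uniq hd Psi_beta (sl D f).
by rewrite sl_inj.
Qed.
End LiftAct.
End Lift.

(** * Lifts in charge zero *)

Section Lift0.
Variables (N : nat) (w : V) (a : mact).
Hypothesis w_const : dv w = 0.
Hypothesis w_charge : Dh w = 0.
Hypothesis w_wt : hv N w.

Lemma Tw_const : dv (Tv w) = 0. Proof. by rewrite Tv_dv w_const (hop0 hop_Tv). Qed.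
Lemma Tw_charge : Dh (Tv w) = mu 1%:R (Tv w).
Proof. by rewrite Tv_Dh w_charge (hop0 hop_Tv) add0r mu1. Qed.
Lemma Tw_wt : hv N (Tv w). Proof. by apply: (hop_hv hop_Tv w_wt); rewrite addr0. Qed.

Notation LT := (Lft N 0 (Tv w)).

Lemma fil_w0 : fil 0 w.
Proof. by move=> q hq; apply: (@charge_eq0 0); rewrite ?mu0 //; apply/eqP; lia. Qed.

Lemma Xm_w k : quad k -> Xm k 0 w = mu (io (2%:R^-1) * d (d k)) (Tv w).
Proof.
move=> /quad_dec[k0 [k1 [k2 [dk0 dk1 dk2 ek [-> _]]]]].
rewrite ek !XmD (Xm_const _ _ _ dk0) (Xm_const _ _ _ dk1) (Xm_const _ _ _ dk2).
rewrite Xm1 X1E X2E /= w_const w_charge !(hop0 (hop_mu _)) (hop0 hop_K2) !addr0 !add0r.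
by rewrite (hop0 (hop_mu _)) add0r.
Qed.

(** T w has charge 1, so it lifts with D = 1. On w itself X^k_0 acts by k''/2 times T w, and the
    second derivative of a transformed field brings in J'; the lift of J'/J is the cocycle that
    accounts for this. *)
Lemma piv_w : piv a w = w - LT (d (Jf a) * Jfi a).
Proof.
have LX k f : quad k -> Xm k 0 (LT f) = LT (k * d f + 1%:R * d k * f).
  exact: (Xm_Lft Tw_const Tw_charge Tw_wt).
have pL f : piv a (LT f) = LT (sl a 1 f) by exact: (piv_Lft Tw_const Tw_charge Tw_wt).
have L1 : LT 1 = Tv w := Lft1 _ _ _.
have muT c : d c = 0 -> mu c (Tv w) = LT c.
  by move=> dc; rewrite -{2}[c]mulr1 Lft_const // L1.
pose x := piv a w - w + LT (d (Jf a) * Jfi a).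
suff x0 : x = 0.
  by apply/eqP; rewrite -subr_eq0; apply/eqP; rewrite -[RHS]x0 /x; vab.
(* The error [x] is killed by the modes of d/db and b d/db. So it is constant of charge 0, and in
   charge 0 it vanishes by comparison of leading terms. *)
have key r : (r <= 1)%N -> Xm (beta ^+ r) 0 x = 0.
  move=> r1; have r2 : (r <= 2)%N := leqW r1.
  have qk := quad_kf a r2; have qb : quad (beta ^+ r) by rewrite -(kfE a); exact: quad_Ad.
  rewrite /x (hopD (hop_Xm _ _)) (hopB (hop_Xm _ _)) LX // (Xm_w qb).
  rewrite -[in X in X - _ + _](kfE a r) -piv_Xm // (Xm_w qk).
  have c1 : d (io (2%:R^-1) * d (d (kf a r))) = 0 by rewrite dM d_io qk mul0r mulr0 addr0.
  have c2 : d (io (2%:R^-1) * d (d (beta ^+ r))) = 0 by rewrite dM d_io qb mul0r mulr0 addr0.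
  rewrite (muT _ c1) (muT _ c2) pL -LftN -!LftD.
  rewrite [X in LT X](_ : _ = 0) ?Lft0 // /sl rmorphM sg_io sg_ddkf.
  have -> : d (d (beta ^+ r)) = 0.
    by have := iter_d_beta 2 r; rewrite /= => ->; case: r r1 {r2 qk qb c1 c2} => [|[|]].
  have half : 2%:R * io (2%:R^-1) = 1.
    by rewrite -(rmorph_nat io) -rmorphM /= divff ?rmorph1 // pnatr_eq0.
  rewrite [d (d (Jf a) * _)]dM dJ2 dJfi muln1.
  transitivity (2%:R * io (2%:R^-1) * (d (Jf a) ^+ 2 * Jfi a ^+ 2 * beta ^+ r
     - (Jf a * Jfi a) * Jfi a * d (Jf a) * d (beta ^+ r)) - beta ^+ r * d (Jf a) ^+ 2 * Jfi a ^+ 2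
     + d (beta ^+ r) * d (Jf a) * Jfi a); first ring.
  by rewrite half JJi; ring.
have e0 : dv x = 0 by have := key 0%N isT; rewrite expr0 Xm1.
have e1 : Dh x = mu 0 x by rewrite mu0 DhU e0 (hop0 (hop_mu _)) subr0; have := key 1%N isT; rewrite expr1.
apply/funext => q; have [q0|q0] := eqVneq (Dg q) 0; last exact: (@charge_eq0 0 x q e1).
have hT : LT (d (Jf a) * Jfi a) q = 0.
  rewrite (Lft_lead Tw_const Tw_charge Tw_wt); last by rewrite q0.
  by rewrite (@charge_eq0 1 (Tv w) q) ?mulr0 ?Tw_charge // q0.
rewrite /x !vx hT addr0 (piv_lead a w_wt fil_w0) ?q0 //.
have dw : d (w q) = 0 by have := congr1 (fun u : V => u q) w_const.
have [c wc] := ker_d dw; rewrite wc sg_io /jfac.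
have -> : size (val q.2) = size (val q.1) by move: q0; rewrite /Dg; lia.
by rewrite -exprMn JJi expr1n mul1r subrr.
Qed.
End Lift0.
End Fock.

(** * Complex differentiation and Cauchy's theorem *)

Definition nc (z : C) : R := Normc.normc z.
Definition rC (x : R) : C := complex.Complex x 0.
Definition iC : C := complex.Complex 0 1.
Notation Re := (@complex.Re R).
Notation Im := (@complex.Im R).

Lemma ReD (x y : C) : Re (x + y) = Re x + Re y. Proof. by case: x; case: y. Qed.
Lemma ImD (x y : C) : Im (x + y) = Im x + Im y. Proof. by case: x; case: y. Qed.
Lemma ReN (x : C) : Re (- x) = - Re x. Proof. by case: x. Qed.
Lemma ImN (x : C) : Im (- x) = - Im x. Proof. by case: x. Qed.
Lemma ReM (x y : C) : Re (x * y) = Re x * Re y - Im x * Im y. Proof. by case: x; case: y. Qed.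
Lemma ImM (x y : C) : Im (x * y) = Re x * Im y + Im x * Re y. Proof. by case: x; case: y. Qed.
Lemma C_eq (x y : C) : Re x = Re y -> Im x = Im y -> x = y.
Proof. by case: x; case: y => a b c d /= -> ->. Qed.
Lemma CE (x : C) : x = rC (Re x) + iC * rC (Im x).
Proof. by apply: C_eq; rewrite !(ReD, ImD, ReM, ImM) /=; ring. Qed.
Lemma rCD x y : rC (x + y) = rC x + rC y. Proof. by apply: C_eq; rewrite !(ReD, ImD) //= addr0. Qed.
Lemma rCN x : rC (- x) = - rC x. Proof. by apply: C_eq; rewrite !(ReN, ImN) //= oppr0. Qed.
Lemma rCB x y : rC (x - y) = rC x - rC y. Proof. by rewrite rCD rCN. Qed.
Lemma rCM x y : rC (x * y) = rC x * rC y.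
Proof. by apply: C_eq; rewrite !(ReM, ImM) /=; ring. Qed.
Lemma rC1 : rC 1 = 1. Proof. by []. Qed.
Lemma rC0 : rC 0 = 0. Proof. by []. Qed.
Lemma rC_int (n : int) : rC n%:~R = n%:~R.
Proof. by rewrite /rC -(rmorph_int (real_complex R)). Qed.
Lemma rC_nat (n : nat) : rC n%:R = n%:R. Proof. exact: (rC_int n). Qed.
Lemma rCV x : rC x^-1 = (rC x)^-1.
Proof. by apply: C_eq => /=; have [->|x0] := eqVneq x 0; rewrite ?invr0 ?mul0r ?oppr0 //; field. Qed.
Lemma rC_inj x y : rC x = rC y -> x = y. Proof. by move=> /(congr1 Re). Qed.

Lemma ncE z : `|z| = rC (nc z) :> C. Proof. by []. Qed.
Lemma nc_ge0 z : 0 <= nc z. Proof. by case: z => a b; apply: sqrtr_ge0. Qed.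
Lemma ncM x y : nc (x * y) = nc x * nc y. Proof. exact: Normc.normcM. Qed.
Lemma ncV x : nc x^-1 = (nc x)^-1. Proof. exact: Normc.normcV. Qed.
Lemma ncN x : nc (- x) = nc x. Proof. exact: complex.normcN. Qed.
Lemma ncB x y : nc (x - y) = nc (y - x). Proof. by rewrite -ncN opprB. Qed.
Lemma nc0 : nc 0 = 0. Proof. exact: Normc.normc0. Qed.
Lemma nc1 : nc 1 = 1. Proof. exact: Normc.normc1. Qed.
Lemma nc_eq0 z : nc z = 0 -> z = 0. Proof. exact: Normc.eq0_normc. Qed.
Lemma nc_gt0 z : (0 < nc z) = (z != 0).
Proof.
rewrite lt0r nc_ge0 andbT; congr (~~ _); apply/eqP/eqP => [/nc_eq0 //|->]; exact: nc0.
Qed.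
Lemma ncX z n : nc (z ^+ n) = nc z ^+ n.
Proof. by elim: n => [|n IH]; rewrite ?expr0 ?nc1 // !exprS ncM IH. Qed.
Lemma nc_tri x y : nc (x + y) <= nc x + nc y. Proof. exact: complex.le_normcD. Qed.
Lemma nc_triB x y : nc (x - y) <= nc x + nc y.
Proof. by rewrite -[nc y]ncN; apply: nc_tri. Qed.
Lemma nc_tri2 (z x y : C) : nc (x - y) <= nc (x - z) + nc (z - y).
Proof. have -> : x - y = (x - z) + (z - y) by ring.
exact: nc_tri. Qed.
Lemma nc_sub_le x y : nc x - nc y <= nc (x - y).
Proof. have := nc_tri (x - y) y; rewrite subrK; lra. Qed.
Lemma nc_rC x : nc (rC x) = `|x|.
Proof. by rewrite /nc /rC /= expr0n addr0 sqrtr_sqr. Qed.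
Lemma nc_iC : nc iC = 1. Proof. by rewrite /nc /= expr0n add0r expr1n sqrtr1. Qed.
Lemma nc_Re z : `|Re z| <= nc z.
Proof. case: z => a b /=; rewrite /nc /= -sqrtr_sqr ler_wsqrtr // lerDl sqr_ge0 //. Qed.
Lemma nc_Im z : `|Im z| <= nc z.
Proof. case: z => a b /=; rewrite /nc /= -[`|b|]sqrtr_sqr ler_wsqrtr // lerDr sqr_ge0 //. Qed.
Lemma nc_le z : nc z <= `|Re z| + `|Im z|.
Proof.
rewrite {1}[z]CE; apply: le_trans (nc_tri _ _) _; rewrite ncM nc_iC mul1r !nc_rC //.
Qed.
Lemma nc_nat n : nc n%:R = n%:R.
Proof. by rewrite -rC_nat nc_rC ger0_norm ?ler0n. Qed.
Lemma nc_sum (I : Type) (r : seq I) (P : pred I) (F : I -> C) :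
  nc (\sum_(i <- r | P i) F i) <= \sum_(i <- r | P i) nc (F i).
Proof.
elim/big_rec2: _ => [|i x y _ h]; first by rewrite nc0.
by apply: le_trans (nc_tri _ _) _; rewrite lerD2l.
Qed.

Lemma ltC (e : R) (z : C) : (`|z| < rC e) = (nc z < e).
Proof. by rewrite ncE /Order.lt /= eqxx. Qed.
Lemma posC (e : C) : 0 < e -> 0 < Re e /\ e = rC (Re e).
Proof. by case: e => a b; rewrite /Order.lt /= => /andP[/eqP -> a0]. Qed.
Lemma rC_pos (e : R) : 0 < e -> 0 < rC e.
Proof. by rewrite /Order.lt /= eqxx. Qed.

Local Open Scope classical_set_scope.

(** Differentiability with real tolerances, so that all estimates are made in the ordered field of
    reals. *)
Definition cdiff (f : fn) (z l : C) := forall e : R, 0 < e ->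
  exists2 d : R, 0 < d & forall h : C, nc h < d -> nc (f (z + h) - f z - h * l) <= e * nc h.

Lemma cdiffP (f : fn) (z l : C) : is_derive z 1 f l <-> cdiff f z l.
Proof.
split=> [[df dl] e e0|H].
  have cv : (fun h : C => h^-1 *: (f (h *: 1 + z) - f z) : C) @ (0 : C)^' --> (l : C).
    by rewrite -dl; exact: df.
  have /cvgrPdist_lt/(_ (rC e) (rC_pos e0)) := cv.
  move=> -[/= d d0 hd]; have [d1 dE] := posC d0.
  exists (Re d) => // h hh; have [->|h0] := eqVneq h 0.
    by rewrite addr0 subrr mul0r subrr nc0 mulr0.
  have := hd h; rewrite /ball /= sub0r normrN dE ltC => /(_ hh h0); rewrite ltC => /ltW.
  have -> : f (z + h) - f z - h * l = - (h * (l - h^-1 *: (f (h *: 1 + z) - f z))).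
    by rewrite /GRing.scale /= mulr1 [h + z]addrC; field.
  by rewrite ncN ncM mulrC => hh2; apply: ler_wpM2r; rewrite ?nc_ge0.
have cv : (fun h : C => h^-1 *: (f (h *: 1 + z) - f z) : C) @ (0 : C)^' --> (l : C).
  apply/cvgrPdist_lt => e /posC[e0 eE]; have e2 : 0 < Re e / 2 by lra.
  have [d d0 hd] := H _ e2; exists (rC d); first exact: rC_pos.
  move=> h; rewrite /ball /= sub0r normrN ltC => /hd hh h0; rewrite eE ltC.
  have -> : l - h^-1 *: (f (h *: 1 + z) - f z) = - (h^-1 * (f (z + h) - f z - h * l)).
    by rewrite /GRing.scale /= mulr1 [h + z]addrC; field.
  rewrite ncN ncM ncV; have h1 : 0 < nc h by rewrite nc_gt0.
  by rewrite mulrC ltr_pdivrMr //; apply: le_lt_trans hh _; nra.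
by split; [apply/cvg_ex; exists l|apply: cvg_lim].
Qed.

Lemma derE (f : fn) (z l : C) : is_derive z 1 f l -> der f z = l.
Proof. by move=> [_ <-]; rewrite /der derive1E. Qed.

Lemma der_is (f : fn) (z : C) : derivable f z 1 -> is_derive z 1 f (der f z).
Proof. move=> h; apply: DeriveDef; [exact: h|by rewrite /der derive1E]. Qed.

Definition ccts (f : fn) (z : C) := forall e : R, 0 < e ->
  exists2 d : R, 0 < d & forall w : C, nc (w - z) < d -> nc (f w - f z) < e.

Lemma cdiff_ccts f z l : cdiff f z l -> ccts f z.
Proof.
move=> H e e0; have [d d0 hd] := H 1 ltr01.
have l0 := nc_ge0 l; set m := nc l + 2; have m0 : 0 < m by rewrite /m; lra.
exists (Num.min d (e / m)) => [|w]; first by rewrite lt_min d0 divr_gt0.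
rewrite lt_min => /andP[/hd]; rewrite [z + _]addrC subrK => h1; rewrite ltr_pdivlMr // => h2.
have h3 : nc (f w - f z) <= nc (f w - f z - (w - z) * l) + nc ((w - z) * l).
  by apply: le_trans (nc_tri _ _); rewrite subrK.
rewrite ncM in h3; have := nc_ge0 (w - z); rewrite /m in h2; nra.
Qed.

Lemma inH_nbhs z : inH z -> forall h, nc h < Im z -> inH (z + h).
Proof.
rewrite /inH => z0 h hh; rewrite ImD; have := nc_Im h; have := ler_norm (- Im h); rewrite normrN; lra.
Qed.

Lemma cdiff_ext (f g : fn) z l : inH z -> (forall w, inH w -> f w = g w) -> cdiff f z l -> cdiff g z l.
Proof.
move=> z0 fg H e e0; have [d d0 hd] := H e e0; exists (Num.min d (Im z)) => [|h].
  by rewrite lt_min d0.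
by rewrite lt_min => /andP[/hd h1 /(inH_nbhs z0) h2]; rewrite -!fg.
Qed.

(** * Integrals along segments and around rectangles *)

Definition cct (h : R -> C) (a b : R) := forall x, a <= x <= b -> forall e : R, 0 < e ->
  exists2 d : R, 0 < d & forall y, `|y - x| < d -> nc (h y - h x) < e.
Definition cint (h : R -> C) (a b : R) : C :=
  complex.Complex (Goursat.rint (fun x => Re (h x)) a b) (Goursat.rint (fun x => Im (h x)) a b).

Lemma rabsE (x : R) : Rbasic_fun.Rabs x = `|x|. Proof. by rewrite RabsE. Qed.

Definition rct (h : R -> R) (a b : R) := forall x, a <= x <= b -> forall e : R, 0 < e ->
  exists2 d : R, 0 < d & forall y, `|y - x| < d -> `|h y - h x| < e.

Lemma rctP h a b : rct h a b -> Goursat.cts h a b.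
Proof.
move=> H x [/RleP ax /RleP xb] e /RltP e0; have [|d d0 hd] := H x _ e e0; first by rewrite ax xb.
by exists d; split=> [|y]; [exact/RltP|rewrite !rabsE => /RltP/hd hh; apply/RltP].
Qed.

Lemma cct_rct h a b : cct h a b -> rct (fun x => Re (h x)) a b /\ rct (fun x => Im (h x)) a b.
Proof.
move=> H; split=> x xx e e0; have [d d0 hd] := H x xx e e0; exists d => // y /hd hh;
  apply: le_lt_trans hh.
  by have := nc_Re (h y - h x); rewrite ReD ReN.
by have := nc_Im (h y - h x); rewrite ImD ImN.
Qed.

Lemma rctZ h a b (u : R) : rct h a b -> rct (fun x => u * h x) a b.
Proof.
move=> H x xx e e0; have u0 := normr_ge0 u; have u1 : 0 < `|u| + 1 by lra.
have [|d d0 hd] := H x xx (e / (`|u| + 1)); first by rewrite divr_gt0.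
exists d => // y /hd; rewrite -mulrBr normrM ltr_pdivlMr // => h1.
by apply: le_lt_trans h1; rewrite mulrC ler_wpM2l //; lra.
Qed.

Lemma rint_lin h k (a b u v : R) : a <= b -> rct h a b -> rct k a b ->
  Goursat.rint (fun x => u * h x + v * k x) a b = u * Goursat.rint h a b + v * Goursat.rint k a b.
Proof.
move=> /RleP ab H K.
rewrite -[u * _](Goursat.rint_scal _ _ _ _ ab (rctP H)) -[v * _](Goursat.rint_scal _ _ _ _ ab (rctP K)).
exact: (Goursat.rint_plus _ _ _ _ ab (rctP (rctZ u H)) (rctP (rctZ v K))).
Qed.

Lemma rint_ext h k (a b : R) : a <= b -> (forall x, a <= x <= b -> h x = k x) ->
  Goursat.rint h a b = Goursat.rint k a b.
Proof.
move=> /RleP ab H; apply: Goursat.rint_ext => // x [/RleP ax /RleP xb]; by rewrite H // ax xb.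
Qed.

Lemma rint_bound h (a b M : R) : a <= b -> rct h a b -> (forall x, a <= x <= b -> `|h x| <= M) ->
  `|Goursat.rint h a b| <= M * (b - a).
Proof.
move=> /RleP ab H hM; rewrite -rabsE; apply/RleP; apply: Goursat.rint_bound => //; first exact: rctP.
by move=> x [/RleP ax /RleP xb]; rewrite rabsE; apply/RleP; apply: hM; rewrite ax xb.
Qed.

Lemma cint_ext h k (a b : R) : a <= b -> (forall x, a <= x <= b -> h x = k x) -> cint h a b = cint k a b.
Proof. by move=> ab H; congr complex.Complex; apply: rint_ext => // x /H ->. Qed.

Lemma cintD h k (a b : R) : a <= b -> cct h a b -> cct k a b ->
  cint (fun x => h x + k x) a b = cint h a b + cint k a b.
Proof.
move=> ab /cct_rct[h1 h2] /cct_rct[k1 k2]; apply: C_eq; rewrite (ReD, ImD) /=.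
  have := rint_lin 1 1 ab h1 k1; rewrite !mul1r => <-.
  by apply: rint_ext => // x _; rewrite !mul1r ReD.
have := rint_lin 1 1 ab h2 k2; rewrite !mul1r => <-.
by apply: rint_ext => // x _; rewrite !mul1r ImD.
Qed.

Lemma cintZ h (c : C) (a b : R) : a <= b -> cct h a b -> cint (fun x => c * h x) a b = c * cint h a b.
Proof.
move=> ab /cct_rct[h1 h2]; apply: C_eq; rewrite (ReM, ImM) /=.
  by rewrite -mulNr -rint_lin //; apply: rint_ext => // x _; rewrite ReM mulNr.
by rewrite -rint_lin //; apply: rint_ext => // x _; rewrite ImM addrC; congr (_ + _); rewrite mulrC.
Qed.

Lemma cint_chasles h (a m b : R) : a <= m <= b -> cct h a b -> cint h a b = cint h a m + cint h m b.
Proof.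
move=> /andP[/RleP am /RleP mb] /cct_rct[h1 h2].
by apply: C_eq; rewrite (ReD, ImD) /=; apply: Goursat.rint_chasles => //; apply: rctP.
Qed.

(** The factor 2 comes from bounding real and imaginary part separately. *)
Lemma cint_bound h (a b M : R) : a <= b -> cct h a b -> (forall x, a <= x <= b -> nc (h x) <= M) ->
  nc (cint h a b) <= 2 * M * (b - a).
Proof.
move=> ab /cct_rct[h1 h2] hM; apply: le_trans (nc_le _) _ => /=.
have q1 : `|Goursat.rint (fun x => Re (h x)) a b| <= M * (b - a).
  by apply: rint_bound => // x xx; apply: le_trans (nc_Re _) _; apply: hM.
have q2 : `|Goursat.rint (fun x => Im (h x)) a b| <= M * (b - a).
  by apply: rint_bound => // x xx; apply: le_trans (nc_Im _) _; apply: hM.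
lra.
Qed.

Lemma cint_const (c : C) (a b : R) : cint (fun=> c) a b = c * rC (b - a).
Proof.
have r (u : R) : Goursat.rint (fun=> u) a b = u * (b - a) by exact: Goursat.rint_const.
by apply: C_eq; rewrite (ReM, ImM) /= r; ring.
Qed.

Lemma cint_Im_pos h (a b : R) : a < b -> cct h a b -> (forall x, a <= x <= b -> 0 < Im (h x)) -> 0 < Im (cint h a b).
Proof.
move=> /RltP ab /cct_rct[_ h2] H; apply/RltP; apply: Goursat.rint_pos; [by []|exact: rctP|] => x [/RleP ax /RleP xb].
by apply/RltP; apply: H; rewrite ax xb.
Qed.

Lemma cint_Im_gt h (a b k : R) : a < b -> cct h a b -> (forall x, a <= x <= b -> k < Im (h x)) -> k * (b - a) < Im (cint h a b).
Proof.
move=> ab hc hk; have cc : cct (fun=> - (iC * rC k)) a b by move=> x _ e e0; exists 1 => // y _; rewrite subrr nc0.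
have : 0 < Im (cint (fun x => h x + - (iC * rC k)) a b).
  apply: cint_Im_pos => // [x xx e e0|x xx]; last first.
    by rewrite ImD ImN ImM /= mul0r mul1r add0r subr_gt0 hk.
  by have [d d0 hd] := hc x xx e e0; exists d => // y /hd; rewrite opprD addrACA subrr addr0.
rewrite cintD ?ltW // cint_const ImD (_ : - (iC * rC k) * rC (b - a) = iC * rC (- (k * (b - a)))); last first.
  by rewrite rCN rCM; ring.
by rewrite ImM /= mul0r mul1r add0r; lra.
Qed.

Definition pt (x y : R) : C := complex.Complex x y.
Lemma ptE x y : pt x y = rC x + iC * rC y. Proof. by rewrite [LHS]CE. Qed.
Definition inR (a b c d : R) (w : C) := (a <= Re w <= b) && (c <= Im w <= d).
Definition bdR (a b c d : R) (w : C) :=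
  inR a b c d w && [|| Re w == a, Re w == b, Im w == c | Im w == d].
Lemma bd_in a b c d w : bdR a b c d w -> inR a b c d w. Proof. by case/andP. Qed.
(** The boundary is run through counterclockwise, with dw = dx on the horizontal and dw = i dy on
    the vertical sides. *)
Definition oint (f : fn) (a b c d : R) : C :=
  cint (fun x => f (pt x c)) a b - cint (fun x => f (pt x d)) a b
  + iC * (cint (fun y => f (pt b y)) c d - cint (fun y => f (pt a y)) c d).

Lemma oint_eq (f g : fn) a b c d : (forall w, f w = g w) -> oint f a b c d = oint g a b c d.
Proof. by move=> /funext ->. Qed.

Lemma nc_ptx x x' y : nc (pt x y - pt x' y) = `|x - x'|.
Proof.
by rewrite -nc_rC; congr nc; apply: C_eq; rewrite !(ReD, ImD, ReN, ImN) /= ?subrr.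
Qed.
Lemma nc_pty x y y' : nc (pt x y - pt x y') = `|y - y'|.
Proof.
rewrite -nc_rC -[RHS]mul1r -nc_iC -ncM; congr nc.
by apply: C_eq; rewrite !(ReD, ImD, ReN, ImN, ReM, ImM) /=; ring.
Qed.

Section Rect.
Variables (f : fn) (a b c d : R).
Hypotheses (ab : a <= b) (cd : c <= d) (fc : forall w, bdR a b c d w -> ccts f w).

Lemma cct_h y : (y == c) || (y == d) -> cct (fun x => f (pt x y)) a b.
Proof.
move=> yy x xx e e0; have [|dl d0 hd] := @fc (pt x y) _ e e0; last by exists dl => // x' xx'; apply: hd; rewrite nc_ptx.
rewrite /bdR /inR /= xx; case/orP: yy => /eqP ->; rewrite ?lexx ?cd ?eqxx ?orbT //=.
Qed.

Lemma cct_v x : (x == a) || (x == b) -> cct (fun y => f (pt x y)) c d.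
Proof.
move=> yy y xx e e0; have [|dl d0 hd] := @fc (pt x y) _ e e0; last by exists dl => // x' xx'; apply: hd; rewrite nc_pty.
rewrite /bdR /inR /= xx; case/orP: yy => /eqP ->; rewrite ?lexx ?ab ?eqxx ?orbT //=.
Qed.

Lemma oint_split m n : a <= m <= b -> c <= n <= d ->
  oint f a b c d = oint f a m c n + oint f m b c n + oint f a m n d + oint f m b n d.
Proof.
move=> /andP[am mb] /andP[cn nd]; rewrite /oint.
have mab : a <= m <= b by rewrite am mb.
have ncd : c <= n <= d by rewrite cn nd.
rewrite (@cint_chasles (fun x => f (pt x c)) a m b) ?(@cint_chasles (fun x => f (pt x d)) a m b) //;
  try by apply: cct_h; rewrite eqxx ?orbT.
rewrite (@cint_chasles (fun x => f (pt a x)) c n d) ?(@cint_chasles (fun x => f (pt b x)) c n d) //;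
  try by apply: cct_v; rewrite eqxx ?orbT.
ring.
Qed.

Lemma oint_bound M : (forall w, bdR a b c d w -> nc (f w) <= M) ->
  nc (oint f a b c d) <= 4 * M * ((b - a) + (d - c)).
Proof.
move=> hM; rewrite /oint.
have t1 : nc (cint (fun x => f (pt x c)) a b) <= 2 * M * (b - a).
  by apply: cint_bound => // [|x xx]; [apply: cct_h; rewrite eqxx ?orbT|apply: hM; rewrite /bdR /inR /= xx lexx cd eqxx ?orbT].
have t2 : nc (cint (fun x => f (pt x d)) a b) <= 2 * M * (b - a).
  by apply: cint_bound => // [|x xx]; [apply: cct_h; rewrite eqxx ?orbT|apply: hM; rewrite /bdR /inR /= xx lexx cd eqxx ?orbT].
have t3 : nc (cint (fun y => f (pt b y)) c d) <= 2 * M * (d - c).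
  by apply: cint_bound => // [|x xx]; [apply: cct_v; rewrite eqxx ?orbT|apply: hM; rewrite /bdR /inR /= xx lexx ab eqxx ?orbT].
have t4 : nc (cint (fun y => f (pt a y)) c d) <= 2 * M * (d - c).
  by apply: cint_bound => // [|x xx]; [apply: cct_v; rewrite eqxx ?orbT|apply: hM; rewrite /bdR /inR /= xx lexx ab eqxx ?orbT].
apply: le_trans (nc_tri _ _) _; rewrite ncM nc_iC mul1r.
set u1 := cint _ _ _ in t1 *; set u2 := cint _ _ _ in t2 *; set u3 := cint _ _ _ in t3 *; set u4 := cint _ _ _ in t4 *.
have := nc_triB u1 u2; have := nc_triB u3 u4; lra.
Qed.

(** The sign conditions give each side a positive share of the imaginary part, so that the bottom
    side is a lower bound. They hold for 1/(w - z). *)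
Lemma oint_gt : a < b -> c < d ->
  (forall x, a <= x <= b -> 0 < Im (f (pt x c)) /\ Im (f (pt x d)) < 0) ->
  (forall y, c <= y <= d -> 0 < Re (f (pt b y)) /\ Re (f (pt a y)) < 0) -> Im (cint (fun x => f (pt x c)) a b) < Im (oint f a b c d).
Proof.
move=> ab' cd' H V; rewrite /oint.
have h1 : cct (fun x => f (pt x c)) a b by apply: cct_h; rewrite eqxx ?orbT.
have h2 : cct (fun x => f (pt x d)) a b by apply: cct_h; rewrite eqxx ?orbT.
have v1 : cct (fun y => f (pt b y)) c d by apply: cct_v; rewrite eqxx ?orbT.
have v2 : cct (fun y => f (pt a y)) c d by apply: cct_v; rewrite eqxx ?orbT.
have cz h (u : C) x y : cct h x y -> nc u = 1 -> cct (fun t => u * h t) x y.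
  by move=> hc u1 t tt e e0; have [dl d0 hd] := hc t tt e e0; exists dl => // z /hd; rewrite -mulrBr ncM u1 mul1r.
have n1 : nc (-1) = 1 by rewrite ncN nc1.
have ni : nc (- iC) = 1 by rewrite ncN nc_iC.
have -> (p q r s : C) : p - q + iC * (r - s) = p + (-1) * q + (iC * r + (- iC) * s) by ring.
rewrite -!cintZ // !ImD -addrA ltrDl; apply: addr_gt0; last apply: addr_gt0;
  apply: cint_Im_pos => //; try by apply: cz; rewrite ?nc_iC.
- by move=> x /H[_]; rewrite mulN1r ImN oppr_gt0.
- by move=> y /V[h _]; rewrite ImM /= mul0r mul1r add0r.
- by move=> y /V[_ h]; rewrite ImM ReN ImN /= oppr0 mul0r add0r mulN1r oppr_gt0.
Qed.
End Rect.

Lemma oint_ext (f g : fn) (a b c d : R) : a <= b -> c <= d ->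
  (forall x, a <= x <= b -> f (pt x c) = g (pt x c) /\ f (pt x d) = g (pt x d)) ->
  (forall y, c <= y <= d -> f (pt a y) = g (pt a y) /\ f (pt b y) = g (pt b y)) ->
  oint f a b c d = oint g a b c d.
Proof.
move=> ab cd H V; rewrite /oint; congr (_ - _ + _ * (_ - _)); apply: cint_ext => // x xx;
  by [case: (H x xx)|case: (V x xx)].
Qed.

Lemma ointD (f g : fn) (a b c d : R) : a <= b -> c <= d ->
  (forall w, bdR a b c d w -> ccts f w) -> (forall w, bdR a b c d w -> ccts g w) ->
  oint (fun w => f w + g w) a b c d = oint f a b c d + oint g a b c d.
Proof.
move=> ab cd F G; rewrite /oint.
have ef y := cct_h cd F (y := y).
have eg y := cct_h cd G (y := y).
have vf y := cct_v ab F (x := y).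
have vg y := cct_v ab G (x := y).
have hD y (yy : (y == c) || (y == d)) := cintD ab (ef y yy) (eg y yy).
have vD y (yy : (y == a) || (y == b)) := cintD cd (vf y yy) (vg y yy).
by rewrite !hD ?vD ?eqxx ?orbT //; ring.
Qed.

Lemma ointZ (f : fn) (u : C) (a b c d : R) : a <= b -> c <= d ->
  (forall w, bdR a b c d w -> ccts f w) -> oint (fun w => u * f w) a b c d = u * oint f a b c d.
Proof.
move=> ab cd F; rewrite /oint.
have ef y := cct_h cd F (y := y).
have vf y := cct_v ab F (x := y).
have hD y (yy : (y == c) || (y == d)) := cintZ u ab (ef y yy).
have vD y (yy : (y == a) || (y == b)) := cintZ u cd (vf y yy).
by rewrite !hD ?vD ?eqxx ?orbT //; ring.
Qed.

Lemma ccts_id (z : C) : ccts id z. Proof. by move=> e e0; exists e. Qed.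
Lemma ccts_cst (u z : C) : ccts (fun=> u) z.
Proof. by move=> e e0; exists 1; rewrite ?ltr01 // => w _; rewrite subrr nc0. Qed.

Lemma oint_affine (u v : C) (a b c d : R) : a <= b -> c <= d -> oint (fun w => u + v * w) a b c d = 0.
Proof.
move=> ab cd; have k1 w : bdR a b c d w -> ccts id w by move=> _; apply: ccts_id.
have k2 (s : C) w : bdR a b c d w -> ccts (fun=> s) w by move=> _; apply: ccts_cst.
have vw (w : C) : bdR a b c d w -> ccts (fun w => v * w) w.
  move=> _ e e0; exists (e / (nc v + 1)) => [|t]; have v0 := nc_ge0 v; first by rewrite divr_gt0 //; lra.
  by rewrite ltr_pdivlMr => [h|]; rewrite -?mulrBr ?ncM; have := nc_ge0 (t - w); nra.
rewrite (ointD ab cd (k2 u) vw) (ointZ v ab cd k1) /oint /=.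
rewrite !cint_const.
have sp x : cint (fun t => pt t x) a b = cint rC a b + cint (fun=> iC * rC x) a b.
  rewrite -cintD //; first by apply: cint_ext => // t _; rewrite ptE.
  - by move=> t _ e e0; exists e => // s; rewrite -rCB nc_rC.
  - by move=> t _ e e0; exists e => // s; rewrite subrr nc0.
have sq x : cint (fun t => pt x t) c d = cint (fun=> rC x) c d + iC * cint rC c d.
  have rr : cct rC c d by move=> t _ e e0; exists e => // s; rewrite -rCB nc_rC.
  rewrite -(cintZ iC cd rr) -cintD //; first by apply: cint_ext => // t _; rewrite ptE.
  - by move=> t _ e e0; exists e => // s; rewrite subrr nc0.
  - by move=> t _ e e0; exists e => // s; rewrite -mulrBr ncM nc_iC mul1r -rCB nc_rC.
rewrite (sp c) (sp d) (sq a) (sq b) !cint_const !rCB; ring.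
Qed.

(** * Goursat's lemma with an exceptional point *)

Definition qmu (a b x : R) : R := ((a <= x < b)%R : nat)%:R + ((a < x <= b)%R : nat)%:R.

(** An interior point lies in both half-open intervals and an end point in one of them, so a cut
    through the point splits 2 into 1 + 1. *)
Lemma qmu_split (a m b x : R) : a <= m <= b -> qmu a b x = qmu a m x + qmu m b x.
Proof.
move=> /andP[am mb]; rewrite /qmu.
have e1 : ((a <= x < b)%R : nat)%:R = ((a <= x < m)%R : nat)%:R + ((m <= x < b)%R : nat)%:R :> R.
  by case: (leP a x); case: (ltP x b); case: (ltP x m); case: (leP m x) => //=; rewrite ?addr0 ?add0r //; lra.
have e2 : ((a < x <= b)%R : nat)%:R = ((a < x <= m)%R : nat)%:R + ((m < x <= b)%R : nat)%:R :> R.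
  by case: (ltP a x); case: (leP x b); case: (leP x m); case: (ltP m x) => //=; rewrite ?addr0 ?add0r //; lra.
rewrite e1 e2; ring.
Qed.

Lemma qmu_ge0 a b x : 0 <= qmu a b x. Proof. by rewrite addr_ge0 ?ler0n. Qed.
Lemma qmu_le2 a b x : qmu a b x <= 2.
Proof. by rewrite /qmu; do 2!case: (_ && _); rewrite /=; lra. Qed.
Lemma qmu_ge1 a b x : a < b -> a <= x <= b -> 1 <= qmu a b x.
Proof.
move=> ab /andP[ax xb]; rewrite /qmu ax xb /= andbT; case: (ltP x b) => [|bx] /=; first by case: (a < x) => /=; lra.
have -> : (a < x) by lra.
by rewrite /=; lra.
Qed.

Lemma inRW a b c d a' b' c' d' w : a <= a' -> b' <= b -> c <= c' -> d' <= d ->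
  inR a' b' c' d' w -> inR a b c d w.
Proof. by rewrite /inR => ? ? ? ? /andP[/andP[? ?] /andP[? ?]]; apply/andP; split; apply/andP; split; lra. Qed.

Lemma inR_dist a b c d (w p : C) : inR a b c d w -> inR a b c d p -> nc (w - p) <= (b - a) + (d - c).
Proof.
move=> /andP[/andP[? ?] /andP[? ?]] /andP[/andP[? ?] /andP[? ?]]; apply: le_trans (nc_le _) _.
by rewrite !(ReD, ImD, ReN, ImN); apply: lerD; rewrite ler_norml; apply/andP; split; lra.
Qed.

Lemma ccts_lin (f g : fn) (u : C) (z : C) : ccts f z -> ccts g z -> ccts (fun w => f w + u * g w) z.
Proof.
move=> F G e e0; have u0 := nc_ge0 u; have e2 : 0 < e / 2 by lra.
have [d1 d10 h1] := F _ e2; have [|d2 d20 h2] := G (e / 2 / (nc u + 1)); first by rewrite divr_gt0 //; lra.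
exists (Num.min d1 d2) => [|w]; first by rewrite lt_min d10.
rewrite lt_min => /andP[/h1 q1 /h2]; rewrite ltr_pdivlMr => [q2|]; last by lra.
have -> : f w + u * g w - (f z + u * g z) = (f w - f z) + u * (g w - g z) by ring.
apply: le_lt_trans (nc_tri _ _) _; rewrite ncM; have := nc_ge0 (g w - g z); nra.
Qed.

Lemma quad_sum (e u v x1 x2 y1 y2 n1 n2 n3 n4 t : R) :
  n1 <= e * ((u + v) ^+ 2 + x1 * y1) -> n2 <= e * ((u + v) ^+ 2 + x2 * y1) ->
  n3 <= e * ((u + v) ^+ 2 + x1 * y2) -> n4 <= e * ((u + v) ^+ 2 + x2 * y2) -> t <= n1 + n2 + n3 + n4 ->
  t <= e * ((2 * u + 2 * v) ^+ 2 + (x1 + x2) * (y1 + y2)).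
Proof. by move=> h1 h2 h3 h4 h; have := lerD (lerD h1 h2) (lerD h3 h4); lra. Qed.

(* [qmu * qmu] counts the quadrants at [z] met by a rectangle, which is additive under subdivision. *)
Lemma goursat (f : fn) (z : C) (a b c d : R) : a < b -> c < d ->
  (forall w, inR a b c d w -> ccts f w) ->
  (forall w, inR a b c d w -> w != z -> exists l, cdiff f w l) -> oint f a b c d = 0.
Proof.
move=> ab cd fc fd.
suff H (e : R) : 0 < e -> nc (oint f a b c d) <= e * ((b - a + (d - c)) ^+ 2 + 4).
  apply: nc_eq0; apply/eqP; rewrite eq_le nc_ge0 andbT leNgt; apply/negP => n0.
  have k0 : 0 < (b - a + (d - c)) ^+ 2 + 4 by rewrite ltr_wpDl ?sqr_ge0 //; lra.
  have := H (nc (oint f a b c d) / ((b - a + (d - c)) ^+ 2 + 4) / 2).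
  rewrite mulrAC divfK ?gt_eqF // => /(_ _)/wrap[]; last lra.
  by rewrite !divr_gt0.
move=> e0.
(* A bound that is superadditive under quartering: the square of width plus height gains a factor 4,
   and the quadrant count adds up exactly. The second term is what an exceptional point is allowed
   to cost. *)
pose P a' b' c' d' := a <= a' -> a' < b' -> b' <= b -> c <= c' -> c' < d' -> d' <= d ->
  nc (oint f a' b' c' d') <= e * ((b' - a' + (d' - c')) ^+ 2 + qmu a' b' (Re z) * qmu c' d' (Im z)).
suff : P a b c d.
  move=> /(_ (lexx _) ab (lexx _) (lexx _) cd (lexx _)) h; apply: le_trans h _.
  rewrite ler_pM2l // lerD2l; have := qmu_le2 a b (Re z); have := qmu_le2 c d (Im z).
  have := qmu_ge0 a b (Re z); have := qmu_ge0 c d (Im z); nra.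
apply: (@Goursat.bisection P); [|exact/RleP/ltW|exact/RleP/ltW|].
  move=> a1 b1 c1 d1 m n [/RleP am /RleP mb] [/RleP cn /RleP nd] e1 e2.
  have {}e1 : m - a1 = b1 - m by []. have {}e2 : n - c1 = d1 - n by [].
  move=> p1 p2 p3 p4 q1 q2 q3 q4 q5 q6.
  rewrite (@oint_split _ _ _ _ _ _ _ _ m n) ?am ?cn //; try exact: ltW; last first.
    by move=> w ww; apply: fc; apply: inRW (bd_in ww).
  have am' : a1 < m by clear -e1 q2; lra.
  have mb' : m < b1 by clear -e1 q2; lra.
  have cn' : c1 < n by clear -e2 q5; lra.
  have nd' : n < d1 by clear -e2 q5; lra.
  have m1 : m <= b by apply: le_trans q3.
  have m2 : a <= m by apply: le_trans am.
  have n1 : n <= d by apply: le_trans q6.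
  have n2 : c <= n by apply: le_trans cn.
  have r1 := p1 q1 am' m1 q4 cn' n1; have r2 := p2 m2 mb' q3 q4 cn' n1.
  have r3 := p3 q1 am' m1 n2 nd' q6; have r4 := p4 m2 mb' q3 n2 nd' q6.
  have A1 : b1 - a1 = 2 * (m - a1) by clear -e1; lra.
  have A2 : d1 - c1 = 2 * (n - c1) by clear -e2; lra.
  rewrite (@qmu_split a1 m b1) ?am // (@qmu_split c1 n d1) ?cn //.
  rewrite A1 A2; rewrite -?e1 -?e2 in r1 r2 r3 r4.
  apply: le_trans (nc_tri _ _) _.
  have t1 := nc_tri (oint f a1 m c1 n + oint f m b1 c1 n) (oint f a1 m n d1).
  have t2 := nc_tri (oint f a1 m c1 n) (oint f m b1 c1 n).
  refine (quad_sum r1 r2 r3 r4 _); clear -t1 t2; lra.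
move=> x y [/RleP ax /RleP xb] [/RleP cy /RleP yd].
have pR : inR a b c d (pt x y) by rewrite /inR /= ax xb cy yd.
(* At z there is only continuity: the integral is bounded by a multiple of the side lengths, which
   is at most e for small rectangles, and the quadrant count is at least 1. *)
have [pz|pz] := eqVneq (pt x y) z.
  have [dl d0 hd] := fc _ pR 1 ltr01; set M := nc (f (pt x y)) + 1.
  have M0 : 0 < M by rewrite /M; have := nc_ge0 (f (pt x y)); lra.
  exists (Num.min (dl / 2) (e / (8 * M))); split.
    by apply/RltP; rewrite lt_min !divr_gt0 // mulr_gt0 // ltr0n.
  move=> a1 b1 c1 d1 /RleP aa [/RleP a1x /RleP xb1] /RleP bb /RleP cc [/RleP c1y /RleP yd1] /RleP dd /RltP l1 /RltP l2.
  move=> _ ab1 _ _ cd1 _.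
  have pR' : inR a1 b1 c1 d1 (pt x y) by rewrite /inR /= a1x xb1 c1y yd1.
  have {}l1 : b1 - a1 < Num.min (dl / 2) (e / (8 * M)) by [].
  have {}l2 : d1 - c1 < Num.min (dl / 2) (e / (8 * M)) by [].
  move: l1 l2; rewrite !lt_min => /andP[l1 l1'] /andP[l2 l2'].
  have B : nc (oint f a1 b1 c1 d1) <= 4 * M * ((b1 - a1) + (d1 - c1)).
    apply: oint_bound; try exact: ltW; first by move=> w ww; apply: fc; apply: inRW (bd_in ww).
    move=> w /bd_in ww; have q := nc_tri (f w - f (pt x y)) (f (pt x y)); rewrite subrK in q.
    have : nc (f w - f (pt x y)) < 1 by apply: hd; have := inR_dist ww pR'; lra.
    rewrite /M; lra.
  have m1 : 1 <= qmu a1 b1 (Re z) by apply: qmu_ge1 => //; rewrite -pz /= a1x.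
  have m2 : 1 <= qmu c1 d1 (Im z) by apply: qmu_ge1 => //; rewrite -pz /= c1y.
  have mm : 1 <= qmu a1 b1 (Re z) * qmu c1 d1 (Im z) by nra.
  apply: le_trans B _.
  have B : 4 * M * ((b1 - a1) + (d1 - c1)) <= e.
    have -> : e = 4 * M * (e / (8 * M) + e / (8 * M)) by field; rewrite gt_eqF.
    by rewrite ler_pM2l ?mulr_gt0 ?ltr0n //; lra.
  apply: le_trans B _; rewrite -[X in X <= _]mulr1 ler_pM2l //.
  have := sqr_ge0 (b1 - a1 + (d1 - c1)); lra.
(* Away from z the affine part of f integrates to 0, and the remainder is at most (e/4) times width
   plus height. *)
have [l hl] := fd _ pR pz; have e4 : 0 < e / 4 by lra.
have [dl d0 hd] := hl _ e4; exists (dl / 2); split; first by apply/RltP; rewrite divr_gt0.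
move=> a1 b1 c1 d1 /RleP aa [/RleP a1x /RleP xb1] /RleP bb /RleP cc [/RleP c1y /RleP yd1] /RleP dd /RltP l1 /RltP l2.
have {}l1 : b1 - a1 < dl / 2 by [].
have {}l2 : d1 - c1 < dl / 2 by [].
move=> _ ab1 _ _ cd1 _.
have pR' : inR a1 b1 c1 d1 (pt x y) by rewrite /inR /= a1x xb1 c1y yd1.
set p := pt x y in hd pR' *.
pose r : fn := fun w => f w + (-1) * ((f p - p * l) + l * w).
have ca (w : C) : ccts (fun w => (f p - p * l) + l * w) w by apply: ccts_lin; [exact: ccts_cst|exact: ccts_id].
have cr w : bdR a1 b1 c1 d1 w -> ccts r w.
  by move=> ww; apply: ccts_lin (ca _); apply: fc; apply: inRW (bd_in ww).
have -> : oint f a1 b1 c1 d1 = oint r a1 b1 c1 d1.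
  have := ointD (ltW ab1) (ltW cd1) cr (fun w _ => ca w); rewrite oint_affine ?ltW // addr0 => <-.
  by apply: oint_eq => w; rewrite /r; ring.
set s := b1 - a1 + (d1 - c1).
have B : nc (oint r a1 b1 c1 d1) <= 4 * (e / 4 * s) * s.
  apply: oint_bound cr _ _; try exact: ltW.
  move=> w /bd_in ww; have q := inR_dist ww pR'.
  have -> : r w = f (p + (w - p)) - f p - (w - p) * l.
    by rewrite [p + _]addrC subrK /r; ring.
  apply: le_trans (hd _ _) _; first by lra.
  by rewrite ler_pM2l.
apply: le_trans B _.
have := mulr_ge0 (qmu_ge0 a1 b1 (Re z)) (qmu_ge0 c1 d1 (Im z)); move: (qmu _ _ _ * _) => M M0.
have -> : 4 * (e / 4 * s) * s = e * s ^+ 2 by field.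
by rewrite ler_pM2l // lerDl.
Qed.

Lemma cctsP (f : C -> C) (z : C) : ccts f z <-> f @ (nbhs (z : C)) --> (f z : C).
Proof.
split=> [H|/(@cvgrPdist_lt _ (R[i]^o) _ (nbhs z)) H e e0].
  apply/(@cvgrPdist_lt _ (R[i]^o) _ (nbhs z)) => e /posC[e0 eE]; have [d d0 hd] := H _ e0.
  exists (rC d); first exact: rC_pos.
  by move=> w /=; rewrite /ball_ /= distrC ltC => /hd hh; rewrite distrC eE ltC.
have [d /posC[d0 dE] hd] := H _ (rC_pos e0); exists (Re d) => // w hw.
by have := hd w; rewrite /= /ball_ /= distrC dE ltC => /(_ hw); rewrite distrC ltC.
Qed.

Lemma cctsM (f g : C -> C) (z : C) : ccts f z -> ccts g z -> ccts (fun w => f w * g w) z.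
Proof. by move=> /cctsP F /cctsP G; apply/cctsP; exact: (cvgM F G). Qed.

Lemma ccts_inv (f : C -> C) (z : C) : f z != 0 -> ccts f z -> ccts (fun w => (f w)^-1) z.
Proof. by move=> f0 /cctsP F; apply/cctsP; exact: (cvgV f0 F). Qed.

Lemma ccts_comp (f g : C -> C) (z : C) : ccts g z -> ccts f (g z) -> ccts (fun w => f (g w)) z.
Proof.
move=> G F e e0; have [d1 d10 h1] := F e e0; have [d2 d20 h2] := G d1 d10.
by exists d2 => // w /h2/h1.
Qed.

Lemma cctsD (f g : C -> C) (z : C) : ccts f z -> ccts g z -> ccts (fun w => f w + g w) z.
Proof.
by move=> F G; have := ccts_lin 1 F G; congr ccts; apply: funext => w; rewrite mul1r.
Qed.

Lemma cdiff_loc (f g : fn) (z l : C) (r : R) : 0 < r -> (forall w, nc (w - z) < r -> f w = g w) ->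
  cdiff f z l -> cdiff g z l.
Proof.
move=> r0 fg F e e0; have [d d0 hd] := F e e0; exists (Num.min d r) => [|h]; first by rewrite lt_min d0.
by rewrite lt_min => /andP[/hd h1 h2]; rewrite -!fg // ?subrr ?nc0 // addrAC subrr add0r.
Qed.

(* Caratheodory's form of the derivative. *)
Lemma cdiffC (f : C -> C) (z l : C) : cdiff f z l <->
  exists phi : C -> C, [/\ ccts phi z, phi z = l & forall w, f w = f z + (w - z) * phi w].
Proof.
split=> [H|[phi [pc pz fE]]].
  exists (fun w => if w == z then l else (f w - f z) / (w - z)); split.
  - move=> e e0; have e2 : 0 < e / 2 by lra.
    have [d d0 hd] := H _ e2; exists d => // w hw; rewrite eqxx; case: eqP => [_|/eqP wz].
      by rewrite subrr nc0.
    have wz0 : w - z != 0 by rewrite subr_eq0.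
    have := hd _ hw; rewrite [z + _]addrC subrK.
    have -> : f w - f z - (w - z) * l = ((f w - f z) / (w - z) - l) * (w - z) by field.
    by rewrite ncM ler_pM2r ?nc_gt0 //; lra.
  - by rewrite eqxx.
  - move=> w; case: eqP => [->|/eqP wz]; first by rewrite subrr mul0r addr0.
    have wz0 : w - z != 0 by rewrite subr_eq0.
    by field.
move=> e e0; have [d d0 hd] := pc e e0; exists d => // h hh.
have -> : f (z + h) - f z - h * l = (phi (z + h) - phi z) * h.
  by rewrite (fE (z + h)) pz; ring.
rewrite ncM ler_wpM2r ?nc_ge0 // ltW //; apply: hd; by rewrite addrAC subrr add0r.
Qed.

Lemma cdiff_eq (f g : C -> C) (z l : C) : (forall w, f w = g w) -> cdiff f z l -> cdiff g z l.
Proof. by move=> /funext ->. Qed.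

Lemma cdiff_cst (k z : C) : cdiff (fun=> k) z 0.
Proof. by move=> e e0; exists 1 => // h _; rewrite subrr mulr0 subrr nc0 mulr_ge0 ?nc_ge0 ?ltW. Qed.

Lemma cdiff_id (z : C) : cdiff id z 1.
Proof.
move=> e e0; exists 1 => // h _ /=.
have -> : z + h - z - h * 1 = 0 by ring.
by rewrite nc0 mulr_ge0 ?nc_ge0 ?ltW.
Qed.

Lemma cdiffD (f g : C -> C) (z k l : C) : cdiff f z k -> cdiff g z l -> cdiff (fun w => f w + g w) z (k + l).
Proof.
move=> /cdiffC[p [pc pz fE]] /cdiffC[q [qc qz gE]]; apply/cdiffC; exists (fun w => p w + q w); split.
- exact: cctsD.
- by rewrite pz qz.
- by move=> w; rewrite (fE w) (gE w); ring.
Qed.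

Lemma cdiffM (f g : C -> C) (z k l : C) : cdiff f z k -> cdiff g z l ->
  cdiff (fun w => f w * g w) z (k * g z + f z * l).
Proof.
move=> hf hg; have := cdiff_ccts hg; move: hf hg.
move=> /cdiffC[p [pc pz fE]] /cdiffC[q [qc qz gE]] gc; apply/cdiffC; exists (fun w => p w * g w + f z * q w); split.
- by apply: cctsD; apply: cctsM => //; apply: ccts_cst.
- by rewrite pz qz.
- by move=> w; rewrite (fE w) mulrDl {1}(gE w); ring.
Qed.

Lemma cdiffZ (u : C) (f : C -> C) (z k : C) : cdiff f z k -> cdiff (fun w => u * f w) z (u * k).
Proof. by move=> hf; have := cdiffM (cdiff_cst u z) hf; rewrite mul0r add0r. Qed.

Lemma cdiffV (f : C -> C) (z k : C) : f z != 0 -> cdiff f z k -> cdiff (fun w => (f w)^-1) z (- k / f z ^+ 2).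
Proof.
move=> f0 hf; have fc := cdiff_ccts hf; have fc' := ccts_inv f0 fc.
have n0 : 0 < nc (f z) by rewrite nc_gt0.
have [r r0 hr] := fc _ n0.
have nz w : nc (w - z) < r -> f w != 0.
  by move=> /hr; rewrite ncB -nc_gt0; have := nc_sub_le (f z) (f z - f w); rewrite (_ : f z - (f z - f w) = f w); [lra|ring].
move/cdiffC: hf => [p [pc pz fE]].
pose F : C -> C := fun w => (f z)^-1 + (w - z) * (- p w / (f w * f z)).
apply: (@cdiff_loc F _ _ _ r) => // [w hw|].
  have w0 := nz w hw; have E : (w - z) * p w = f w - f z by rewrite (fE w); ring.
  by rewrite /F mulrA mulrN E; field; rewrite f0 w0.
apply/cdiffC; exists (fun w => - p w / (f w * f z)); split => //.
- apply: cctsM; last by apply: ccts_inv; [rewrite mulf_neq0|apply: cctsM => //; apply: ccts_cst].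
  by have := cctsM (ccts_cst (-1) z) pc; congr ccts; apply: funext => w; rewrite mulN1r.
- by rewrite pz expr2.
- by move=> w; rewrite /F subrr mul0r addr0.
Qed.

Lemma cdiff_comp (f g : C -> C) (z k l : C) : cdiff g z k -> cdiff f (g z) l ->
  cdiff (fun w => f (g w)) z (k * l).
Proof.
move=> hg; have := cdiff_ccts hg; move: hg.
move=> /cdiffC[p [pc pz gE]] gc /cdiffC[q [qc qz fE]]; apply/cdiffC; exists (fun w => p w * q (g w)); split.
- by apply: cctsM => //; apply: ccts_comp.
- by rewrite pz qz.
- by move=> w; rewrite (fE (g w)) {1}(gE w); ring.
Qed.

Lemma cctsX (f : fn) n (z : C) : ccts f z -> ccts (fun w => f w ^+ n) z.
Proof.
move=> F; elim: n => [|n IH]; first by have := ccts_cst 1 z.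
have := cctsM F IH; congr ccts; apply: funext => w; by rewrite exprS.
Qed.

Lemma bounded_rect (f : fn) (a b c d : R) : a <= b -> c <= d -> (forall w, inR a b c d w -> ccts f w) ->
  exists M : R, forall w, inR a b c d w -> nc (f w) <= M.
Proof.
move=> ab cd fc.
pose P a' b' c' d' := exists M : R, forall w, inR a' b' c' d' w -> inR a b c d w -> nc (f w) <= M.
suff [M hM] : P a b c d by exists M => w ww; apply: hM.
apply: (@Goursat.bisection P); [|exact/RleP|exact/RleP|].
  move=> a1 b1 c1 d1 m n _ _ _ _ [M1 h1] [M2 h2] [M3 h3] [M4 h4].
  exists (`|M1| + `|M2| + `|M3| + `|M4|) => w /andP[/andP[w1 w2] /andP[w3 w4]] ww.
  have := ler_norm M1; have := ler_norm M2; have := ler_norm M3; have := ler_norm M4.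
  have := normr_ge0 M1; have := normr_ge0 M2; have := normr_ge0 M3; have := normr_ge0 M4.
  case: (leP (Re w) m) => wm; case: (leP (Im w) n) => wn.
  - have := h1 w _ ww; rewrite /inR w1 wm w3 wn => /(_ isT); lra.
  - have := h3 w _ ww; rewrite /inR w1 wm (ltW wn) w4 => /(_ isT); lra.
  - have := h2 w _ ww; rewrite /inR w2 (ltW wm) w3 wn => /(_ isT); lra.
  - have := h4 w _ ww; rewrite /inR w2 (ltW wm) (ltW wn) w4 => /(_ isT); lra.
move=> x y [/RleP ax /RleP xb] [/RleP cy /RleP yd].
have pR : inR a b c d (pt x y) by rewrite /inR /= ax xb cy yd.
have [dl d0 hd] := fc _ pR 1 ltr01; exists (dl / 2); split; first by apply/RltP; rewrite divr_gt0.
move=> a1 b1 c1 d1 /RleP aa [/RleP a1x /RleP xb1] /RleP bb /RleP cc [/RleP c1y /RleP yd1] /RleP dd /RltP l1 /RltP l2.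
exists (nc (f (pt x y)) + 1) => w ww _.
have pR' : inR a1 b1 c1 d1 (pt x y) by rewrite /inR /= a1x xb1 c1y yd1.
have {}l1 : b1 - a1 < dl / 2 by [].
have {}l2 : d1 - c1 < dl / 2 by [].
have := nc_tri (f w - f (pt x y)) (f (pt x y)); rewrite subrK.
have : nc (f w - f (pt x y)) < 1 by apply: hd; have := inR_dist ww pR'; lra.
lra.
Qed.

(** * Cauchy's formula on a rectangle *)

Section Cauchy.
Variables (a b c d : R).
Hypotheses (ab : a < b) (cd : c < d).
Definition insideR (z : C) := (a < Re z < b) && (c < Im z < d).
Let ab' := ltW ab.
Let cd' := ltW cd.

Lemma inside_dist z : insideR z -> exists2 r : R, 0 < r &
  (forall w, bdR a b c d w -> r <= nc (w - z)) /\ (forall w, nc (w - z) < r -> insideR w).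
Proof.
move=> /andP[/andP[z1 z2] /andP[z3 z4]].
exists (Num.min (Num.min (Re z - a) (b - Re z)) (Num.min (Im z - c) (d - Im z))).
  by rewrite !lt_min !subr_gt0 z1 z2 z3.
have n1 w := nc_Re (w - z); have n2 w := nc_Im (w - z).
split=> w.
  case/andP => _; have := n1 w; have := n2 w; rewrite !(ReD, ReN, ImD, ImN) => i1 i2.
  rewrite !ge_min; case/or4P => /eqP e1; rewrite e1 in i1 i2; apply/orP.
  - left; apply/orP; left; apply: le_trans i2; rewrite ler0_norm; lra.
  - left; apply/orP; right; apply: le_trans i2; rewrite ger0_norm; lra.
  - right; apply/orP; left; apply: le_trans i1; rewrite ler0_norm; lra.
  - right; apply/orP; right; apply: le_trans i1; rewrite ger0_norm; lra.
rewrite !lt_min => /andP[/andP[r1 r2] /andP[r3 r4]].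
have := n1 w; have := n2 w; rewrite !(ReD, ReN, ImD, ImN) !ler_norml => /andP[i1 i2] /andP[i3 i4].
by rewrite /insideR; apply/andP; split; apply/andP; split; lra.
Qed.

(** Differentiation under the integral sign: a remainder of the kernel that is quadratic in h
    uniformly on the boundary remains quadratic after integration. *)
Lemma oint_param (phi : fn) (ka ka' : C -> fn) (z : C) (dl B M : R) : 0 < dl -> 0 <= B ->
  (forall w, bdR a b c d w -> nc (phi w) <= M) -> (forall w, bdR a b c d w -> ccts phi w) ->
  (forall h w, nc h < dl -> bdR a b c d w -> ccts (ka (z + h)) w) ->
  (forall w, bdR a b c d w -> ccts (ka' z) w) ->
  (forall h w, nc h < dl -> bdR a b c d w ->
     nc (ka (z + h) w - ka z w - h * ka' z w) <= B * nc h ^+ 2) ->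
  cdiff (fun z => oint (fun w => phi w * ka z w) a b c d) z (oint (fun w => phi w * ka' z w) a b c d).
Proof.
move=> dl0 B0 hM pc kc kc' hB e e0.
set S := b - a + (d - c); have S0 : 0 < S by apply: addr_gt0; rewrite subr_gt0.
set T := 4 * (`|M| * B) * S.
have T0 : 0 <= T by rewrite /T !mulr_ge0 // ?ler0n // ltW.
exists (Num.min dl (e / (T + 1))) => [|h]; first by rewrite lt_min dl0 divr_gt0 //; lra.
rewrite lt_min ltr_pdivlMr => [/andP[hd h2]|]; last by lra.
have z0 w : bdR a b c d w -> ccts (ka z) w.
  by move=> ww; have := kc 0 w; rewrite nc0 addr0; apply.
have c1 w (ww : bdR a b c d w) := cctsM (pc w ww) (kc h w hd ww).
have c2 w (ww : bdR a b c d w) := cctsM (pc w ww) (z0 w ww).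
have c3 w (ww : bdR a b c d w) := cctsM (pc w ww) (kc' w ww).
have cN w (ww : bdR a b c d w) := cctsM (ccts_cst (-1) w) (c2 w ww).
have c4 w (ww : bdR a b c d w) := cctsM (ccts_cst (- h) w) (c3 w ww).
have c12 w : bdR a b c d w -> ccts (fun w => phi w * ka (z + h) w + (-1) * (phi w * ka z w)) w.
  by move=> ww; apply: ccts_lin; [exact: c1|exact: c2].
have -> : oint (fun w => phi w * ka (z + h) w) a b c d - oint (fun w => phi w * ka z w) a b c d
     - h * oint (fun w => phi w * ka' z w) a b c d =
     oint (fun w => (phi w * ka (z + h) w + (-1) * (phi w * ka z w)) + (- h) * (phi w * ka' z w)) a b c d.
  rewrite (ointD ab' cd' c12 c4) (ointD ab' cd' c1 cN) (ointZ (-1) ab' cd' c2) (ointZ (- h) ab' cd' c3).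
  ring.
have bd : nc (oint (fun w => (phi w * ka (z + h) w + (-1) * (phi w * ka z w)) + (- h) * (phi w * ka' z w)) a b c d)
    <= 4 * (`|M| * (B * nc h ^+ 2)) * S.
  apply: oint_bound => // [w ww|w ww]; first by apply: ccts_lin; [exact: c12|exact: c3].
  have -> : phi w * ka (z + h) w + (-1) * (phi w * ka z w) + (- h) * (phi w * ka' z w)
    = phi w * (ka (z + h) w - ka z w - h * ka' z w) by ring.
  rewrite ncM; apply: ler_pM; rewrite ?nc_ge0 //; last exact: hB.
  by apply: le_trans (hM w ww) (ler_norm M).
apply: le_trans bd _; have -> : 4 * (`|M| * (B * nc h ^+ 2)) * S = T * nc h * nc h by rewrite /T; ring.
by apply: ler_wpM2r; rewrite ?nc_ge0 //; have := nc_ge0 h; nra.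
Qed.

(** Integrals of Cauchy type. [Phi 1] of the constant 1 stands for 2 pi i throughout. *)
Definition Phi n (phi : fn) (z : C) : C := oint (fun w => phi w * (w - z)^-1 ^+ n) a b c d.

Lemma ccts_ker n (z w : C) : w != z -> ccts (fun w => (w - z)^-1 ^+ n) w.
Proof.
move=> wz; apply: cctsX; apply: ccts_inv; first by rewrite subr_eq0.
have := ccts_lin 1 (ccts_id w) (ccts_cst (- z) w); congr ccts; apply: funext => t; by rewrite mul1r.
Qed.

Lemma ker1_rem (u h : C) : u != 0 -> u - h != 0 ->
  (u - h)^-1 ^+ 1 - u^-1 ^+ 1 - h * u^-1 ^+ 2 = h ^+ 2 * (u^-1 ^+ 2 * (u - h)^-1).
Proof. by move=> q1 q2; field; rewrite q1 q2. Qed.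

Lemma ker2_rem (u h : C) : u != 0 -> u - h != 0 ->
  (u - h)^-1 ^+ 2 - u^-1 ^+ 2 - h * (2 * u^-1 ^+ 3) =
  h ^+ 2 * (u^-1 ^+ 2 * (u - h)^-1 ^+ 2 * (1 + 2 * (u - h) / u)).
Proof. by move=> q1 q2; field; rewrite q1 q2. Qed.

Lemma ler_pV (r t : R) : 0 < r -> r <= t -> t^-1 <= r^-1.
Proof. by move=> r0 rt; rewrite lef_pV2 // posrE (lt_le_trans r0). Qed.

Section PhiDiff.
Variables (phi : fn) (M : R) (z : C).
Hypotheses (hM : forall w, bdR a b c d w -> nc (phi w) <= M) (pc : forall w, bdR a b c d w -> ccts phi w)
  (zi : insideR z).

Lemma bd_lb : exists2 r : R, 0 < r & forall h w, nc h < r / 2 -> bdR a b c d w ->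
  [/\ w - z != 0, w - z - h != 0, r <= nc (w - z), r / 2 <= nc (w - z - h) & nc (w - z - h) <= 3 / 2 * nc (w - z)].
Proof.
have [r r0 [h1 _]] := inside_dist zi; exists r => // h w hh ww; rewrite -!nc_gt0.
have q1 := h1 w ww; have q2 := nc_sub_le (w - z) h; have q3 := nc_triB (w - z) h.
split; lra.
Qed.

Lemma Phi1_diff : cdiff (Phi 1 phi) z (Phi 2 phi z).
Proof.
have [r r0 lb] := bd_lb; have r2 : 0 < r / 2 by rewrite divr_gt0.
apply: (@oint_param phi (fun z w => (w - z)^-1 ^+ 1) (fun z w => (w - z)^-1 ^+ 2) z (r / 2) (r^-1 ^+ 2 * (r / 2)^-1) M) => //.
- by rewrite mulr_ge0 ?exprn_ge0 ?invr_ge0 // ltW.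
- by move=> h w hh ww; case: (lb h w hh ww) => _ q _ _ _; apply: ccts_ker; rewrite -subr_eq0 opprD addrA.
- by move=> w ww; case: (lb 0 w _ ww) => [|q _ _ _ _]; rewrite ?nc0 //; apply: ccts_ker; rewrite -subr_eq0.
move=> h w hh ww; have [q1 q2 q4 q3 _] := lb h w hh ww.
rewrite opprD addrA ker1_rem // ncM ncX mulrC ler_wpM2r ?exprn_ge0 ?nc_ge0 // ncM ncX !ncV.
apply: ler_pM; rewrite ?exprn_ge0 ?invr_ge0 ?nc_ge0 // ?ler_pV //.
by rewrite lerXn2r // ?nnegrE ?invr_ge0 ?nc_ge0 ?(ltW r0) // ler_pV.
Qed.

Lemma Phi2_diff : cdiff (Phi 2 phi) z (2 * Phi 3 phi z).
Proof.
have [r r0 lb] := bd_lb; have r2 : 0 < r / 2 by rewrite divr_gt0.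
have lc w : bdR a b c d w -> ccts (fun w => (w - z)^-1 ^+ 3) w.
  by move=> ww; case: (lb 0 w _ ww) => [|q _ _ _ _]; rewrite ?nc0 //; apply: ccts_ker; rewrite -subr_eq0.
have -> : 2 * Phi 3 phi z = oint (fun w => phi w * (2 * (w - z)^-1 ^+ 3)) a b c d.
  rewrite /Phi -ointZ //; last by move=> w ww; apply: cctsM; [exact: pc|exact: lc].
  by apply: oint_eq => w; rewrite mulrCA.
apply: (@oint_param phi (fun z w => (w - z)^-1 ^+ 2) (fun z w => 2 * (w - z)^-1 ^+ 3) z (r / 2) (r^-1 ^+ 2 * (r / 2)^-1 ^+ 2 * 4) M) => //.
- by rewrite !mulr_ge0 ?exprn_ge0 ?invr_ge0 ?ler0n // ltW.
- by move=> h w hh ww; case: (lb h w hh ww) => _ q _ _ _; apply: ccts_ker; rewrite -subr_eq0 opprD addrA.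
- by move=> w ww; apply: cctsM; [exact: ccts_cst|exact: lc].
move=> h w hh ww; have [q1 q2 q4 q3 q5] := lb h w hh ww.
rewrite opprD addrA ker2_rem // ncM ncX mulrC ler_wpM2r ?exprn_ge0 ?nc_ge0 //.
rewrite ncM [nc (_ * (w - z - h)^-1 ^+ 2)]ncM !ncX !ncV.
have w0 : 0 < nc (w - z) by rewrite nc_gt0.
apply: ler_pM; rewrite ?mulr_ge0 ?exprn_ge0 ?invr_ge0 ?nc_ge0 //.
  apply: ler_pM; rewrite ?exprn_ge0 ?invr_ge0 ?nc_ge0 //; rewrite lerXn2r // ?nnegrE ?invr_ge0 ?nc_ge0 ?(ltW r0) ?(ltW r2) //;
    exact: ler_pV.
apply: le_trans (nc_tri _ _) _; rewrite nc1 !ncM ncV nc_nat.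
move: q5; rewrite -ler_pdivrMr // => hh2; lra.
Qed.
End PhiDiff.

(** An explicit lower bound in place of the value 2 pi i. It estimates the imaginary part of 1/(w -
    z) on the bottom side; the factor 1/2 makes the inequality strict. The size of the bound matters
    for the derivative estimate [der_bound]. *)
Lemma K_gt (z : C) : insideR z -> (Im z - c) / ((b - a) ^+ 2 + (Im z - c) ^+ 2) * (b - a) / 2 < Im (Phi 1 (fun=> 1) z).
Proof.
move=> zi; have [r r0 [h1 _]] := inside_dist zi; case/andP: zi => /andP[z1 z2] /andP[z3 z4].
have sq_gt0 (u : R) : u != 0 -> 0 < u ^+ 2 by rewrite lt0r sqrf_eq0 sqr_ge0 andbT.
have cb w : bdR a b c d w -> ccts (fun w => 1 * (w - z)^-1 ^+ 1) w.
  move=> ww; apply: cctsM; first exact: ccts_cst.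
  by apply: ccts_ker; rewrite -subr_eq0 -nc_gt0 (lt_le_trans r0) // h1.
have invI (u v : R) : Im ((complex.Complex u v : C)^-1) = - v / (u ^+ 2 + v ^+ 2) by rewrite /= mulNr.
have z34 : 0 < Im z - c by rewrite subr_gt0.
have ba : 0 < b - a by rewrite subr_gt0.
set k := _ / _ * _ / 2.
have kE : k = ((Im z - c) / ((b - a) ^+ 2 + (Im z - c) ^+ 2) / 2) * (b - a) by rewrite /k mulrAC.
suff G : k < Im (cint (fun x => 1 * (pt x c - z)^-1 ^+ 1) a b).
  apply: (lt_trans G); apply: oint_gt => //.
  - move=> x /andP[x1 x2]; rewrite !mul1r !expr1.
    have E y : pt x y - z = complex.Complex (x - Re z) (y - Im z) by case: (z).
    rewrite !E !invI; split; first by rewrite divr_gt0 ?oppr_gt0 ?subr_lt0 // ltr_wpDl ?sqr_ge0 // sq_gt0 // lt_eqF // subr_lt0.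
    by rewrite mulNr oppr_lt0 divr_gt0 ?subr_gt0 // ltr_wpDl ?sqr_ge0 // sq_gt0 // gt_eqF // subr_gt0.
  - have invR (u v : R) : Re ((complex.Complex u v : C)^-1) = u / (u ^+ 2 + v ^+ 2) by [].
    move=> y /andP[x1 x2]; rewrite !mul1r !expr1.
    have E x : pt x y - z = complex.Complex (x - Re z) (y - Im z) by case: (z).
    rewrite !E !invR; split; first by rewrite divr_gt0 ?subr_gt0 // ltr_wpDr ?sqr_ge0 // sq_gt0 // gt_eqF // subr_gt0.
    by rewrite -oppr_gt0 -mulNr divr_gt0 ?oppr_gt0 ?subr_lt0 // ltr_wpDr ?sqr_ge0 // sq_gt0 // lt_eqF // subr_lt0.
rewrite kE; apply: cint_Im_gt => // [|x /andP[x1 x2]].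
  by apply: (cct_h cd' cb); rewrite eqxx.
rewrite mul1r expr1 (_ : pt x c - z = complex.Complex (x - Re z) (c - Im z)); last by case: (z).
rewrite invI opprB -[(x - _) ^+ 2]sqrrN opprB -[(c - _) ^+ 2]sqrrN opprB -mulrA ltr_pM2l //.
have q1 : 0 < (b - a) ^+ 2 + (Im z - c) ^+ 2 by apply: addr_gt0; rewrite exprn_gt0.
have q2 : 0 < (Re z - x) ^+ 2 + (Im z - c) ^+ 2 by rewrite ltr_wpDl ?sqr_ge0 // exprn_gt0.
have q3 : (Re z - x) ^+ 2 <= (b - a) ^+ 2.
  have z1' : a < Re z := z1; have z2' : Re z < b := z2.
  by rewrite -subr_ge0 subr_sqr mulr_ge0 //; lra.
apply: (@lt_le_trans _ _ ((b - a) ^+ 2 + (Im z - c) ^+ 2)^-1).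
  by rewrite ltr_pdivrMr // mulr_natr mulr2n ltrDl invr_gt0.
by apply: ler_pV => //; rewrite lerD2r.
Qed.

Lemma K_neq0 (z : C) : insideR z -> Phi 1 (fun=> 1) z != 0.
Proof.
move=> zi; have K := K_gt zi; case/andP: zi => _ /andP[z3 z4].
suff : 0 < Im (Phi 1 (fun=> 1) z) by apply: contraTneq => ->; rewrite ltxx.
apply: lt_trans K; have z34 : 0 < Im z - c by rewrite subr_gt0.
have ba : 0 < b - a by rewrite subr_gt0.
by rewrite !divr_gt0 // !mulr_gt0 ?invr_gt0 // addr_gt0 // exprn_gt0.
Qed.

(** The difference quotient, completed by the derivative at z, is continuous at z and differentiable
    elsewhere, which is the case that [goursat] admits. *)
Lemma cauchy (f : fn) (z : C) : (forall w, inR a b c d w -> exists l, cdiff f w l) -> insideR z ->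
  f z * Phi 1 (fun=> 1) z = Phi 1 f z.
Proof.
move=> fd zi; have [r r0 [h1 _]] := inside_dist zi.
have zR : inR a b c d z by case/andP: zi => /andP[z1 z2] /andP[z3 z4]; rewrite /inR !ltW.
have fc w : inR a b c d w -> ccts f w by case/fd => l /cdiff_ccts.
have [l hl] := fd z zR.
pose g : fn := fun w => if w == z then l else (f w - f z) * (w - z)^-1.
have gd w : inR a b c d w -> w != z -> exists k, cdiff g w k.
  move=> ww wz; have [k hk] := fd w ww.
  have wz0 : w - z != 0 by rewrite subr_eq0.
  have hd := cdiffM (cdiffD hk (cdiff_cst (- f z) w)) (cdiffV (f := fun w => w - z) wz0 (cdiffD (cdiff_id w) (cdiff_cst (- z) w))).
  eexists.
  apply: (@cdiff_loc _ _ _ _ (nc (w - z)) _ _ hd); first by rewrite nc_gt0.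
  move=> t ht; rewrite /g; case: eqP => // tz; move: ht; by rewrite tz ncB ltxx.
have gc w : inR a b c d w -> ccts g w.
  move=> ww; have [->|wz] := eqVneq w z; last by have [k /cdiff_ccts] := gd w ww wz.
  move=> e e0; have e2 : 0 < e / 2 by lra.
  have [dl d0 hd] := hl _ e2; exists dl => // t ht; rewrite /g eqxx; case: eqP => [_|/eqP tz].
    by rewrite subrr nc0.
  have tz0 : t - z != 0 by rewrite subr_eq0.
  have := hd _ ht; rewrite [z + _]addrC subrK.
  have -> : f t - f z - (t - z) * l = ((f t - f z) / (t - z) - l) * (t - z) by field.
  rewrite ncM ler_pM2r ?nc_gt0 //; lra.
have I0 := goursat ab cd gc gd.
have wz w : bdR a b c d w -> w != z.
  by move=> /h1 q; rewrite -subr_eq0 -nc_gt0; apply: lt_le_trans q.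
have cf w : bdR a b c d w -> ccts (fun w => f w * (w - z)^-1 ^+ 1) w.
  by move=> ww; apply: cctsM; [apply: fc; exact: bd_in|apply: ccts_ker; exact: wz].
have c1 w : bdR a b c d w -> ccts (fun w => 1 * (w - z)^-1 ^+ 1) w.
  by move=> ww; apply: cctsM; [exact: ccts_cst|apply: ccts_ker; exact: wz].
have c1' w (ww : bdR a b c d w) := cctsM (ccts_cst (- f z) w) (c1 w ww).
have : oint g a b c d = oint (fun w => f w * (w - z)^-1 ^+ 1 + (- f z) * (1 * (w - z)^-1 ^+ 1)) a b c d.
  have E w : bdR a b c d w -> g w = f w * (w - z)^-1 ^+ 1 + (- f z) * (1 * (w - z)^-1 ^+ 1).
    by move=> /wz/negbTE h; rewrite /g h expr1; ring.
  by apply: oint_ext => // t tt; split; apply: E; rewrite /bdR /inR /= tt ?lexx ?ab' ?cd' eqxx ?orbT.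
rewrite I0 (ointD ab' cd' cf c1') (ointZ _ ab' cd' c1) => /eqP; rewrite eq_sym mulNr subr_eq0 => /eqP.
by rewrite /Phi => ->.
Qed.
End Cauchy.

(** Near z one has f = G / K with Cauchy integrals G and K. These are differentiable twice, so the
    quotient rule gives a differentiable formula for the derivative. *)
Theorem holo_der (f : fn) : holo f -> holo (der f).
Proof.
move=> hf z zH.
pose a := Re z - 1; pose b := Re z + 1; pose c := Im z / 2; pose d := Im z * 2.
have z0 : 0 < Im z := zH.
have ab : a < b by rewrite /a /b; lra.
have cd : c < d by rewrite /c /d; lra.
have zi : insideR a b c d z by rewrite /insideR /a /b /c /d; apply/andP; split; apply/andP; split; lra.
have inHR w : inR a b c d w -> inH w.
  by rewrite /inH => /andP[_ /andP[w1 _]]; apply: lt_le_trans w1; rewrite /c; lra.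
have fd w : inR a b c d w -> exists l, cdiff f w l.
  by move=> /inHR/hf/der_is/cdiffP ?; exists (der f w).
have fc w : inR a b c d w -> ccts f w by case/fd => l /cdiff_ccts.
have [M hM] := bounded_rect (ltW ab) (ltW cd) fc.
have hMb w : bdR a b c d w -> nc (f w) <= M by move=> /bd_in; apply: hM.
have fcb w : bdR a b c d w -> ccts f w by move=> /bd_in; apply: fc.
have h1 w : bdR a b c d w -> nc 1 <= 1 by rewrite nc1.
have c1 w : bdR a b c d w -> ccts (fun=> 1) w by move=> _; apply: ccts_cst.
pose K := Phi a b c d 1 (fun=> 1); pose G := Phi a b c d 1 f.
pose K2 := Phi a b c d 2 (fun=> 1); pose G2 := Phi a b c d 2 f.
have dK w (wi : insideR a b c d w) : cdiff K w (K2 w) by apply: Phi1_diff h1 c1 wi.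
have dG w (wi : insideR a b c d w) : cdiff G w (G2 w) by apply: Phi1_diff hMb fcb wi.
have dK2 : cdiff K2 z (2 * Phi a b c d 3 (fun=> 1) z) by apply: Phi2_diff h1 c1 zi.
have dG2 : cdiff G2 z (2 * Phi a b c d 3 f z) by apply: Phi2_diff hMb fcb zi.
have [r r0 [_ hr]] := inside_dist zi.
have K0 w : insideR a b c d w -> K w != 0 by apply: K_neq0.
have fE w : insideR a b c d w -> f w = G w * (K w)^-1.
  by move=> wi; rewrite /G -(cauchy ab cd fd wi) mulfK // K0.
pose D : fn := fun w => G2 w * (K w)^-1 - G w * (K2 w * (K w)^-1 ^+ 2).
have derD w : insideR a b c d w -> der f w = D w.
  move=> wi; apply: derE; apply/cdiffP; have [s s0 [_ hs]] := inside_dist wi.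
  apply: (@cdiff_loc (fun w => G w * (K w)^-1) _ _ _ s s0) => [t /hs/fE //|].
  have := cdiffM (dG w wi) (cdiffV (K0 w wi) (dK w wi)); congr cdiff.
  by rewrite /D -exprVn; ring.
have [l dD] : exists l, cdiff D z l.
  have kd := cdiffV (K0 z zi) (dK z zi); have q := cdiffM (dG z zi) (cdiffM dK2 (cdiffM kd kd)).
  by eexists; apply: cdiff_eq (cdiffD (cdiffM dG2 kd) (cdiffZ (-1) q)) => // w; rewrite /D mulN1r expr2.
suff : is_derive z 1 (der f) l by case.
apply/cdiffP; apply: (@cdiff_loc D _ _ _ r r0) => [w /hr/derD //|]; exact: dD.
Qed.

Local Close Scope classical_set_scope.

(** * Holomorphic functions on the upper half plane *)

Lemma holoP (f : fn) : holo f <-> forall z, inH z -> exists l, cdiff f z l.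
Proof.
split=> [h z zH|h z zH]; first by exists (der f z); apply/cdiffP/der_is/h.
by have [l /cdiffP[]] := h z zH.
Qed.

Lemma holo_cdiff (f : fn) z : holo f -> inH z -> cdiff f z (der f z).
Proof. by move=> h zH; apply/cdiffP/der_is/h. Qed.

Lemma cdiff_der (f : fn) (z l : C) : cdiff f z l -> der f z = l.
Proof. by move=> /cdiffP; apply: derE. Qed.

Lemma holo_ext (f g : fn) : (forall z, inH z -> f z = g z) -> holo f -> holo g.
Proof.
by move=> fg /holoP h; apply/holoP => z zH; have [l hl] := h z zH; exists l; apply: cdiff_ext hl.
Qed.

Lemma holo_cst (k : C) : holo (fun=> k).
Proof. by apply/holoP => z _; exists 0; apply: cdiff_cst. Qed.
Arguments holo_cst k : clear implicits.
Lemma holo_id : holo id.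
Proof. by apply/holoP => z _; exists 1; apply: cdiff_id. Qed.
Lemma holoD (f g : fn) : holo f -> holo g -> holo (fun z => f z + g z).
Proof.
move=> hf hg; apply/holoP => z zH; eexists; apply: cdiffD; exact: holo_cdiff.
Qed.
Lemma holoM (f g : fn) : holo f -> holo g -> holo (fun z => f z * g z).
Proof.
move=> hf hg; apply/holoP => z zH; eexists; apply: cdiffM; exact: holo_cdiff.
Qed.
Lemma holoZ (k : C) (f : fn) : holo f -> holo (fun z => k * f z).
Proof. by move=> hf; exact: (holoM (holo_cst k) hf). Qed.
Lemma holoN (f : fn) : holo f -> holo (fun z => - f z).
Proof. by move=> hf; apply: (holo_ext _ (@holoZ (-1) f hf)) => z _; rewrite mulN1r. Qed.
Lemma holoX (f : fn) n : holo f -> holo (fun z => f z ^+ n).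
Proof.
move=> hf; elim: n => [|n IH]; first exact: holo_cst.
by apply: (holo_ext _ (holoM hf IH)) => z _; rewrite exprS.
Qed.
Lemma holoV (f : fn) : (forall z, inH z -> f z != 0) -> holo f -> holo (fun z => (f z)^-1).
Proof.
move=> f0 hf; apply/holoP => z zH; eexists; apply: cdiffV; [exact: f0|exact: holo_cdiff].
Qed.
Lemma holo_comp (f g : fn) : (forall z, inH z -> inH (g z)) -> holo f -> holo g -> holo (fun z => f (g z)).
Proof.
move=> gH hf hg; apply/holoP => z zH; eexists; apply: cdiff_comp; apply: holo_cdiff => //; exact: gH.
Qed.
Lemma holo_sum (I : Type) (r : seq I) (F : I -> fn) :
  (forall i, holo (F i)) -> holo (fun z => \sum_(i <- r) F i z).
Proof.
move=> hF; elim: r => [|i r IH].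
  by apply: (holo_ext _ (holo_cst 0)) => z _; rewrite big_nil.
by apply: (holo_ext _ (holoD (hF i) IH)) => z _; rewrite big_cons.
Qed.

Lemma segH (z w : C) (t : R) : 0 <= t <= 1 -> inH z -> inH w -> inH (z + rC t * (w - z)).
Proof.
rewrite /inH => /andP[t0 t1] zH wH; rewrite ImD ImM ImD ImN /= mul0r addr0.
by nra.
Qed.

(** The mean value inequality along the segment from z to w, by bisection in the parameter; the
    second side of the rectangle is the point 0. *)
Lemma holo_der0 (f : fn) : holo f -> (forall z, inH z -> der f z = 0) ->
  forall z w, inH z -> inH w -> f z = f w.
Proof.
move=> hf d0 z w zH wH; pose g (t : R) := f (z + rC t * (w - z)).
suff H (e : R) : 0 < e -> nc (g 1 - g 0) <= e.
  apply/eqP; rewrite eq_sym -subr_eq0 -[_ == 0]negbK -nc_gt0; apply/negP => n0.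
  have n2 : 0 < nc (f w - f z) / 2 by lra.
  by have := H _ n2; rewrite /g rC0 rC1 mul0r mul1r addr0 [z + _]addrC subrK; lra.
move=> e0; pose k := e / (nc (w - z) + 1); have n0 := nc_ge0 (w - z).
have k0 : 0 < k by rewrite divr_gt0 //; lra.
have kn : k * nc (w - z) <= e.
  rewrite /k mulrAC ler_pdivrMr; last by lra.
  by rewrite ler_pM2l //; lra.
pose P (a b c d : R) := nc (g b - g a) <= e * (b - a).
suff : P 0 1 0 0 by rewrite /P subr0 mulr1.
apply: (@Goursat.bisection P); [|exact/RleP/ler01|exact/RleP/lexx|].
  move=> a b c d m n _ _ _ _; rewrite /P => h1 h2 _ _.
  have := nc_tri2 (g m) (g b) (g a); lra.
move=> x y [/RleP x0 /RleP x1] _.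
have xx : 0 <= x <= 1 by rewrite x0 x1.
have pH := segH xx zH wH; have [dl dl0 hd] := holo_cdiff hf pH k0; rewrite (d0 _ pH) in hd.
exists (dl / (nc (w - z) + 1)); split; first by apply/RltP; rewrite divr_gt0 //; lra.
move=> a b c d _ [/RleP ax /RleP xb] _ _ _ _ /RltP ab _.
have {}ab : b - a < dl / (nc (w - z) + 1) by [].
have L t : a <= t <= b -> nc (g t - g x) <= e * `|t - x|.
  move=> /andP[at_ tb]; have := hd (rC (t - x) * (w - z)).
  have -> : z + rC x * (w - z) + rC (t - x) * (w - z) = z + rC t * (w - z) by rewrite rCB; ring.
  rewrite mulr0 subr0 ncM nc_rC => /(_ _)/wrap[].
    have q : `|t - x| <= b - a by rewrite ler_norml; apply/andP; split; lra.
    move: ab; rewrite ltr_pdivlMr; last by lra.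
    have := normr_ge0 (t - x); nra.
  by have := normr_ge0 (t - x) => q1 q2; apply: le_trans q2 _; nra.
have q1 := L a _; have q2 := L b _; rewrite /P.
have := nc_tri2 (g x) (g b) (g a).
have {}q1 : nc (g a - g x) <= e * (x - a) by have := q1; rewrite lexx (le_trans ax xb) ler0_norm ?opprB ?subr_le0 //; apply.
have {}q2 : nc (g b - g x) <= e * (b - x) by have := q2; rewrite lexx (le_trans ax xb) ger0_norm ?subr_ge0 //; apply.
rewrite (ncB (g x)); lra.
Qed.

(** * The differential ring of holomorphic functions *)

Record hfun := HFun { hval :> C -> C; hval_holo : holo hval; hval_off : forall z, ~ inH z -> hval z = 0 }.
Arguments hval_holo : clear implicits.

(** Values outside the half plane are normalized to 0, so functions that agree on it are equal and
    form a ring for plain equality. *)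
Lemma hfun_ext (f g : hfun) : (forall z, inH z -> f z = g z) -> f = g.
Proof.
case: f g => f hf of_ [g hg og] /= fg.
have e : f = g by apply: funext => z; have [zH|zH] := pselect (inH z); [exact: fg|rewrite of_ ?og].
by subst g; congr HFun; apply: Prop_irrelevance.
Qed.

Definition cutH (f : fn) : fn := fun z => if (0 < Im z) then f z else 0.
Lemma cutHE f z : inH z -> cutH f z = f z. Proof. by rewrite /cutH /inH => ->. Qed.
Lemma holo_cut f : holo f -> holo (cutH f).
Proof. by apply: holo_ext => z zH; rewrite cutHE. Qed.
Lemma cutH_off f z : ~ inH z -> cutH f z = 0.
Proof. by rewrite /cutH /inH => /negP/negbTE ->. Qed.
Definition mkO f (h : holo f) : hfun := HFun (holo_cut h) (@cutH_off f).
Lemma mkOE f (h : holo f) z : inH z -> mkO h z = f z. Proof. exact: cutHE. Qed.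

HB.instance Definition _ := gen_eqMixin hfun.
HB.instance Definition _ := gen_choiceMixin hfun.

Definition hzero := mkO (holo_cst 0).
Definition hone := mkO (holo_cst 1).
Definition hadd (f g : hfun) := mkO (holoD (hval_holo f) (hval_holo g)).
Definition hopp (f : hfun) := mkO (holoN (hval_holo f)).
Definition hmul (f g : hfun) := mkO (holoM (hval_holo f) (hval_holo g)).

Fact haddA : associative hadd.
Proof. by move=> f g h; apply: hfun_ext => z zH; rewrite !mkOE // addrA. Qed.
Fact haddC : commutative hadd.
Proof. by move=> f g; apply: hfun_ext => z zH; rewrite !mkOE // addrC. Qed.
Fact hadd0 : left_id hzero hadd.
Proof. by move=> f; apply: hfun_ext => z zH; rewrite !mkOE // add0r. Qed.
Fact haddN : left_inverse hzero hopp hadd.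
Proof. by move=> f; apply: hfun_ext => z zH; rewrite !mkOE // addNr. Qed.
HB.instance Definition _ := GRing.isZmodule.Build hfun haddA haddC hadd0 haddN.
Fact hmulA : associative hmul.
Proof. by move=> f g h; apply: hfun_ext => z zH; rewrite !mkOE // mulrA. Qed.
Fact hmulC : commutative hmul.
Proof. by move=> f g; apply: hfun_ext => z zH; rewrite !mkOE // mulrC. Qed.
Fact hmul1 : left_id hone hmul.
Proof. by move=> f; apply: hfun_ext => z zH; rewrite !mkOE // mul1r. Qed.
Fact hmulD : left_distributive hmul hadd.
Proof. by move=> f g h; apply: hfun_ext => z zH; rewrite !mkOE // mulrDl. Qed.
Lemma inH_i : inH iC. Proof. exact: ltr01. Qed.
Fact hone_neq0 : hone != hzero.
Proof.
by apply/eqP => /(congr1 (fun f : hfun => f iC)); rewrite !(mkOE _ inH_i) => /eqP; rewrite oner_eq0.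
Qed.
HB.instance Definition _ := GRing.Zmodule_isComNzRing.Build hfun hmulA hmulC hmul1 hmulD hone_neq0.

Lemma hfD (f g : hfun) z : inH z -> (f + g) z = f z + g z. Proof. exact: mkOE. Qed.
Lemma hfN (f : hfun) z : inH z -> (- f) z = - f z. Proof. exact: mkOE. Qed.
Lemma hfM (f g : hfun) z : inH z -> (f * g) z = f z * g z. Proof. exact: mkOE. Qed.
Lemma hf0 z : (0 : hfun) z = 0. Proof. by rewrite -[LHS]/(cutH (fun=> 0) z) /cutH; case: ifP. Qed.
Lemma hf1 z : inH z -> (1 : hfun) z = 1. Proof. exact: mkOE. Qed.
Lemma hfX (f : hfun) n z : inH z -> (f ^+ n) z = f z ^+ n.
Proof. by move=> zH; elim: n => [|n IH]; rewrite ?expr0 ?hf1 // !exprS hfM ?IH. Qed.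
Lemma hf_sum (I : Type) (r : seq I) (P : pred I) (F : I -> hfun) z : inH z ->
  (\sum_(i <- r | P i) F i) z = \sum_(i <- r | P i) F i z.
Proof. by move=> zH; elim/big_rec2: _ => [|i x y _ <-]; rewrite ?hf0 ?hfD. Qed.

Definition cO (k : R[i]) : hfun := mkO (holo_cst k).
Lemma cOE k z : inH z -> cO k z = k. Proof. exact: mkOE. Qed.
Fact cO_additive : additive cO.
Proof. by move=> a b; apply: hfun_ext => z zH; rewrite hfD ?hfN // !cOE. Qed.
Fact cO_multiplicative : multiplicative cO.
Proof. by split=> [a b|]; apply: hfun_ext => z zH; rewrite ?hfM // ?hf1 // !cOE. Qed.
HB.instance Definition _ := GRing.isAdditive.Build R[i] hfun cO cO_additive.
HB.instance Definition _ := GRing.isMultiplicative.Build R[i] hfun cO cO_multiplicative.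

Definition dO (f : hfun) : hfun := mkO (holo_der (hval_holo f)).
Lemma dOE (f : hfun) z : inH z -> dO f z = der f z. Proof. exact: mkOE. Qed.
Lemma dO_cdiff (f : hfun) z : inH z -> cdiff f z (dO f z).
Proof. by move=> zH; rewrite dOE //; apply: holo_cdiff => //; apply: hval_holo. Qed.
Lemma dO_eq (f : hfun) (g : fn) z l : inH z -> (forall w, inH w -> f w = g w) -> cdiff g z l -> dO f z = l.
Proof.
move=> zH fg h; rewrite dOE //; apply: cdiff_der; apply: cdiff_ext h => // w wH; by rewrite fg.
Qed.
Lemma dO_D (f g : hfun) : dO (f + g) = dO f + dO g.
Proof.
apply: hfun_ext => z zH; rewrite hfD //.
by apply: (dO_eq zH (fun w wH => hfD f g wH)); apply: cdiffD; apply: dO_cdiff.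
Qed.
Lemma dO_M (f g : hfun) : dO (f * g) = dO f * g + f * dO g.
Proof.
apply: hfun_ext => z zH; rewrite hfD ?hfM //.
by apply: (dO_eq zH (fun w wH => hfM f g wH)); apply: cdiffM; apply: dO_cdiff.
Qed.
Lemma dO_c k : dO (cO k) = 0.
Proof. by apply: hfun_ext => z zH; rewrite hf0; apply: (dO_eq zH (fun w wH => cOE k wH)); apply: cdiff_cst. Qed.
Definition bO : hfun := mkO holo_id.
Lemma bOE z : inH z -> bO z = z. Proof. exact: mkOE. Qed.
Lemma dO_b : dO bO = 1.
Proof. by apply: hfun_ext => z zH; rewrite hf1 //; apply: (dO_eq zH (fun w wH => bOE wH)); apply: cdiff_id. Qed.
Lemma ker_dO (f : hfun) : dO f = 0 -> exists k, f = cO k.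
Proof.
move=> h; exists (f iC); apply: hfun_ext => z zH; rewrite cOE //.
by apply: holo_der0 (hval_holo f) _ _ _ zH inH_i => w wH; rewrite -dOE // h hf0.
Qed.

Definition toO := locked_with fock_key (fun f : fn => if pselect (holo f) is left h then mkO h else 0).
Lemma toOE f z : holo f -> inH z -> toO f z = f z.
Proof. by move=> hf zH; rewrite /toO unlock; case: pselect => [h|//]; rewrite (mkOE h zH). Qed.
Lemma toO_eq f (g : hfun) : holo f -> (forall z, inH z -> f z = g z) -> toO f = g.
Proof. by move=> hf fg; apply: hfun_ext => z zH; rewrite (toOE hf zH) (fg z zH). Qed.
Lemma toO_id (f : hfun) : toO f = f. Proof. exact: (toO_eq (hval_holo f)). Qed.

(** * Moebius transformations *)

Definition jac (g : 'M[int]_2) (z : C) : C := (gc g)%:~R * z + (gd g)%:~R.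

Lemma Re_int (n : int) : Re (n%:~R : C) = n%:~R. Proof. by rewrite -rC_int. Qed.
Lemma Im_int (n : int) : Im (n%:~R : C) = 0. Proof. by rewrite -rC_int. Qed.
Lemma Re_jac g z : Re (jac g z) = (gc g)%:~R * Re z + (gd g)%:~R.
Proof. by rewrite ReD ReM !Re_int !Im_int mul0r subr0. Qed.
Lemma Im_jac g z : Im (jac g z) = (gc g)%:~R * Im z.
Proof. by rewrite ImD ImM !Re_int !Im_int mul0r !addr0. Qed.

Lemma det22 (g : 'M[int]_2) : \det g = ga g * gd g - gb g * gc g.
Proof.
rewrite (expand_det_row _ ord0) !big_ord_recl big_ord0 /cofactor !det_mx11 !mxE /=.
have -> : lift ord0 ord0 = ord_max :> 'I_2 by apply: val_inj.
have -> : lift ord_max 0 = ord0 :> 'I_2 by apply: val_inj.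
by rewrite /ga /gb /gc /gd /bump /= expr0 expr1; ring.
Qed.
Lemma SL2Z_det g : SL2Z g -> ga g * gd g - gb g * gc g = 1.
Proof. by rewrite /SL2Z det22. Qed.

Lemma jac_neq0 g z : SL2Z g -> inH z -> jac g z != 0.
Proof.
move=> /SL2Z_det dg zH; apply/eqP => j0.
have i0 := Im_jac g z; have r0 := Re_jac g z; move: i0 r0; rewrite j0 /= => /esym/eqP.
rewrite mulf_eq0 (gt_eqF zH) orbF intr_eq0 => /eqP c0; rewrite c0 mul0r add0r => /esym/eqP.
rewrite intr_eq0 => /eqP d0; move: dg; rewrite c0 d0 !mulr0; lia.
Qed.

Lemma Im_mob g z : SL2Z g -> inH z -> Im (mob g z) = Im z / nc (jac g z) ^+ 2.
Proof.
move=> sg zH; have j0 := jac_neq0 sg zH; have dg := SL2Z_det sg.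
have n0 : nc (jac g z) != 0 by rewrite gt_eqF ?nc_gt0.
have sqn (w : C) : nc w ^+ 2 = Re w ^+ 2 + Im w ^+ 2.
  by case: w => a b; rewrite /nc /= sqr_sqrtr // addr_ge0 ?sqr_ge0.
have invE (w : C) : w != 0 -> Im w^-1 = - Im w / nc w ^+ 2 /\ Re w^-1 = Re w / nc w ^+ 2.
  by rewrite sqn; case: w => a b _ /=; rewrite mulNr.
have [i1 i2] := invE _ j0; rewrite /mob ImM -/(jac g z) i1 i2 Re_jac Im_jac ReD ImD ReM ImM !Re_int !Im_int.
have {}dg : (ga g)%:~R * (gd g)%:~R - (gb g)%:~R * (gc g)%:~R = 1 :> R by rewrite -!intrM -intrB dg.
apply: (mulIf (expf_neq0 2 n0)); rewrite divfK ?expf_neq0 // mulrDl -!mulrA mulVf ?expf_neq0 // !mulr1.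
have e : ((ga g)%:~R * (gd g)%:~R - (gb g)%:~R * (gc g)%:~R) * Im z = Im z by rewrite dg mul1r.
rewrite -[RHS]e; ring.
Qed.

Lemma inH_mob g z : SL2Z g -> inH z -> inH (mob g z).
Proof. by move=> sg zH; rewrite /inH Im_mob // divr_gt0 // exprn_gt0 // nc_gt0 jac_neq0. Qed.

Lemma mul2E (x y : 'M[int]_2) i j : (x *m y) i j = x i ord0 * y ord0 j + x i ord_max * y ord_max j.
Proof.
rewrite mxE big_ord_recl big_ord1; congr (_ + _ * _); congr (_ _ _); exact: val_inj.
Qed.

Lemma jac_mul x y z : SL2Z y -> inH z -> jac (x *m y) z = jac x (mob y z) * jac y z.
Proof.
move=> sy zH; have j0 := jac_neq0 sy zH; rewrite /jac /gc /gd !mul2E !intrD !intrM /mob.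
rewrite -/(gc y) -/(gd y) -/(jac y z); rewrite /jac in j0 *.
by rewrite /ga /gb /gc /gd in j0 *; field.
Qed.

Lemma SL2Z_mul x y : SL2Z x -> SL2Z y -> SL2Z (x *m y).
Proof. by rewrite /SL2Z det_mulmx => -> ->; rewrite mulr1. Qed.

Lemma mob_mul x y z : SL2Z x -> SL2Z y -> inH z -> mob (x *m y) z = mob x (mob y z).
Proof.
move=> sx sy zH; have j0 := jac_neq0 sy zH; have jx := jac_neq0 sx (inH_mob sy zH).
have jxy := jac_neq0 (SL2Z_mul sx sy) zH.
apply: (mulIf jxy); rewrite {1}/mob -/(jac _ z) divfK // jac_mul // mulrA {1}/mob -/(jac x _) divfK //.
rewrite mulrDl {1}/mob -/(jac y z) mulrA divfK // /jac /ga /gb /gc /gd !mul2E !intrD !intrM; ring.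
Qed.

Lemma adj22 (g : 'M[int]_2) : [/\ ga (\adj g) = gd g, gb (\adj g) = - gb g, gc (\adj g) = - gc g & gd (\adj g) = ga g].
Proof.
rewrite /ga /gb /gc /gd !mxE /cofactor /= !det_mx11 !mxE /=.
split; rewrite ?expr0 ?expr1 ?exprS ?mulN1r ?mul1r ?expr0 ?mulr1 ?opprK //; congr (_ _ _) => //; try congr (- _ _ _);
  try exact: val_inj.
- by congr (g _ _); exact: val_inj.
- by congr (g _ _); exact: val_inj.
Qed.

Lemma SL2Z_adj g : SL2Z g -> SL2Z (\adj g) /\ (g *m \adj g = 1%:M /\ \adj g *m g = 1%:M).
Proof.
rewrite /SL2Z => dg; have m1 := mul_mx_adj g; have m2 := mul_adj_mx g; rewrite dg in m1 m2.
split=> //; have : \det (g *m \adj g) = 1 by rewrite m1 det1.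
by rewrite det_mulmx dg mul1r.
Qed.

Lemma jac1 z : jac 1%:M z = 1.
Proof. by rewrite /jac /gc /gd !mxE /= mul0r add0r. Qed.
Lemma mob1 z : mob 1%:M z = z.
Proof. by rewrite /mob -/(jac _ z) jac1 divr1 /ga /gb !mxE /= mul1r addr0. Qed.

Lemma holo_jac g : holo (jac g).
Proof.
apply: (holo_ext _ (holoD (holoZ (k := (gc g)%:~R) holo_id) (holo_cst (gd g)%:~R))) => z _; by [].
Qed.
Lemma holo_mob g : SL2Z g -> holo (mob g).
Proof.
move=> sg; have hn : holo (fun z => (ga g)%:~R * z + (gb g)%:~R).
  exact: (holoD (holoZ (k := (ga g)%:~R) holo_id) (holo_cst (gb g)%:~R)).
have hd : holo (fun z => (jac g z)^-1).
  by apply: (holoV _ (@holo_jac g)) => z zH; apply: jac_neq0.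
exact: (holoM hn hd).
Qed.

Lemma cdiff_mob g z : SL2Z g -> inH z -> cdiff (mob g) z ((jac g z)^-1 ^+ 2).
Proof.
move=> sg zH; have j0 := jac_neq0 sg zH.
have cj : cdiff (jac g) z ((gc g)%:~R).
  by have := cdiffD (cdiffZ (gc g)%:~R (cdiff_id z)) (cdiff_cst (gd g)%:~R z); rewrite mulr1 addr0.
have cn : cdiff (fun z => (ga g)%:~R * z + (gb g)%:~R) z ((ga g)%:~R).
  by have := cdiffD (cdiffZ (ga g)%:~R (cdiff_id z)) (cdiff_cst (gb g)%:~R z); rewrite mulr1 addr0.
have := cdiffM cn (cdiffV j0 cj); congr cdiff.
have dg := SL2Z_det sg.
have {}dg : (ga g)%:~R * (gd g)%:~R - (gb g)%:~R * (gc g)%:~R = 1 :> C by rewrite -!intrM -intrB dg.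
have -> : (jac g z)^-1 ^+ 2 = ((ga g)%:~R * (gd g)%:~R - (gb g)%:~R * (gc g)%:~R) * (jac g z)^-1 ^+ 2.
  by rewrite dg mul1r.
rewrite /jac in j0 *; field; exact: j0.
Qed.

Record SL := MkSL { smx : 'M[int]_2; smxP : SL2Z smx }.
Definition sinv (g : SL) : SL := MkSL (proj1 (SL2Z_adj (smxP g))).
Definition smul (x y : SL) : SL := MkSL (SL2Z_mul (smxP x) (smxP y)).

Definition sgO (g : SL) (f : hfun) : hfun :=
  mkO (holo_comp (fun z zH => inH_mob (smxP g) zH) (hval_holo f) (@holo_mob _ (smxP g))).
Lemma sgOE g f z : inH z -> sgO g f z = f (mob (smx g) z). Proof. exact: mkOE. Qed.
Section SgO.
Variable g : SL.
Fact sgO_additive : additive (sgO g).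
Proof.
move=> f k; apply: hfun_ext => z zH; have mH := inH_mob (smxP g) zH.
by rewrite hfD ?hfN // !sgOE // hfD // hfN.
Qed.
Fact sgO_multiplicative : multiplicative (sgO g).
Proof.
split=> [f k|]; apply: hfun_ext => z zH; have mH := inH_mob (smxP g) zH.
  by rewrite hfM // !sgOE // hfM.
by rewrite sgOE // !hf1.
Qed.
HB.instance Definition _ := GRing.isAdditive.Build hfun hfun (sgO g) sgO_additive.
HB.instance Definition _ := GRing.isMultiplicative.Build hfun hfun (sgO g) sgO_multiplicative.

Definition jO : hfun := mkO (@holo_jac (smx g)).
Lemma jOE z : inH z -> jO z = jac (smx g) z. Proof. exact: mkOE. Qed.
Definition jiO : hfun := mkO (holoV (fun z zH => jac_neq0 (smxP g) zH) (@holo_jac (smx g))).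
Lemma jiOE z : inH z -> jiO z = (jac (smx g) z)^-1. Proof. exact: mkOE. Qed.

Fact jjiO : jO * jiO = 1.
Proof. by apply: hfun_ext => z zH; rewrite hfM // hf1 // jOE // jiOE // mulfV // jac_neq0 //; apply: smxP. Qed.
Lemma jO_lin : jO = cO (gc (smx g))%:~R * bO + cO (gd (smx g))%:~R.
Proof. by apply: hfun_ext => z zH; rewrite jOE // hfD // hfM // !cOE // bOE. Qed.
Lemma dO_j : dO jO = cO (gc (smx g))%:~R.
Proof. by rewrite jO_lin dO_D dO_M !dO_c dO_b mul0r add0r addr0 mulr1. Qed.
Fact dd_jO : dO (dO jO) = 0. Proof. by rewrite dO_j dO_c. Qed.
Fact dO_sg f : dO (sgO g f) = jiO ^+ 2 * sgO g (dO f).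
Proof.
apply: hfun_ext => z zH; rewrite hfM // hfX // jiOE // sgOE //.
apply: (dO_eq zH (fun w wH => sgOE g f wH)); apply: cdiff_comp; first exact: cdiff_mob (smxP g) zH.
by apply: dO_cdiff; apply: inH_mob => //; apply: smxP.
Qed.
Fact sgO_c k : sgO g (cO k) = cO k.
Proof. by apply: hfun_ext => z zH; rewrite sgOE // !cOE //; apply: inH_mob => //; apply: smxP. Qed.
Fact sgO_K : cancel (sgO g) (sgO (sinv g)).
Proof.
move=> f; apply: hfun_ext => z zH; have mH := inH_mob (smxP (sinv g)) zH; rewrite !sgOE //.
have [sa [m1 _]] := SL2Z_adj (smxP g).
by rewrite /= -mob_mul ?m1 ?mob1 //; apply: smxP.
Qed.
Fact sgO_Ki : cancel (sgO (sinv g)) (sgO g).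
Proof.
move=> f; apply: hfun_ext => z zH; have mH := inH_mob (smxP g) zH; rewrite !sgOE //.
have [sa [_ m1]] := SL2Z_adj (smxP g).
by rewrite /= -mob_mul ?m1 ?mob1 //; apply: smxP.
Qed.
Definition actg : mact cO dO := @Mact _ _ cO dO (sgO g) (sgO (sinv g)) jO jiO jjiO dd_jO dO_sg sgO_c sgO_K sgO_Ki.
End SgO.

Notation fmO := (fm cO dO bO).
Notation XmO := (Xm cO dO bO).
Notation amO := (am dO).
Notation bmO := (bm bO).
Definition pivg (g : SL) : V hfun -> V hfun := piv bO (actg g).

(** The order is that of a right action, in accordance with the cocycle rule for [jac]. *)
Lemma pivg_comp x y v : pivg y (pivg x v) = pivg (smul x y) v.
Proof.
apply: (piv_comp dO_D dO_M dO_c dO_b) => [f|] /=; apply: hfun_ext => z zH;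
  have mH := inH_mob (smxP y) zH.
  by rewrite !sgOE //= mob_mul //; apply: smxP.
by rewrite hfM // sgOE // !jOE //= jac_mul // 1?mulrC //; apply: smxP.
Qed.

(** * Elements as vectors of the Fock space *)

Section InputBound.
Variables (O : comNzRingType) (beta : O).

(* [fmode] and [Amode] are truncated in terms of |lambda| of the input monomial. *)
Definition lbz (L : int) (v : V O) := forall q, L < (wts false q)%:Z -> v q = 0.

Lemma lbz_neg L v : lbz L v -> L < 0 -> v = 0.
Proof. by move=> h l0; apply/funext => q; apply: h; lia. Qed.

Lemma bm_lbz L v n : lbz L v -> lbz (L - Num.max 0 n) (bm beta n v).
Proof.
move=> h q; case: n => [[|n]|n] hq.
- by rewrite /= /mu h ?mulr0 //; move: hq; lia.
- by rewrite bm_pos h ?mulr0 ?oppr0 // wts_add /=; move: hq; lia.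
- rewrite bm_neg; case: ifP => // hp; apply: h; have := wts_sub false hp; move: hq; rewrite /=; lia.
Qed.

Arguments bm_lbz [L v] n _ _ _.

Lemma SopS B i k v : Sop beta B i.+1 k v = \sum_(n <- nzrange B) Sop beta B i (k - n) (bm beta n v).
Proof. by apply: eq_bigr => n _; rewrite Sop_bm. Qed.

Lemma nzrange_neq0 B n : n \in nzrange B -> n != 0.
Proof. by rewrite /nzrange mem_cat => /orP[] /mapP[m _ ->]. Qed.

(** Annihilating modes of b consume a-variables, so their total degree, and with it k, is at most
    the a-weight of the input. *)
Lemma Sop_inz B i (k : int) v (L : int) : lbz L v -> L < k -> Sop beta B i k v = 0.
Proof.
elim: i k v L => [|i IH] k v L h hk.
  by rewrite /=; case: eqP => // k0; apply: (lbz_neg h); rewrite -k0.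
rewrite SopS big_seq big1 // => n /nzrange_neq0 n0; apply: (IH (k - n) _ _ (bm_lbz n h)); lia.
Qed.

(** At most L factors annihilate, with total degree at most L; the creating ones then have total
    degree at most L - k, and so their number is at most L - k. This explains the truncation in
    [fmode]. *)
Lemma Sop_inbig B i (k : int) v (L : int) : lbz L v -> 2 * L - k < i%:Z -> Sop beta B i k v = 0.
Proof.
elim: i k v L => [|i IH] k v L h hk.
  by rewrite /=; case: eqP => // k0; apply: (lbz_neg h); lia.
rewrite SopS big_seq big1 // => n /nzrange_neq0 n0; apply: (IH (k - n) _ _ (bm_lbz n h)); lia.
Qed.

Lemma Sop_instab B B' i (k : int) v (L : int) : lbz L v -> L <= B%:Z -> L - k <= B%:Z -> L <= B'%:Z -> L - k <= B'%:Z ->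
  Sop beta B i k v = Sop beta B' i k v.
Proof.
elim: i k v L => [|i IH] k v L h h1 h2 h3 h4 //.
pose C := `|(Num.max 0 (Num.max L (L - k)))%R|%N.
have hvan A n : (C < `|n|)%N -> Sop beta A i (k - n) (bm beta n v) = 0.
  move=> hn; have hb := bm_lbz n h; case: n hn hb => n hn hb.
    by rewrite (lbz_neg hb) ?(hop0 (hop_Sop _ _ _ _)) //; move: hn; rewrite /C; lia.
  by apply: (Sop_inz _ _ hb); move: hn; rewrite /C; lia.
rewrite !SopS; apply/funext => p.
rewrite (@nz_trunc _ (fun n => Sop beta B i (k - n) (bm beta n v)) p B C); last first.
  - by move=> n hn; rewrite hvan.
  - by rewrite /C; lia.
rewrite (@nz_trunc _ (fun n => Sop beta B' i (k - n) (bm beta n v)) p B' C); last first.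
  - by move=> n hn; rewrite hvan.
  - by rewrite /C; lia.
rewrite !fct_sumE; apply: eq_bigr => n _; congr (_ p); apply: (IH (k - n) _ _ (bm_lbz n h)); lia.
Qed.

Lemma lbz_mono q f : lbz (wts false q)%:Z (mono q f).
Proof. by move=> p; rewrite /mono; case: eqP => // ->; rewrite ltxx. Qed.

Variables (F : numFieldType) (io : {rmorphism F -> O}) (d : O -> O).

Lemma fm_inE f (k : int) v (L : int) B : lbz L v -> L <= B%:Z -> L - k <= B%:Z -> 2 * L - k <= B%:Z ->
  fm io d beta f k v = \sum_(i < B.+1) mu (ifact io i * iter i d f) (Sop beta B i k v).
Proof.
move=> h h1 h2 h3; apply/funext => p.
pose B' := maxn B.+1 (2 * wt p + `|k|).+1.
rewrite (@fmE _ _ _ _ _ _ _ _ _ B') /fmt ?fct_sumE; last by rewrite /B'; lia.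
rewrite (@ord_trunc _ (fun i => mu (ifact io i * iter i d f) (Sop beta B' i k v) p) B' B.+1).
- apply: eq_bigr => i _; congr (mu _ _ p); apply: (Sop_instab _ h); rewrite /B'; lia.
- by rewrite /B'; lia.
- by move=> i hi; rewrite (@Sop_inbig _ _ _ _ L) ?(hop0 (hop_mu _)) //; lia.
Qed.

Lemma fm_inz f (k : int) v (L : int) : lbz L v -> L < k -> fm io d beta f k v = 0.
Proof.
move=> h hk; pose B := (`|L| + `|k| + `|L|)%N.
rewrite (@fm_inE _ _ _ L B) //; try by rewrite /B; lia.
by apply: big1 => i _; rewrite (@Sop_inz _ _ _ _ L) ?(hop0 (hop_mu _)).
Qed.
End InputBound.

Definition wft (t : term) := [/\ is_part t.1.1, is_part t.1.2 & holo t.2].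
Definition wfe (v : elt) := List.Forall wft v.
Definition tsem (t : term) : V hfun := mono (to_pp t.1) (toO t.2).
Definition sem (v : elt) : V hfun := \sum_(t <- v) tsem t.

Lemma wfe_cat u v : wfe u -> wfe v -> wfe (u ++ v).
Proof. by move=> hu hv; apply/List.Forall_app. Qed.
Lemma wfe1 t : wft t -> wfe [:: t]. Proof. by move=> h; constructor. Qed.
Lemma sem_cat u v : sem (u ++ v) = sem u + sem v. Proof. exact: big_cat. Qed.
Lemma sem1 t : sem [:: t] = tsem t. Proof. exact: big_seq1. Qed.
Lemma wfe_flatten (T : Type) (r : seq T) (f : T -> elt) : (forall x, List.In x r -> wfe (f x)) ->
  wfe (flatten (map f r)).
Proof.
elim: r => [|x r IH] h /=; first by constructor.
by apply: wfe_cat; [apply: h; left|apply: IH => y hy; apply: h; right].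
Qed.
Lemma sem_flatten (T : Type) (r : seq T) (f : T -> elt) : sem (flatten (map f r)) = \sum_(x <- r) sem (f x).
Proof. by elim: r => [|x r IH] /=; rewrite ?big_nil ?[LHS]big_nil // big_cons sem_cat IH. Qed.

(** The operation on lists of terms computes the Fock space operator; together with [lift_sem] this
    transports the formulas of the statement term by term. *)
Definition opsem (o : term -> elt) (X : V hfun -> V hfun) :=
  forall t, wft t -> wfe (o t) /\ sem (o t) = X (tsem t).

Lemma lift_sem o X k v : hop k X -> opsem o X -> wfe v -> wfe (Defs.lift o v) /\ sem (Defs.lift o v) = X (sem v).
Proof.
move=> hX ho hv; elim: hv => [|t u ht hu [w s]].
  by rewrite /sem !big_nil (hop0 hX); split=> //; constructor.
have [w' s'] := ho t ht; rewrite /Defs.lift /= -/(Defs.lift o u); split; first exact: wfe_cat.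
by rewrite sem_cat s s' {2}/sem big_cons (hopD hX).
Qed.

Lemma toO_M f g : holo f -> holo g -> toO (fun z => f z * g z) = toO f * toO g.
Proof.
move=> hf hg; apply: (toO_eq (holoM hf hg)) => z zH.
by rewrite (hfM (toO f) (toO g) zH) (toOE hf zH) (toOE hg zH).
Qed.
Lemma toO_N f : holo f -> toO (fun z => - f z) = - toO f.
Proof. by move=> hf; apply: (toO_eq (holoN hf)) => z zH; rewrite (hfN _ zH) (toOE hf zH). Qed.
Lemma toO_c k : toO (fun=> k) = cO k.
Proof. by apply: (toO_eq (holo_cst k)) => z zH; rewrite (cOE _ zH). Qed.
Lemma toO_nat n f : holo f -> toO (fun z => n%:R * f z) = n%:R * toO f.
Proof. by move=> hf; rewrite (toO_M (holo_cst _) hf) toO_c (rmorph_nat cO). Qed.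
Lemma toO_der f : holo f -> toO (der f) = dO (toO f).
Proof.
move=> hf; apply: (toO_eq (@holo_der f hf)) => z zH; rewrite (dOE _ zH).
have h := cdiff_ext zH (fun w wH => esym (toOE hf wH)) (holo_cdiff hf zH).
by rewrite (cdiff_der h).
Qed.
Lemma holo_dern i f : holo f -> holo (dern i f).
Proof. by move=> hf; elim: i => [|i IH]; [exact: hf|exact: (@holo_der (dern i f) IH)]. Qed.
Lemma toO_dern i f : holo f -> toO (dern i f) = iter i dO (toO f).
Proof.
move=> hf; elim: i => [|i IH]; first by [].
by rewrite [LHS](toO_der (holo_dern (i := i) hf)) IH.
Qed.

Lemma to_pp_ins1 n l m : is_part l -> is_part m -> to_pp (ins n.+1 l, m) = padd (false, n) (to_pp (l, m)).
Proof.
move=> hl hm; rewrite /to_pp /padd /upd /sel /=; congr pair; apply: val_inj.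
by rewrite /= !insubdK //; apply: is_part_ins.
Qed.
Lemma to_pp_ins2 n l m : is_part l -> is_part m -> to_pp (l, ins n.+1 m) = padd (true, n) (to_pp (l, m)).
Proof.
move=> hl hm; rewrite /to_pp /padd /upd /sel /=; congr pair; apply: val_inj.
by rewrite /= !insubdK //; apply: is_part_ins.
Qed.
Lemma to_pp_rem1 n l m : is_part l -> is_part m -> to_pp (rem n.+1 l, m) = psub (false, n) (to_pp (l, m)).
Proof.
move=> hl hm; rewrite /to_pp /psub /upd /sel /=; congr pair; apply: val_inj.
by rewrite /= !insubdK //; apply: is_part_rem.
Qed.
Lemma to_pp_rem2 n l m : is_part l -> is_part m -> to_pp (l, rem n.+1 m) = psub (true, n) (to_pp (l, m)).
Proof.
move=> hl hm; rewrite /to_pp /psub /upd /sel /=; congr pair; apply: val_inj.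
by rewrite /= !insubdK //; apply: is_part_rem.
Qed.
Lemma pcnt_pp1 n l m : is_part l -> pcnt (false, n) (to_pp (l, m)) = count_mem n.+1 l.
Proof. by move=> hl; rewrite /pcnt /= insubdK. Qed.
Lemma pcnt_pp2 n l m : is_part m -> pcnt (true, n) (to_pp (l, m)) = count_mem n.+1 m.
Proof. by move=> hl; rewrite /pcnt /= insubdK. Qed.

Lemma amode_sem k : opsem (amode k) (amO k).
Proof.
move=> [[l m] f] [/= hl hm hf]; case: k => [[|n]|n] /=; rewrite sem1 /tsem /=.
- by rewrite (toO_der hf) (dv_mono dO_c); split; [apply: wfe1; split; [exact: hl|exact: hm|exact: (@holo_der f hf)]|].
- rewrite an_mono (to_pp_rem2 _ hl hm) (pcnt_pp2 _ _ hm) (toO_nat _ hf); split.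
    by apply: wfe1; split; [exact: hl|exact: is_part_rem|exact: (holoZ hf)].
  by case: (count_mem _ m) => [|c] //=; rewrite mul0r; apply/funext => q; rewrite /mono; case: eqP.
- by rewrite cr_mono (to_pp_ins1 _ hl hm); split; [apply: wfe1; split; [exact: is_part_ins|exact: hm|exact: hf]|].
Qed.

Lemma bmode_sem k : opsem (bmode k) (bmO k).
Proof.
move=> [[l m] f] [/= hl hm hf]; case: k => [[|n]|n] /=; rewrite sem1 /tsem /=.
- rewrite mu_mono (toO_M holo_id hf); split.
    by apply: wfe1; split; [exact: hl|exact: hm|exact: (holoM holo_id hf)].
  by congr (mono _ (_ * _)); apply: (toO_eq holo_id) => z zH; rewrite (bOE zH).
- rewrite an_mono (to_pp_rem1 _ hl hm) (pcnt_pp1 _ _ hl) (toO_N (holoZ (k := (count_mem n.+1 l)%:R) hf)).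
  rewrite (toO_nat _ hf); split.
    by apply: wfe1; split; [exact: is_part_rem|exact: hm|exact: (holoN (holoZ hf))].
  case: (count_mem _ l) => [|c] /=; apply/funext => q; rewrite /mono !opprfctE; case: eqP => // _.
  - by rewrite mul0r oppr0.
  - by rewrite oppr0.
  - by rewrite oppr0.
- by rewrite cr_mono (to_pp_ins2 _ hl hm); split; [apply: wfe1; split; [exact: hl|exact: is_part_ins|exact: hf]|].
Qed.

Lemma bprod_sem s t : wft t -> wfe (bprod s t) /\ sem (bprod s t) = foldr (fun n acc => bmO n acc) (tsem t) s.
Proof.
move=> ht; elim: s => [|n s [w e]] /=; first by rewrite sem1; split=> //; apply: wfe1.
by rewrite -e; apply: (lift_sem (hop_bm bO n)) => //; apply: bmode_sem.
Qed.

Lemma tscale_sem (c : fn) v : holo c -> wfe v ->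
  wfe (map (tscale c) v) /\ sem (map (tscale c) v) = mu (toO c) (sem v).
Proof.
move=> hc; elim=> [|t u ht hu [w e]] /=.
  by rewrite /sem !big_nil (hop0 (hop_mu _)); split=> //; constructor.
case: ht => h1 h2 h3; split.
  by constructor; [split; [exact: h1|exact: h2|exact: (holoM hc h3)]|exact: w].
rewrite /sem !big_cons -/(sem _) e (hopD (hop_mu _)); congr (_ + _).
by rewrite /tsem mu_mono -(toO_M hc h3).
Qed.

Lemma Sop_seqs B i k (v : V hfun) :
  \sum_(s <- nzseqs i B | \sum_(n <- s) n == k) foldr (fun n acc => bmO n acc) v s = Sop bO B i k v.
Proof.
elim: i k => [|i IH] k /=; first by rewrite big_mkcond big_seq1 big_nil /= eq_sym.
rewrite big_flatten big_map /=; apply: eq_bigr => n _; rewrite big_map -IH (hop_sum (hop_bm bO n)) /=.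
by apply: eq_bigl => s; rewrite big_cons -subr_eq0 -[RHS]subr_eq0; congr (_ == 0); ring.
Qed.

(** The index shifts by 1 because f_(k) is the coefficient of z^{-k-1}. The input-based truncation
    of [fmode] and the output-based one of [fm] agree by [fm_inE]. *)
Lemma fmode_sem f k : holo f -> opsem (fmode f k) (fmO (toO f) (k + 1)).
Proof.
move=> hf t ht; set B := (2 * sumn t.1.1 + `|k| + 1)%N.
have hc i : holo (fun z => (i`!%:R)^-1 * dern i f z) by exact: (holoZ (holo_dern (i := i) hf)).
split.
  apply: wfe_flatten => i _; apply: wfe_flatten => s _; case: ifP => _; last by constructor.
  by apply: (proj1 (tscale_sem (hc i) _)); have [] := bprod_sem s ht.
rewrite sem_flatten (@fm_inE _ _ _ _ _ _ _ _ (sumn t.1.1)%:Z B); first last.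
- by rewrite /B; lia.
- by rewrite /B; lia.
- by rewrite /B; lia.
- have [hl _ _] := ht; have := @lbz_mono hfun (to_pp t.1) (toO t.2).
  by rewrite /wts /= insubdK.
rewrite -(big_mkord xpredT (fun i => mu (ifact cO i * iter i dO (toO f)) (Sop bO B i (k + 1) (tsem t)))).
rewrite /index_iota subn0; apply: eq_bigr => i _; rewrite sem_flatten -Sop_seqs (hop_sum (hop_mu _)) [RHS]big_mkcond.
apply: eq_bigr => s _; case: ifP => _; last by rewrite /sem big_nil.
have [w <-] := bprod_sem s ht; rewrite (proj2 (tscale_sem (hc i) w)); congr mu.
by rewrite (toO_M (holo_cst _) (holo_dern (i := i) hf)) toO_c (toO_dern _ hf).
Qed.

Lemma iter_dO_c k f i : iter i dO (cO k * f) = cO k * iter i dO f.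
Proof. by elim: i => [|i IH] //=; rewrite IH dO_M dO_c mul0r add0r. Qed.

Lemma fm_cmul k f n v : fmO (cO k * f) n v = mu (cO k) (fmO f n v).
Proof.
apply/funext => p; rewrite /mu !fmU /fmt !fct_sumE mulr_sumr; apply: eq_bigr => i _.
by rewrite iter_dO_c /mu; ring.
Qed.

Lemma holo_jac2 g : holo (fun z => ((gc g)%:~R * z + (gd g)%:~R) ^+ 2).
Proof. exact: (holoX (n := 2) (@holo_jac g)). Qed.

Lemma toO_jac2 g : toO (fun z => ((gc (smx g))%:~R * z + (gd (smx g))%:~R) ^+ 2) = jO g ^+ 2.
Proof. by apply: (toO_eq (@holo_jac2 (smx g))) => z zH; rewrite (hfX _ _ zH) (jOE g zH). Qed.

(** The derivative of (cb + d)^2 is 2c^2 b + 2cd, and the constant has a mode in degree 0 only,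
    where the factor k kills it. Thus the shift in [Xm] is the summand 2c^2 b_{-1} of the
    transformed a_{-1}. *)
Lemma fm_djac2 g k v : mu k%:~R (fmO (dO (jO g ^+ 2)) k v) = mu (cO (2 * (gc (smx g))%:~R ^+ 2 * k%:~R)) (bmO k v).
Proof.
have -> : dO (jO g ^+ 2) = cO (2 * (gc (smx g))%:~R ^+ 2) * bO + cO (2 * (gc (smx g))%:~R * (gd (smx g))%:~R).
  rewrite expr2 dO_M dO_j jO_lin expr2 !rmorphM rmorph_nat /=; ring.
rewrite fmD ?fm_cmul; [|exact: dO_D].
rewrite (fm_beta dO_c dO_b) (fm_const _ dO_c) ?dO_c // (hopD (hop_mu _)) mu_mu.
rewrite -(rmorph_int cO) -rmorphM mulrC /=; case: eqP => [->|_]; last by rewrite (hop0 (hop_mu _)) addr0.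
by rewrite /= rmorph0 mulr0 !mu0 addr0.
Qed.

Lemma am_big j l m f : is_part l -> is_part m -> (sumn m < j)%N -> amO (Posz j) (tsem ((l, m), f)) = 0.
Proof.
move=> hl hm; case: j => [|j] hj //; rewrite /tsem /= an_mono; case: ifP => // hp.
have := wts_sub true hp; rewrite /wts /= insubdK //; lia.
Qed.

(** Far negative j drop out because the mode of h then exceeds the a-weight of the input, and large
    positive j because a_j exceeds its b-weight. *)
Lemma Amode_sem g k : opsem (Amode (smx g) k) (XmO (jO g ^+ 2) k).
Proof.
move=> t ht; have := ht; case: t ht => [[l m] f] ht [/= hl hm hf].
rewrite /Amode; set h : fn := fun z => _ ^+ 2; set L := (_ + 1)%N.
have hh : holo h by exact: (@holo_jac2 (smx g)).
have fs j : opsem (fmode h (k - j - 1)) (fmO (jO g ^+ 2) (k - j)).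
  by have := fmode_sem (k - j - 1) hh; rewrite subrK toO_jac2.
have s1 j : wfe (Defs.lift (amode j) (fmode h (k - j - 1) ((l, m), f))) /\
    sem (Defs.lift (amode j) (fmode h (k - j - 1) ((l, m), f))) = amO j (fmO (jO g ^+ 2) (k - j) (tsem ((l, m), f))).
  have [w <-] := fs j _ ht; exact: (lift_sem (hop_am dO_D j) (amode_sem j) w).
have s2 j : wfe (Defs.lift (fmode h (k - j - 1)) (amode j ((l, m), f))) /\
    sem (Defs.lift (fmode h (k - j - 1)) (amode j ((l, m), f))) = fmO (jO g ^+ 2) (k - j) (amO j (tsem ((l, m), f))).
  have [w <-] := amode_sem j ht; exact: (lift_sem (hop_fm cO dO bO _ _) (fs j) w).
have [wb eb] := bmode_sem k ht.
have [w3 e3] := tscale_sem (holo_cst (2 * (gc (smx g))%:~R ^+ 2 * (- k)%:~R)) wb.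
split.
  apply: wfe_cat; first by apply: wfe_flatten => j _; case: (s1 j).
  by apply: wfe_cat => //; apply: wfe_flatten => j _; case: (s2 j).
set v := tsem _ in s1 s2 eb *.
rewrite [LHS]sem_cat [X in _ + X = _]sem_cat e3 eb toO_c.
have -> : sem (flatten [seq Defs.lift (amode j) (fmode h (k - j - 1) ((l, m), f)) | j <- [seq Negz n | n <- iota 0 L]])
    = \sum_(n <- iota 0 L) amO (Negz n) (fmO (jO g ^+ 2) (k - Negz n) v).
  by rewrite sem_flatten big_map; apply: eq_bigr => n _; case: (s1 (Negz n)).
have -> : sem (flatten [seq Defs.lift (fmode h (k - j - 1)) (amode j ((l, m), f)) | j <- [seq Posz n | n <- iota 0 (sumn m).+1]])
    = \sum_(n <- iota 0 (sumn m).+1) fmO (jO g ^+ 2) (k - Posz n) (amO (Posz n) v).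
  by rewrite sem_flatten big_map; apply: eq_bigr => n _; case: (s2 (Posz n)).
apply/funext => p; set L' := (wt p + `|k| + 1 + L + (sumn m).+1)%N.
rewrite (@XmE _ _ _ _ _ _ _ _ _ L'); last by rewrite /L'; lia.
rewrite /Xmt fm_djac2 !vx /Zs !addrfctE !fct_sumE addrA.
congr (_ + _); last by rewrite intrN mulrN rmorphN muN.
rewrite addrC; congr (_ + _).
  rewrite (@ord_trunc _ (fun j => nord cO dO bO (jO g ^+ 2) k (Posz j) v p) L' (sumn m).+1).
  - by rewrite -(big_mkord xpredT (fun j => nord cO dO bO (jO g ^+ 2) k (Posz j) v p)) /index_iota subn0.
  - by rewrite /L'; lia.
  - move=> j hj; have a0 := am_big f hl hm hj; rewrite -/v in a0.
    by rewrite /nord (_ : (j%:Z < 0) = false) // a0 (hop0 (hop_fm _ _ _ _ _)).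
rewrite (@ord_trunc _ (fun j => nord cO dO bO (jO g ^+ 2) k (Negz j) v p) L' L).
- by rewrite -(big_mkord xpredT (fun j => nord cO dO bO (jO g ^+ 2) k (Negz j) v p)) /index_iota subn0.
- by rewrite /L'; lia.
- move=> j hj; rewrite /nord /= (@fm_inz _ _ _ _ _ _ _ _ (sumn l)%:Z).
  + by rewrite (hop0 (hop_cr _ (false, j))).
  + by have := @lbz_mono hfun (to_pp (l, m)) (toO f); rewrite /wts /= insubdK.
  + by move: hj; rewrite /L /=; lia.
Qed.

Lemma pi_term_sem g : opsem (pi_term (smx g)) (pivg g).
Proof.
move=> t ht; have := ht; case: t ht => [[l m] f] ht [/= hl hm hf].
rewrite /pivg /tsem (piv_mono _ dO_D) /pimono /= !insubdK //.
elim: l hl {ht} => [|n l IH] hl /=; last first.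
  have hl' : is_part l by case/andP: hl => /= sl /andP[_ al]; rewrite /is_part (path_sorted sl).
  have [w <-] := IH hl'; exact: (lift_sem (hop_Xm cO bO dO_D _ _) (Amode_sem g _) w).
elim: m hm => [|n m IH] hm /=; last first.
  have hm' : is_part m by case/andP: hm => /= sl /andP[_ al]; rewrite /is_part (path_sorted sl).
  have [w <-] := IH hm'.
  have e : toO (mob (smx g)) = sgO g bO.
    apply: (toO_eq (@holo_mob _ (smxP g))) => z zH; rewrite (sgOE g _ zH) bOE //.
    by apply: inH_mob => //; apply: smxP.
  have := fmode_sem (- n%:Z - 1) (@holo_mob _ (smxP g)); rewrite subrK e => fs.
  exact: (lift_sem (hop_fm cO dO bO _ _) fs w).
have hfg : holo (fun z => f (mob (smx g) z)).
  exact: (holo_comp (fun z zH => inH_mob (smxP g) zH) hf (@holo_mob _ (smxP g))).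
rewrite sem1 /tsem /=; split; first by apply: wfe1; split=> //; exact: hfg.
have -> : to_pp ([::], [::]) = pp0 by apply: (to_pp_val pp0).
congr (mono _ _); apply: (toO_eq hfg) => z zH; rewrite (sgOE g _ zH) toOE //.
by apply: inH_mob => //; apply: smxP.
Qed.

Lemma piact_sem g v : wfe v -> wfe (piact (smx g) v) /\ sem (piact (smx g) v) = pivg g (sem v).
Proof. by move=> hv; apply: (lift_sem (hop_piv bO dO_D (actg g)) (pi_term_sem g) hv). Qed.

Lemma sem_coef v p z : wfe v -> inH z -> sem v p z = coefv v (val p.1, val p.2) z.
Proof.
move=> hv zH; rewrite /sem /coefv fct_sumE (hf_sum _ _ _ zH) [RHS]big_mkcond.
elim: hv => [|t u [h1 h2 h3] hu IH]; first by rewrite !big_nil.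
rewrite !big_cons IH; congr (_ + _); rewrite /tsem /mono.
have -> : (p == to_pp t.1) = (t.1 == (val p.1, val p.2)).
  apply/eqP/eqP => [->|->]; first by rewrite to_ppK.
  by rewrite to_pp_val.
by case: eqP => _; rewrite ?hf0 // (toOE h3 zH).
Qed.

Lemma coefv_npart v p z : wfe v -> ~~ (is_part p.1 && is_part p.2) -> coefv v p z = 0.
Proof.
move=> hv np; rewrite /coefv; elim: hv => [|t u [h1 h2 h3] hu IH]; first by rewrite big_nil.
by rewrite big_cons IH; case: eqP => // e; move: np; rewrite -e h1 h2.
Qed.

Lemma eqvP u v : wfe u -> wfe v -> eqv u v <-> sem u = sem v.
Proof.
move=> hu hv; split=> [h|h].
  apply/funext => p; apply: hfun_ext => z zH; by rewrite !sem_coef ?h.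
move=> p z zH; have [/andP[h1 h2]|np] := boolP (is_part p.1 && is_part p.2); last by rewrite !coefv_npart.
by have := sem_coef (to_pp p) hu zH; rewrite h sem_coef // to_ppK // => ->.
Qed.

Lemma weight_eltP N v : weight_elt N v -> wfe v /\ hv N (sem v).
Proof.
move=> [ha hf]; elim: v ha hf => [|t v IH] /=.
  by move=> _ _; rewrite /sem big_nil; split; [constructor|].
move=> /andP[/and3P[h1 h2 /eqP h3] ha] /List.Forall_cons_iff[ht hf]; have [w s] := IH ha hf.
split; first by constructor.
move=> q qN; rewrite /sem big_cons addrfctE -/(sem v) (s q qN) addr0 /tsem /mono; case: eqP => // e.
by move: qN; rewrite e /wt /wts /= !insubdK // h3 eqxx.
Qed.

(** A right inverse of [sem] in weight N, used to write basis vectors as formal sums. *)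
Definition toelt (N : nat) (v : V hfun) : elt :=
  [seq ((val p.1, val p.2), v p : fn) | p <- pps N].

Lemma toelt_weight N v : weight_elt N (toelt N v).
Proof.
split.
  rewrite all_map; apply/allP => p; rewrite mem_pps /= => /eqP <-.
  by rewrite (valP p.1) (valP p.2) /= eqxx.
rewrite /toelt; elim: (pps N) => [|p s IH] /=; constructor => //=; exact: hval_holo.
Qed.

Lemma toelt_sem N v : hv N v -> sem (toelt N v) = v.
Proof.
move=> h; apply/funext => q; rewrite /sem /toelt big_map fct_sumE.
under eq_bigr => p _ do rewrite /tsem /= to_pp_val /mono toO_id.
have [qN|qN] := boolP (q \in pps N).
  rewrite (bigD1_seq q) ?pps_uniq //= eqxx big1 ?addr0 // => p pq.
  by rewrite eq_sym (negPf pq).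
rewrite big_seq big1 ?h //; first by rewrite -mem_pps.
by move=> p hp; case: eqP => // e; move: qN; rewrite e hp.
Qed.

(** * q-expansions *)

Definition rdiff (K : realType) (f : K -> K) (x l : K) := forall e : K, 0 < e ->
  exists2 d : K, 0 < d & forall h : K, `|h| < d -> `|f (x + h) - f x - h * l| <= e * `|h|.

Lemma is_derive_rdiff (K : realType) (f : K -> K) (x l : K) : is_derive x 1 f l -> rdiff f x l.
Proof.
move=> [df dl] e e0.
have cv : ((fun h : K => h^-1 *: (f (h *: 1 + x) - f x) : K) @ (0 : K)^' --> (l : K))%classic.
  by rewrite -dl; exact: df.
have /cvgrPdist_lt/(_ e e0) := cv.
move=> -[/= d d0 hd]; exists d => // h hh; have [->|h0] := eqVneq h 0.
  by rewrite addr0 subrr mul0r subrr normr0 mulr0.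
have := hd h; rewrite /ball_ /= sub0r normrN => /(_ hh h0) /ltW.
have -> : f (x + h) - f x - h * l = - (h * (l - h^-1 *: (f (h *: 1 + x) - f x))).
  by rewrite /GRing.scale /= mulr1 [h + x]addrC; field.
by rewrite normrN normrM mulrC => hh2; apply: ler_wpM2r; rewrite ?normr_ge0.
Qed.

Definition tau : R := 2 * pi.
Lemma tau_gt0 : 0 < tau. Proof. by rewrite mulr_gt0 // pi_gt0. Qed.

(** The function e^{2 pi i z}. *)
Definition ee (z : C) : C :=
  complex.Complex (expR (- (tau * Im z)) * cos (tau * Re z)) (expR (- (tau * Im z)) * sin (tau * Re z)).

Lemma qN_ee N z : qN N z = ee (z / N%:R).
Proof.
have -> : z / N%:R = complex.Complex (Re z / N%:R) (Im z / N%:R) :> C.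
  by rewrite -rC_nat -rCV; apply: C_eq; rewrite (ReM, ImM) /= ?mulr0 ?subr0 ?add0r.
by rewrite /qN /ee /= /tau !mulrA.
Qed.

Lemma eeD (x y : C) : ee (x + y) = ee x * ee y.
Proof.
have E : expR (- (tau * Im (x + y))) = expR (- (tau * Im x)) * expR (- (tau * Im y)).
  by rewrite ImD mulrDr opprD exp.expRD.
have T : tau * Re (x + y) = tau * Re x + tau * Re y by rewrite ReD mulrDr.
by apply: C_eq; [rewrite ReM /= E T trigo.cosD|rewrite ImM /= E T trigo.sinD]; ring.
Qed.
Lemma nc_ee z : nc (ee z) = expR (- (tau * Im z)).
Proof.
rewrite /nc /ee /= !exprMn -mulrDr cos2Dsin2 mulr1 sqrtr_sqr ger0_norm // expR_ge0 //.
Qed.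
Lemma ee_neq0 z : ee z != 0. Proof. by rewrite -nc_gt0 nc_ee expR_gt0. Qed.
Lemma ee0 : ee 0 = 1.
Proof. by apply: C_eq; rewrite /= !mulr0 oppr0 exp.expR0 ?cos0 ?sin0 mul1r. Qed.
Lemma ee1 : ee 1 = 1.
Proof. by apply: C_eq; rewrite /= mulr0 oppr0 exp.expR0 mul1r mulr1 /tau mulr_natl ?cos2pi ?sin2pi. Qed.
Lemma ee_nat (n : nat) : ee n%:R = 1.
Proof. by elim: n => [|n IH]; rewrite ?ee0 // -natr1 eeD IH ee1 mulr1. Qed.
Lemma eeN z : ee (- z) = (ee z)^-1.
Proof. by apply: (mulfI (ee_neq0 z)); rewrite -eeD subrr ee0 mulfV // ee_neq0. Qed.
Lemma eeB x y : ee (x - y) = ee x / ee y. Proof. by rewrite eeD eeN. Qed.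
Lemma ee_int (n : int) : ee n%:~R = 1.
Proof. by case: n => n; rewrite ?NegzE ?mulrNz ?eeN ee_nat ?invr1. Qed.
Lemma eeX z n : ee z ^+ n = ee (n%:R * z).
Proof. by elim: n => [|n IH]; rewrite ?expr0 ?mul0r ?ee0 // exprS IH -natr1 mulrDl mul1r addrC eeD. Qed.

Lemma ee_eq1 (z : C) : `|Re z| <= 1 / 2 -> ee z = 1 -> z = 0.
Proof.
move=> xz e1; have n1 : nc (ee z) = 1 by rewrite e1 nc1.
have i0 : Im z = 0.
  have h : expR (- (tau * Im z)) = expR 0 by rewrite -nc_ee n1 exp.expR0.
  have /eqP := expR_inj h; rewrite oppr_eq0 mulf_eq0 (gt_eqF tau_gt0) /= => /eqP //.
apply: C_eq => //=; have := congr1 Re e1; rewrite /= i0 mulr0 oppr0 exp.expR0 mul1r.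
have -> : cos (tau * Re z) = cos (tau * `|Re z|).
  by have [r0|r0] := leP 0 (Re z); [rewrite ger0_norm|rewrite ltr0_norm // mulrN cosN].
rewrite -cos0 => /cos_inj h; apply/eqP; rewrite -normr_eq0.
have := h _ _; rewrite !in_itv /= lexx pi_ge0 mulr_ge0 ?(ltW tau_gt0) //=.
have -> : tau * `|Re z| <= pi by rewrite /tau; have := pi_gt0 R; nra.
by move=> /(_ isT isT)/eqP; rewrite mulf_eq0 (gt_eqF tau_gt0).
Qed.

Lemma rdiff_scale (f : R -> R) (k l : R) : rdiff f 0 l -> forall e : R, 0 < e ->
  exists2 d : R, 0 < d & forall h : R, `|h| < d -> `|f (k * h) - f 0 - h * (k * l)| <= e * `|h|.
Proof.
move=> H e e0; have k0 := normr_ge0 k; have k1 : 0 < `|k| + 1 by lra.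
have [|d d0 hd] := H (e / (`|k| + 1)); first by rewrite divr_gt0.
exists (d / (`|k| + 1)) => [|h]; first by rewrite divr_gt0.
rewrite ltr_pdivlMr // => hh; have := hd (k * h); rewrite add0r normrM => /(_ _)/wrap[].
  by have := normr_ge0 h; nra.
rewrite -[k * h * l]mulrA [k * (h * l)]mulrCA => q; apply: le_trans q _.
rewrite mulrA ler_wpM2r // mulrAC ler_pdivrMr //; nra.
Qed.

Lemma cdiff_ee0 : cdiff ee 0 (iC * rC tau).
Proof.
move=> e e0; have e4 : 0 < Num.min (e / 8) 1 by rewrite lt_min divr_gt0 ?ltr01.
(* The relative error granted to exp, cos and sin: the real part costs 3k, the imaginary part 2k,
   and 5k < e. *)
set k := Num.min (e / 8) 1 in e4 *.
have k1 : k <= 1 by rewrite ge_min lexx orbT.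
have k8 : k <= e / 8 by rewrite ge_min lexx.
have t0 := tau_gt0.
have [d1 d10 h1] := rdiff_scale (- tau) (is_derive_rdiff (is_derive_expR 0)) e4.
have [d2 d20 h2] := rdiff_scale tau (is_derive_rdiff (is_derive_cos 0)) e4.
have [d3 d30 h3] := rdiff_scale tau (is_derive_rdiff (is_derive_sin 0)) e4.
pose d := Num.min (Num.min d1 (Num.min d2 d3)) (k / (tau + 1) ^+ 2).
have d0 : 0 < d by rewrite !lt_min d10 d20 d30 divr_gt0 // exprn_gt0 //; lra.
exists d => // h hh; rewrite add0r ee0.
set a := Re h; set b := Im h.
have ha : `|a| <= nc h := nc_Re h; have hb : `|b| <= nc h := nc_Im h.
have dd1 : nc h < d1 by apply: lt_le_trans hh _; rewrite !ge_min lexx.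
have dd2 : nc h < d2 by apply: lt_le_trans hh _; rewrite !ge_min lexx !orbT.
have dd3 : nc h < d3 by apply: lt_le_trans hh _; rewrite !ge_min lexx !orbT.
have dd4 : nc h * (tau + 1) ^+ 2 < k.
  rewrite -ltr_pdivlMr ?exprn_gt0 //; last lra.
  by apply: lt_le_trans hh _; rewrite !ge_min lexx !orbT.
have {h1} := h1 b (le_lt_trans hb dd1); rewrite exp.expR0 => h1.
have {h2} := h2 a (le_lt_trans ha dd2); rewrite cos0 sin0 oppr0 !mulr0 subr0 => h2.
have {h3} := h3 a (le_lt_trans ha dd3); rewrite sin0 cos0 subr0 mulr1 => h3.
rewrite mulr1 in h1.
apply: le_trans (nc_le _) _.
rewrite !(ReD, ImD, ReN, ImN) !ReM !ImM /= -/a -/b !mul0r !mul1r ?subr0 ?sub0r ?add0r ?mulr0 ?addr0 ?oppr0.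
rewrite -[- (tau * b)]mulNr.
set E := expR _ in h1 *; set c := cos _ in h2 *; set s := sin _ in h3 *.
have c1 : `|c| <= 1 by rewrite ler_norml cos_geN1 cos_le1.
have hn := nc_ge0 h; have hk := nc_ge0 h.
have B1 : `|E * c - 1 - (- (b * tau))| <= 3 * k * nc h.
  have -> : E * c - 1 - (- (b * tau)) = (E - 1 - b * - tau) * c + (1 - b * tau) * (c - 1) by ring.
  apply: le_trans (ler_normD _ _) _; rewrite !normrM.
  have q1 : `|E - 1 - b * - tau| * `|c| <= k * nc h.
    by apply: le_trans (ler_pM _ _ h1 c1) _; rewrite ?normr_ge0 // mulr1 ler_wpM2l // ltW.
  have q2 : `|1 - b * tau| <= 2.
    apply: le_trans (ler_normB _ _) _; rewrite normr1 normrM (gtr0_norm t0).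
    have : `|b| * tau <= 1 by nra.
    by lra.
  have q3 : `|1 - b * tau| * `|c - 1| <= 2 * (k * nc h).
    apply: ler_pM; rewrite ?normr_ge0 //; apply: le_trans h2 _; rewrite ler_wpM2l // ltW //.
  lra.
have B2 : `|E * s - a * tau| <= 2 * k * nc h.
  have -> : E * s - a * tau = (E - 1) * s + (s - a * tau) by ring.
  apply: le_trans (ler_normD _ _) _; rewrite !normrM.
  have q1 : `|E - 1| <= (tau + 1) * nc h.
    have -> : E - 1 = (E - 1 - b * - tau) - b * tau by ring.
    apply: le_trans (ler_normB _ _) _; rewrite normrM (gtr0_norm t0); nra.
  have q2 : `|s| <= (tau + 1) * nc h.
    have -> : s = (s - a * tau) + a * tau by ring.
    apply: le_trans (ler_normD _ _) _; rewrite normrM (gtr0_norm t0); nra.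
  have q3 : `|E - 1| * `|s| <= k * nc h.
    apply: le_trans (ler_pM _ _ q1 q2) _; rewrite ?normr_ge0 //.
    have -> : (tau + 1) * nc h * ((tau + 1) * nc h) = (nc h * (tau + 1) ^+ 2) * nc h by ring.
    by rewrite ler_wpM2r // ltW.
  have q4 : `|s - a * tau| <= k * nc h by apply: le_trans h3 _; rewrite ler_wpM2l // ltW.
  lra.
have B3 : (3 * k + 2 * k) * nc h <= e * nc h by apply: ler_wpM2r => //; lra.
by rewrite sub0r; apply: le_trans (lerD B1 B2) _; rewrite -mulrDl.
Qed.

Lemma cdiff_ee (z : C) : cdiff ee z (iC * rC tau * ee z).
Proof.
have h := cdiff_comp (g := fun w => w - z) (cdiffD (cdiff_id z) (cdiff_cst (- z) z)) (f := ee) (l := iC * rC tau).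
have h' (q : cdiff ee (z - z) (iC * rC tau)) := cdiffZ (ee z) (h q); move: h'; rewrite addr0 mul1r subrr [ee z * (iC * _)]mulrC => /(_ cdiff_ee0).
by apply: cdiff_eq => w; rewrite -eeD addrC subrK.
Qed.

Lemma cvgnP (u : nat -> C) (l : C) : (u @ \oo --> l)%classic <->
  forall e : R, 0 < e -> exists n0, forall n, (n0 <= n)%N -> nc (u n - l) < e.
Proof.
split=> [/(@cvgrPdist_lt _ (R[i]^o)) H e e0|H].
  have [n0 _ hn] := H _ (rC_pos e0); exists n0 => n nn; by have := hn n nn; rewrite distrC ltC.
apply/(@cvgrPdist_lt _ (R[i]^o)) => e /posC[e0 eE]; have [n0 hn] := H _ e0.
by exists n0 => // n /hn h; rewrite distrC eE ltC.
Qed.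

(** * Fourier expansion of periodic functions *)

Definition perd (N : nat) (f : fn) := forall z, inH z -> f (z + N%:R) = f z.
Definition bdab (f : fn) (Y M : R) := forall z, Y <= Im z -> nc (f z) <= M.
(** Equivalent, for holomorphic functions, to having an expansion without negative powers
    ([qh_qexp], [qexp_qh]). In this form the condition is visibly stable under products, sums and,
    by [der_bound], derivatives. *)
Definition qh (N : nat) (f : fn) := [/\ holo f, perd N f & exists Y M, 0 < Y /\ bdab f Y M].
Definition en (N m : nat) (w : C) : C := ee (- (m%:R * w / N%:R)).
Definition coef (N m : nat) (f : fn) : C :=
  N%:R^-1 * cint (fun x => f (pt x 1) * en N m (pt x 1)) 0 N%:R.

Section Expansion.
Variable N : nat.
Hypothesis N0 : (0 < N)%N.

Lemma Nr0 : 0 < N%:R :> R. Proof. by rewrite ltr0n. Qed.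
Lemma Nc0 : N%:R != 0 :> C. Proof. by rewrite pnatr_eq0 -lt0n. Qed.

Lemma ImdivN (z : C) : Im (z / N%:R) = Im z / N%:R.
Proof. by rewrite -rC_nat -rCV ImM /= mulr0 add0r. Qed.
Lemma RedivN (z : C) : Re (z / N%:R) = Re z / N%:R.
Proof. by rewrite -rC_nat -rCV ReM /= mulr0 subr0. Qed.
Lemma Im_natM n (z : C) : Im (n%:R * z) = n%:R * Im z.
Proof. by rewrite -rC_nat ImM /= mul0r addr0. Qed.
Lemma Im_natD n (z : C) : Im (z + n%:R) = Im z.
Proof. by rewrite -rC_nat ImD addr0. Qed.

Lemma nc_en m w : nc (en N m w) = expR (tau * m%:R * Im w / N%:R).
Proof. by rewrite nc_ee ImN ImdivN Im_natM mulrN opprK !mulrA. Qed.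
Lemma en_per m w : en N m (w + N%:R) = en N m w.
Proof.
rewrite /en; have -> : m%:R * (w + N%:R) / N%:R = m%:R * w / N%:R + m%:R by field; exact: Nc0.
by rewrite opprD eeD [X in _ * X]eeN ee_nat invr1 mulr1.
Qed.
Lemma cdiff_en m (w : C) : exists l, cdiff (en N m) w l.
Proof.
have c1 : cdiff (fun w : C => - (m%:R * w / N%:R)) w (- m%:R / N%:R).
  have := cdiffZ (- m%:R / N%:R) (cdiff_id w); rewrite mulr1; apply: cdiff_eq => t.
  by rewrite !mulNr; congr (- _); rewrite mulrAC.
eexists; exact: (cdiff_comp c1 (cdiff_ee _)).
Qed.

Lemma perd_nat k f z : perd N f -> inH z -> f (z + (k * N)%:R) = f z.
Proof.
move=> pf zH; elim: k => [|k IH]; first by rewrite addr0.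
by rewrite mulSn natrD [N%:R + _]addrC addrA pf // /inH Im_natD.
Qed.

Lemma Im_intD (k : int) (z : C) : Im (z + k%:~R * N%:R) = Im z.
Proof. by rewrite -rC_int -rC_nat -rCM ImD /= addr0. Qed.
Lemma Re_intD (k : int) (z : C) : Re (z + k%:~R * N%:R) = Re z + k%:~R * N%:R.
Proof. by rewrite -rC_int -rC_nat -rCM ReD. Qed.

Lemma perd_int (k : int) f z : perd N f -> inH z -> f (z + k%:~R * N%:R) = f z.
Proof.
move=> pf zH; case: k => n; first by rewrite -natrM perd_nat.
have := @perd_nat n.+1 f (z + (Negz n)%:~R * N%:R) pf; rewrite natrM NegzE mulrNz mulNr subrK => -> //.
by rewrite /inH -mulNr -mulrNz Im_intD.
Qed.

Lemma red_strip (x : R) : exists k : int, 0 <= x + k%:~R * N%:R < N%:R.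
Proof.
exists (- Num.floor (x / N%:R)); have := floor_itv (x / N%:R); rewrite mulrNz mulNr.
move=> /andP[]; rewrite ler_pdivlMr ?Nr0 // ltr_pdivrMr ?Nr0 // intrD mulrDl mul1r => q1 q2.
by apply/andP; split; lra.
Qed.

Lemma expR_small (k : R) : 0 < k -> forall (A e : R), 0 < e -> exists n0 : nat, forall y : R, n0%:R <= y ->
  A * expR (- (k * y)) <= e.
Proof.
move=> k0 A e e0; pose n0 := Num.bound (`|A| / (k * e)); exists n0 => y hy.
have A0 := normr_ge0 A; have ke : 0 < k * e by rewrite mulr_gt0.
have b : `|A| / (k * e) < y.
  by apply: lt_le_trans hy; apply: archi_boundP; rewrite divr_ge0 // ltW.
move: b; rewrite ltr_pdivrMr // => b.
have E : expR (k * y) * expR (- (k * y)) = 1 by rewrite -exp.expRD subrr exp.expR0.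
have y0 : 0 <= y by apply: le_trans hy; rewrite ler0n.
have g1 : k * y <= expR (k * y).
  by apply: le_trans (expR_ge1Dx _); rewrite lerDr ler01.
have e1 := expR_gt0 (- (k * y)).
apply: le_trans (ler_wpM2r (ltW e1) (ler_norm A)) _.
have : `|A| <= e * expR (k * y) by nra.
move=> h; apply: le_trans (ler_wpM2r (ltW e1) h) _; by rewrite -mulrA E mulr1.
Qed.

(** The vertical sides of the rectangle cancel by periodicity. *)
Lemma per_line (g : fn) (y1 y2 : R) z0 : y1 < y2 ->
  (forall w, inR 0 N%:R y1 y2 w -> ccts g w) ->
  (forall w, inR 0 N%:R y1 y2 w -> w != z0 -> exists l, cdiff g w l) ->
  (forall y, y1 <= y <= y2 -> g (pt N%:R y) = g (pt 0 y)) ->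
  cint (fun x => g (pt x y1)) 0 N%:R = cint (fun x => g (pt x y2)) 0 N%:R.
Proof.
move=> y12 gc gd gp; have := goursat Nr0 y12 gc gd; rewrite /oint.
have -> : cint (fun y => g (pt N%:R y)) y1 y2 = cint (fun y => g (pt 0 y)) y1 y2.
  by apply: cint_ext => //; apply: ltW.
by rewrite subrr mulr0 addr0 => /eqP; rewrite subr_eq0 => /eqP.
Qed.

Lemma pt_nat y : pt N%:R y = pt 0 y + N%:R.
Proof. by rewrite -rC_nat; apply: C_eq; rewrite ?ReD ?ImD /= ?add0r ?addr0. Qed.

(** The integral is the same at all heights, and the integrand tends to 0 far below the real
    axis. *)
Lemma int_en m y : (0 < m)%N -> cint (fun x => en N m (pt x y)) 0 N%:R = 0.
Proof.
move=> m0; apply: nc_eq0; apply/eqP; rewrite eq_le nc_ge0 andbT leNgt; apply/negP => n0.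
have cc w : ccts (en N m) w by have [l /cdiff_ccts] := cdiff_en m w.
have I y' : y' < y -> cint (fun x => en N m (pt x y)) 0 N%:R = cint (fun x => en N m (pt x y')) 0 N%:R.
  move=> yy; apply/esym; apply: (@per_line _ _ _ 0) => // [w _ _|t _]; first exact: cdiff_en.
  by rewrite pt_nat en_per.
pose k := tau * m%:R / N%:R; have k0 : 0 < k by rewrite divr_gt0 ?Nr0 // mulr_gt0 ?tau_gt0 // ltr0n.
set A := cint _ _ _ in n0 I.
have n2 : 0 < nc A / 2 by rewrite divr_gt0.
have [n hn] := expR_small k0 (2 * N%:R) n2.
pose y' := - (n%:R + `|y| + 1).
have yy : y' < y by rewrite /y'; have := ler_norm (- y); rewrite normrN; have := ler0n R n; lra.
have B : nc A <= 2 * expR (- (k * (n%:R + `|y| + 1))) * (N%:R - 0).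
  rewrite (I _ yy); apply: cint_bound; first exact: ltW Nr0.
    by move=> x _ e e0; have [dl d0 hd] := cc (pt x y') e e0; exists dl => // x' hx; apply: hd; rewrite nc_ptx.
  move=> x _; rewrite nc_en /= /k /y'.
  by rewrite (_ : tau * m%:R * _ / N%:R = - (tau * m%:R / N%:R * (n%:R + `|y| + 1))) //; field; rewrite gt_eqF // Nr0.
have := hn (n%:R + `|y| + 1) _; rewrite -mulrA mulrCA subr0 in B *; have ny := normr_ge0 y.
have -> : n%:R <= n%:R + `|y| + 1 by lra.
by move=> /(_ isT); rewrite mulrAC; lra.
Qed.

Lemma qh_bound f (Y : R) : qh N f -> 0 < Y -> exists M : R, bdab f Y M.
Proof.
move=> [hf pf [Y0 [M [Y00 hM]]]] Yp.
have fc w : inH w -> ccts f w by move=> wH; apply: cdiff_ccts (holo_cdiff hf wH).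
pose Y1 := Num.max Y Y0; have YY : Y <= Y1 by rewrite le_max lexx.
have [|M1 hM1] := @bounded_rect f 0 N%:R Y Y1 (ltW Nr0) YY.
  by move=> w /andP[_ /andP[wY _]]; apply: fc; apply: lt_le_trans wY.
exists (Num.max M M1) => z zY; rewrite le_max.
have [h|h] := leP Y1 (Im z); first by rewrite hM // (le_trans _ h) // le_max lexx orbT.
have zH : inH z by apply: lt_le_trans zY.
have [k /andP[k1 k2]] := red_strip (Re z); apply/orP; right; rewrite -(perd_int k pf zH); apply: hM1.
by rewrite /inR Re_intD Im_intD zY (ltW h) k1 (ltW k2).
Qed.

Section Coef.
Variable f : fn.
Hypothesis qf : qh N f.

Let hf : holo f. Proof. by case: qf. Qed.
Let pf : perd N f. Proof. by case: qf. Qed.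
Let fd w : inH w -> cdiff f w (der f w). Proof. by move=> wH; apply: holo_cdiff. Qed.

Lemma cint_coef m y : 0 < y -> cint (fun x => f (pt x y) * en N m (pt x y)) 0 N%:R = N%:R * coef N m f.
Proof.
move=> y0; rewrite /coef mulVKf ?Nc0 //.
have I y1 y2 : 0 < y1 -> y1 < y2 -> cint (fun x => f (pt x y1) * en N m (pt x y1)) 0 N%:R
    = cint (fun x => f (pt x y2) * en N m (pt x y2)) 0 N%:R.
  move=> y10 y12.
  have gd w : inR 0 N%:R y1 y2 w -> exists l, cdiff (fun w => f w * en N m w) w l.
    move=> /andP[_ /andP[w1 _]]; have [l hl] := cdiff_en m w.
    by eexists; apply: cdiffM hl; apply: fd; apply: lt_le_trans w1.
  apply: (@per_line (fun w => f w * en N m w) _ _ 0) => // [w /gd[l /cdiff_ccts]|w /gd|t /andP[t1 _]] //.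
  by rewrite pt_nat en_per pf // /inH /=; apply: lt_le_trans t1.
by have [e|l|g] := ltgtP y 1; [exact: I|apply/esym/I|rewrite g].
Qed.

Lemma coef_bound m (y M : R) : 0 < y -> (forall x, nc (f (pt x y)) <= M) ->
  nc (coef N m f) <= 2 * M * expR (tau * m%:R * y / N%:R).
Proof.
move=> y0 hM; have n0 := Nr0.
rewrite -(ler_pM2l n0) -[X in X * _]nc_nat -ncM -(cint_coef m y0).
have cc x : ccts (fun w => f w * en N m w) (pt x y).
  by have [l /cdiff_ccts hl] := cdiff_en m (pt x y); apply: cctsM hl; apply: cdiff_ccts (fd _).
have B : nc (cint (fun x => f (pt x y) * en N m (pt x y)) 0 N%:R) <=
    2 * (M * expR (tau * m%:R * y / N%:R)) * (N%:R - 0).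
  apply: cint_bound; first exact: ltW.
    by move=> x _ e e0; have [dl d0 hd] := cc x e e0; exists dl => // x' hx; apply: hd; rewrite nc_ptx.
  by move=> x _; rewrite ncM nc_en ler_wpM2r // expR_ge0.
by apply: le_trans B _; rewrite subr0 le_eqVlt; apply/orP; left; apply/eqP; ring.
Qed.

Lemma ee_eq1' (z : C) : -1 < Re z < 1 -> ee z = 1 -> z = 0.
Proof.
move=> /andP[z1 z2] e1; have [h|h] := leP `|Re z| (1 / 2); first exact: ee_eq1.
case: (leP 0 (Re z)) => z0.
  have : z - 1 = 0.
    apply: ee_eq1; last by rewrite eeB e1 ee1 divr1.
    by rewrite ReD ReN /= ler_norml; move: h; rewrite ger0_norm // => h; apply/andP; split; lra.
  by move/(congr1 Re); rewrite ReD ReN /= => h'; exfalso; lra.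
have : z + 1 = 0.
  apply: ee_eq1; last by rewrite eeD e1 ee1 mulr1.
  by rewrite ReD /= ler_norml; move: h; rewrite ltr0_norm // => h; apply/andP; split; lra.
by move/(congr1 Re); rewrite ReD /= => h'; exfalso; lra.
Qed.

Lemma geo_split (E : C) (K : nat) : 1 - E != 0 -> (1 - E)^-1 = \sum_(m < K) E ^+ m + E ^+ K * (1 - E)^-1.
Proof.
move=> e1; apply: (mulIf e1); rewrite mulVf // mulrDl -mulrA mulVf // mulr1 mulrC.
by have := subrX1 E K; rewrite -[1 - E]opprB mulNr => <-; rewrite opprB subrK.
Qed.

Section Inversion.
Variables (z : C) (y1 M : R).
Hypotheses (zx : 0 < Re z < N%:R) (y10 : 0 < y1) (yz : y1 < Im z) (hM : bdab f y1 M).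

(** The function 1 / (1 - E w) is a Cauchy kernel of period N with a simple pole at z. Its expansion
    in powers of E separates the variables: E^m is q(z)^m times [en N m w]. *)
Let E (w : C) : C := ee ((z - w) / N%:R).
Let zH : inH z. Proof. exact: lt_trans y10 yz. Qed.
Let M0 : 0 <= M. Proof. by apply: le_trans (nc_ge0 (f z)) _; apply: hM; apply: ltW. Qed.

Let EX m w : E w ^+ m = qN N z ^+ m * en N m w.
Proof.
rewrite /E qN_ee !eeX /en -eeD; congr ee; field; exact: Nc0.
Qed.
Let ncE w : nc (E w) = expR (tau * (Im w - Im z) / N%:R).
Proof. by rewrite nc_ee ImdivN ImD ImN -mulrN; congr (expR _); field; rewrite gt_eqF // Nr0. Qed.
Let E_neq w : 0 <= Re w <= N%:R -> w != z -> 1 - E w != 0.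
Proof.
move=> /andP[w1 w2]; apply: contraNneq => /eqP; rewrite subr_eq0 => /eqP/esym/ee_eq1' h.
have : (z - w) / N%:R = 0.
  apply: h; rewrite RedivN ReD ReN ltr_pdivlMr ?Nr0 // ltr_pdivrMr ?Nr0 //.
  by case/andP: zx => x1 x2; apply/andP; split; lra.
by move/eqP; rewrite mulf_eq0 invr_eq0 (negPf (Nc0)) orbF subr_eq0 eq_sym.
Qed.
Let E_per w : E (w + N%:R) = E w.
Proof.
rewrite /E; have -> : (z - (w + N%:R)) / N%:R = (z - w) / N%:R - 1 by field; exact: Nc0.
by rewrite eeB ee1 divr1.
Qed.
Let cdE w : cdiff (fun w => 1 - E w) w (iC * rC tau * E w / N%:R).
Proof.
have c1 : cdiff (fun w : C => (z - w) / N%:R) w (- N%:R^-1).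
  have := cdiffD (cdiff_cst (z / N%:R) w) (cdiffZ (- N%:R^-1) (cdiff_id w)); rewrite add0r mulr1.
  by apply: cdiff_eq => t; rewrite mulrBl mulNr [t / _]mulrC.
have := cdiffD (cdiff_cst 1 w) (cdiffZ (-1) (cdiff_comp c1 (cdiff_ee _))).
rewrite -/(E w) add0r mulN1r mulNr opprK [_^-1 * _]mulrC.
by apply: cdiff_eq => t; rewrite mulN1r.
Qed.

(** The pole of the kernel is cancelled by f(w) - f(z), so the integral does not change when the
    line is pushed up through z. There |E w| grows exponentially while f stays bounded, and the
    integral tends to 0. *)
Lemma bottom_zero : cint (fun x => (f (pt x y1) - f z) * (1 - E (pt x y1))^-1) 0 N%:R = 0.
Proof.
have [phi [pc pz fE]] := (proj1 (cdiffC _ _ _) (fd zH)).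
have [psi [qc qz EE]] := (proj1 (cdiffC _ _ _) (cdE z)).
have Ez : E z = 1 by rewrite /E subrr mul0r ee0.
have psz : psi z != 0.
  rewrite qz Ez mulr1 mulf_neq0 ?invr_eq0 ?Nc0 // mulf_neq0 //; last first.
    by apply/eqP => /rC_inj; apply/eqP; rewrite gt_eqF // tau_gt0.
  by rewrite -nc_gt0 nc_iC ltr01.
(* The quotient of the two Caratheodory factors removes the singularity at z, where the denominator
   is the nonzero derivative of 1 - E. *)
pose h : C -> C := fun w => phi w * (psi w)^-1.
have hE w : 0 <= Re w <= N%:R -> w != z -> h w = (f w - f z) * (1 - E w)^-1.
  move=> wr wz; have e0 := E_neq wr wz; have wz0 : w - z != 0 by rewrite subr_eq0.
  have e1 : 1 - E w = (w - z) * psi w by rewrite (EE w) Ez subrr add0r.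
  have p0 : psi w != 0 by apply: contraNneq e0 => p0; rewrite e1 p0 mulr0.
  rewrite e1 (fE w) /h; field; by rewrite p0 wz0.
have hd w y2 : inR 0 N%:R y1 y2 w -> w != z -> exists l, cdiff h w l.
  move=> /andP[wr /andP[wy _]] wz; have e0 := E_neq wr wz.
  have wH : inH w by apply: lt_le_trans wy.
  have hd := cdiffM (cdiffD (fd wH) (cdiff_cst (- f z) w)) (cdiffV (f := fun w => 1 - E w) e0 (cdE w)).
  have wz0 : 0 < nc (w - z) by rewrite nc_gt0 subr_eq0.
  (* near [w] the quotient formula holds even outside the strip *)
  have [r r0 hr] : exists2 r : R, 0 < r & forall t, nc (t - w) < r -> t != z /\ 1 - E t != 0.
    have cE := cdiff_ccts (cdE w); have e1 : 0 < nc (1 - E w) by rewrite nc_gt0.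
    have [r r0 hr] := cE _ e1; exists (Num.min r (nc (w - z))) => [|t]; first by rewrite lt_min r0.
    rewrite lt_min => /andP[/hr q1 q2]; split.
      by apply: contraTneq q2 => ->; rewrite ncB ltxx.
    by apply: contraTneq q1 => ->; rewrite sub0r ncN ltxx.
  eexists; apply: (@cdiff_loc _ _ _ _ r r0 _ hd) => t /hr[tz e1].
  have tz0 : t - z != 0 by rewrite subr_eq0.
  have e2 : 1 - E t = (t - z) * psi t by rewrite (EE t) Ez subrr add0r.
  have p0 : psi t != 0 by apply: contraNneq e1 => p0; rewrite e2 p0 mulr0.
  rewrite e2 (fE t) /h; field; by rewrite p0 tz0.
have hc w y2 : inR 0 N%:R y1 y2 w -> ccts h w.
  move=> wr; have [->|wz] := eqVneq w z; first by apply: cctsM => //; apply: ccts_inv.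
  by have [l /cdiff_ccts] := hd w y2 wr wz.
have hN y : y1 <= y -> 0 <= Re (pt 0 y) <= N%:R /\ 0 <= Re (pt N%:R y) <= N%:R by rewrite /= !lexx ler0n.
have nz x y : x = 0 \/ x = N%:R -> pt x y != z.
  by case/andP: zx => x1 x2 [] ->; apply/eqP => e; move: x1 x2; rewrite -e /= ltxx.
have hp y : y1 <= y -> h (pt N%:R y) = h (pt 0 y).
  move=> yy; have [a1 a2] := hN y yy; rewrite !hE ?nz //; [|by left|by right].
  rewrite pt_nat E_per pf //; exact: lt_le_trans yy.
have lineE y : y != Im z -> cint (fun x => (f (pt x y) - f z) * (1 - E (pt x y))^-1) 0 N%:R = cint (fun x => h (pt x y)) 0 N%:R.
  move=> yy; apply: cint_ext => [|x xx]; first exact: ltW Nr0.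
  by rewrite hE //; apply: contraNneq yy => <-.
rewrite lineE ?(lt_eqF yz) //.
have I y2 : y1 < y2 -> cint (fun x => h (pt x y1)) 0 N%:R = cint (fun x => h (pt x y2)) 0 N%:R.
  by move=> y12; apply: (@per_line _ _ _ z) => // [w /hc|w /hd|y /andP[/hp]].
apply: nc_eq0; apply/eqP; rewrite eq_le nc_ge0 andbT leNgt; apply/negP => n0.
set A := cint _ _ _ in n0 I.
have k0 : 0 < tau / N%:R by rewrite divr_gt0 ?tau_gt0 ?Nr0.
have M1 : 0 < M + 1 by rewrite ltr_wpDl ?ltr01.
have n8 : 0 < 8 * (M + 1) * N%:R by rewrite !mulr_gt0 ?Nr0 ?ltr0n.
have n2 : 0 < Num.min (nc A / (8 * (M + 1) * N%:R)) (1 / 2).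
  by rewrite lt_min !divr_gt0 // ?ltr01 ?ltr0n.
have [n hn] := expR_small k0 1 n2.
pose y2 := Im z + n%:R + 1; have yz' : y1 < Im z := yz; have M0' : 0 <= M := M0.
have y12 : y1 < y2 by rewrite /y2; have := ler0n R n; lra.
have y2z : Im z < y2 by rewrite /y2; have := ler0n R n; lra.
set q := expR (- (tau / N%:R * (n%:R + 1))).
have [q1 q2] : q <= nc A / (8 * (M + 1) * N%:R) /\ q <= 1 / 2.
  by have := hn (n%:R + 1) _; rewrite lerDl ler01 mul1r -/q le_min => /(_ isT)/andP[].
have q0 : 0 < q by apply: expR_gt0.
have B : nc A <= 2 * (2 * M * (2 * q)) * (N%:R - 0).
  rewrite (I _ y12) -lineE ?(gt_eqF y2z) //; apply: cint_bound; first exact: ltW Nr0.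
    move=> x xx e e0; have [|dl d0 hd'] := hc (pt x y2) y2 _ e e0; first by rewrite /inR /= xx lexx (ltW y12).
    have nn t : pt t y2 != z by apply: contraTneq y2z => <-; rewrite /= ltxx.
    have cf : ccts (fun w => (f w - f z) * (1 - E w)^-1) (pt x y2).
      have pH : inH (pt x y2) by apply: lt_trans y12.
      apply: cctsM; first by apply: cctsD (ccts_cst _ _); apply: cdiff_ccts (fd pH).
      by apply: ccts_inv (cdiff_ccts (cdE _)); apply: E_neq.
    by have [d1 d10 h1] := cf e e0; exists d1 => // t tt; apply: h1; rewrite nc_ptx.
  move=> x xx; rewrite ncM ncV; apply: ler_pM; rewrite ?invr_ge0 ?nc_ge0 //.
    have h1 : nc (f (pt x y2)) <= M by apply: hM; apply: ltW.
    have h2 : nc (f z) <= M by apply: hM; apply: ltW.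
    by have := nc_triB (f (pt x y2)) (f z); lra.
  have e1 : nc (E (pt x y2)) = q^-1.
    rewrite ncE /q expRN invrK; congr expR; rewrite /= /y2; field; by rewrite gt_eqF // Nr0.
  have e2 : q^-1 - 1 <= nc (1 - E (pt x y2)) by rewrite ncB -e1 -nc1; apply: nc_sub_le.
  have e3 : (2 * q)^-1 <= q^-1 - 1.
    have -> : q^-1 - 1 = (2 * q)^-1 + (1 - 2 * q) * (2 * q)^-1 by field; rewrite gt_eqF.
    rewrite lerDl mulr_ge0 ?invr_ge0 //; lra.
  rewrite -[2 * q]invrK; apply: ler_pV; last by apply: le_trans e2.
  by rewrite invr_gt0; lra.
move: B; apply/negP; rewrite -ltNge subr0.
move: q1; rewrite ler_pdivlMr // => q1; apply: lt_le_trans q1.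
have qN : 0 < q * N%:R by rewrite mulr_gt0 ?Nr0.
have -> : q * (8 * (M + 1) * N%:R) = 8 * M * (q * N%:R) + 8 * (q * N%:R) by ring.
have -> : 2 * (2 * M * (2 * q)) * N%:R = 8 * M * (q * N%:R) by ring.
by rewrite ltrDl; lra.
Qed.

(** On the lower line |E| is a constant rho < 1, so the kernel in [bottom_zero] is a finite
    geometric sum plus a remainder; the sum yields the Fourier polynomial minus f(z). *)
Lemma expand_strip K : nc (f z - \sum_(m < K.+1) coef N m f * qN N z ^+ m) <=
  4 * M * (expR (- (tau * (Im z - y1) / N%:R)) ^+ K.+1 / (1 - expR (- (tau * (Im z - y1) / N%:R)))).
Proof.
set rho := expR _; have yz' : y1 < Im z := yz.
have r1 : rho < 1.
  rewrite -exp.expR0 ltr_expR oppr_lt0 divr_gt0 ?Nr0 // mulr_gt0 ?tau_gt0 // subr_gt0 //.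
have r0 : 0 < rho by apply: expR_gt0.
have nE x : nc (E (pt x y1)) = rho by rewrite ncE /rho; congr expR => /=; rewrite -mulNr -mulrN opprB.
have nz x : 1 - E (pt x y1) != 0.
  rewrite -nc_gt0; have := nc_sub_le 1 (E (pt x y1)); rewrite nc1 nE; lra.
have pH x : inH (pt x y1) by [].
have cE x : ccts E (pt x y1).
  have := cctsD (ccts_cst 1 (pt x y1)) (cctsM (ccts_cst (-1) _) (cdiff_ccts (cdE (pt x y1)))).
  by congr ccts; apply: funext => w; rewrite mulN1r opprB addrC subrK.
have cf x : ccts (fun w => f w - f z) (pt x y1).
  by apply: cctsD (ccts_cst _ _); apply: cdiff_ccts (fd (pH x)).
have line (g : C -> C) : (forall x, ccts g (pt x y1)) -> cct (fun x => g (pt x y1)) 0 N%:R.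
  by move=> gc x _ e e0; have [dl d0 hd] := gc x e e0; exists dl => // t tt; apply: hd; rewrite nc_ptx.
have lN := ltW (Nr0).
have cterm m x : ccts (fun w => (f w - f z) * E w ^+ m) (pt x y1) by apply: cctsM => //; apply: cctsX.
have cs K' x : ccts (fun w => (f w - f z) * \sum_(m < K') E w ^+ m) (pt x y1).
  apply: cctsM => //; elim: K' => [|k IH].
    by have := ccts_cst 0 (pt x y1); congr ccts; apply: funext => w; rewrite big_ord0.
  by have := cctsD IH (cctsX k (cE x)); congr ccts; apply: funext => w; rewrite big_ord_recr.
have cr x : ccts (fun w => (f w - f z) * (E w ^+ K.+1 * (1 - E w)^-1)) (pt x y1).
  apply: cctsM => //; apply: cctsM; first exact: cctsX.
  by apply: ccts_inv => //; apply: cdiff_ccts (cdE _).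
have fc m : cint (fun x => (f (pt x y1) - f z) * E (pt x y1) ^+ m) 0 N%:R =
    N%:R * (coef N m f * qN N z ^+ m - (m == 0)%:R * f z).
  have cen x : ccts (en N m) (pt x y1) by have [l /cdiff_ccts] := cdiff_en m (pt x y1).
  have c1 := line _ (fun x => cctsM (cdiff_ccts (fd (pH x))) (cen x)).
  have c2 := line _ cen.
  have c3 := line _ (fun x => cctsM (ccts_cst (- f z) _) (cen x)).
  have c4 : cct (fun x => f (pt x y1) * en N m (pt x y1) + (- f z) * en N m (pt x y1)) 0 N%:R.
    by apply: (line (fun w => f w * en N m w + (- f z) * en N m w)) => x; apply: cctsD;
      [exact: (cctsM (cdiff_ccts (fd (pH x))) (cen x))|exact: (cctsM (ccts_cst (- f z) _) (cen x))].
  have -> : cint (fun x => (f (pt x y1) - f z) * E (pt x y1) ^+ m) 0 N%:R =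
     cint (fun x => qN N z ^+ m * (f (pt x y1) * en N m (pt x y1) + (- f z) * en N m (pt x y1))) 0 N%:R.
    by apply: cint_ext => // x _; rewrite EX; ring.
  rewrite (cintZ _ lN c4) (cintD lN c1 c3) (cintZ _ lN c2) (cint_coef m y10).
  case: m {c1 c2 c3 c4 cen} => [|m]; last by rewrite int_en //= mul0r subr0 mulr0 addr0; ring.
  have -> : cint (fun x => en N 0 (pt x y1)) 0 N%:R = N%:R.
    rewrite (@cint_ext _ (fun=> 1)) // => [|x _]; first by rewrite cint_const mul1r subr0 rC_nat.
    by rewrite /en mul0r mul0r oppr0 ee0.
  by rewrite expr0 /=; ring.
have := bottom_zero.
have -> : cint (fun x => (f (pt x y1) - f z) * (1 - E (pt x y1))^-1) 0 N%:R =
   cint (fun x => (f (pt x y1) - f z) * \sum_(m < K.+1) E (pt x y1) ^+ m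
     + (f (pt x y1) - f z) * (E (pt x y1) ^+ K.+1 * (1 - E (pt x y1))^-1)) 0 N%:R.
  by apply: cint_ext => // x _; rewrite -mulrDr -geo_split.
rewrite (cintD lN (line _ (cs K.+1)) (line _ cr)).
have -> : cint (fun x => (f (pt x y1) - f z) * \sum_(m < K.+1) E (pt x y1) ^+ m) 0 N%:R =
   N%:R * (\sum_(m < K.+1) coef N m f * qN N z ^+ m - f z).
  have S K' : cint (fun x => (f (pt x y1) - f z) * \sum_(m < K') E (pt x y1) ^+ m) 0 N%:R =
     N%:R * \sum_(m < K') (coef N m f * qN N z ^+ m - (m == 0%N :> nat)%:R * f z).
    elim: K' => [|k IH].
      rewrite big_ord0 mulr0 (@cint_ext _ (fun=> 0)) // => [|x _]; first by rewrite cint_const mul0r.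
      by rewrite big_ord0 mulr0.
    rewrite big_ord_recr /= mulrDr -IH -fc -(cintD lN (line _ (cs k)) (line _ (cterm k))).
    by apply: cint_ext => // x _; rewrite big_ord_recr /= mulrDr.
  rewrite S sumrB; congr (_ * (_ - _)); rewrite big_ord_recl /= mul1r big1 ?addr0 // => i _.
  by rewrite mul0r.
set S := \sum_(m < K.+1) _; set I := cint _ _ _ => e.
have eI : N%:R * (f z - S) = I by rewrite -[LHS]addr0 -e; ring.
have B : nc I <= 2 * (2 * M * (rho ^+ K.+1 * (1 - rho)^-1)) * (N%:R - 0).
  apply: (cint_bound lN (line _ cr)) => x xx.
  rewrite !ncM ncX ncV nE; apply: ler_pM; rewrite ?nc_ge0 ?mulr_ge0 ?exprn_ge0 ?invr_ge0 ?nc_ge0 ?(ltW r0) //.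
    have h1 : nc (f (pt x y1)) <= M by apply: hM.
    have h2 : nc (f z) <= M by apply: hM; apply: ltW.
    by have := nc_triB (f (pt x y1)) (f z); lra.
  apply: ler_wpM2l; first by rewrite exprn_ge0 // ltW.
  by apply: ler_pV; [lra|have := nc_sub_le 1 (E (pt x y1)); rewrite nc1 nE].
rewrite -(ler_pM2l (Nr0)) -[X in X * nc _]nc_nat -ncM eI; apply: le_trans B _.
by rewrite subr0 le_eqVlt; apply/orP; left; apply/eqP; ring.
Qed.
End Inversion.
End Coef.
End Expansion.

Lemma ccts_eq (f g : C -> C) (z : C) : (forall w, f w = g w) -> ccts f z -> ccts g z.
Proof. by move=> /funext ->. Qed.

Section Qh.
Variable N : nat.
Hypothesis N0 : (0 < N)%N.

Lemma cdiff_qN (z : C) : exists l, cdiff (qN N) z l.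
Proof.
have := cdiff_comp (cdiffZ N%:R^-1 (cdiff_id z)) (cdiff_ee _) => h; eexists; apply: cdiff_eq h => w.
by rewrite qN_ee mulrC.
Qed.

Lemma nc_qN (z : C) : nc (qN N z) = expR (- (tau * Im z / N%:R)).
Proof. by rewrite qN_ee nc_ee ImdivN mulrA. Qed.

Lemma qN_int (k : int) (z : C) : qN N (z + k%:~R * N%:R) = qN N z.
Proof. by rewrite !qN_ee mulrDl mulfK ?Nc0 // eeD ee_int mulr1. Qed.

Lemma ccts_psum (u : nat -> C) K (z : C) : ccts (fun z => \sum_(m < K) u m * qN N z ^+ m) z.
Proof.
have [l /cdiff_ccts hq] := cdiff_qN z; elim: K => [|K IH].
  by apply: ccts_eq (ccts_cst 0 z) => w; rewrite big_ord0.
by apply: ccts_eq (cctsD IH (cctsM (ccts_cst (u K) z) (cctsX K hq))) => w; rewrite big_ord_recr.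
Qed.

Section Expand.
Variable f : fn.
Hypothesis qf : qh N f.

Lemma expand (z : C) (y1 M : R) : 0 < y1 -> y1 < Im z -> bdab f y1 M -> forall K,
  nc (f z - \sum_(m < K.+1) coef N m f * qN N z ^+ m) <=
  4 * M * (expR (- (tau * (Im z - y1) / N%:R)) ^+ K.+1 / (1 - expR (- (tau * (Im z - y1) / N%:R)))).
Proof.
move=> y10 yz hM K; set B := 4 * M * _; rewrite leNgt; apply/negP => gt.
case: (qf) => hf pf _.
have zH : inH z by apply: lt_trans yz.
pose G (w : C) := f w - \sum_(m < K.+1) coef N m f * qN N w ^+ m.
have cG : ccts G z.
  have h := cctsD (cdiff_ccts (holo_cdiff hf zH)) (cctsM (ccts_cst (-1) z) (ccts_psum (fun m => coef N m f) K.+1 z)).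
  by apply: ccts_eq h => w; rewrite /G mulN1r.
have g0 : 0 < nc (G z) - B by rewrite subr_gt0.
have [dl d0 hd] := cG _ g0.
have [k /andP[k1 k2]] := red_strip N0 (Re z).
(* Reduction modulo N may give real part 0, which the strip excludes. A small shift to the right
   enters the strip, and continuity carries the bound back. *)
pose t := Num.min (dl / 2) ((N%:R - (Re z + k%:~R * N%:R)) / 2).
have t0 : 0 < t by rewrite lt_min !divr_gt0 // subr_gt0.
have t1 : t <= dl / 2 by rewrite ge_min lexx.
have t2 : t <= (N%:R - (Re z + k%:~R * N%:R)) / 2 by rewrite ge_min lexx orbT.
pose w : C := z + rC t; pose w' : C := w + k%:~R * N%:R.
have nw : nc (w - z) < dl.
  rewrite (_ : w - z = rC t); last by rewrite /w addrAC subrr add0r.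
  by rewrite nc_rC (ger0_norm (ltW t0)); clear - t1 d0; lra.
have iw : Im w = Im z by rewrite ImD /= addr0.
have iw' : Im w' = Im z by rewrite Im_intD iw.
have wH : inH w by rewrite /inH iw.
have rw' : Re w' = Re z + t + k%:~R * N%:R by rewrite Re_intD ReD.
have := @expand_strip N N0 f qf w' y1 M _ y10 _ hM K.
rewrite iw' rw' yz (_ : (0 < Re z + t + k%:~R * N%:R < N%:R)); last by clear - k1 k2 t0 t2; apply/andP; split; lra.
move=> /(_ isT isT); rewrite (perd_int k pf wH).
under eq_bigr => i _ do rewrite qN_int.
rewrite -/B -/(G w) => le.
have h := hd w nw; clear - h le; move: (G w) (G z) h le => p q h le.
have := nc_tri (q - p) p; rewrite subrK (ncB q p); lra.
Qed.

Lemma expand_cvg (z : C) : inH z -> (\sum_(m < M) coef N m f * qN N z ^+ m @[M --> \oo] --> f z)%classic.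
Proof.
move=> zH; pose y1 := Im z / 2; have y10 : 0 < y1 by rewrite divr_gt0.
have zH' : 0 < Im z := zH.
have yz : y1 < Im z by rewrite /y1; lra.
have [M hM] := qh_bound N0 qf y10.
apply/cvgnP => e e0; pose a := tau * (Im z - y1) / N%:R.
have a0 : 0 < a by rewrite divr_gt0 ?Nr0 // mulr_gt0 ?tau_gt0 // subr_gt0.
have r1 : expR (- a) < 1 by rewrite -exp.expR0 ltr_expR oppr_lt0.
have e2 : 0 < e / 2 by lra.
have [n0 hn] := expR_small a0 (4 * M / (1 - expR (- a))) e2.
exists n0.+1 => -[//|n] nn; rewrite ncB; apply: le_lt_trans (expand y10 yz hM n) _.
have -> : expR (- (tau * (Im z - y1) / N%:R)) = expR (- a) by [].
have -> : expR (- a) ^+ n.+1 = expR (- (a * n.+1%:R)) by rewrite -expRM_natl mulrN mulrC.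
have := hn n.+1%:R; rewrite ler_nat (leq_trans _ nn) // => /(_ isT); rewrite mulrAC -mulrA; lra.
Qed.

Lemma qh_qexp : qexp_holo N f. Proof. by exists (fun m => coef N m f) => z zH; apply: expand_cvg. Qed.
End Expand.

Lemma geo_bound (a : R) n : 0 <= a -> a < 1 -> \sum_(m < n) a ^+ m <= (1 - a)^-1.
Proof.
move=> a0 a1; have q : 0 < 1 - a by rewrite subr_gt0.
rewrite -(ler_pM2l q) mulfV ?gt_eqF //.
have -> : (1 - a) * \sum_(m < n) a ^+ m = 1 - a ^+ n.
  by rewrite -[1 - a]opprB mulNr -subrX1 opprB.
by rewrite gerBl exprn_ge0.
Qed.

(** Convergence at i bounds the terms there; for Im z >= 2 they are then dominated by a geometric
    series, which gives boundedness high up. Periodicity is that of q. *)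
Lemma qexp_qh f : holo f -> qexp_holo N f -> qh N f.
Proof.
move=> hf [u hu]; split; first exact: hf.
  move=> z zH; have zH' : inH (z + N%:R) by rewrite /inH Im_natD.
  have h1 := hu _ zH'; have := hu _ zH; move: h1.
  have e M : \sum_(m < M) u m * qN N (z + N%:R) ^+ m = \sum_(m < M) u m * qN N z ^+ m.
    by apply: eq_bigr => m _; have := qN_int 1 z; rewrite mul1r => ->.
  under eq_fun => M do rewrite e.
  move=> /cvgnP h1 /cvgnP h2; apply/eqP; rewrite -subr_eq0 -[_ == 0]negbK -nc_gt0; apply/negP => n0.
  have n2 : 0 < nc (f (z + N%:R) - f z) / 2 by rewrite divr_gt0.
  have [m1 k1] := h1 _ n2; have [m2 k2] := h2 _ n2.
  have := k1 (maxn m1 m2) (leq_maxl _ _); have := k2 (maxn m1 m2) (leq_maxr _ _).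
  set S := \sum_(m < _) _ => q1 q2; have := nc_tri2 S (f (z + N%:R)) (f z); rewrite (ncB (f _) S); lra.
(* From index n0 on, two partial sums at i differ by at most 2; the finitely many earlier terms are
   added into [A]. *)
have [n0 hn] := (proj1 (cvgnP _ _) (hu _ inH_i)) 1 ltr01.
pose t m := nc (u m * qN N iC ^+ m); pose A := 2 + \sum_(m < n0) t m.
have tA m : t m <= A.
  have s0 : 0 <= \sum_(i < n0) t i by apply: sumr_ge0 => i _; apply: nc_ge0.
  have [mn|nm] := ltnP m n0.
    rewrite /A (bigD1 (Ordinal mn)) //=; set s := \sum_(i < n0 | _) _.
    have : 0 <= s by apply: sumr_ge0 => i _; apply: nc_ge0.
    lra.
  have := hn m.+1 (leqW nm); have := hn m nm; rewrite big_ord_recr /=.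
  set S := \sum_(i < m) _ => q1 q2; have := nc_tri2 (f iC) (S + u m * qN N iC ^+ m) S.
  by rewrite addrAC subrr add0r -/(t m) (ncB (f iC)) /A; lra.
have A0 : 0 <= A by apply: le_trans (tA 0%N); apply: nc_ge0.
pose r := expR (- (tau / N%:R)).
have r0 : 0 < r by apply: expR_gt0.
have r1 : r < 1 by rewrite -exp.expR0 ltr_expR oppr_lt0 divr_gt0 ?tau_gt0 ?Nr0.
exists 2, (A / (1 - r) + 1); split=> // z z2; have zH : inH z by apply: lt_le_trans z2.
have [n1 hn1] := (proj1 (cvgnP _ _) (hu _ zH)) 1 ltr01.
have := hn1 n1 (leqnn _); set S := \sum_(m < n1) _ => q1.
have : nc S <= A / (1 - r).
  apply: le_trans (nc_sum _ _ _) _.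
  apply: (@le_trans _ _ (\sum_(m < n1) A * r ^+ m)).
    apply: ler_sum => m _.
    have mv (x y w : C) : y != 0 -> w * x ^+ m = w * y ^+ m * (x / y) ^+ m.
      by move=> y0; rewrite -mulrA -exprMn mulrCA mulfV // mulr1.
    have q0 : qN N iC != 0 by rewrite qN_ee ee_neq0.
    rewrite (mv _ _ _ q0).
    rewrite ncM; apply: ler_pM; rewrite ?nc_ge0 ?tA // ncX lerXn2r ?nnegrE ?nc_ge0 ?(ltW r0) //.
    rewrite ncM ncV !nc_qN -expRN -exp.expRD ler_expR /=.
    have q1' : 0 < tau / N%:R by rewrite divr_gt0 ?tau_gt0 ?Nr0.
    have -> : - (tau * Im z / N%:R) - - (tau * 1 / N%:R) = - (tau / N%:R * (Im z - 1)) by ring.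
    by rewrite lerN2 ler_peMr ?(ltW q1') //; lra.
  by rewrite -mulr_sumr ler_wpM2l // geo_bound // ltW.
have := nc_tri2 S (f z) 0; rewrite !subr0 (ncB (f z)); lra.
Qed.

Lemma qh_cst k : qh N (fun=> k).
Proof. split; [exact: holo_cst|by []|exists 1, (nc k); split=> //; exact: ltr01]. Qed.

Lemma qhD f g : qh N f -> qh N g -> qh N (fun z => f z + g z).
Proof.
move=> qf qg; have [hf pf _] := qf; have [hg pg _] := qg; split; first exact: (holoD hf hg).
  by move=> z zH; rewrite pf // pg.
have [M1 h1] := qh_bound N0 qf ltr01; have [M2 h2] := qh_bound N0 qg ltr01.
exists 1, (M1 + M2); split=> // z zz; apply: le_trans (nc_tri _ _) _; apply: lerD; [exact: h1|exact: h2].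
Qed.

Lemma qhM f g : qh N f -> qh N g -> qh N (fun z => f z * g z).
Proof.
move=> qf qg; have [hf pf _] := qf; have [hg pg _] := qg; split; first exact: (holoM hf hg).
  by move=> z zH; rewrite pf // pg.
have [M1 h1] := qh_bound N0 qf ltr01; have [M2 h2] := qh_bound N0 qg ltr01.
exists 1, (M1 * M2); split=> // z zz; rewrite ncM; apply: ler_pM; rewrite ?nc_ge0 //; [exact: h1|exact: h2].
Qed.

Lemma qh_ext f g : (forall z, inH z -> f z = g z) -> qh N f -> qh N g.
Proof.
move=> fg [hf pf [Y [M [Y0 hM]]]]; split; first exact: (holo_ext fg hf).
  by move=> z zH; rewrite -!fg ?pf // /inH Im_natD.
by exists Y, M; split=> // z zY; rewrite -fg; [exact: hM|exact: lt_le_trans zY].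
Qed.

Lemma qhZ k f : qh N f -> qh N (fun z => k * f z).
Proof. by move=> qf; apply: (qhM (qh_cst k) qf). Qed.

Lemma qh_sum (I : Type) (s : seq I) (F : I -> fn) : (forall i, qh N (F i)) -> qh N (fun z => \sum_(i <- s) F i z).
Proof.
move=> hF; elim: s => [|i s IH].
  by apply: (qh_ext _ (qh_cst 0)) => z _; rewrite big_nil.
by apply: (qh_ext _ (qhD (hF i) IH)) => z _; rewrite big_cons.
Qed.

(** Cauchy's estimate on the square of side 1/2 around z. The kernel is at most 16 on the boundary,
    so each of the two integrals of order 2 is at most 64 M, and [K_gt] gives 1/5 as lower bound of
    the normalizing factor: 640 = 128 * 5. *)
Lemma der_bound f (z : C) (M : R) : holo f -> 1 <= Im z -> bdab f (1 / 2) M -> nc (der f z) <= 640 * M.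
Proof.
move=> hf z1 hM.
pose a := Re z - 1 / 4; pose b := Re z + 1 / 4; pose c := Im z - 1 / 4; pose d := Im z + 1 / 4.
have ab : a < b by rewrite /a /b; lra.
have cd : c < d by rewrite /c /d; lra.
have zi : insideR a b c d z by rewrite /insideR /a /b /c /d; apply/andP; split; apply/andP; split; lra.
have zH : inH z by apply: lt_le_trans z1.
have inRH w : inR a b c d w -> 1 / 2 <= Im w by move=> /andP[_ /andP[w1 _]]; apply: le_trans w1; rewrite /c; lra.
have fd w : inR a b c d w -> exists l, cdiff f w l.
  by move=> /inRH wi; exists (der f w); apply: (holo_cdiff hf); apply: lt_le_trans wi; lra.
have fcb w : bdR a b c d w -> ccts f w by move=> /bd_in/fd[l /cdiff_ccts].
have hMb w : bdR a b c d w -> nc (f w) <= M by move=> /bd_in/inRH; apply: hM.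
have h1 w : bdR a b c d w -> nc 1 <= 1 by rewrite nc1.
have c1 w : bdR a b c d w -> ccts (fun=> 1) w by move=> _; apply: ccts_cst.
have M0 : 0 <= M by apply: le_trans (nc_ge0 (f z)) _; apply: hM; lra.
have dK := Phi1_diff ab cd h1 c1 zi; have dG := Phi1_diff ab cd hMb fcb zi.
have [r r0 [_ hr]] := inside_dist zi.
have E : der f z * Phi a b c d 1 (fun=> 1) z + f z * Phi a b c d 2 (fun=> 1) z = Phi a b c d 2 f z.
  have q := cdiffM (holo_cdiff hf zH) dK.
  have q' : cdiff (fun w => f w * Phi a b c d 1 (fun=> 1) w) z (Phi a b c d 2 f z).
    by apply: (@cdiff_loc (Phi a b c d 1 f) _ _ _ r r0 _ dG) => w /hr wi; rewrite (cauchy ab cd fd wi).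
  by rewrite -(cdiff_der q) (cdiff_der q').
have dist w : bdR a b c d w -> 1 / 4 <= nc (w - z).
  case/andP => _; have := nc_Re (w - z); have := nc_Im (w - z); rewrite ImD ReD ImN ReN => i1 i2.
  case/or4P => /eqP e; rewrite e in i1 i2; [apply: le_trans i2|apply: le_trans i2|apply: le_trans i1|apply: le_trans i1];
    rewrite /a /b /c /d; [rewrite ler0_norm|rewrite ger0_norm|rewrite ler0_norm|rewrite ger0_norm]; lra.
have B phi m : (forall w, bdR a b c d w -> nc (phi w) <= m) -> (forall w, bdR a b c d w -> ccts phi w) ->
    0 <= m -> nc (Phi a b c d 2 phi z) <= 64 * m.
  move=> pm pc m0; have -> : 64 * m = 4 * (m * 16) * ((b - a) + (d - c)) by rewrite /a /b /c /d; field.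
  apply: oint_bound => //; try exact: ltW.
    move=> w ww; apply: cctsM; first exact: pc.
    by apply: ccts_ker; rewrite -subr_eq0 -nc_gt0; have := dist w ww; lra.
  move=> w ww; rewrite ncM ncX ncV; apply: ler_pM; rewrite ?exprn_ge0 ?invr_ge0 ?nc_ge0 //; first exact: pm.
  have -> : 16 = (1 / 4)^-1 ^+ 2 :> R by field.
  rewrite lerXn2r // ?nnegrE ?invr_ge0 ?nc_ge0 //; try lra.
  by apply: ler_pV; [lra|exact: dist].
have B1 := B f M hMb fcb M0; have B2 := B (fun=> 1) 1 h1 c1 ler01.
have K1 : 1 / 5 < nc (Phi a b c d 1 (fun=> 1) z).
  have := K_gt ab cd zi; have -> : (Im z - c) / ((b - a) ^+ 2 + (Im z - c) ^+ 2) * (b - a) / 2 = 1 / 5.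
    have e1 : Im z - c = 1 / 4 by rewrite /c; lra.
    have e2 : b - a = 1 / 2 by rewrite /a /b; lra.
    by rewrite e1 e2; field.
  by move=> k; apply: lt_le_trans k (le_trans (ler_norm _) (nc_Im _)).
have fz : nc (f z) <= M by apply: hM; lra.
have D : nc (der f z) * nc (Phi a b c d 1 (fun=> 1) z) <= 128 * M.
  rewrite -ncM; have -> : der f z * Phi a b c d 1 (fun=> 1) z = Phi a b c d 2 f z - f z * Phi a b c d 2 (fun=> 1) z.
    by rewrite -E addrK.
  apply: le_trans (nc_triB _ _) _; rewrite ncM.
  have : nc (f z) * nc (Phi a b c d 2 (fun=> 1) z) <= M * (64 * 1) by apply: ler_pM; rewrite ?nc_ge0.
  lra.
have := nc_ge0 (der f z); nra.
Qed.

Lemma qh_der f : qh N f -> qh N (der f).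
Proof.
move=> qf; have [hf pf _] := qf; split; first exact: (@holo_der f hf).
  move=> z zH; have zH' : inH (z + N%:R) by rewrite /inH Im_natD.
  have h := cdiff_comp (cdiffD (cdiff_id z) (cdiff_cst N%:R z)) (holo_cdiff hf zH').
  rewrite addr0 mul1r in h; apply/esym/cdiff_der; apply: (cdiff_ext zH _ h) => w wH /=; exact: pf.
have [|M hM] := @qh_bound N N0 f (1 / 2) qf; first by lra.
by exists 1, (640 * M); split; [exact: ltr01|move=> z z1; apply: der_bound].
Qed.

Lemma coef_line m f : qh N f -> cct (fun x => f (pt x 1) * en N m (pt x 1)) 0 N%:R.
Proof.
move=> [hf _ _] x _ e e0; have [l /cdiff_ccts hl] := cdiff_en N m (pt x 1).
have pH : inH (pt x 1) by exact: ltr01.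
have [dl d0 hd] := cctsM (cdiff_ccts (holo_cdiff hf pH)) hl e0.
by exists dl => // t tt; apply: hd; rewrite nc_ptx.
Qed.

Lemma coefD m f g : qh N f -> qh N g -> coef N m (fun z => f z + g z) = coef N m f + coef N m g.
Proof.
move=> qf qg; rewrite /coef -mulrDr -(cintD (ltW (Nr0 N0)) (coef_line m qf) (coef_line m qg)).
by congr (_ * _); apply: cint_ext => [|x _]; [exact: ltW (Nr0 N0)|rewrite mulrDl].
Qed.

Lemma coefZ m k f : qh N f -> coef N m (fun z => k * f z) = k * coef N m f.
Proof.
move=> qf; rewrite /coef mulrCA -(cintZ k (ltW (Nr0 N0)) (coef_line m qf)).
by congr (_ * _); apply: cint_ext => [|x _]; [exact: ltW (Nr0 N0)|rewrite mulrA].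
Qed.

Lemma coef_ext m f g : (forall z, inH z -> f z = g z) -> coef N m f = coef N m g.
Proof.
move=> fg; congr (_ * _); apply: cint_ext => [|x _]; first exact: ltW (Nr0 N0).
by rewrite fg //; exact: ltr01.
Qed.

Lemma coef_sum m (I : Type) (s : seq I) (F : I -> fn) : (forall i, qh N (F i)) ->
  coef N m (fun z => \sum_(i <- s) F i z) = \sum_(i <- s) coef N m (F i).
Proof.
move=> hF; elim: s => [|i s IH].
  rewrite big_nil -[RHS](mul0r (coef N m (fun=> 1))) -(coefZ m 0 (qh_cst 1)).
  by apply: coef_ext => z _; rewrite big_nil mul0r.
rewrite big_cons -IH -(coefD m (hF i) (qh_sum s hF)).
by apply: coef_ext => z _; rewrite big_cons.
Qed.
End Qh.

(** * Modular forms of congruence subgroups *)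

Definition Smat : 'M[int]_2 := \matrix_(i < 2, j < 2) (if i == j then 0 else if i == ord0 then -1 else 1).
Definition TZ (k : int) : 'M[int]_2 := \matrix_(i < 2, j < 2) (if i == j then 1 else if i == ord0 then k else 0).

Lemma SmatE : [/\ ga Smat = 0, gb Smat = -1, gc Smat = 1 & gd Smat = 0].
Proof. by rewrite /ga /gb /gc /gd !mxE. Qed.
Lemma TZE k : [/\ ga (TZ k) = 1, gb (TZ k) = k, gc (TZ k) = 0 & gd (TZ k) = 1].
Proof. by rewrite /ga /gb /gc /gd !mxE. Qed.
Lemma SL_S : SL2Z Smat. Proof. by rewrite /SL2Z det22; have [-> -> -> ->] := SmatE. Qed.
Lemma SL_T k : SL2Z (TZ k). Proof. by rewrite /SL2Z det22; have [-> -> -> ->] := TZE k; rewrite mulr0 subr0. Qed.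
Definition sS := MkSL SL_S.
Definition sT k := MkSL (SL_T k).
Definition s1 : SL := MkSL (det1 _ 2).
Lemma mob_S z : mob Smat z = - z^-1.
Proof. by rewrite /mob; have [-> -> -> ->] := SmatE; rewrite mul0r add0r mul1r addr0 mulN1r. Qed.
Lemma jac_S z : jac Smat z = z.
Proof. by rewrite /jac; have [_ _ -> ->] := SmatE; rewrite mul1r addr0. Qed.
Lemma mob_T k z : mob (TZ k) z = z + k%:~R.
Proof. by rewrite /mob; have [-> -> -> ->] := TZE k; rewrite mul1r mul0r add0r divr1. Qed.
Lemma jac_T k z : jac (TZ k) z = 1.
Proof. by rewrite /jac; have [_ _ -> ->] := TZE k; rewrite mul0r add0r. Qed.
Lemma smx_inj (x y : SL) : smx x = smx y -> x = y.
Proof. by case: x y => x hx [y hy] /= e; subst y; congr MkSL; apply: Prop_irrelevance. Qed.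
Lemma smulA x y z : smul x (smul y z) = smul (smul x y) z.
Proof. by apply: smx_inj; rewrite /= mulmxA. Qed.
Lemma smulV x : smul x (sinv x) = s1.
Proof. by apply: smx_inj; case: (SL2Z_adj (smxP x)) => _ []. Qed.
Lemma sVmul x : smul (sinv x) x = s1.
Proof. by apply: smx_inj; case: (SL2Z_adj (smxP x)) => _ []. Qed.
Lemma smul1 x : smul x s1 = x.
Proof. by apply: smx_inj; rewrite /= mulmx1. Qed.

Lemma nc_sqr (z : C) : nc z ^+ 2 = Re z ^+ 2 + Im z ^+ 2.
Proof. by case: z => a b; rewrite /nc /= sqr_sqrtr // addr_ge0 ?sqr_ge0. Qed.

(** If |Re w| <= 1/2 and Im w < 1/2, then |w|^2 <= 1/2 and the inversion at least doubles the
    height. So the height 1/2 is reached after finitely many translations and inversions. *)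
Lemma red_height (z : C) : inH z -> exists g : SL, 1 / 2 <= Im (mob (smx g) z).
Proof.
move=> zH; have z0 : 0 < Im z := zH.
have half (t : R) : 1 <= t -> 1 / 2 <= t by lra.
have step (w : C) : inH w -> Im w < 1 / 2 -> exists g : SL, 2 * Im w <= Im (mob (smx g) w).
  move=> wH w2; have [k /andP[k1 k2]] := @red_strip 1 isT (Re w + 1 / 2).
  pose w' := mob (TZ k) w; have w'E : w' = w + k%:~R by rewrite /w' mob_T.
  exists (smul sS (sT k)); rewrite /= (mob_mul SL_S (SL_T k) wH) -/w'.
  have iw : Im w' = Im w by rewrite w'E ImD Im_int addr0.
  have rw : Re w' = Re w + k%:~R by rewrite w'E ReD Re_int.
  have w'H : inH w' by rewrite /inH iw.
  rewrite (Im_mob SL_S w'H) jac_S iw nc_sqr iw rw.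
  have w0 : 0 < Im w := wH; rewrite mulr1n in k1 k2.
  have q : 0 < (Re w + k%:~R) ^+ 2 + Im w ^+ 2 by rewrite ltr_wpDl ?sqr_ge0 // exprn_gt0.
  rewrite ler_pdivlMr // mulrAC -[X in _ <= X]mul1r ler_pM2r //.
  have r2 : (Re w + k%:~R) ^+ 2 <= 1 / 4.
    have -> : 1 / 4 = (1 / 2) ^+ 2 :> R by field.
    by rewrite -subr_ge0 subr_sqr mulr_ge0 //; lra.
  have i2 : Im w ^+ 2 <= 1 / 4 by rewrite expr2; have -> : 1 / 4 = 1 / 2 * (1 / 2) :> R by [field|]; apply: ler_pM; lra.
  lra.
have iterate n : exists g : SL, 1 / 2 <= Im (mob (smx g) z) \/ 2 ^+ n * Im z <= Im (mob (smx g) z).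
  elim: n => [|n [g [h|h]]]; first by exists s1; right; rewrite /= mob1 mul1r.
    by exists g; left.
  have [|lt] := leP (1 / 2) (Im (mob (smx g) z)); first by exists g; left.
  have gH := inH_mob (smxP g) zH; have [g' hg'] := step _ gH lt.
  exists (smul g' g); right; rewrite /= (mob_mul (smxP g') (smxP g) zH) exprS -mulrA.
  by apply: le_trans hg'; rewrite ler_pM2l.
pose n := Num.bound (Im z)^-1; have [g [h|h]] := iterate n; first by exists g.
exists g; apply: le_trans h; have b : (Im z)^-1 < n%:R by apply: archi_boundP; rewrite invr_ge0 ltW.
have b2 : n%:R <= 2 ^+ n :> R by rewrite -natrX ler_nat ltnW // ltn_expl.
have : 1 <= 2 ^+ n * Im z by rewrite -ler_pdivrMr // mul1r; apply: le_trans b2; exact: ltW.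
exact: half.
Qed.

(** * Growth and vanishing of families of translates *)

Section Family.
Variables (N : nat) (N0 : (0 < N)%N) (I : finType) (rp : I -> SL).

(** [F r] is the translate by r of one form. The function |F| W(Im) is compatible with the group,
    and up to equality on the half plane there are finitely many translates. Growth can thus be
    studied at height at least 1/2 for all cusps together. *)
Record family (W : R -> R) (F : SL -> fn) : Prop := {
  fam_qh : forall r, qh N (F r);
  fam_fin : forall r, exists i, forall z, inH z -> F r z = F (rp i) z;
  fam_mob : forall r g z, inH z ->
    nc (F (smul r g) z) * W (Im z) = nc (F r (mob (smx g) z)) * W (Im (mob (smx g) z)) }.

Lemma fam_bd W F (Y : R) : family W F -> 0 < Y -> exists2 M : R, 0 <= M & forall r, bdab (F r) Y M.
Proof.
move=> fF Y0; have /choice[m hm] : forall i, exists M : R, bdab (F (rp i)) Y M.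
  by move=> i; apply: (qh_bound N0 (fam_qh fF (rp i)) Y0).
exists (\sum_i `|m i|) => [|r z zY]; first by apply: sumr_ge0.
have zH : inH z by apply: lt_le_trans Y0 zY.
have [i ->] := fam_fin fF r => //; apply: (le_trans (hm i z zY)); apply: (le_trans (ler_norm _)).
by rewrite (bigD1 i) //= lerDl; apply: sumr_ge0.
Qed.

Lemma fam_up W F (B : R) : family W F ->
  (forall r z, 1 / 2 <= Im z -> nc (F r z) * W (Im z) <= B) ->
  forall r z, inH z -> nc (F r z) * W (Im z) <= B.
Proof.
move=> fF h r z zH; have [g hg] := red_height zH.
have -> : r = smul (smul r (sinv g)) g by rewrite -smulA sVmul smul1.
by rewrite (fam_mob fF) //; apply: h.
Qed.

(** In negative weight the invariant bound reads |F| <= B y^n, so the Fourier coefficients, computed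
    at height y, tend to 0 with y. *)
Lemma fam_neg n F : (0 < n)%N -> family (fun y => y^-1 ^+ n) F -> forall r z, inH z -> F r z = 0.
Proof.
move=> n0 fF r; have h2 : 0 < 1 / 2 :> R by lra.
have [M M0 hM] := fam_bd fF h2; pose B := M * 2 ^+ n.
have B0 : 0 <= B by rewrite mulr_ge0 // exprn_ge0.
have bd s z : inH z -> nc (F s z) <= B * Im z ^+ n.
  move=> zH; have y0 : 0 < Im z := zH.
  have : nc (F s z) * (Im z)^-1 ^+ n <= B.
    apply: (fam_up fF) zH => s' w w2; apply: ler_pM; [exact: nc_ge0| |exact: hM|].
      by rewrite exprn_ge0 // invr_ge0; apply: le_trans w2; exact: ltW.
    have w0 : 0 < Im w by apply: lt_le_trans w2.
    rewrite lerXn2r ?nnegrE ?invr_ge0 ?(ltW w0) // -[leRHS]invrK lef_pV2 ?posrE ?invr_gt0 //; lra.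
  by rewrite exprVn ler_pdivrMr // exprn_gt0.
have c0 m : coef N m (F r) = 0.
  apply: nc_eq0; apply/eqP; rewrite eq_le nc_ge0 andbT leNgt; apply/negP => cp.
  set c := nc _ in cp; pose A := 2 * B * expR (tau * m%:R / N%:R).
  have A0 : 0 <= A by rewrite !mulr_ge0 // expR_ge0.
  pose y := Num.min 1 (c / (2 * (A + 1))).
  have q : 0 < c / (2 * (A + 1)) by rewrite divr_gt0 // mulr_gt0 // ltr_wpDl.
  have y0 : 0 < y by rewrite lt_min ltr01.
  have y1 : y <= 1 by rewrite ge_min lexx.
  have yc : y <= c / (2 * (A + 1)) by rewrite ge_min lexx orbT.
  have := @coef_bound N N0 (F r) (fam_qh fF r) m y (B * y) y0 => h.
  have {}h : nc (coef N m (F r)) <= 2 * (B * y) * expR (tau * m%:R * y / N%:R).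
    apply: h => x; apply: (le_trans (bd r (pt x y) y0)); rewrite ler_wpM2l //=.
    by case: (n) n0 => // k _; rewrite exprS ler_piMr ?(ltW y0) // exprn_ile1 // ltW.
  rewrite -/c in h.
  have : c <= A * y.
    apply: (le_trans h); have -> : A * y = 2 * (B * y) * expR (tau * m%:R / N%:R) by rewrite /A; ring.
    rewrite ler_wpM2l ?mulr_ge0 ?(ltW y0) // ler_expR.
    rewrite ler_pM2r ?invr_gt0 ?(Nr0 N0) // ler_piMr // mulr_ge0 //; exact: ltW tau_gt0.
  move: yc; rewrite ler_pdivlMr; last by rewrite mulr_gt0 // ltr_wpDl.
  nra.
move=> z zH; have := expand_cvg N0 (fam_qh fF r) zH; rewrite cvgnP => h.
apply: nc_eq0; apply/eqP; rewrite eq_le nc_ge0 andbT leNgt; apply/negP => fp.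
have [k /(_ k (leqnn k))] := h _ fp.
by rewrite big1 => [|i _]; rewrite ?c0 ?mul0r // sub0r ncN ltxx.
Qed.

Lemma pow_expR D (y : R) : 0 <= y -> y ^+ D <= D`!%:R * expR y.
Proof.
move=> y0; case: D => [|D]; first by rewrite expr0 fact0 mul1r -exp.expR0 ler_expR.
rewrite mulrC -ler_pdivrMr ?ltr0n ?fact_gt0 //.
by apply: le_trans (expR_ge1Dxn D y0); rewrite lerDr.
Qed.

(** If the first K + 1 coefficients vanish, [expand] from height 1/4 leaves a remainder of
    exponential decay, which beats the power y^D as soon as s = tau (K + 1) / N is at least 1.
    Larger K makes kappa as small as desired. *)
Lemma vanish_bound D : exists K : nat, exists2 kappa : R, 0 <= kappa /\ kappa * 4 ^+ D <= 1 / 2 &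
  forall f (M : R), qh N f -> 0 <= M -> bdab f (1 / 4) M -> (forall m, (m < K.+1)%N -> coef N m f = 0) ->
  forall z, 1 / 2 <= Im z -> nc (f z) * Im z ^+ D <= M * kappa.
Proof.
have q4 : 1 / 4 < 1 / 2 :> R by lra.
have z0 : 0 < 1 / 4 :> R by lra.
have ar3 (M g p : R) : M * (4 / g * p) = 4 * M * (p / g) by ring.
have ar4 (M g p d e : R) : M * (g * p) * (d * e) = M * (g * d * (p * e)) by ring.
have ar1 (a y : R) : 0 < a -> 1 / 2 <= y -> a / 4 <= a * (y - 1 / 4) by nra.
have ar2 (s y : R) : 1 <= s -> 1 / 2 <= y -> - (s * (y - 1 / 4)) + y <= 1 / 2 - s / 4 by nra.
pose a : R := tau / N%:R; have a0 : 0 < a by rewrite divr_gt0 ?tau_gt0 ?(Nr0 N0).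
pose G : R := 4 / (1 - expR (- (a / 4))).
have a4 : 0 < a / 4 by rewrite divr_gt0.
have e1 : 0 < 1 - expR (- (a / 4)) by rewrite subr_gt0 -[ltRHS]exp.expR0 ltr_expR oppr_lt0.
have G0 : 0 <= G by rewrite divr_ge0 // ltW.
pose A : R := G * D`!%:R * expR (1 / 2) * 4 ^+ D.
have h2 : 0 < 1 / 2 :> R by lra.
have [n0 hn0] := expR_small a4 A h2.
pose K := maxn n0 (Num.bound a^-1); pose s : R := a * K.+1%:R.
have s1 : 1 <= s.
  rewrite /s -ler_pdivrMl // mulr1.
  have : a^-1 < (Num.bound a^-1)%:R by apply: archi_boundP; rewrite invr_ge0 ltW.
  by move=> /ltW h; apply: (le_trans h); rewrite ler_nat; apply: leqW; apply: leq_maxr.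
pose kappa : R := G * D`!%:R * expR (1 / 2 - s / 4).
exists K, kappa; first split.
- by apply: mulr_ge0 (expR_ge0 _); apply: mulr_ge0.
- have -> : kappa * 4 ^+ D = A * expR (- (a / 4 * K.+1%:R)).
    rewrite /kappa /A [in LHS]exp.expRD; have -> : - (a / 4 * K.+1%:R) = - (s / 4) by rewrite /s; field.
    ring.
  by apply: hn0; rewrite ler_nat; apply: leqW; apply: leq_maxl.
move=> f M qf M0 hM c0 z z2.
have y4 : 1 / 4 < Im z by apply: lt_le_trans z2.
have := expand N0 qf z0 y4 hM K; rewrite big1 => [|m _]; last by rewrite c0 ?mul0r.
rewrite subr0; set y := Im z in z2 y4 *.
have -> : tau * (y - 1 / 4) / N%:R = a * (y - 1 / 4) by rewrite /a mulrAC.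
set rho := expR _ => h.
have r1 : rho <= expR (- (a / 4)) by rewrite ler_expR lerN2; exact: ar1.
have rX : rho ^+ K.+1 = expR (- (s * (y - 1 / 4))).
  by rewrite /rho -expRM_natl; congr expR; rewrite /s; ring.
have y0 : 0 <= y by apply: le_trans z2; exact: ltW h2.
have yD := pow_expR D y0.
have h1 : nc (f z) <= M * (G * rho ^+ K.+1).
  apply: (le_trans h); rewrite /G.
  rewrite ar3 ler_wpM2l ?mulr_ge0 // ler_wpM2l ?exprn_ge0 ?expR_ge0 // lef_pV2 ?posrE // ?lerD2l ?lerN2 //.
  by apply: (lt_le_trans e1); rewrite lerD2l lerN2.
apply: (le_trans (ler_pM (nc_ge0 _) (exprn_ge0 _ y0) h1 yD)).
rewrite rX ar4 /kappa; apply: ler_wpM2l => //; apply: ler_wpM2l; first exact: mulr_ge0.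
by rewrite -exp.expRD ler_expR; exact: ar2.
Qed.

(** A bound B for |F| y^D gives |F| <= B 4^D at height at least 1/4, hence B/2 for |F| y^D at height
    at least 1/2, hence everywhere. Iteration yields 0. This contraction is the reason for requiring
    kappa 4^D <= 1/2. *)
Lemma fam_pos D : exists K : nat, forall F, family (fun y => y ^+ D) F ->
  (forall i m, (m < K)%N -> coef N m (F (rp i)) = 0) -> forall r z, inH z -> F r z = 0.
Proof.
have [K [kap [k0 k4] hK]] := vanish_bound D; exists K.+1 => F fF c0 r.
have {}c0 s m : (m < K.+1)%N -> coef N m (F s) = 0.
  by move=> mK; have [i hi] := fam_fin fF s; rewrite (coef_ext N0 m hi) c0.
have h4 : 0 < 1 / 4 :> R by lra.
have [M M0 hM] := fam_bd fF h4.
have b0 s z : inH z -> nc (F s z) * Im z ^+ D <= M * kap.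
  apply: (fam_up fF) => {}s {}z z2; apply: hK => //; [exact: fam_qh fF s|exact: c0].
have it n s z : inH z -> nc (F s z) * Im z ^+ D <= M * kap / 2 ^+ n.
  elim: n s z => [|n IH] s z zH; first by rewrite divr1 b0.
  move: s z zH; apply: (fam_up fF) => s z z2.
  pose B : R := M * kap / 2 ^+ n; have B0 : 0 <= B by rewrite divr_ge0 ?mulr_ge0 // exprn_ge0.
  have bb : bdab (F s) (1 / 4) (B * 4 ^+ D).
    move=> w w4; have wH : inH w by apply: lt_le_trans w4.
    have := IH s w wH; rewrite -/B -ler_pdivlMr ?exprn_gt0 // => h; apply: (le_trans h).
    rewrite ler_wpM2l // -exprVn lerXn2r ?nnegrE ?invr_ge0 ?(ltW wH) //.
    by rewrite -[leRHS]invrK lef_pV2 ?posrE ?invr_gt0 // -[leLHS]mul1r.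
  have := hK _ _ (fam_qh fF s) (mulr_ge0 B0 (exprn_ge0 D (ler0n _ 4))) bb (c0 s) z z2 => h.
  apply: (le_trans h); rewrite -[leLHS]mulrA [4 ^+ D * kap]mulrC.
  have -> : M * kap / 2 ^+ n.+1 = B * (1 / 2).
    by rewrite /B exprS invfM; field; rewrite expf_neq0 // pnatr_eq0.
  exact: ler_wpM2l.
move=> z zH; apply: nc_eq0; apply/eqP; rewrite eq_le nc_ge0 andbT leNgt; apply/negP => fp.
have p : 0 < nc (F r z) * Im z ^+ D by rewrite mulr_gt0 // exprn_gt0.
set u := _ * _ in p; pose n := Num.bound (M * kap / u).
have := it n r z zH; rewrite -/u ler_pdivlMr ?exprn_gt0 // -ler_pdivlMl // mulrC leNgt => /negP; apply.
have : M * kap / u < n%:R by apply: archi_boundP; apply: divr_ge0; [exact: mulr_ge0|exact: ltW].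
by move=> h; apply: (lt_le_trans h); rewrite -natrX ler_nat ltnW // ltn_expl.
Qed.
End Family.

(** * Classes modulo the level *)

Section Level.
Variables (N : nat) (N0 : (0 < N)%N).

Definition cls (g : SL) : 'M['I_N]_2 := \matrix_(i, j) Ordinal (ltn_pmod `|(smx g i j %% N)%Z| N0).

Lemma clsP g h : cls g = cls h -> forall i j, (N %| smx g i j - smx h i j)%Z.
Proof.
move=> e i j; have := congr1 (fun f : 'M['I_N]_2 => val (f i j)) e; rewrite !mxE /=.
have k (a : int) : (`|(a %% N)%Z| %% N)%N%:Z = (a %% N)%Z.
  have N' : N%:Z != 0 by rewrite eqz_nat -lt0n.
  have := modz_ge0 a N'; have := ltz_mod a N'.
  case: (a %% N)%Z => // m; rewrite absz_nat => + _; rewrite -abszE absz_nat ltz_nat => h1; by rewrite modn_small.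
by move=> /(congr1 Posz); rewrite !k => /eqP; rewrite eqz_mod_dvd.
Qed.

Lemma cls_reps : exists rp : 'M['I_N]_2 -> SL, forall g, cls (rp (cls g)) = cls g.
Proof.
have /choice[rp h] : forall c, exists r, forall g, cls g = c -> cls r = c.
  move=> c; case: (pselect (exists g, cls g = c)) => [[g e]|ne]; first by exists g.
  by exists s1 => g e; case: ne; exists g.
by exists rp => g; apply: (h _ g).
Qed.

Lemma cls_quot g h : cls g = cls h -> forall i j, (N %| smx (smul g (sinv h)) i j - (i == j)%:Z)%Z.
Proof.
move=> /clsP e i j; have := smulV h => /(congr1 (fun x => smx x i j)) /=; rewrite [RHS]mxE.
have -> : (i == j)%:R = (i == j)%:Z :> int by case: (i == j).
move=> <-; rewrite !mul2E opprD addrACA -!mulrBl rpredD //; apply: dvdz_mulr; exact: e.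
Qed.

(** T^N is congruent to 1 modulo N, so all its conjugates lie in the principal congruence subgroup;
    every cusp has a width dividing N. *)
Lemma conj_T (r : SL) i j : (N %| smx (smul r (smul (sT N%:Z) (sinv r))) i j - (i == j)%:Z)%Z.
Proof.
rewrite smulA; move: i j; apply: cls_quot; apply/matrixP => i j; rewrite [LHS]mxE [RHS]mxE; apply: val_inj => /=.
congr (`|_| %% _)%N; apply/eqP; rewrite eqz_mod_dvd mul2E.
have [t1 t2 t3 t4] := TZE N%:Z; rewrite /ga /gb /gc /gd in t1 t2 t3 t4.
have : (j == ord0) || (j == ord_max) by case: j => -[|[|]].
case/orP => /eqP ->; rewrite ?t1 ?t2 ?t3 ?t4 !(mulr0, mulr1) ?(addr0, add0r) ?subrr ?dvdz0 //.
by rewrite addrK dvdz_mull.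
Qed.
End Level.

(** * Spaces of modular forms *)

Section Cong.
Variables (G : 'M[int]_2 -> Prop) (N : nat) (N0 : (0 < N)%N).
Hypothesis lvl : forall g, SL2Z g -> (forall i j, (N%:Z %| g i j - (i == j)%:Z)%Z) -> G g.

Definition linv (T : Type) (F : SL -> T) := forall g r : SL, G (smx g) -> F (smul g r) = F r.

Lemma linv_cls (T : Type) (F : SL -> T) r s : linv F -> cls N0 r = cls N0 s -> F r = F s.
Proof.
move=> hF e; have -> : r = smul (smul r (sinv s)) s by rewrite -smulA sVmul smul1.
by apply: hF; apply: lvl (cls_quot e); exact: smxP.
Qed.
Lemma linv_T (T : Type) (F : SL -> T) r : linv F -> F (smul r (sT N%:Z)) = F r.
Proof.
move=> hF; have -> : smul r (sT N%:Z) = smul (smul r (smul (sT N%:Z) (sinv r))) r.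
  by rewrite -!smulA sVmul smul1.
by apply: hF; apply: lvl (conj_T N0 r); exact: smxP.
Qed.

Hypothesis GS : forall g, G g -> SL2Z g.

Lemma slash_mul k f x y z : SL2Z x -> SL2Z y -> inH z ->
  slash k f (x *m y) z = (jac y z)^-1 ^+ k * slash k f x (mob y z).
Proof.
move=> sx sy zH; rewrite /slash -/(jac _ z) -/(jac x _) (jac_mul x sy zH) (mob_mul sx sy zH).
by rewrite invfM exprMn mulrCA mulrA.
Qed.
Lemma holo_slash k f r : holo f -> SL2Z r -> holo (slash k f r).
Proof.
move=> hf sr; have hi : holo (fun z => (jac r z)^-1).
  by apply: (holoV _ (@holo_jac r)) => z zH; apply: jac_neq0.
exact (holoM (holoX (n:=k) hi) (holo_comp (fun z zH => inH_mob sr zH) hf (@holo_mob _ sr))).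
Qed.
Lemma slash_T k f r (n : int) z : SL2Z r -> inH z -> slash k f (r *m TZ n) z = slash k f r (z + n%:~R).
Proof. by move=> sr zH; rewrite (slash_mul k f sr (SL_T n) zH) jac_T mob_T invr1 expr1n mul1r. Qed.
Lemma slash_s1 k f z : slash k f (smx s1) z = f z.
Proof. by rewrite /slash -/(jac _ z) /= jac1 mob1 invr1 expr1n mul1r. Qed.

Lemma has_cusp r : SL2Z r -> exists c, maps_to_inf r c.
Proof.
move=> sr; have [c0|c0] := eqVneq (gc r) 0; first by exists None.
exists (Some (- (gd r)%:~R / (gc r)%:~R)); rewrite /maps_to_inf mulrCA mulfV ?intr_eq0 // mulr1 addNr //.
Qed.

Lemma qh_perd M f K : (0 < M)%N -> qh M f -> perd K f -> qh K f.
Proof. by move=> M0 [hf _ b] pk; split. Qed.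

(** Modular forms with the cusps replaced by all translates under SL_2(Z), each with the common
    period N. *)
Record mf (m : nat) (f : fn) : Prop := {
  mf_holo : holo f;
  mf_inv : forall z, inH z -> linv (fun r => slash (2 * m) f (smx r) z);
  mf_qh : forall r : SL, qh N (slash (2 * m) f (smx r)) }.

(** Each r maps some cusp to infinity, and its translate has period N by [linv_T]. Conversely,
    boundedness high up does not refer to the period, so it gives the expansion for whatever period
    K is tested. *)
Lemma modformP m f : modform (2 * m) G f <-> mf m f.
Proof.
split=> [[hf fi fc]|[hf fi fq]].
  have inv z : inH z -> linv (fun r => slash (2 * m) f (smx r) z).
    move=> zH g r gG /=; have rH := inH_mob (smxP r) zH.
    rewrite (slash_mul _ _ (smxP g) (smxP r) zH) {1}/slash (fi _ gG _ rH) -/(jac (smx g) _).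
    rewrite [X in _ * X]mulrA -exprMn mulVf ?expr1n ?mul1r //; exact: jac_neq0 (smxP g) rH.
  split; [exact: hf|exact: inv|move=> r]; have [c hc] := has_cusp (smxP r); apply: (qexp_qh N0).
    exact: (@holo_slash (2 * m) f (smx r) hf (smxP r)).
  apply: fc (smxP r) hc N N0 _ => z zH.
  by have /= := linv_T r (inv z zH); rewrite (slash_T _ _ _ (smxP r) zH).
split; [exact: hf|move=> g gG z zH|move=> c r sr _ K K0 pk].
  have sg := GS gG; have /= := fi z zH (MkSL sg) s1 gG; rewrite mulmx1 slash_s1 /slash -/(jac g z).
  by move=> <-; rewrite mulrA -exprMn mulfV ?expr1n ?mul1r // jac_neq0.
by apply: (qh_qexp K0); apply: (qh_perd N0) pk; apply: (fq (MkSL sr)).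
Qed.

Lemma mf_family rp m f : (forall g, cls N0 (rp (cls N0 g)) = cls N0 g) -> mf m f ->
  family N rp (fun y => y ^+ m) (fun r => slash (2 * m) f (smx r)).
Proof.
move=> hrp [hf fi fq]; split; [exact: fq|move=> r|move=> r g z zH].
  exists (cls N0 r) => z zH; apply: (linv_cls (F := fun r => slash (2 * m) f (smx r) z)) => //.
    exact: fi.
rewrite /= (slash_mul _ _ (smxP r) (smxP g) zH) ncM ncX ncV (Im_mob (smxP g) zH) mulrAC mulrC.
by congr (_ * _); rewrite expr_div_n mulrC exprVn exprM.
Qed.

Lemma slashD k f g r z : slash k (fun z => f z + g z) r z = slash k f r z + slash k g r z.
Proof. by rewrite /slash mulrDr. Qed.
Lemma slashZ k c f r z : slash k (fun z => c * f z) r z = c * slash k f r z.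
Proof. by rewrite /slash mulrCA. Qed.

Lemma mfD m f g : mf m f -> mf m g -> mf m (fun z => f z + g z).
Proof.
move=> [hf fi fq] [hg gi gq]; split; first exact: (holoD hf hg).
  by move=> z zH x r xG; rewrite /= !slashD; congr (_ + _); [apply: fi|apply: gi].
by move=> r; apply: (qh_ext _ (qhD N0 (fq r) (gq r))) => z _; rewrite slashD.
Qed.
Lemma mfZ m c f : mf m f -> mf m (fun z => c * f z).
Proof.
move=> [hf fi fq]; split; first exact: (holoZ (k := c) hf).
  by move=> z zH x r xG; rewrite /= !slashZ; congr (_ * _); apply: fi.
by move=> r; apply: (qh_ext _ (qhZ N0 c (fq r))) => z _; rewrite slashZ.
Qed.
Lemma mf0 m : mf m (fun=> 0).
Proof.
have s0 r z : slash (2 * m) (fun=> 0) r z = 0 by rewrite /slash mulr0.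
split; [exact: holo_cst|by move=> z zH x r _ /=; rewrite !s0|].
by move=> r; apply: (qh_ext _ (qh_cst N 0)) => z _; rewrite s0.
Qed.
Lemma mf_sum (J : Type) (s : seq J) m (c : J -> C) (F : J -> fn) : (forall j, mf m (F j)) ->
  mf m (fun z => \sum_(j <- s) c j * F j z).
Proof.
move=> hF; elim: s => [|j s IH].
  by have -> : (fun z => \sum_(j <- [::]) c j * F j z) = (fun=> 0); [apply: funext => z; rewrite big_nil|exact: mf0].
have -> : (fun z => \sum_(i <- j :: s) c i * F i z) = (fun z => c j * F j z + \sum_(i <- s) c i * F i z).
  by apply: funext => z; rewrite big_cons.
exact: mfD (mfZ _ (hF j)) IH.
Qed.

(** The first K coefficients of the finitely many translates give a matrix with more rows than
    columns. A vector in its kernel combines the forms to one that vanishes by [fam_pos]. *)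
Lemma mf_dep m : exists B : nat, forall F : 'I_B.+1 -> fn, (forall i, mf m (F i)) ->
  exists2 c : 'I_B.+1 -> C, exists i, c i != 0 & forall z, inH z -> \sum_i c i * F i z = 0.
Proof.
have [rp hrp] := cls_reps N0; have [K hK] := fam_pos N0 rp m.
pose J : finType := ('M['I_N]_2 * 'I_K)%type; pose ev (j : 'I_#|J|) : J := enum_val j; exists #|J| => F hF.
pose A : 'M[R[i]]_(#|J|.+1, #|J|) :=
  \matrix_(i, j) coef N (ev j).2 (slash (2 * m) (F i) (smx (rp (ev j).1))).
have : kermx A != 0.
  by rewrite -mxrank_eq0 mxrank_ker subn_eq0 -ltnNge ltnS rank_leq_col.
case/rowV0Pn => u /sub_kermxP uA u0; exists (fun i => u ord0 i).
  apply/existsP; rewrite -negb_forall; apply/negP => /forallP h; case/negP: u0; apply/eqP/matrixP => i j.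
  by rewrite !ord1 mxE; apply/eqP/h.
pose f z := \sum_(i <- index_enum 'I_#|J|.+1) u ord0 i * F i z.
have mff : mf m f by exact: mf_sum.
have h := hK _ (mf_family hrp mff); move=> z zH.
have := h _ s1 z zH; rewrite slash_s1; apply => a k kK.
have sf w : \sum_(i <- index_enum 'I_#|J|.+1) u ord0 i * slash (2 * m) (F i) (smx (rp a)) w
   = slash (2 * m) f (smx (rp a)) w.
  by rewrite /slash /f mulr_sumr; apply: eq_bigr => i _; rewrite mulrCA.
rewrite -(coef_ext N0 k (fun w _ => sf w)).
have qi i : qh N (fun w => u ord0 i * slash (2 * m) (F i) (smx (rp a)) w) by apply: (qhZ N0); apply: mf_qh.
rewrite (coef_sum N0 k _ qi).
have := congr1 (fun v : 'rV__ => v ord0 (enum_rank ((a, Ordinal kK) : J))) uA; rewrite mxE [RHS]mxE.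
move=> e; rewrite -[RHS]e; apply: eq_bigr => i _; rewrite mxE /ev enum_rankK /=.
by rewrite (coefZ N0) //; apply: mf_qh.
Qed.

Lemma lincomb_fnE (cs : seq C) (fs : seq fn) z : size cs = size fs ->
  lincomb_fn cs fs z = \sum_(i < size fs) nth 0 cs i * nth (fun=> 0) fs i z.
Proof.
move=> e; rewrite /lincomb_fn (big_nth (0, fun=> 0)) big_mkord size_zip e minnn.
by apply: eq_bigr => i _; rewrite nth_zip.
Qed.

Definition findep (vs : seq fn) := forall cs : seq C, size cs = size vs ->
  (forall z, inH z -> lincomb_fn cs vs z = 0) -> forall i, nth 0 cs i = 0.

(** An independent family of maximal length exists by [mf_dep]; by maximality it spans. *)
Lemma mf_dim m : exists d, dim_fn (modform (2 * m) G) d.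
Proof.
have [B hB] := mf_dep m.
pose P n := `[< exists vs : seq fn, [/\ size vs = n, forall i, (i < n)%N -> mf m (nth (fun=> 0) vs i) & findep vs] >].
have P0 : exists n, P n.
  by exists 0; apply/asboolP; exists [::]; split=> // cs; move/eqP; rewrite size_eq0 => /eqP -> _ i; rewrite nth_nil.
have Pn n : P n -> (n <= B)%N.
  move=> /asboolP[vs [sv mv iv]]; rewrite leqNgt; apply/negP => Bn.
  have [|c [i ci] hc] := hB (fun i => nth (fun=> 0) vs i).
    by move=> i; apply: mv; apply: leq_trans Bn.
  pose cs := [seq (if insub k is Some j then c j else 0) | k <- iota 0 n].
  have scs : size cs = size vs by rewrite size_map size_iota.
  have ncs k : nth 0 cs k = if insub k is Some j then c j else 0.
    have [kn|kn] := ltnP k n; first by rewrite (nth_map 0) ?size_iota // nth_iota.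
    rewrite nth_default ?size_map ?size_iota //; case: insubP => // j /= kB jk.
    by have := leq_trans kB (leq_trans Bn kn); rewrite ltnn.
  case/negP: ci; have := iv cs scs _ i; rewrite ncs valK => -> // z zH.
  pose F k := (if insub k is Some j then c j else 0) * nth (fun=> 0) vs k z.
  rewrite lincomb_fnE // sv -[RHS](hc z zH).
  transitivity (\sum_(k < B.+1) F k); last by apply: eq_bigr => k _; rewrite /F valK.
  rewrite (big_ord_widen n F Bn) [RHS]big_mkcond /=; apply: eq_bigr => k _; rewrite /F ncs.
  by case: ifP => // /negbT kB; rewrite insubN // mul0r.
have mx := ex_maxnP P0 Pn; case: mx => d /asboolP[vs [sv mv iv]] dmax; exists d, vs; split=> //.
- by move=> i id; apply/modformP; apply: mv.
- by move=> cs scs h; apply: iv; rewrite ?sv // => z zH; rewrite h.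
move=> v /modformP mfv.
have : ~ findep (v :: vs).
  move=> iv'; have : P d.+1.
    apply/asboolP; exists (v :: vs); split=> //; first by rewrite /= sv.
    by case=> [|i] //= id; apply: mv.
  by move=> /dmax; rewrite ltnn.
move=> /existsNP[cs] /not_implyP[scs] /not_implyP[hz] /existsNP[i ci].
case: cs scs hz i ci => // c cs [scs] hz i ci.
have hz' z : inH z -> c * v z + lincomb_fn cs vs z = 0.
  by move=> zH; have := hz z zH; rewrite /lincomb_fn /= big_cons.
have c0 : c != 0.
  apply/eqP => c0; case: i ci => [|i] /=; first by rewrite c0.
  by case; apply: (iv cs scs) => z zH; have := hz' z zH; rewrite c0 mul0r add0r.
exists [seq - (c^-1 * x) | x <- cs]; split; first by rewrite size_map scs.
move=> z zH; have /eqP := hz' z zH; rewrite addr_eq0 => /eqP e.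
have -> : v z = - c^-1 * lincomb_fn cs vs z by rewrite mulNr -mulrN -e mulKf.
rewrite !lincomb_fnE ?size_map // mulr_sumr; apply: eq_bigr => j _.
by rewrite (nth_map 0) ?scs // !mulrA mulNr.
Qed.

(** All powers of f have weight 0 and so are linearly dependent: f satisfies a polynomial equation
    with constant coefficients, takes finitely many values and is locally constant. *)
Lemma mf_0cst f : mf 0 f -> exists c, forall z, inH z -> f z = c.
Proof.
move=> mff; have [B hB] := mf_dep 0; have hf := mf_holo mff.
have s0 h r z : slash (2 * 0) h r z = h (mob r z) by rewrite /slash muln0 expr0 mul1r.
have mX n : mf 0 (fun z => f z ^+ n).
  split; first exact: (holoX (n := n) hf).
    by move=> z zH g r gG /=; rewrite !s0; congr (_ ^+ n); have := mf_inv mff zH r gG; rewrite /= !s0.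
  move=> r; elim: n => [|n IH].
    by apply: (qh_ext _ (qh_cst N 1)) => z _; rewrite s0.
  by apply: (qh_ext _ (qhM N0 (mf_qh mff r) IH)) => z _; rewrite !s0 exprS.
have [c [i0 ci] hc] := hB (fun i z => f z ^+ i) (fun i => mX i).
pose p : {poly R[i]} := \poly_(i < B.+1) (if insub i is Some j then c j else 0).
have p0 : p != 0.
  apply/eqP => /(congr1 (fun q : {poly R[i]} => q`_i0)); rewrite coef_poly ltn_ord coef0 valK.
  by move/eqP; rewrite (negbTE ci).
have pf z : inH z -> p.[f z] = 0.
  move=> zH; rewrite horner_poly -[RHS](hc z zH); apply: eq_bigr => i _; by rewrite valK.
suff d0 z : inH z -> der f z = 0.
  by exists (f iC) => z zH; apply: (holo_der0 hf d0 zH inH_i).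
move=> zH; apply: cdiff_der.
(* Near z the factor q(f(w)) stays nonzero by continuity, so the power of X - f(z) must vanish at
   f(w), that is f(w) = f(z). *)
have [m [q [/implyP/(_ p0) qr pE]]] := multiplicity_XsubC p (f z).
have qc : ccts (fun w => q.[f w]) z.
  have hq : holo (fun w => q.[f w]).
    have h i : holo (fun w => q`_i * f w ^+ i) by exact: (holoZ (k := q`_i) (holoX (n := i) hf)).
    have := @holo_sum _ (index_enum 'I_(size q)) (fun (i : 'I_(size q)) w => q`_i * f w ^+ i) (fun i => h i).
    by apply: holo_ext => w _; rewrite horner_coef.
  exact: cdiff_ccts (holo_cdiff hq zH).
have q0 : 0 < nc q.[f z] by rewrite nc_gt0.
have [d1 d10 h1] := qc _ q0; have z0 : 0 < Im z := zH.
move=> e e0; exists (Num.min d1 (Im z)) => [|h]; first by rewrite lt_min d10.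
rewrite lt_min => /andP[hd1 hd2].
have wH : inH (z + h) by exact: inH_nbhs.
have qw : q.[f (z + h)] != 0.
  apply/eqP => q1; have := h1 (z + h); have -> : z + h - z = h by ring.
  by move=> /(_ hd1); rewrite q1 sub0r ncN ltxx.
have := pf _ wH; rewrite pE hornerM horner_exp hornerXsubC => /eqP.
rewrite mulf_eq0 (negbTE qw) /= expf_eq0 => /andP[_ /eqP ->].
by rewrite sub0r mulr0 oppr0 nc0 mulr_ge0 ?nc_ge0 // ltW.
Qed.
End Cong.

(** * A quasi-modular form of weight 2 *)

(** A summable majorant that is finite at 0. *)
Definition mz (n : int) : R := ((`|n|%N.+1)%:R ^+ 2)^-1.
Definition zr (D : nat) : seq int := [seq i%:Z - D%:Z | i <- iota 0 (2 * D).+1].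
Definition box (A D : nat) : seq (int * int) := [seq (c, d) | c <- zr A, d <- zr D].

Lemma mz_ge0 n : 0 <= mz n. Proof. by rewrite invr_ge0 exprn_ge0. Qed.
Lemma zr_uniq D : uniq (zr D).
Proof. by rewrite map_inj_uniq ?iota_uniq // => i j /addIr[]. Qed.
Lemma mem_zr D (n : int) : (n \in zr D) = (`|n| <= D)%N.
Proof.
apply/mapP/idP => [[j + ->]|h]; first by rewrite mem_iota => /andP[_ h]; lia.
by exists (absz (n + D%:Z)); [rewrite mem_iota|]; lia.
Qed.
Lemma box_uniq A D : uniq (box A D).
Proof. by apply: allpairs_uniq; rewrite ?zr_uniq // => -[c d] [c' d'] _ _ [-> ->]. Qed.
Lemma mem_box A D p : (p \in box A D) = (`|p.1| <= A)%N && (`|p.2| <= D)%N.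
Proof.
apply/allpairsP/idP => [[[c d]] /= [h1 h2 ->]|]; first by rewrite -!mem_zr h1 h2.
by case: p => c d /=; rewrite -!mem_zr => /andP[h1 h2]; exists (c, d).
Qed.

Definition Sz D : R := \sum_(n <- zr D) mz n.
Lemma zrS D : perm_eq (zr D.+1) [:: D.+1%:Z, - D.+1%:Z & zr D].
Proof.
apply: uniq_perm; first exact: zr_uniq.
  by rewrite cons_uniq cons_uniq zr_uniq in_cons !mem_zr andbT; apply/andP; split; [rewrite negb_or; apply/andP; split; [apply/eqP; lia|lia]|lia].
move=> n; rewrite mem_zr 2!in_cons mem_zr; apply/idP/idP => [h|/or3P[/eqP->|/eqP->|]]; try lia.
Qed.
Lemma SzS D : Sz D.+1 = Sz D + 2 / D.+2%:R ^+ 2.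
Proof.
rewrite /Sz (perm_big _ (zrS D)) !big_cons /= /mz abszN absz_nat.
rewrite addrA addrC; congr (_ + _); ring.
Qed.
(** [Sz D] increases while [Sz D] + 2/(D+1) decreases; this is the tail estimate. *)
Lemma Sz_step D : Sz D.+1 + 2 / D.+2%:R <= Sz D + 2 / D.+1%:R.
Proof.
rewrite SzS -addrA lerD2l -[D.+2%:R]natr1; set x : R := D.+1%:R.
have x0 : 0 < x by rewrite ltr0n.
have -> : 2 / x = 2 / (x + 1) ^+ 2 + 2 / (x + 1) + 2 / (x * (x + 1) ^+ 2).
  by field; rewrite !gt_eqF //= ltr_wpDl.
by rewrite lerDl divr_ge0 // mulr_ge0 ?exprn_ge0 ?ltW // ltr_wpDl.
Qed.
Lemma Sz_mono D M : (D <= M)%N -> Sz M + 2 / M.+1%:R <= Sz D + 2 / D.+1%:R.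
Proof.
elim: M => [|M IH]; first by rewrite leqn0 => /eqP ->.
rewrite leq_eqVlt => /orP[/eqP -> //|DM]; exact: le_trans (Sz_step M) (IH DM).
Qed.
Lemma Sz_ge0 D : 0 <= Sz D. Proof. by apply: sumr_ge0 => n _; apply: mz_ge0. Qed.
Lemma Sz_le3 D : Sz D <= 3.
Proof.
have := Sz_mono (leq0n D); have : Sz 0 = 1 by rewrite /Sz /zr /= big_seq1 /mz subrr absz0 expr1n invr1.
move=> ->; have : 0 <= 2 / D.+1%:R :> R by rewrite divr_ge0.
by set x := _ / _; rewrite divr1; lra.
Qed.

Lemma sum_box (V : nmodType) (f : int -> int -> V) A D :
  \sum_(p <- box A D) f p.1 p.2 = \sum_(c <- zr A) \sum_(d <- zr D) f c d.
Proof. by rewrite /box big_allpairs. Qed.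
Lemma Sz_box A D : \sum_(p <- box A D) mz p.1 * mz p.2 = Sz A * Sz D.
Proof. by rewrite (sum_box (fun c d => mz c * mz d)) mulr_suml; apply: eq_bigr => c _; rewrite mulr_sumr. Qed.

Lemma sum_sub (V : zmodType) (f : int * int -> V) (s t : seq (int * int)) : uniq s -> uniq t -> {subset t <= s} ->
  \sum_(p <- s) f p = \sum_(p <- t) f p + \sum_(p <- [seq p <- s | p \notin t]) f p.
Proof.
move=> us ut ts; rewrite (bigID (fun p => p \in t)) /=; congr (_ + _); last by rewrite big_filter.
rewrite -big_filter; apply: perm_big; apply: uniq_perm => //; first exact: filter_uniq.
by move=> p; rewrite mem_filter andb_idr // => /ts.
Qed.

(** Over the complement of the box the majorant sums to at most Sz(M)^2 - Sz(D)^2, where Sz <= 3 and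
    Sz(M) - Sz(D) <= 2/(D+1): hence 6 * 2 = 12. *)
Lemma sum_tail (f : int * int -> C) (ka : R) (s : seq (int * int)) D : 0 <= ka ->
  (forall p, nc (f p) <= ka * (mz p.1 * mz p.2)) -> uniq s -> {subset box D D <= s} ->
  nc (\sum_(p <- s) f p - \sum_(p <- box D D) f p) <= ka * (12 / D.+1%:R).
Proof.
move=> k0 hf us bs; rewrite (sum_sub f us (box_uniq D D) bs) addrAC subrr add0r.
apply: (le_trans (nc_sum _ _ _)).
pose M := maxn D (\max_(p <- s) maxn `|p.1| `|p.2|).
have sM : {subset s <= box M M}.
  move=> p ps; rewrite mem_box; have := @leq_bigmax_seq _ s xpredT (fun p : int * int => maxn `|p.1| `|p.2|) p ps isT.
  by rewrite geq_max => /andP[h1 h2]; rewrite /M !leq_max h1 h2 !orbT.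
have DM : (D <= M)%N by rewrite leq_maxl.
apply: (@le_trans _ _ (\sum_(p <- [seq p <- s | p \notin box D D]) ka * (mz p.1 * mz p.2))).
  by apply: ler_sum => p _; apply: hf.
rewrite -mulr_sumr ler_wpM2l //.
apply: (@le_trans _ _ (\sum_(p <- [seq p <- box M M | p \notin box D D]) mz p.1 * mz p.2)).
  have fs : {subset [seq p <- s | p \notin box D D] <= [seq p <- box M M | p \notin box D D]}.
    by move=> p; rewrite !mem_filter => /andP[-> /sM].
  rewrite (sum_sub (fun p => mz p.1 * mz p.2) (filter_uniq _ (box_uniq M M)) (filter_uniq _ us) fs) lerDl.
  by apply: sumr_ge0 => p _; rewrite mulr_ge0 ?mz_ge0.
have bb : {subset box D D <= box M M} by move=> p; rewrite !mem_box; lia.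
have := sum_sub (fun p => mz p.1 * mz p.2) (box_uniq M M) (box_uniq D D) bb; rewrite !Sz_box => e.
have -> : \sum_(p <- [seq p <- box M M | p \notin box D D]) mz p.1 * mz p.2 = Sz M * Sz M - Sz D * Sz D.
  by rewrite e addrAC subrr add0r.
have := Sz_mono DM; have : 0 <= 2 / M.+1%:R :> R by rewrite divr_ge0.
have -> : 12 / D.+1%:R = 6 * (2 / D.+1%:R) :> R by rewrite mulrA -natrM.
have : 0 <= 2 / D.+1%:R :> R by rewrite divr_ge0.
move: (Sz_le3 D) (Sz_le3 M) (Sz_ge0 D) (Sz_ge0 M); move: (2 / _) (2 / _) (Sz D) (Sz M) => x y a b.
clear => h1 h2 h3 h4 h5 h6 h7; nra.
Qed.

Lemma real_limit (u : nat -> R) (K : R) : (forall D M, (D <= M)%N -> `|u M - u D| <= K / D.+1%:R) ->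
  exists l, forall D, `|u D - l| <= K / D.+1%:R.
Proof.
move=> hu; have ab D M : u D - K / D.+1%:R <= u M + K / M.+1%:R.
  have : 0 <= K / D.+1%:R by apply: le_trans (hu D D (leqnn D)).
  have : 0 <= K / M.+1%:R by apply: le_trans (hu M M (leqnn M)).
  by case/orP: (leq_total D M) => /hu; rewrite ler_norml => /andP[]; move: (K / _) (K / _) => x y; lra.
pose A : set R := [set x | exists D, x = u D - K / D.+1%:R]%classic.
have hs : has_sup A.
  by split; [exists (u 0 - K / 1); exists 0|exists (u 0 + K / 1) => _ [D ->]; exact: (ab D 0)].
exists (sup A) => D; rewrite ler_norml; apply/andP; split.
  suff : sup A <= u D + K / D.+1%:R by move: (K / _) => x; lra.
  by apply: ge_sup; [case: hs|move=> _ [M ->]].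
suff : u D - K / D.+1%:R <= sup A by move: (K / _) => x; lra.
by apply: ub_le_sup; [case: hs|exists D].
Qed.

(** The error is uniform over all finite index sets containing the box, which permits reindexing by
    lattice maps. Of the constant 36, 12 comes from the tail and 12 each from the real and imaginary
    part of the limit. *)
Lemma usum_ex (f : int * int -> C) (ka : R) : 0 <= ka -> (forall p, nc (f p) <= ka * (mz p.1 * mz p.2)) ->
  exists l : C, forall s D, uniq s -> {subset box D D <= s} -> nc (\sum_(p <- s) f p - l) <= ka * 36 / D.+1%:R.
Proof.
move=> k0 hf; pose u D := \sum_(p <- box D D) f p.
have hu D M : (D <= M)%N -> nc (u M - u D) <= ka * 12 / D.+1%:R.
  move=> DM; rewrite -mulrA; apply: sum_tail => //; first exact: box_uniq.
  by move=> p; rewrite !mem_box; lia.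
have [a ha] := @real_limit (fun D => Re (u D)) (ka * 12) (fun D M DM =>
  le_trans (eq_ind _ (fun x => `|x| <= nc (u M - u D)) (nc_Re (u M - u D)) _ (etrans (ReD _ _) (congr1 _ (ReN _)))) (hu D M DM)).
have [b hb] := @real_limit (fun D => Im (u D)) (ka * 12) (fun D M DM =>
  le_trans (eq_ind _ (fun x => `|x| <= nc (u M - u D)) (nc_Im (u M - u D)) _ (etrans (ImD _ _) (congr1 _ (ImN _)))) (hu D M DM)).
exists (complex.Complex a b) => s D us bs.
have h1 : nc (u D - complex.Complex a b) <= ka * 24 / D.+1%:R.
  apply: (le_trans (nc_le _)); rewrite ReD ImD ReN ImN /=; have := ha D; have := hb D.
  have -> : ka * 24 / D.+1%:R = ka * 12 / D.+1%:R + ka * 12 / D.+1%:R by rewrite -mulrDl -mulrDr -natrD.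
  by move=> h1 h2; apply: lerD.
have h2 := sum_tail k0 hf us bs; rewrite mulrA in h2.
have -> : \sum_(p <- s) f p - complex.Complex a b = (\sum_(p <- s) f p - u D) + (u D - complex.Complex a b).
  by rewrite addrA subrK.
apply: (le_trans (nc_tri _ _)).
have -> : ka * 36 / D.+1%:R = ka * 12 / D.+1%:R + ka * 24 / D.+1%:R by rewrite -mulrDl -mulrDr -natrD.
exact: lerD.
Qed.

(** * The regularized lattice sum *)

Definition lin (p : int * int) (z : C) : C := p.1%:~R * z + p.2%:~R.
Definition hC : C := rC (1 / 2).
Definition rr (z : C) (p : int * int) : C :=
  if p.1 == 0 then 0 else (lin p z)^-1 ^+ 2 - ((lin p z) ^+ 2 - hC ^+ 2)^-1.
Definition stripc (B y0 : R) : R := y0^-1 + 1 + B / y0.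

Lemma stripc_ge0 (B y0 : R) : 0 <= B -> 0 < y0 -> 0 <= stripc B y0.
Proof. by move=> B0 y0p; rewrite !addr_ge0 ?divr_ge0 ?invr_ge0 // ltW. Qed.

Lemma lin_lb (B y0 t : R) (c d : int) (z : C) : 0 < y0 -> `|Re z| <= B -> y0 <= Im z ->
  `|c%:~R| + `|d%:~R + t| <= stripc B y0 * nc (lin (c, d) z + rC t).
Proof.
move=> y0p zB zy; set n := nc _; have B0 : 0 <= B by apply: le_trans zB.
have n0 : 0 <= n by exact: nc_ge0.
have iE : Im (lin (c, d) z + rC t) = c%:~R * Im z by rewrite /lin !ImD ImM Re_int !Im_int /= mul0r !addr0.
have rE : Re (lin (c, d) z + rC t) = c%:~R * Re z + (d%:~R + t).
  by rewrite /lin !ReD ReM !Re_int Im_int /= mul0r subr0 addrA.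
have h1 : `|c%:~R| * y0 <= n.
  apply: le_trans (nc_Im _); rewrite iE normrM ler_wpM2l //; apply: le_trans zy (ler_norm _).
have h2 : `|c%:~R| <= n / y0 by rewrite ler_pdivlMr.
have h3 : `|d%:~R + t| <= n + n / y0 * B.
  have -> : d%:~R + t = (c%:~R * Re z + (d%:~R + t)) - c%:~R * Re z by rewrite [LHS]addrC addrAC subrr add0r addrC.
  apply: (le_trans (ler_normB _ _)); apply: lerD; first by rewrite -rE; exact: nc_Re.
  by rewrite normrM; apply: ler_pM.
have -> : stripc B y0 * n = n / y0 + (n + n / y0 * B) by rewrite /stripc; ring.
exact: lerD.
Qed.

Lemma rr_fact (X : C) : X != 0 -> X - hC != 0 -> X + hC != 0 ->
  X^-1 ^+ 2 - (X ^+ 2 - hC ^+ 2)^-1 = - hC ^+ 2 * (X^-1 ^+ 2 * ((X - hC)^-1 * (X + hC)^-1)).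
Proof.
move=> h1 h2 h3; have h4 : X ^+ 2 - hC ^+ 2 != 0 by rewrite subr_sqr mulf_neq0.
by field; rewrite h4 h2 h3 h1.
Qed.

Lemma lin_neq0 (z : C) (p : int * int) (t : R) : inH z -> p.1 != 0 -> lin p z + rC t != 0.
Proof.
move=> zH c0; apply/eqP => /(congr1 Im); rewrite /lin !ImD ImM Re_int !Im_int /= mul0r !addr0 => /eqP.
by rewrite mulf_eq0 intr_eq0 (negbTE c0) gt_eqF.
Qed.

(** The difference decays like n^{-4} with n = |c| + |d| >= 1. The constant 9 is the square of 3 in
    (1 + |c|)(1 + |d|) <= 3 n^2, which compares this with the product majorant. *)
Lemma rr_bound (B y0 : R) (z : C) p : 0 < y0 -> `|Re z| <= B -> y0 <= Im z ->
  nc (rr z p) <= 9 * stripc B y0 ^+ 4 * (mz p.1 * mz p.2).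
Proof.
move=> y0p zB zy; have B0 : 0 <= B by apply: le_trans zB.
have zH : inH z by apply: lt_le_trans zy.
have k0 := stripc_ge0 B0 y0p; set k := stripc B y0 in k0 *.
rewrite /rr; case: eqVneq => [_|c0].
  by rewrite nc0 mulr_ge0 ?mulr_ge0 ?mz_ge0 // exprn_ge0.
case: p c0 => c d /= c0; set X := lin _ _.
have X0 : X != 0 by have := @lin_neq0 z (c, d) 0 zH c0; rewrite rC0 addr0.
have X1 : X - hC != 0 by rewrite /hC -rCN; exact: lin_neq0.
have X2 : X + hC != 0 by exact: lin_neq0.
pose cr : R := `|c%:~R|; pose dr : R := `|d%:~R|; pose n := cr + dr.
have c1 : 1 <= cr by rewrite /cr -intr_norm (ler_int R 1) -gtz0_ge1 normr_gt0.
have d0 : 0 <= dr by rewrite /dr.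
have n1 : 1 <= n by rewrite /n; lra.
have b0 : n <= k * nc X.
  by have := @lin_lb B y0 0 c d z y0p zB zy; rewrite rC0 !addr0.
have bt (t : R) : `|t| <= 1 / 2 -> n <= 2 * (k * nc (X + rC t)).
  move=> t2; have := @lin_lb B y0 t c d z y0p zB zy; rewrite -/X -/k -/cr.
  have : dr <= `|d%:~R + t| + `|t|.
    by rewrite /dr -{1}[d%:~R](addrK t); exact: ler_normB.
  by rewrite /n; move: c1 t2; lra.
have b1 : n <= 2 * (k * nc (X - hC)) by rewrite /hC -rCN; apply: bt; rewrite normrN ger0_norm.
have b2 : n <= 2 * (k * nc (X + hC)) by apply: bt; rewrite ger0_norm.
have nM (x y u v : C) : nc (- x * (y * (u * v))) = nc x * (nc y * (nc u * nc v)) by rewrite mulNr ncN !ncM.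
rewrite rr_fact // nM !ncX !ncV nc_rC ger0_norm //.
have p0 : 0 < nc X by rewrite nc_gt0.
have p1 : 0 < nc (X - hC) by rewrite nc_gt0.
have p2 : 0 < nc (X + hC) by rewrite nc_gt0.
have q0 : (nc X)^-1 <= k / n by rewrite -div1r ler_pdivrMr // mulrAC ler_pdivlMr ?mul1r //; lra.
have q1 : (nc (X - hC))^-1 <= 2 * k / n by rewrite -div1r ler_pdivrMr // mulrAC ler_pdivlMr ?mul1r -?mulrA //; lra.
have q2 : (nc (X + hC))^-1 <= 2 * k / n by rewrite -div1r ler_pdivrMr // mulrAC ler_pdivlMr ?mul1r -?mulrA //; lra.
apply: (@le_trans _ _ ((1 / 2) ^+ 2 * ((k / n) ^+ 2 * (2 * k / n * (2 * k / n))))).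
  rewrite ler_wpM2l ?exprn_ge0 //.
  have kn : 0 <= k / n by rewrite divr_ge0 //; lra.
  apply: ler_pM; rewrite ?exprn_ge0 ?mulr_ge0 ?invr_ge0 ?nc_ge0 //.
    by rewrite lerXn2r ?nnegrE ?invr_ge0 ?nc_ge0.
  by apply: ler_pM; rewrite ?invr_ge0 ?nc_ge0.
have -> : (1 / 2) ^+ 2 * ((k / n) ^+ 2 * (2 * k / n * (2 * k / n))) = k ^+ 4 * (n^-1 ^+ 2) ^+ 2.
  have nn : n != 0 by rewrite gt_eqF //; lra.
  by field.
have an (e : int) : `|e|%N.+1%:R = 1 + `|e%:~R| :> R by rewrite -natr1 addrC natr_absz -intr_norm.
have -> : 9 * k ^+ 4 * (mz c * mz d) = k ^+ 4 * (3 / ((1 + cr) * (1 + dr))) ^+ 2.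
  rewrite /mz !an -/cr -/dr; field.
  by rewrite !gt_eqF //; lra.
rewrite ler_wpM2l ?exprn_ge0 // lerXn2r ?nnegrE ?exprn_ge0 ?invr_ge0 ?divr_ge0 ?mulr_ge0 //; try lra.
have m0 : 0 < (1 + cr) * (1 + dr) by rewrite mulr_gt0 //; lra.
rewrite ler_pdivlMr // exprVn mulrC ler_pdivrMr ?exprn_gt0 //; last lra.
by rewrite /n; clear -c1 d0; nra.
Qed.

(** The limit is continuous, and Cauchy's formula on a rectangle passes to it; a function equal to
    its Cauchy integral is differentiable. *)
Lemma weierstrass (f : nat -> fn) (g : fn) : (forall n, holo (f n)) ->
  (forall B y0 : R, 0 < y0 -> exists2 K : R, 0 <= K & forall z, `|Re z| <= B -> y0 <= Im z ->
     forall n, nc (f n z - g z) <= K / n.+1%:R) -> holo g.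
Proof.
move=> hf hu.
have small (K e : R) : 0 <= K -> 0 < e -> exists n : nat, K / n.+1%:R < e.
  move=> K0 e0; exists (Num.bound (K / e)); rewrite ltr_pdivrMr ?ltr0n // mulrC -ltr_pdivrMr //.
  have h : K / e < (Num.bound (K / e))%:R by apply: archi_boundP; apply: divr_ge0 => //; apply: ltW.
  by apply: (lt_le_trans h); rewrite ler_nat.
have gc z : inH z -> ccts g z.
  move=> zH e e0; have z0 : 0 < Im z := zH.
  have z2 : 0 < Im z / 2 by rewrite divr_gt0.
  have [K K0 hK] := hu (`|Re z| + Im z) _ z2.
  have e3 : 0 < e / 3 by rewrite divr_gt0.
  have [n hn] := small _ _ K0 e3.
  have [d d0 hd] := cdiff_ccts (holo_cdiff (hf n) zH) e3.
  exists (Num.min d (Im z / 2)) => [|w]; first by rewrite lt_min d0.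
  rewrite lt_min => /andP[/hd h1 h2].
  have i1 := nc_Im (w - z); have r1 := nc_Re (w - z); rewrite ImD ImN in i1; rewrite ReD ReN in r1.
  have wi : Im z / 2 <= Im w.
    by move: (le_lt_trans i1 h2); rewrite ltr_norml => /andP[q _]; lra.
  have wr : `|Re w| <= `|Re z| + Im z.
    have -> : Re w = Re z + (Re w - Re z) by rewrite addrC subrK.
    by apply: (le_trans (ler_normD _ _)); rewrite lerD2l; move: (le_lt_trans r1 h2); lra.
  have b1 := le_lt_trans (hK w wr wi n) hn.
  have b2 : nc (f n z - g z) < e / 3.
    by apply: le_lt_trans hn; apply: hK; [rewrite lerDl ltW|lra].
  have -> : g w - g z = - (f n w - g w) + (f n w - f n z) + (f n z - g z) by ring.
  apply: (le_lt_trans (nc_tri _ _)); have := nc_tri (- (f n w - g w)) (f n w - f n z); rewrite ncN.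
  by move: b1 b2 h1; lra.
apply/holoP => z zH; have z0 : 0 < Im z := zH.
pose a := Re z - 1; pose b := Re z + 1; pose c := Im z / 2; pose d := Im z + 1.
have ab : a < b by rewrite /a /b; lra.
have cd : c < d by rewrite /c /d; lra.
have zi : insideR a b c d z by rewrite /insideR /a /b /c /d; apply/andP; split; apply/andP; split; lra.
have c0 : 0 < c by rewrite /c; lra.
have inRH w : inR a b c d w -> inH w by move=> /andP[_ /andP[w1 _]]; apply: lt_le_trans w1.
have [K K0 hK] := hu (`|a| + `|b|) c c0.
have hKR w n : inR a b c d w -> nc (f n w - g w) <= K / n.+1%:R.
  move=> /andP[/andP[w1 w2] /andP[w3 _]]; apply: hK => //.
  rewrite ler_norml; apply/andP; split.
    by have := ler_norm (- a); rewrite normrN; have := normr_ge0 b; lra.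
  by have := ler_norm b; have := normr_ge0 a; lra.
have gb w : bdR a b c d w -> ccts g w by move=> /bd_in/inRH/gc.
have [M hM] : exists M : R, forall w, inR a b c d w -> nc (g w) <= M.
  by apply: bounded_rect; [exact: ltW|exact: ltW|move=> w /inRH/gc].
have hMb w : bdR a b c d w -> nc (g w) <= M by move=> /bd_in/hM.
have h1 w : bdR a b c d w -> nc 1 <= 1 by rewrite nc1.
have c1 w : bdR a b c d w -> ccts (fun=> 1) w by move=> _; apply: ccts_cst.
have E w : insideR a b c d w -> g w * Phi a b c d 1 (fun=> 1) w = Phi a b c d 1 g w.
  move=> wi; apply/eqP; rewrite -subr_eq0 -[_ == 0]negbK; apply/negP => n0.
  have p0 : 0 < nc (g w * Phi a b c d 1 (fun=> 1) w - Phi a b c d 1 g w) by rewrite nc_gt0.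
  have wR : inR a b c d w by move: wi => /andP[/andP[? ?] /andP[? ?]]; rewrite /inR !ltW.
  have [r r0 [hr _]] := inside_dist wi.
  have kb t : bdR a b c d t -> ccts (fun t => (t - w)^-1 ^+ 1) t.
    move=> /hr tr; apply: ccts_ker; rewrite -subr_eq0 -nc_gt0; exact: lt_le_trans tr.
  pose L := nc (Phi a b c d 1 (fun=> 1) w) + 4 * r^-1 * ((b - a) + (d - c)).
  have bound n : nc (g w * Phi a b c d 1 (fun=> 1) w - Phi a b c d 1 g w) <= K / n.+1%:R * L.
    have fd t : inR a b c d t -> exists l, cdiff (f n) t l.
      by move=> /inRH tH; exists (der (f n) t); exact: (holo_cdiff (hf n) tH).
    have ft t : bdR a b c d t -> ccts (f n) t by move=> /bd_in/fd[l /cdiff_ccts].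
    have ce := cauchy ab cd fd wi.
    have dE : Phi a b c d 1 (f n) w - Phi a b c d 1 g w = oint (fun t => (f n t - g t) * (t - w)^-1 ^+ 1) a b c d.
      have -> : - Phi a b c d 1 g w = -1 * Phi a b c d 1 g w by rewrite mulN1r.
      rewrite /Phi -ointZ; [|exact: ltW|exact: ltW|by move=> t tb; apply: cctsM; [exact: gb|exact: kb]].
      rewrite -ointD; [|exact: ltW|exact: ltW| |].
      - by apply: oint_eq => t; rewrite mulrBl mulN1r.
      - by move=> t tb; apply: cctsM; [exact: ft|exact: kb].
      - move=> t tb; apply: (@ccts_eq (fun t => (fun=> -1) t * (g t * (t - w)^-1 ^+ 1))) => //.
        by apply: cctsM; [exact: ccts_cst|apply: cctsM; [exact: gb|exact: kb]].
    have -> : g w * Phi a b c d 1 (fun=> 1) w - Phi a b c d 1 g w =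
       - ((f n w - g w) * Phi a b c d 1 (fun=> 1) w) + (Phi a b c d 1 (f n) w - Phi a b c d 1 g w).
      by rewrite mulrBl ce; ring.
    apply: (le_trans (nc_tri _ _)); have -> : K / n.+1%:R * L = K / n.+1%:R * nc (Phi a b c d 1 (fun=> 1) w) + K / n.+1%:R * (4 * r^-1 * (b - a + (d - c))).
      exact: mulrDr.
    apply: lerD.
      by rewrite ncN ncM; apply: ler_wpM2r; [exact: nc_ge0|exact: hKR].
    rewrite dE; have -> : K / n.+1%:R * (4 * r^-1 * (b - a + (d - c))) = 4 * (K / n.+1%:R * r^-1) * (b - a + (d - c)) by ring.
    apply: oint_bound; [exact: ltW|exact: ltW| |].
      move=> t tb; apply: cctsM; last exact: kb.
      apply: (@ccts_eq (fun t => f n t + -1 * g t)) => [s|]; first by rewrite mulN1r.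
      by apply: ccts_lin; [exact: ft|exact: gb].
    move=> t tb; rewrite ncM ncX ncV expr1; apply: ler_pM; rewrite ?invr_ge0 ?nc_ge0 //.
      by apply: hKR; apply: bd_in.
    by apply: ler_pV => //; apply: hr.
  have L0 : 0 < L + 1.
    rewrite ltr_wpDl // addr_ge0 ?nc_ge0 // !mulr_ge0 ?invr_ge0 ?(ltW r0) //; lra.
  have [n hn] := small _ _ K0 (divr_gt0 p0 L0).
  have := bound n; move: hn; rewrite ltr_pdivlMr // mulrDr mulr1 => q1 q2.
  have y0 : 0 <= K / n.+1%:R by rewrite divr_ge0.
  by have := lt_le_trans q1 q2; rewrite gtrDl ltNge y0.
have [r r0 [_ hr]] := inside_dist zi.
have dK := Phi1_diff ab cd h1 c1 zi; have dG := Phi1_diff ab cd hMb gb zi.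
have K0' := K_neq0 ab cd zi.
have := cdiffM dG (cdiffV K0' dK) => q; eexists; apply: (@cdiff_loc _ _ _ _ r r0 _ q) => w /hr wi.
by rewrite -(E w wi) mulfK // K_neq0.
Qed.

Arguments zr : simpl never.
Arguments box : simpl never.

Lemma nc_small (x : C) (K : R) (J : nat) : (forall n : nat, (J <= n)%N -> nc x <= K / n.+1%:R) -> x = 0.
Proof.
move=> h; apply: nc_eq0; apply/eqP; rewrite eq_le nc_ge0 andbT leNgt; apply/negP => x0.
have K0 : 0 <= K.
  have := h J (leqnn J); rewrite ler_pdivlMr ?ltr0n //; apply: le_trans.
  by rewrite mulr_ge0 // ltW.
pose n := (J + Num.bound (K / nc x))%N.
have := h n (leq_addr _ _); rewrite ler_pdivlMr ?ltr0n // -ler_pdivlMl // mulrC leNgt => /negP; apply.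
have q : K / nc x < (Num.bound (K / nc x))%:R by apply: archi_boundP; apply: divr_ge0 => //; apply: ltW.
by apply: (lt_trans q); rewrite ltr_nat /n ltnS leq_addl.
Qed.

Definition Kc (B y0 : R) : R := 9 * stripc B y0 ^+ 4 * 36.

Lemma stripc_mono (B B' y y' : R) : 0 <= B -> B <= B' -> 0 < y' -> y' <= y -> stripc B y <= stripc B' y'.
Proof.
move=> B0 BB y0 yy; have v : y^-1 <= y'^-1 by apply: ler_pV.
have v0 : 0 <= y^-1 by rewrite invr_ge0; apply: le_trans yy; exact: ltW.
by rewrite /stripc; apply: lerD; [rewrite lerD2r|exact: ler_pM].
Qed.

Lemma U_ex : exists U : fn, forall (B y0 : R) z, 0 < y0 -> `|Re z| <= B -> y0 <= Im z ->
  forall s D, uniq s -> {subset box D D <= s} -> nc (\sum_(p <- s) rr z p - U z) <= Kc B y0 / D.+1%:R.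
Proof.
have /choice[U hU] : forall z, exists l : C, inH z -> forall s D, uniq s -> {subset box D D <= s} ->
    nc (\sum_(p <- s) rr z p - l) <= Kc `|Re z| (Im z) / D.+1%:R.
  move=> z; case: (pselect (inH z)) => [zH|nz]; last by exists 0 => /nz.
  have k0 : 0 <= 9 * stripc `|Re z| (Im z) ^+ 4 by rewrite mulr_ge0 // exprn_ge0 // stripc_ge0.
  have [l hl] := usum_ex k0 (fun p => rr_bound p zH (lexx _) (lexx _)).
  by exists l => _.
exists U => B y0 z y0p zB zy s D us bs; have zH : inH z by apply: lt_le_trans zy.
apply: (le_trans (hU z zH s D us bs)); rewrite ler_wpM2r // ?invr_ge0 // /Kc ler_wpM2r // ler_wpM2l //.
by rewrite lerXn2r ?nnegrE ?stripc_ge0 //; [exact: le_trans zB|exact: stripc_mono].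
Qed.

Definition U : fn := projT1 (cid U_ex).
Lemma U_bd (B y0 : R) z : 0 < y0 -> `|Re z| <= B -> y0 <= Im z ->
  forall s D, uniq s -> {subset box D D <= s} -> nc (\sum_(p <- s) rr z p - U z) <= Kc B y0 / D.+1%:R.
Proof. exact: (projT2 (cid U_ex)). Qed.

Lemma Kc_ge0 (B y0 : R) : 0 <= B -> 0 < y0 -> 0 <= Kc B y0.
Proof. by move=> B0 y0p; apply: mulr_ge0 => //; apply: mulr_ge0 => //; apply: exprn_ge0; exact: stripc_ge0. Qed.

Lemma rr_sq_neq0 p z : inH z -> p.1 != 0 -> lin p z ^+ 2 - hC ^+ 2 != 0.
Proof.
move=> zH c0; rewrite subr_sqr mulf_neq0 //; last exact: lin_neq0.
by rewrite /hC -rCN; exact: lin_neq0.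
Qed.
Lemma holo_lin p : holo (lin p).
Proof. exact: (holoD (holoZ (k := p.1%:~R) holo_id) (holo_cst p.2%:~R)). Qed.
Lemma holo_rr p : holo (fun z => rr z p).
Proof.
case: (eqVneq p.1 0) => c0.
  by apply: (holo_ext _ (holo_cst 0)) => z _; rewrite /rr c0 eqxx.
have h0 z : inH z -> lin p z != 0 by move=> zH; have := @lin_neq0 z p 0 zH c0; rewrite rC0 addr0.
have h1 : holo (fun z => (lin p z)^-1) by exact: (holoV h0 (@holo_lin p)).
have h2 : holo (fun z => lin p z ^+ 2 + - hC ^+ 2) by exact: (holoD (holoX (n := 2) (@holo_lin p)) (holo_cst (- hC ^+ 2))).
have h3 : holo (fun z => (lin p z ^+ 2 - hC ^+ 2)^-1) by exact: (holoV (fun z zH => rr_sq_neq0 zH c0) h2).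
apply: (holo_ext _ (holoD (holoX (n := 2) h1) (holoN h3))) => z _.
by rewrite /rr (negbTE c0).
Qed.

Lemma holo_U : holo U.
Proof.
apply: (@weierstrass (fun n z => \sum_(p <- box n n) rr z p)) => [n|B y0 y0p].
  exact: (@holo_sum _ (box n n) (fun p z => rr z p) holo_rr).
exists (Kc (Num.max B 0) y0) => [|z zB zy n]; first by apply: Kc_ge0 => //; rewrite le_max lexx orbT.
by apply: U_bd; rewrite ?le_max ?zB ?box_uniq.
Qed.

(** The shift of z is the substitution d -> d + c. A box of height 2D and its image both contain the
    box of size D, so one finite sum approximates both values. *)
Lemma U_per z : inH z -> U (z + 1) = U z.
Proof.
move=> zH; have z0 : 0 < Im z := zH; apply/eqP; rewrite -subr_eq0; apply/eqP.
pose B := `|Re z| + 1; pose K := Kc B (Im z); apply: (@nc_small _ (2 * K) 0) => D _.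
pose sh (p : int * int) : int * int := (p.1, p.2 + p.1).
have rz : Re (z + 1) = Re z + 1 by rewrite ReD.
have iz : Im (z + 1) = Im z by rewrite ImD /= addr0.
have b1 : `|Re (z + 1)| <= B by rewrite rz /B; apply: le_trans (ler_normD _ _) _; rewrite normr1.
have b2 : `|Re z| <= B by rewrite lerDl.
have u1 : uniq [seq sh p | p <- box D (2 * D)].
  by rewrite map_inj_uniq ?box_uniq // => -[c d] [c' d'] /= [-> /addIr ->].
have s1 : {subset box D D <= box D (2 * D)} by move=> p; rewrite !mem_box; lia.
have s2 : {subset box D D <= [seq sh p | p <- box D (2 * D)]}.
  move=> [c d]; rewrite mem_box => h; have {}h : (`|c| <= D)%N && (`|d| <= D)%N := h; have -> : (c, d) = sh (c, d - c) by rewrite /sh /= subrK.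
  apply: map_f; rewrite mem_box; cbn [fst snd]; lia.
have e1 := U_bd z0 b1 (eq_ind_r (fun x => Im z <= x) (lexx _) iz) (box_uniq D (2 * D)) s1.
have e2 := U_bd z0 b2 (lexx _) u1 s2.
rewrite big_map in e2.
have E : \sum_(p <- box D (2 * D)) rr z (sh p) = \sum_(p <- box D (2 * D)) rr (z + 1) p.
  apply: eq_bigr => -[c d] _; rewrite /rr /sh /lin /=.
  by have -> : c%:~R * z + (d + c)%:~R = c%:~R * (z + 1) + d%:~R by rewrite intrD; ring.
rewrite E in e2; set S := \sum_(p <- _) _ in e1 e2.
have -> : U (z + 1) - U z = - (S - U (z + 1)) + (S - U z) by ring.
apply: (le_trans (nc_tri _ _)); rewrite ncN -mulrA mulr_natl mulr2n.
exact: lerD e1 e2.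
Qed.

Lemma qh_U : qh 1 U.
Proof.
split; [exact: holo_U|move=> z zH; exact: U_per|].
exists 1, (Kc 1 1); split=> [|z z1]; first exact: ltr01.
have zH : inH z by apply: lt_le_trans z1.
have [k /andP[k1 k2]] := @red_strip 1 isT (Re z).
have -> : U z = U (z + k%:~R * 1%:R).
  by rewrite (@perd_int 1) // => w wH; exact: U_per.
set w := z + _; have rw : Re w = Re z + k%:~R * 1%:R by rewrite /w Re_intD.
have iw : Im w = Im z by rewrite /w Im_intD.
(* The index set containing just (0, 0) has sum 0, so the error estimate for D = 0 is a bound for U
   itself. *)
have := @U_bd 1 1 w ltr01 _ _ [:: (0, 0)] 0%N isT.
rewrite big_seq1 /rr eqxx sub0r ncN divr1; apply; rewrite ?rw ?iw //.
  by rewrite ger0_norm // ltW.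
Qed.

(** * Transformation of the lattice sum under -1/z *)

Definition Kt (A : nat) (w : C) : C := \sum_(c <- zr A) (w + c%:~R)^-1.
Definition zt (D : nat) : R := 2 * \sum_(i < D) (i.+1%:R ^+ 2)^-1.

Lemma zr_telescope (f : int -> C) A : \sum_(c <- zr A) (f c - f (c + 1)) = f (- A%:Z) - f (A%:Z + 1).
Proof.
rewrite /zr big_map -[iota 0 _]/(index_iota 0 (2 * A).+1) big_mkord.
pose g i := f (i%:Z - A%:Z).
have -> : f (- A%:Z) - f (A%:Z + 1) = - (g (2 * A).+1 - g 0).
  by rewrite opprB /g sub0r; congr (_ - f _); lia.
rewrite -(telescope_sumr g (leq0n _)) big_mkord -sumrN; apply: eq_bigr => i _.
by rewrite opprB /g; congr (_ - f _); lia.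
Qed.

Lemma zr_opp (V : nmodType) (f : int -> V) A : \sum_(c <- zr A) f (- c) = \sum_(c <- zr A) f c.
Proof.
rewrite -(big_map (fun c : int => - c) xpredT f); apply: perm_big; apply: uniq_perm; rewrite ?zr_uniq //.
  by rewrite map_inj_uniq ?zr_uniq //; apply: oppr_inj.
move=> n; rewrite mem_zr; apply/mapP/idP => [[m + ->]|h]; first by rewrite mem_zr abszN.
by exists (- n); rewrite ?opprK // mem_zr abszN.
Qed.

Lemma zr_0 (V : zmodType) (f : int -> V) A : \sum_(c <- zr A) (if c == 0 then 0 else f c) = \sum_(c <- zr A) f c - f 0.
Proof.
have z0 : 0 \in zr A by rewrite mem_zr.
rewrite (bigD1_seq 0) ?zr_uniq //= add0r [in RHS](bigD1_seq 0) ?zr_uniq //= addrAC subrr add0r.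
by apply: eq_bigr => c c0; rewrite (negbTE c0).
Qed.

Lemma ztE D : \sum_(d <- zr D) (if d == 0 then 0 else (d%:~R^-1 ^+ 2 : C)) = rC (zt D).
Proof.
elim: D => [|D IH].
  by rewrite /zr /= big_seq1 /= /zt big_ord0 mulr0.
rewrite (perm_big _ (zrS D)) big_cons big_cons IH /= /zt big_ord_recr /= mulrDr rCD addrA addrC; congr (_ + _).
rewrite mulrNz invrN sqrrN exprVn rCM rCV.
have -> : rC (D.+1%:R ^+ 2) = D.+1%:R ^+ 2 by rewrite -natrX rC_nat natrX.
have -> : rC 2 = 2%:R by rewrite -rC_nat.
by rewrite mulr_natl mulr2n.
Qed.

Lemma zt_lim : exists ze : R, forall D, `|zt D - ze| <= 4 / D.+1%:R.
Proof.
have st D : zt D.+1 + 4 / D.+2%:R <= zt D + 4 / D.+1%:R.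
  rewrite /zt big_ord_recr /= mulrDr -addrA lerD2l -[D.+2%:R]natr1; set x : R := D.+1%:R.
  have x1 : 1 <= x by rewrite ler1n.
  have -> : 4 / x = 2 / x ^+ 2 + 4 / (x + 1) + (2 * x - 2) / (x ^+ 2 * (x + 1)).
    by field; rewrite !gt_eqF //; lra.
  by rewrite lerDl divr_ge0 ?mulr_ge0 ?exprn_ge0 //; lra.
have mo D M : (D <= M)%N -> zt M + 4 / M.+1%:R <= zt D + 4 / D.+1%:R.
  elim: M => [|M IH]; first by rewrite leqn0 => /eqP ->.
  rewrite leq_eqVlt => /orP[/eqP -> //|DM]; exact: le_trans (st M) (IH DM).
have inc D M : (D <= M)%N -> zt D <= zt M.
  elim: M => [|M IH]; first by rewrite leqn0 => /eqP ->.
  rewrite leq_eqVlt => /orP[/eqP -> //|DM]; apply: (le_trans (IH DM)).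
  by rewrite /zt big_ord_recr /= mulrDr lerDl mulr_ge0 // invr_ge0 exprn_ge0.
apply: real_limit => D M DM; rewrite ger0_norm ?subr_ge0 ?inc //.
have := mo D M DM; have : 0 <= 4 / M.+1%:R :> R by rewrite divr_ge0.
by move: (4 / _) (4 / _) => x y; lra.
Qed.
Definition ze : R := projT1 (cid zt_lim).
Lemma zeP D : `|zt D - ze| <= 4 / D.+1%:R. Proof. exact: (projT2 (cid zt_lim)). Qed.

(** [Kt] is a partial sum of pi cot(pi w). A unit shift exchanges two end terms, each of size at
    most 1/L when w stays at distance L from the ends. *)
Lemma Kt_shift A n (w : C) (L : R) : 0 < L -> nc w + n%:R + L <= A%:R ->
  nc (Kt A (w - n%:R) - Kt A w) <= n%:R * (2 / L).
Proof.
move=> L0; elim: n => [|n IH] h; first by rewrite subr0 subrr nc0 mul0r.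
have h' : nc w + n%:R + L <= A%:R by move: h; rewrite -natr1; lra.
pose w' := w - n%:R.
have -> : w - n.+1%:R = w' - 1 by rewrite /w' -natr1; ring.
have tel : Kt A (w' - 1) - Kt A w' = (w' - 1 - A%:R)^-1 - (w' + A%:R)^-1.
  pose f (c : int) : C := (w' - 1 + c%:~R)^-1.
  transitivity (\sum_(c <- zr A) (f c - f (c + 1))).
    rewrite /Kt -sumrB; apply: eq_bigr => c _; congr (_ - _^-1).
    by rewrite intrD; ring.
  rewrite zr_telescope /f; congr (_^-1 - _^-1); first by rewrite mulrNz.
  by rewrite intrD; ring.
have lb (x : C) (t : R) : nc x + t <= A%:R -> 0 < t -> forall y : C, (y = A%:R \/ y = - A%:R) -> nc (x + y)^-1 <= t^-1.
  move=> xt t0 y yA; rewrite ncV; apply: ler_pV => //.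
  have ny : nc y = A%:R by case: yA => ->; rewrite ?ncN nc_nat.
  have := nc_sub_le y (- x); rewrite ncN opprK ny [y + x]addrC; move: xt; lra.
have nw : nc w' <= nc w + n%:R by apply: (le_trans (nc_triB _ _)); rewrite nc_nat.
have nw1 : nc (w' - 1) <= nc w + n.+1%:R.
  by apply: (le_trans (nc_triB _ _)); rewrite nc1 -natr1 addrA lerD2r.
have e1 : nc (w' - 1 - A%:R)^-1 <= L^-1 by apply: lb => //; [move: h nw1; lra|right].
have e2 : nc (w' + A%:R)^-1 <= L^-1 by apply: lb => //; [move: h' nw; lra|left].
have -> : Kt A (w' - 1) - Kt A w = (Kt A (w' - 1) - Kt A w') + (Kt A w' - Kt A w) by rewrite addrA subrK.
apply: (le_trans (nc_tri _ _)); rewrite tel.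
have := IH h'; have := nc_triB (w' - 1 - A%:R)^-1 (w' + A%:R)^-1.
have -> : n.+1%:R * (2 / L) = n%:R * (2 / L) + (L^-1 + L^-1) by rewrite -natr1; ring.
rewrite -/w'; move: e1 e2; move: (n%:R * (2 / L)) (L^-1) => x y; lra.
Qed.

Lemma hC2 : hC + hC = 1.
Proof. by rewrite /hC -rCD -rC1; congr rC; field. Qed.

Lemma rz_neq0 (z : C) (s : R) (d : int) : inH z -> d != 0 -> rC s * z + d%:~R != 0.
Proof.
move=> zH d0; apply/eqP => e; have := congr1 Im e; rewrite ImD ImM Im_int /= mul0r !addr0 => /eqP.
rewrite mulf_eq0 (gt_eqF zH) orbF => /eqP s0; move: e; rewrite s0 rC0 mul0r add0r => /eqP.
by rewrite intr_eq0 (negbTE d0).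
Qed.

Lemma tele_d (z : C) (c : int) D : inH z -> c != 0 ->
  \sum_(d <- zr D) (lin (c, d) z ^+ 2 - hC ^+ 2)^-1 =
  (c%:~R * z - (D%:R + hC))^-1 - (c%:~R * z + (D%:R + hC))^-1.
Proof.
move=> zH c0; pose f (d : int) : C := (c%:~R * z + d%:~R - hC)^-1.
transitivity (\sum_(d <- zr D) (f d - f (d + 1))).
  apply: eq_bigr => d _; have X1 : lin (c, d) z + hC != 0 by exact: lin_neq0.
  have X2 : lin (c, d) z - hC != 0 by rewrite /hC -rCN; exact: lin_neq0.
  rewrite /f; have -> : c%:~R * z + (d + 1)%:~R - hC = lin (c, d) z + hC.
    by rewrite /lin intrD -[1%:~R]hC2 /=; ring.
  rewrite -/(lin (c, d) z) subr_sqr -[LHS]mul1r -[X in X * _]hC2.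
  by field; rewrite X1 X2.
rewrite zr_telescope /f; congr (_^-1 - _^-1); first by rewrite mulrNz opprD addrA.
by rewrite intrD -[1%:~R]hC2; ring.
Qed.

Lemma tele_c (z : C) (d : int) A : inH z -> d != 0 ->
  \sum_(c <- zr A) (lin (c, d) z ^+ 2 - (hC * z) ^+ 2)^-1 =
  z^-1 * ((d%:~R - (A%:R + hC) * z)^-1 - (d%:~R + (A%:R + hC) * z)^-1).
Proof.
move=> zH d0; have z0 : z != 0 by apply/eqP => e; move: zH; rewrite e /inH ltxx.
pose f (c : int) : C := z^-1 * (c%:~R * z + d%:~R - hC * z)^-1.
transitivity (\sum_(c <- zr A) (f c - f (c + 1))).
  apply: eq_bigr => c _.
  have X1 : lin (c, d) z + hC * z != 0.
    have -> : lin (c, d) z + hC * z = rC (c%:~R + 1 / 2) * z + d%:~R by rewrite /lin rCD rC_int -/hC mulrDl addrAC.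
    exact: rz_neq0.
  have X2 : lin (c, d) z - hC * z != 0.
    have -> : lin (c, d) z - hC * z = rC (c%:~R - 1 / 2) * z + d%:~R by rewrite /lin rCB rC_int -/hC mulrBl addrAC.
    exact: rz_neq0.
  rewrite /f; have -> : (c + 1)%:~R * z + d%:~R - hC * z = lin (c, d) z + hC * z.
    by rewrite /lin intrD -[1%:~R]hC2 /=; ring.
  rewrite -/(lin (c, d) z) subr_sqr -[LHS]mul1r -[X in X * _]hC2.
  by field; rewrite X1 X2 z0.
rewrite zr_telescope /f -mulrBr; congr (_ * (_^-1 - _^-1)); first by rewrite mulrNz; ring.
by rewrite intrD -[1%:~R]hC2; ring.
Qed.

Definition Prest (z : C) A D : C := \sum_(d <- zr D) (if d == 0 then 0 else
  z^-1 * ((d%:~R - (A%:R + hC) * z)^-1 - (d%:~R + (A%:R + hC) * z)^-1)).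

(** Over a finite box the double sums of 1/X^2 on the two sides differ only by the axes c = 0 and d
    = 0, which give partial sums of 2 zeta(2). The two correction terms telescope, one in d and the
    other in c, to [Kt] and [Prest]. *)
Lemma box_identity (z : C) A D : inH z ->
  z^-1 ^+ 2 * (\sum_(p <- box A D) rr (- z^-1) (- p.2, p.1)) - \sum_(p <- box A D) rr z p =
  rC (zt D) - z^-1 ^+ 2 * rC (zt A) - Prest z A D
   - 2 * z^-1 * Kt A ((D%:R + hC) / z) + 2 / (D%:R + hC).
Proof.
move=> zH; have z0 : z != 0 by apply/eqP => e; move: zH; rewrite e /inH ltxx.
set de : C := D%:R + hC; pose a (c d : int) : C := (lin (c, d) z)^-1 ^+ 2.
pose t1 (c d : int) : C := (lin (c, d) z ^+ 2 - hC ^+ 2)^-1.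
pose t2 (c d : int) : C := (lin (c, d) z ^+ 2 - (hC * z) ^+ 2)^-1.
have -> : \sum_(p <- box A D) rr z p =
   \sum_(c <- zr A) (if c == 0 then 0 else \sum_(d <- zr D) a c d)
   - \sum_(c <- zr A) (if c == 0 then 0 else \sum_(d <- zr D) t1 c d).
  transitivity (\sum_(p <- box A D) rr z (p.1, p.2)); first by apply: eq_bigr => -[].
  rewrite (sum_box (fun c d => rr z (c, d))) -sumrB; apply: eq_bigr => c _.
  case: (eqVneq c 0) => [->|c0]; first by rewrite subr0 big1 // => d _; rewrite /rr eqxx.
  by rewrite -sumrB; apply: eq_bigr => d _; rewrite /rr (negbTE c0).
have -> : z^-1 ^+ 2 * (\sum_(p <- box A D) rr (- z^-1) (- p.2, p.1)) =
   \sum_(d <- zr D) (if d == 0 then 0 else \sum_(c <- zr A) a c d)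
   - \sum_(d <- zr D) (if d == 0 then 0 else \sum_(c <- zr A) t2 c d).
  rewrite (sum_box (fun c d => rr (- z^-1) (- d, c))) exchange_big mulr_sumr -sumrB; apply: eq_bigr => d _.
  case: (eqVneq d 0) => [->|d0]; first by rewrite subr0 big1 ?mulr0 // => c _; rewrite /rr oppr0 eqxx.
  rewrite mulr_sumr -sumrB; apply: eq_bigr => c _; rewrite /rr oppr_eq0 (negbTE d0) /a /t2.
  have -> : lin (- d, c) (- z^-1) = lin (c, d) z / z.
    by rewrite /lin /= mulrNz mulrNN mulrDl mulfK // addrC.
  move: (lin (c, d) z) => X; rewrite mulrBr; congr (_ - _).
    by rewrite invfM invrK exprMn mulrCA -exprMn mulVf // expr1n mulr1.
  have -> : (X / z) ^+ 2 - hC ^+ 2 = (X ^+ 2 - (hC * z) ^+ 2) / z ^+ 2.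
    by rewrite mulrBl -!expr_div_n mulfK.
  by rewrite invfM invrK mulrCA exprVn mulVf ?mulr1 // expf_neq0.
have E1 : \sum_(d <- zr D) (if d == 0 then 0 else \sum_(c <- zr A) t2 c d) = Prest z A D.
  by apply: eq_bigr => d _; case: eqVneq => // d0; apply: tele_c.
have E2 : \sum_(c <- zr A) (if c == 0 then 0 else \sum_(d <- zr D) t1 c d) =
    - (2 * z^-1 * Kt A (de / z)) + 2 / de.
  transitivity (\sum_(c <- zr A) (if c == 0 then 0 else - (- c%:~R * z + de)^-1 - (c%:~R * z + de)^-1)).
    apply: eq_bigr => c _; case: eqVneq => // c0; rewrite tele_d //; congr (_ - _).
    by rewrite -invrN -/de; congr (_^-1); ring.
  rewrite (zr_0 (fun c => - (- c%:~R * z + de)^-1 - (c%:~R * z + de)^-1)).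
  have -> : Kt A (de / z) = z * \sum_(c <- zr A) (c%:~R * z + de)^-1.
    rewrite /Kt mulr_sumr; apply: eq_bigr => c _.
    have -> : de / z + c%:~R = (c%:~R * z + de) / z by rewrite [RHS]mulrDl mulfK // addrC.
    by rewrite invfM invrK mulrC.
  have -> : 2 * z^-1 * (z * \sum_(c <- zr A) (c%:~R * z + de)^-1) = 2 * \sum_(c <- zr A) (c%:~R * z + de)^-1.
    by rewrite mulrA -[2 * z^-1 * z]mulrA mulVf // mulr1.
  rewrite big_split /= sumrN sumrN.
  have -> : \sum_(c <- zr A) (- c%:~R * z + de)^-1 = \sum_(c <- zr A) (c%:~R * z + de)^-1.
    rewrite -[RHS]zr_opp; apply: eq_bigr => c _; by rewrite mulrNz.
  rewrite oppr0 mul0r add0r; set S := \sum_(c <- _) _; ring.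
have E3 : \sum_(d <- zr D) (if d == 0 then 0 else \sum_(c <- zr A) a c d) -
   \sum_(c <- zr A) (if c == 0 then 0 else \sum_(d <- zr D) a c d) = rC (zt D) - z^-1 ^+ 2 * rC (zt A).
  rewrite (zr_0 (fun d => \sum_(c <- zr A) a c d)) (zr_0 (fun c => \sum_(d <- zr D) a c d)).
  rewrite [in X in X - _]exchange_big /= -!ztE.
  rewrite (zr_0 (fun d : int => (d%:~R : C)^-1 ^+ 2)) (zr_0 (fun d : int => (d%:~R : C)^-1 ^+ 2)) invr0 expr0n /= !subr0.
  have -> : \sum_(c <- zr A) a c 0 = z^-1 ^+ 2 * \sum_(c <- zr A) (c%:~R : C)^-1 ^+ 2.
    by rewrite mulr_sumr; apply: eq_bigr => c _; rewrite /a /lin /= addr0 invfM exprMn mulrC.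
  have -> : \sum_(d <- zr D) a 0 d = \sum_(d <- zr D) (d%:~R : C)^-1 ^+ 2.
    by apply: eq_bigr => d _; rewrite /a /lin /= mul0r add0r.
  by rewrite opprB addrC addrA subrK.
rewrite E1 E2; move: E3.
set s1 := \sum_(_ <- _) _; set s2 := \sum_(_ <- _) _ => E3.
have -> : s1 - Prest z A D - (s2 - (- (2 * z^-1 * Kt A (de / z)) + 2 / de)) =
  (s1 - s2) - Prest z A D - 2 * z^-1 * Kt A (de / z) + 2 / de by ring.
by rewrite E3.
Qed.

Lemma size_zr D : size (zr D) = (2 * D).+1.
Proof. by rewrite size_map size_iota. Qed.

Lemma sum_zr_le (f : int -> C) (M : R) D : (forall d, nc (f d) <= M) -> nc (\sum_(d <- zr D) f d) <= (2 * D).+1%:R * M.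
Proof.
move=> h; apply: (le_trans (nc_sum _ _ _)); apply: (@le_trans _ _ (\sum_(d <- zr D) M)).
  by apply: ler_sum.
by rewrite big_const_seq count_predT size_zr iter_addr addr0 mulr_natl.
Qed.

(** The box is chosen with A = D^2: there are 2D + 1 terms of size about 1/D^2. *)
Lemma Prest_bound (z : C) D : inH z -> nc (Prest z (D * D) D) <= nc z^-1 * (12 / Im z) / D.+1%:R.
Proof.
move=> zH; have y0 : 0 < Im z := zH; pose a : R := (D * D)%:R + 1 / 2.
have a0 : 0 < a by rewrite ltr_wpDl.
have ay : 0 < a * Im z by rewrite mulr_gt0.
have imb (d : int) (s : C) : (s = 1 \/ s = -1) -> nc (d%:~R + s * ((D * D)%:R + hC) * z)^-1 <= (a * Im z)^-1.
  move=> hs; rewrite ncV; apply: ler_pV => //.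
  have -> : (D * D)%:R + hC = rC a by rewrite rCD rC_nat.
  apply: le_trans (nc_Im _); rewrite ImD Im_int add0r -mulrA.
  have e : Im (rC a * z) = a * Im z by rewrite ImM /= mul0r addr0.
  by case: hs => ->; rewrite ?mul1r ?mulN1r ?ImN ?normrN e ger0_norm // ltW.
apply: (@le_trans _ _ ((2 * D).+1%:R * (nc z^-1 * (2 / (a * Im z))))).
  apply: sum_zr_le => d; case: ifP => _; first by rewrite nc0 mulr_ge0 ?nc_ge0 // divr_ge0 // ltW.
  rewrite ncM ler_wpM2l ?nc_ge0 //; apply: (le_trans (nc_triB _ _)).
  have := imb d 1 (or_introl erefl); have := imb d (-1) (or_intror erefl); rewrite mul1r mulN1r mulNr.
  move=> h1 h2; have -> : 2 / (a * Im z) = (a * Im z)^-1 + (a * Im z)^-1 by rewrite mulr_natl mulr2n.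
  exact: lerD.
have -> : (2 * D).+1%:R * (nc z^-1 * (2 / (a * Im z))) = nc z^-1 * ((2 * D).+1%:R * (2 / a) / Im z).
  by rewrite invfM; ring.
rewrite -[leRHS]mulrA ler_wpM2l ?nc_ge0 // [leRHS]mulrAC ler_wpM2r ?invr_ge0 ?(ltW y0) //.
rewrite mulrA ler_pdivrMr // mulrAC ler_pdivlMr ?ltr0n //.
rewrite /a -[(2 * D).+1%:R]natr1 -[D.+1%:R]natr1 !natrM; have : 0 <= D%:R :> R by [].
move: (D%:R) => x; clear; nra.
Qed.

(** The limit of [Kt] in [box_identity], solved for in terms of U. Showing it to be constant amounts
    to the transformation law of U. *)
Definition lam (z : C) : C :=
  z / 2 * (rC ze - z^-1 ^+ 2 * rC ze - z^-1 ^+ 2 * U (- z^-1) + U z).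

Lemma Kt_lim (z : C) : inH z -> exists K : R, forall D, nc (Kt (D * D) ((D%:R + hC) / z) - lam z) <= K / D.+1%:R.
Proof.
move=> zH; have z0 : z != 0 by apply/eqP => e; move: zH; rewrite e /inH ltxx.
pose w := - z^-1; have wH : inH w by rewrite /w -mob_S; apply: inH_mob => //; exact: SL_S.
pose K1 := Kc `|Re z| (Im z); pose K2 := Kc `|Re w| (Im w).
pose nz := nc (z^-1 ^+ 2); pose Kp := nc z^-1 * (12 / Im z).
exists (nc (z / 2) * (4 + nz * 4 + Kp + 4 + nz * K2 + K1)) => D.
pose A := (D * D)%N; have DA : (D <= A)%N by rewrite /A; case: (D) => // n; rewrite leq_pmulr.
pose S1 := \sum_(p <- box A D) rr z p; pose S2 := \sum_(p <- box A D) rr w (- p.2, p.1).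
have b1 : nc (S1 - U z) <= K1 / D.+1%:R.
  apply: U_bd => //; first exact: box_uniq.
  by move=> p; rewrite !mem_box => /andP[h1 ->]; rewrite (leq_trans h1).
have b2 : nc (S2 - U w) <= K2 / D.+1%:R.
  pose tr (p : int * int) : int * int := (- p.2, p.1).
  have -> : S2 = \sum_(p <- [seq tr p | p <- box A D]) rr w p by rewrite big_map.
  apply: U_bd => //.
    by rewrite map_inj_uniq ?box_uniq // => -[c d] [c' d'] [/oppr_inj -> ->].
  move=> [c d] h; have {}h : (`|c| <= D)%N && (`|d| <= D)%N by rewrite mem_box in h.
  have -> : (c, d) = tr (d, - c) by rewrite /tr /= opprK.
  by apply: map_f; rewrite mem_box; cbn [fst snd]; move: h DA; lia.
have id := @box_identity z A D zH; rewrite -/w -/S1 -/S2 in id.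
set Kd := Kt A _ in id *; set P := Prest z A D in id; set de := 2 / (D%:R + hC) in id.
have E : Kd - lam z = z / 2 * ((rC (zt D) - rC ze) - z^-1 ^+ 2 * (rC (zt A) - rC ze) - P + de
    - z^-1 ^+ 2 * (S2 - U w) + (S1 - U z)).
  have id' : 2 * z^-1 * Kd = rC (zt D) - z^-1 ^+ 2 * rC (zt A) - P + de - (z^-1 ^+ 2 * S2 - S1).
    by rewrite id; ring.
  have -> : Kd = z / 2 * (2 * z^-1 * Kd) by field.
  by rewrite id' /lam -/w; ring.
rewrite -/A -/Kd E ncM -mulrA ler_wpM2l ?nc_ge0 //.
have q1 : nc (rC (zt D) - rC ze) <= 4 / D.+1%:R by rewrite -rCB nc_rC; exact: zeP.
have q2 : nc (rC (zt A) - rC ze) <= 4 / D.+1%:R.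
  rewrite -rCB nc_rC; apply: (le_trans (zeP A)); rewrite ler_wpM2l //; apply: ler_pV; rewrite ?ltr0n //.
  by rewrite ler_nat.
have q3 : nc P <= Kp / D.+1%:R by exact: Prest_bound.
have q4 : nc de <= 4 / D.+1%:R.
  rewrite /de; have -> : D%:R + hC = rC (D%:R + 1 / 2) by rewrite rCD rC_nat.
  rewrite ncM ncV nc_rC nc_nat ger0_norm ?addr_ge0 // ler_pdivrMr; last by rewrite ltr_wpDl.
  rewrite mulrAC ler_pdivlMr ?ltr0n // -[D.+1%:R]natr1; have : 0 <= D%:R :> R by [].
  by move: (D%:R) => x; lra.
have nM (x y : C) (u v : R) : nc x = u -> nc y <= v -> nc (x * y) <= u * v.
  by move=> <- h; rewrite ncM ler_wpM2l ?nc_ge0.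
have p2 := nM _ _ _ _ (erefl nz) q2; have p5 := nM _ _ _ _ (erefl nz) b2.
have -> : (4 + nz * 4 + Kp + 4 + nz * K2 + K1) / D.+1%:R =
   4 / D.+1%:R + nz * (4 / D.+1%:R) + Kp / D.+1%:R + 4 / D.+1%:R + nz * (K2 / D.+1%:R) + K1 / D.+1%:R by ring.
apply: (le_trans (nc_tri _ _)); apply: lerD => //.
apply: (le_trans (nc_triB _ _)); apply: lerD => //.
apply: (le_trans (nc_tri _ _)); apply: lerD => //.
apply: (le_trans (nc_triB _ _)); apply: lerD => //.
by apply: (le_trans (nc_triB _ _)); apply: lerD.
Qed.

Lemma holo_lam : holo lam.
Proof.
have hi : holo (fun z => z^-1).
  by apply: (holoV _ holo_id) => z zH; apply/eqP => e; move: zH; rewrite e /inH ltxx.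
have hU : holo (fun z => U (- z^-1)).
  have := holo_comp (fun z zH => inH_mob SL_S zH) holo_U (@holo_mob _ SL_S).
  by apply: holo_ext => z _; rewrite mob_S.
have h1 : holo (fun z => rC ze + - (z^-1 ^+ 2 * rC ze)) :=
  holoD (holo_cst (rC ze)) (holoN (holoM (holoX (n := 2) hi) (holo_cst (rC ze)))).
have h2 := holoD (holoD h1 (holoN (holoM (holoX (n := 2) hi) hU))) holo_U.
have := holoM (holoM holo_id (holo_cst 2^-1)) h2.
by apply: holo_ext => z _.
Qed.

Definition Lam (u : C) : C := lam (- u^-1).
Lemma holo_Lam : holo Lam.
Proof.
have := holo_comp (fun z zH => inH_mob SL_S zH) holo_lam (@holo_mob _ SL_S).
by apply: holo_ext => z _; rewrite /Lam mob_S.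
Qed.
Lemma Kt_Lim (u : C) : inH u -> exists K : R, forall D, nc (Kt (D * D) (- ((D%:R + hC) * u)) - Lam u) <= K / D.+1%:R.
Proof.
move=> uH; have wH : inH (- u^-1) by rewrite -mob_S; apply: inH_mob => //; exact: SL_S.
have [K hK] := Kt_lim wH; exists K => D; have := hK D.
by rewrite invrN invrK mulrN.
Qed.

(** Up to a small error [Kt] has period 1 in its argument -(D + 1/2) u. Along those D for which (D +
    1/2) t is an integer, a shift of u by t = 2/(2k+1) is such a period. *)
Lemma Lam_shift (u : C) (k : nat) : inH u -> Lam (u + 2 / (2 * k).+1%:R) = Lam u.
Proof.
move=> uH; set t : C := 2 / _; pose tr : R := 2 / (2 * k).+1%:R.
have tE : t = rC tr by rewrite /t /tr rCM rCV !rC_nat.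
have vH : inH (u + t) by rewrite /inH tE ImD /= addr0.
have [K1 h1] := Kt_Lim uH; have [K2 h2] := Kt_Lim vH.
apply/eqP; rewrite -subr_eq0; apply/eqP.
pose b := nc u + 2; pose J := Num.bound (4 * b).
have b2 : 2 <= b by rewrite /b lerDr nc_ge0.
have K10 : 0 <= K1 by have := h1 0%N; rewrite divr1; apply: le_trans; exact: nc_ge0.
have K20 : 0 <= K2 by have := h2 0%N; rewrite divr1; apply: le_trans; exact: nc_ge0.
apply: (@nc_small _ (K1 + K2 + 24) J) => j jJ.
(* Chosen so that 2D + 1 = (2j+1)(2k+1), whence (D + 1/2) t = 2j + 1. *)
pose D := (2 * k * j + k + j)%N; pose A := (D * D)%N; pose de : C := D%:R + hC.
have Dj : (j <= D)%N by rewrite /D; lia.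
pose x : R := D%:R; have xb : 4 * b <= x.
  have q : 4 * b < J%:R by apply: archi_boundP; rewrite mulr_ge0 //; lra.
  by apply: (le_trans (ltW q)); rewrite /x ler_nat; apply: leq_trans jJ Dj.
have nde : nc de = x + 1 / 2.
  have -> : de = rC (x + 1 / 2) by rewrite rCD rC_nat.
  by rewrite nc_rC ger0_norm // addr_ge0 // /x.
have shE : - (de * (u + t)) = - (de * u) - (2 * j).+1%:R.
  have dt : de * t = (2 * j).+1%:R.
    have e : (2 * D).+1 = ((2 * j).+1 * (2 * k).+1)%N by rewrite /D; lia.
    rewrite /t mulrA; have -> : de * 2 = (2 * D).+1%:R.
      rewrite /de -[(2 * D).+1%:R]natr1 natrM -[X in _ = _ + X]hC2; ring.
    by rewrite e natrM mulfK // pnatr_eq0.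
  by rewrite mulrDr dt opprD.
have nb : nc (- (de * u)) + (2 * j).+1%:R + x ^+ 2 / 2 <= A%:R.
  rewrite ncN ncM nde /A natrM -/x -[(2 * j).+1%:R]natr1 natrM.
  have jx : j%:R <= x by rewrite /x ler_nat.
  have u0 : nc u = b - 2 by rewrite /b addrK.
  rewrite u0; move: jx xb b2; move: (j%:R) (x) (b) => y X B; clear; nra.
have x0 : 0 < x by apply: lt_le_trans xb; lra.
have sh := @Kt_shift A (2 * j).+1 (- (de * u)) (x ^+ 2 / 2) (divr_gt0 (exprn_gt0 2 x0) (ltr0Sn _ 1)) nb.
have jx : j.+1%:R <= x + 1 by rewrite /x natr1 ler_nat ltnS.
have sh' : nc (Kt A (- (de * u) - (2 * j).+1%:R) - Kt A (- (de * u))) <= 24 / D.+1%:R.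
  apply: (le_trans sh); rewrite ler_pdivlMr ?ltr0n // -[D.+1%:R]natr1 -/x invfM invrK.
  have -> : (2 * j).+1%:R * (2 * ((x ^+ 2)^-1 * 2)) * (x + 1) = ((2 * j).+1%:R * 4 * (x + 1)) / x ^+ 2 by ring.
  rewrite ler_pdivrMr ?exprn_gt0 // -[(2 * j).+1%:R]natr1 natrM; move: jx; rewrite -[j.+1%:R]natr1; move: xb b2.
  have : 0 <= j%:R :> R by [].
  by move: (j%:R) (x) (b) => y X B; clear; nra.
rewrite -shE in sh'.
have m (K : R) : 0 <= K -> K / D.+1%:R <= K / j.+1%:R.
  by move=> K0; rewrite ler_wpM2l //; apply: ler_pV; rewrite ?ltr0n // ler_nat ltnS.
have e1 := le_trans (h1 D) (m _ K10); have e2 := le_trans (h2 D) (m _ K20).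
have e3 := le_trans sh' (m 24 (ler0n _ 24)).
rewrite -/A -/de in e1 e2.
have -> : Lam (u + t) - Lam u = - (Kt A (- (de * (u + t))) - Lam (u + t))
  + (Kt A (- (de * (u + t))) - Kt A (- (de * u))) + (Kt A (- (de * u)) - Lam u) by ring.
have -> : (K1 + K2 + 24) / j.+1%:R = K2 / j.+1%:R + 24 / j.+1%:R + K1 / j.+1%:R by ring.
apply: (le_trans (nc_tri _ _)); apply: lerD => //.
by apply: (le_trans (nc_tri _ _)); apply: lerD => //; rewrite ncN.
Qed.

(** A holomorphic function with arbitrarily small real periods has derivative 0. *)
Lemma Lam_cst : exists l : C, forall u, inH u -> Lam u = l.
Proof.
exists (Lam iC) => u uH; apply: (holo_der0 holo_Lam _ uH inH_i) => z zH.
apply: nc_eq0; apply/eqP; rewrite eq_le nc_ge0 andbT leNgt; apply/negP => dp.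
have e0 : 0 < nc (der Lam z) / 2 by rewrite divr_gt0.
have [d d0 hd] := holo_cdiff holo_Lam zH e0.
pose k := Num.bound (2 / d); pose t : C := 2 / (2 * k).+1%:R.
have nt : nc t = 2 / (2 * k).+1%:R by rewrite ncM ncV !nc_nat.
have t0 : 0 < nc t by rewrite nt divr_gt0.
have td : nc t < d.
  rewrite nt ltr_pdivrMr ?ltr0n // mulrC -ltr_pdivrMr //.
  have q : 2 / d < k%:R by apply: archi_boundP; rewrite divr_ge0 // ltW.
  by apply: (lt_le_trans q); rewrite ler_nat; lia.
have := hd t td; rewrite Lam_shift // subrr sub0r ncN ncM mulrC ler_pM2r //.
lra.
Qed.
Definition lc : C := projT1 (cid Lam_cst).
Lemma lamE z : inH z -> lam z = lc.
Proof.
move=> zH; have wH : inH (- z^-1) by rewrite -mob_S; apply: inH_mob => //; exact: SL_S.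
by have := projT2 (cid Lam_cst) _ wH; rewrite /Lam invrN invrK opprK.
Qed.

(** At u = i every term of the sum has positive imaginary part, and each of the 2D + 1 terms with
    |c| <= D contributes at least 1/(2D+1). The constant is pi i. *)
Lemma lc_neq0 : lc != 0.
Proof.
have [K hK] := Kt_Lim inH_i; rewrite (projT2 (cid Lam_cst) _ inH_i) -/lc in hK.
apply/eqP => l0; rewrite l0 in hK.
suff ge1 D : 1 <= nc (Kt (D * D) (- ((D%:R + hC) * iC))).
  have : (1 : C) = 0.
    apply: (@nc_small _ K 0) => n _; rewrite nc1; apply: (le_trans (ge1 n)).
    by have := hK n; rewrite subr0.
  by move/eqP; rewrite oner_eq0.
apply: le_trans (nc_Im _); apply: le_trans (ler_norm _).
pose de : R := D%:R + 1 / 2; have de0 : 0 < de by rewrite ltr_wpDl.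
have tE (c : int) : Im ((- ((D%:R + hC) * iC) + c%:~R)^-1) = de / (c%:~R ^+ 2 + de ^+ 2).
  have -> : - ((D%:R + hC) * iC) + c%:~R = complex.Complex c%:~R (- de).
    have -> : D%:R + hC = rC de by rewrite rCD rC_nat.
    by apply: C_eq; rewrite ?ReD ?ImD ?ReN ?ImN ?ReM ?ImM ?Re_int ?Im_int /=; ring.
  by rewrite /= sqrrN mulNr opprK.
have ImS (s : seq int) (f : int -> C) : Im (\sum_(c <- s) f c) = \sum_(c <- s) Im (f c).
  by elim: s => [|c s IH]; rewrite ?big_nil ?big_cons // ImD IH.
rewrite /Kt ImS; under eq_bigr do rewrite tE.
have pos (c : int) : 0 < c%:~R ^+ 2 + de ^+ 2 :> R by rewrite ltr_wpDl ?sqr_ge0 // exprn_gt0.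
apply: (@le_trans _ _ (\sum_(c <- zr (D * D) | (`|c| <= D)%N) (2 * de)^-1)).
  rewrite -big_filter; have pe : perm_eq [seq c <- zr (D * D) | (`|c| <= D)%N] (zr D).
    apply: uniq_perm; rewrite ?filter_uniq ?zr_uniq // => c; rewrite mem_filter !mem_zr.
    by apply/andP/idP => [[]//|h]; split=> //; apply: leq_trans h _; case: (D) => // n; rewrite leq_pmulr.
  rewrite (perm_big _ pe) big_const_seq count_predT size_zr iter_addr addr0 -[_ *+ (2 * D).+1]mulr_natl.
  have -> : (2 * D).+1%:R = 2 * de by rewrite /de -[(2 * D).+1%:R]natr1 natrM; field.
  by rewrite mulfV // mulf_neq0 // gt_eqF.
rewrite big_mkcond; apply: ler_sum => c _; case: ifP => cD; last by rewrite divr_ge0 // ltW.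
rewrite -div1r ler_pdivrMr ?mulr_gt0 // mulrAC ler_pdivlMr // mul1r.
have : (c%:~R : R) ^+ 2 <= D%:R ^+ 2.
  by rewrite -real_normK ?num_real // lerXn2r ?nnegrE // -intr_norm -natr_absz ler_nat.
have : 0 <= D%:R :> R by [].
rewrite /de; move: (c%:~R ^+ 2) (D%:R) => x y; clear; nra.
Qed.

(** With [ze] = 2 zeta(2) and [lc] = pi i this is -G_2 / (2 pi i), that is (pi i / 6) E_2. The
    normalization makes the cocycle exactly c / (c tau + d). *)
Definition phi (z : C) : C := - (U z + rC ze) / (2 * lc).

Lemma phi_S z : inH z -> z^-1 ^+ 2 * phi (- z^-1) = phi z + z^-1.
Proof.
move=> zH; have z0 : z != 0 by apply/eqP => e; move: zH; rewrite e /inH ltxx.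
have := lamE zH; rewrite /lam /phi; have := lc_neq0; move: (U _) (U _) (rC ze) lc => a b c l l0 e.
have e2 : z^-1 ^+ 2 * b = c - z^-1 ^+ 2 * c + a - 2 * l / z by rewrite -e; field.
by rewrite mulrA mulrN mulrDr e2; field; rewrite z0 l0.
Qed.

Lemma qh_phi N : (0 < N)%N -> qh N phi.
Proof.
move=> N0; have q1 : qh 1 phi.
  have i1 : (0 < 1)%N by [].
  have := qhZ i1 (- (2 * lc)^-1) (qhD i1 qh_U (qh_cst 1 (rC ze))).
  by apply: qh_ext => z _; rewrite /phi mulNr mulNr mulrC.
have [_ p1 _] := q1; apply: (qh_perd (M := 1)) => // z zH.
by have := @perd_nat 1 N phi z p1 zH; rewrite muln1.
Qed.

(** * Quasi-modularity for the whole modular group *)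

Definition qmod (g : SL) := forall z, inH z ->
  (jac (smx g) z)^-1 ^+ 2 * phi (mob (smx g) z) = phi z + (gc (smx g))%:~R / jac (smx g) z.

Lemma qmod_mul g h : qmod g -> qmod h -> qmod (smul g h).
Proof.
move=> hg hh z zH; have hzH := inH_mob (smxP h) zH.
have jh := jac_neq0 (smxP h) zH; have jg := jac_neq0 (smxP g) hzH.
have := hg _ hzH; have := hh _ zH; rewrite /= (jac_mul _ (smxP h) zH) (mob_mul (smxP g) (smxP h) zH).
set P := phi (mob (smx g) _); set Q := phi (mob (smx h) z) => e1 e2.
rewrite invfM exprMn -mulrA mulrCA e2 mulrDr e1 -addrA; congr (_ + _).
have cE : gc (smx g *m smx h) = gc (smx g) * ga (smx h) + gd (smx g) * gc (smx h) by rewrite /gc mul2E.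
have jE : jac (smx g) (mob (smx h) z) * jac (smx h) z =
   (gc (smx g))%:~R * ((ga (smx h))%:~R * z + (gb (smx h))%:~R) + (gd (smx g))%:~R * jac (smx h) z.
  by rewrite {1}/jac mulrDl /mob -/(jac _ z) mulrA divfK.
have dh : (ga (smx h))%:~R * (gd (smx h))%:~R - (gb (smx h))%:~R * (gc (smx h))%:~R = 1 :> C.
  by rewrite -!intrM -intrB (SL2Z_det (smxP h)).
set J := jac (smx g) _ in jg jE *; set j := jac (smx h) z in jh jE *.
apply: (mulIf (mulf_neq0 jg jh)); apply: (mulIf jh).
have -> : ((gc (smx h))%:~R / j + j^-1 ^+ 2 * ((gc (smx g))%:~R / J)) * (J * j) * j
  = (gc (smx h))%:~R * (J * j) + (gc (smx g))%:~R by field; rewrite jg jh.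
have -> : (gc (smx g *m smx h))%:~R * (J^-1 * j^-1) * (J * j) * j = (gc (smx g *m smx h))%:~R * j by field; rewrite jg jh.
have -> : (gc (smx g))%:~R = (gc (smx g))%:~R * ((ga (smx h))%:~R * (gd (smx h))%:~R - (gb (smx h))%:~R * (gc (smx h))%:~R) :> C.
  by rewrite dh mulr1.
rewrite jE cE intrD !intrM /j /jac; ring.
Qed.

Lemma qmod_sinv g : qmod g -> qmod (sinv g).
Proof.
move=> hg z zH; have wH := inH_mob (smxP (sinv g)) zH.
have := hg _ wH.
have m1 : mob (smx g) (mob (smx (sinv g)) z) = z.
  by rewrite -(mob_mul (smxP g) (smxP (sinv g)) zH) -[_ *m _]/(smx (smul g (sinv g))) smulV mob1.
have j1 : jac (smx g) (mob (smx (sinv g)) z) * jac (smx (sinv g)) z = 1.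
  by rewrite -(jac_mul _ (smxP (sinv g)) zH) -[_ *m _]/(smx (smul g (sinv g))) smulV jac1.
have [_ _ cE _] := adj22 (smx g).
rewrite m1 /= in j1 *; rewrite cE mulrNz; set J := jac _ _ in j1 *; set j := jac _ _ in j1 *.
set P := phi (mob _ _) => e.
have j0 : j != 0 by apply/eqP => j0; move: j1; rewrite j0 mulr0 => /esym/eqP; rewrite oner_eq0.
have JE : J = j^-1 by apply: (mulIf j0); rewrite j1 mulVf.
move: e; rewrite JE invrK => e; have -> : phi z = j^-1 ^+ 2 * (P + (gc (smx g))%:~R * j).
  by rewrite -e mulrA -exprMn mulVf // expr1n mul1r.
by field.
Qed.

Lemma qmod_S : qmod sS.
Proof.
move=> z zH; rewrite /= jac_S mob_S; have [_ _ -> _] := SmatE.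
by rewrite phi_S // mul1r.
Qed.
Lemma qmod_T k : qmod (sT k).
Proof.
move=> z zH; rewrite /= jac_T mob_T; have [_ _ -> _] := TZE k.
have [_ p1 _] := qh_phi (ltn0Sn 0).
rewrite invr1 expr1n mul1r mul0r addr0; have := @perd_int 1 k phi z p1 zH.
by rewrite mulr1.
Qed.

Lemma gc_mulT g k : gc (smx (smul g (sT k))) = gc (smx g) /\ gd (smx (smul g (sT k))) = gc (smx g) * k + gd (smx g).
Proof.
have [a b c d] := TZE k; rewrite /= /gc /gd !mul2E; rewrite /ga /gb /gc /gd in a b c d.
by rewrite a b c d !mulr1 mulr0 addr0.
Qed.
Lemma gc_mulS g : gc (smx (smul g sS)) = gd (smx g).
Proof.
have [a b c d] := SmatE; rewrite /= /gc /gd mul2E; rewrite /ga /gb /gc /gd in a b c d.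
by rewrite a c mulr0 add0r mulr1.
Qed.

(** The Euclidean algorithm on the lower row (c, d): a translation reduces d modulo c and the
    inversion exchanges the entries. The base case c = 0 consists of the translations up to sign. *)
Lemma qmod_all g : qmod g.
Proof.
have key h x : qmod (smul h x) -> qmod x -> qmod h.
  move=> hx xx; have -> : h = smul (smul h x) (sinv x) by rewrite -smulA smulV smul1.
  by apply: qmod_mul => //; apply: qmod_sinv.
have [n] := ubnP `|gc (smx g)|%N; elim: n g => // n IH g; rewrite ltnS => cn.
have [c0|c0] := eqVneq (gc (smx g)) 0.
  have dg := SL2Z_det (smxP g); rewrite c0 mulr0 subr0 in dg.
  move=> z zH; rewrite c0 mul0r addr0.
  have jE : jac (smx g) z = (gd (smx g))%:~R by rewrite /jac c0 mul0r add0r.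
  have pm : gd (smx g) = 1 \/ gd (smx g) = -1.
    by move: (congr1 absz dg); rewrite abszM => /eqP; rewrite muln_eq1 => /andP[_ /eqP]; lia.
  have d2 : gd (smx g) * gd (smx g) = 1 by case: pm => ->.
  have mE : mob (smx g) z = z + (gb (smx g) * gd (smx g))%:~R.
    have a0 : ga (smx g) = gd (smx g) by move: dg; case: pm => ->; lia.
    have d2C : (gd (smx g))%:~R * (gd (smx g))%:~R = 1 :> C by rewrite -intrM d2.
    have d0 : (gd (smx g))%:~R != 0 :> C.
      by apply/eqP => d0; move: d2C; rewrite d0 mul0r => /esym/eqP; rewrite oner_eq0.
    rewrite /mob -/(jac _ z) jE a0; apply: (mulIf d0); rewrite divfK // mulrDl intrM -[_ * _ * _]mulrA d2C mulr1.
    by rewrite mulrC.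
  have [_ p1 _] := qh_phi (ltn0Sn 0).
  rewrite jE mE; have := @perd_int 1 (gb (smx g) * gd (smx g)) phi z p1 zH; rewrite mulr1 => ->.
  by rewrite exprVn -rmorphXn /= expr2 d2 invr1 mul1r.
pose k := - (gd (smx g) %/ gc (smx g))%Z; pose h := smul g (sT k).
apply: (key g (sT k)); last exact: qmod_T.
apply: (key _ sS); last exact: qmod_S.
apply: IH; rewrite gc_mulS; have [_ ->] := gc_mulT g k.
have -> : gc (smx g) * k + gd (smx g) = (gd (smx g) %% gc (smx g))%Z by rewrite /modz /k mulrN addrC mulrC.
apply: leq_trans cn; have := modz_ge0 (gd (smx g)) c0; have := ltz_mod (gd (smx g)) c0.
lia.
Qed.

(** * Invariant vectors *)

Lemma count_pps (N m n i : nat) : (i <= N)%N ->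
  count (fun q : PP => [&& Dg q == m%:Z, size (val q.1) == n & sumn (val q.1) == i]) (pps N)
  = (size (parts n i) * size (parts (m + n) (N - i)))%N.
Proof.
move=> iN; rewrite -size_filter -(size_allpairs (fun l l' => to_pp (l, l'))); apply: perm_size; apply: uniq_perm.
- by rewrite filter_uniq // pps_uniq.
- apply: allpairs_uniq; rewrite ?parts_uniq // => -[l l'] [k k'] /allpairsP[[x x'] /= [hx hx' [-> ->]]].
  move=> /allpairsP[[y y'] /= [hy hy' [-> ->]]] e.
  move: hx hx' hy hy'; rewrite !mem_parts => /andP[h1 _] /andP[h2 _] /andP[h3 _] /andP[h4 _].
  by rewrite -[(x, x')](to_ppK (l := (x, x'))) // -[RHS](to_ppK (l := (y, y'))) // e.
move=> q; rewrite mem_filter mem_pps; apply/idP/allpairsP.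
  case/andP => /and3P[/eqP h1 /eqP h2 /eqP h3] /eqP h4; exists (val q.1, val q.2); rewrite /= to_pp_val !mem_parts.
  split=> //; first by rewrite h2 h3 !eqxx (valP q.1).
  rewrite (valP q.2) /=; move: h1 h4; rewrite /Dg /wt /wts /= h2 h3; move: (size _) (sumn _) => x y h1 h4.
  by apply/andP; split; apply/eqP; lia.
case=> -[l l'] /= [h1 h2 ->]; move: h1 h2; rewrite !mem_parts => /and3P[p1 /eqP s1 /eqP w1] /and3P[p2 /eqP s2 /eqP w2].
have [e1 e2] : val (to_pp (l, l')).1 = l /\ val (to_pp (l, l')).2 = l'.
  by have := @to_ppK (l, l') p1 p2 => -[].
case: (to_pp (l, l')) e1 e2 => -[x px] [y py] /= ex ey; subst x y.
rewrite /Dg /wt /wts /= s1 s2 w1 w2 !eqxx !andbT; apply/andP; split; apply/eqP; lia.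
Qed.

Definition dgn (q : PP) : nat := absz (Dg q).
Definition dgp (q : PP) : bool := 0 <= Dg q.

(** Charge, number of parts and size of lambda are at most N for a pair of weight N and charge at
    least 0, so the ranges up to N lose nothing. *)
Lemma gf_sum (dM : nat -> nat) N :
  (\sum_(q <- pps N | dgp q) dM (dgn q))%N%:Z = \sum_(m < N.+1) \sum_(n < N.+1) (dM m)%:Z * gf_coef m n N.
Proof.
have E : (\sum_(q <- pps N | dgp q) dM (dgn q) =
  \sum_(m < N.+1) \sum_(n < N.+1) \sum_(i < N.+1) (dM m * (size (parts n i) * size (parts (m + n) (N - i))))%N)%N.
  have -> : (\sum_(q <- pps N | dgp q) dM (dgn q) = \sum_(q <- pps N) \sum_(m < N.+1) \sum_(n < N.+1) \sum_(i < N.+1)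
     (if [&& Dg q == m%:Z, size (val q.1) == n & sumn (val q.1) == i] then dM m else 0))%N.
    rewrite big_mkcond /= big_seq [RHS]big_seq; apply: eq_bigr => q; rewrite mem_pps => /eqP qN.
    case: ifP => D0; last first.
      apply/esym; rewrite big1 // => m _; rewrite big1 // => n _; rewrite big1 // => i _.
      by case: eqP => // e; move: D0; rewrite /dgp e.
    have b1 : (sumn (val q.1) < N.+1)%N by move: qN; rewrite /wt /wts /= => <-; rewrite ltnS leq_addr.
    have szw (l : Ptn) : (size (val l) <= sumn (val l))%N.
      case: l => l /= /andP[_]; elim: l => //= x l IH /andP[x0 /IH]; lia.
    have b2 : (size (val q.1) < N.+1)%N by apply: leq_ltn_trans b1; exact: szw.
    have b3 : (dgn q < N.+1)%N.
      have := szw q.2; move: qN D0; rewrite /dgp /dgn /wt /wts /Dg /=.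
      by move: (size _) (size _) (sumn _) (sumn _) => x y a b; lia.
    rewrite (bigD1 (Ordinal b3)) //= (bigD1 (Ordinal b2)) //= (bigD1 (Ordinal b1)) //= /dgn !eqxx /= gez0_abs // eqxx.
    rewrite !big1 ?addn0 //.
    - move=> m /negP hm; rewrite big1 // => n _; rewrite big1 // => i _; case: eqP => // e; case: hm.
      by apply/eqP/val_inj; rewrite /= /dgn e absz_nat.
    - move=> n /negP hn; rewrite big1 // => i _; case: eqP => //= e; case: hn.
      by apply/eqP/val_inj; rewrite /= e.
    - move=> i /negP hi; case: eqP => //= e; case: hi; by apply/eqP/val_inj.
  rewrite exchange_big /=; apply: eq_bigr => m _; rewrite exchange_big /=; apply: eq_bigr => n _.
  rewrite exchange_big /=; apply: eq_bigr => i _; rewrite -count_pps; last by rewrite -ltnS.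
  by rewrite -big_mkcond /= big_const_seq iter_addn_0.
rewrite E -natz natr_sum; apply: eq_bigr => m _; rewrite natr_sum; apply: eq_bigr => n _.
rewrite natr_sum gf_coefE mulr_sumr; apply: eq_bigr => i _; by rewrite natrM !natz.
Qed.

(** For a translation J = 1 and b goes to b + k, so the nonzero modes are fixed. Hence invariance
    under T^K is periodicity of each coefficient. *)
Lemma pivg_T k (v : V hfun) p : pivg (sT k) v p = sgO (sT k) (v p).
Proof.
pose X (v : V hfun) : V hfun := fun p => sgO (sT k) (v p).
suff -> : pivg (sT k) v = X v by [].
have J1 : jO (sT k) = 1 by apply: hfun_ext => z zH; rewrite jOE // hf1 // jac_T.
have B1 : sgO (sT k) bO = bO + cO k%:~R.
  apply: hfun_ext => z zH; have mH := inH_mob (smxP (sT k)) zH.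
  by rewrite sgOE // hfD // !bOE // cOE //= mob_T.
apply: (@hop_ext _ 0 (pivg (sT k)) X); first exact: hop_piv dO_D _.
  split=> [u w|u w q h]; first by apply/funext => q; rewrite /X vx rmorphD.
  by rewrite /X h // addr0.
move=> p0 f0; move: p0 f0; apply: (@mono_ind hfun dO bO (fun w => pivg (sT k) w = X w)) => [f|n w IH|n w IH].
- rewrite /pivg piv_vac; last exact: dO_D.
  by apply/funext => q; rewrite /X /vac /mono; case: eqP => //; rewrite rmorph0.
- rewrite /pivg (piv_am_neg dO_D dO_M dO_c dO_b) -/(pivg _) IH /= J1 expr1n Xm1 //; [|exact: dO_D|exact: dO_c].
  by apply/funext => q; rewrite /X /= /cr; case: ifP => //; rewrite rmorph0.
- rewrite /pivg (piv_bm_neg dO_D dO_M dO_c dO_b) -/(pivg _) IH /= B1 fmD; last exact: dO_D.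
  rewrite (fm_beta dO_c dO_b) (fm_const _ dO_c) ?dO_c // addr0.
  by apply/funext => q; rewrite /X /= /cr; case: ifP => //; rewrite rmorph0.
Qed.

Lemma qexp_ext K f g : (forall z, inH z -> f z = g z) -> qexp_holo K f -> qexp_holo K g.
Proof. by move=> fg [u hu]; exists u => z zH; rewrite -fg //; apply: hu. Qed.

Lemma TmatE K : Tmat K = TZ K%:Z.
Proof. by apply/matrixP => i j; rewrite !mxE. Qed.

Section Invariants.
Variables (G : 'M[int]_2 -> Prop) (L : nat) (L0 : (0 < L)%N).
Hypothesis lvl : forall g, SL2Z g -> (forall i j, (L%:Z %| g i j - (i == j)%:Z)%Z) -> G g.
Hypothesis GS : forall g, G g -> SL2Z g.
Hypothesis G1 : G 1%:M.

(** The invariants seen as vectors, with the cusp condition imposed on all translates as in [mf]. *)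
Record invs (n : nat) (v : V hfun) : Prop := {
  iv_wt : hv n v;
  iv_G : forall g : SL, G (smx g) -> pivg g v = v;
  iv_qh : forall r p, qh L (pivg r v p) }.

Lemma iv_linv n v : invs n v -> linv G (fun r => pivg r v).
Proof. by move=> [_ iv _] g r gG; rewrite -pivg_comp iv. Qed.

(** As for modular forms: the translate by r is fixed by T^L because conjugates of T^L lie in the
    group, and boundedness high up serves for every period K in the definition. Indices that are not
    partitions have coefficient 0. *)
Lemma Dch_invP n v : Dch_inv G n v <-> weight_elt n v /\ invs n (sem v).
Proof.
split=> [[wv iv cv]|[wv iv]].
  have [fv hn] := weight_eltP wv; split=> //.
  have iG (g : SL) : G (smx g) -> pivg g (sem v) = sem v.
    by move=> gG; have [w <-] := piact_sem g fv; apply/eqvP => //; exact: iv.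
  split=> // r p; have [c hc] := has_cusp (smxP r).
  apply: (qexp_qh L0); first exact: hval_holo.
  have [w e] := piact_sem r fv.
  apply: (@qexp_ext _ (coefv (piact (smx r) v) (val p.1, val p.2))).
    by move=> z zH; rewrite -e sem_coef.
  apply: cv (smxP r) hc L L0 _ _; have [w' e'] := piact_sem (sT L%:Z) w.
  rewrite TmatE; apply/eqvP => //; rewrite e' e pivg_comp.
  by apply: (linv_T L0 lvl (F := fun r => pivg r (sem v))) => g s gG; rewrite -pivg_comp iG.
have [fv hn] := weight_eltP wv; split=> // [g gG|c r sr _ K K0 ev p].
  have [w e] := piact_sem (MkSL (GS gG)) fv; apply/eqvP => //.
  by rewrite [LHS]e (iv_G iv).
have [w e] := piact_sem (MkSL sr) fv; have [w' e'] := piact_sem (sT K%:Z) w.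
move: ev; rewrite TmatE => /(eqvP w' w); rewrite e' => ev.
have [pp|np] := boolP (is_part p.1 && is_part p.2); last first.
  apply: (@qexp_ext _ (fun=> 0)); first by move=> z zH; rewrite coefv_npart.
  by apply: (qh_qexp K0); apply: qh_cst.
case/andP: pp => p1 p2; pose q := to_pp p.
have qE : p = (val q.1, val q.2) by rewrite /q to_ppK //; case: (p).
apply: (@qexp_ext _ (pivg (MkSL sr) (sem v) q)).
  by move=> z zH; rewrite -e qE sem_coef // -qE.
apply: (qh_qexp K0); apply: (qh_perd L0 (iv_qh iv _ _)) => z zH.
have := congr1 (fun x : V hfun => x q z) ev; rewrite e pivg_T sgOE //= mob_T.
by move=> h; rewrite -[RHS]h.
Qed.

Lemma pivg_hop g : hop 0 (pivg g).
Proof. exact: hop_piv dO_D (actg g). Qed.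

Lemma invs0 n : invs n 0.
Proof.
split=> [q _ //|g _|r p]; first by rewrite (hop0 (pivg_hop g)).
by rewrite (hop0 (pivg_hop r)); apply: (qh_ext _ (qh_cst L 0)) => z _; rewrite hf0.
Qed.
Lemma invsD n u v : invs n u -> invs n v -> invs n (u + v).
Proof.
move=> [u1 u2 u3] [v1 v2 v3]; split=> [q qn|g gG|r p]; first by rewrite vx u1 // v1 // addr0.
  by rewrite (hopD (pivg_hop g)) u2 // v2.
rewrite (hopD (pivg_hop r)); apply: (qh_ext _ (qhD L0 (u3 r p) (v3 r p))) => z zH.
by rewrite vx hfD.
Qed.
Lemma pivg_cmul g k v : pivg g (mu (cO k) v) = mu (cO k) (pivg g v).
Proof.
rewrite /pivg (piv_mu_const dO_D dO_M dO_c dO_b) ?dO_c //=; congr (mu _ _); exact: sgO_c.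
Qed.
Lemma invsZ n k v : invs n v -> invs n (mu (cO k) v).
Proof.
move=> [v1 v2 v3]; split=> [q qn|g gG|r p]; first by rewrite mux v1 // mulr0.
  by rewrite pivg_cmul v2.
rewrite pivg_cmul; apply: (qh_ext _ (qhZ L0 k (v3 r p))) => z zH.
by rewrite mux hfM // cOE.
Qed.
Lemma invsN n v : invs n v -> invs n (- v).
Proof.
move=> /(invsZ (-1)); congr invs; apply/funext => p.
by rewrite mux rmorphN1 mulN1r.
Qed.
Lemma invs_sum n (I : Type) (s : seq I) (P : pred I) (F : I -> V hfun) : (forall i, P i -> invs n (F i)) ->
  invs n (\sum_(i <- s | P i) F i).
Proof. by move=> h; elim/big_ind: _ => //; [exact: invs0|exact: invsD]. Qed.

Lemma nc_jfac g q z : inH z -> nc (jfac (actg g) q z) =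
  nc (jac (smx g) z) ^+ (2 * size (val q.1)) * (nc (jac (smx g) z))^-1 ^+ (2 * size (val q.2)).
Proof. by move=> zH; rewrite /jfac hfM // !hfX // jOE // jiOE // ncM !ncX ncV. Qed.

Lemma lead_act n v D q g z : hv n v -> fil D v -> Dg q <= D -> inH z ->
  pivg g v q z = jfac (actg g) q z * v q (mob (smx g) z).
Proof.
by move=> hn fv qD zH; rewrite /pivg (piv_lead dO_D dO_c dO_b (actg g) hn fv qD) hfM // sgOE.
Qed.
Lemma fil_pivg n v D g : hv n v -> fil D v -> fil D (pivg g v).
Proof.
move=> hn fv q qD; rewrite /pivg (piv_lead dO_D dO_c dO_b (actg g) hn fv (ltW qD)) fv //.
by rewrite rmorph0 mulr0.
Qed.
Lemma hv_pivg n v g : hv n v -> hv n (pivg g v).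
Proof. by move=> h; apply: (hop_hv (pivg_hop g) h); rewrite addr0. Qed.

(** The lowest coefficient transforms with weight 2D < 0, and its translates form a family to which
    [fam_neg] applies. *)
Lemma lead_neg n v D q : invs n v -> fil D v -> D < 0 -> Dg q = D -> v q = 0.
Proof.
move=> iv fv D0 qD; have [rp hrp] := cls_reps L0.
have hn := iv_wt iv; pose k := absz D; have kp : (0 < k)%N by rewrite /k; lia.
have fam : family L rp (fun y => y^-1 ^+ k) (fun r => pivg r v q).
  split=> [r|r|r g z zH]; first exact: iv_qh iv r q.
    exists (cls L0 r) => z zH; congr (hval _ z); apply: (linv_cls lvl (F := fun r => pivg r v q)).
      by move=> g s gG; rewrite /= (iv_linv iv).
    by rewrite hrp.
  have gz := inH_mob (smxP g) zH.
  rewrite -pivg_comp (lead_act g (hv_pivg r hn) (fil_pivg r hn fv) _ zH) ?qD // ncM nc_jfac //.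
  set a := nc (pivg r v q _); rewrite (Im_mob (smxP g) zH); set j := nc _.
  have j0 : j != 0 by rewrite gt_eqF // nc_gt0 jac_neq0 //; exact: smxP.
  have sz : size (val q.1) = (size (val q.2) + k)%N by move: qD; rewrite /Dg /k; lia.
  rewrite sz invfM invrK exprMn -exprM mulnDr exprD exprVn -/j.
  rewrite [j ^+ (2 * size (val q.2)) * _]mulrC mulfK ?expf_neq0 //; ring.
apply: hfun_ext => z zH; rewrite hf0.
by have := fam_neg L0 kp fam s1 zH; rewrite (iv_G iv).
Qed.

(** In charge m the automorphy factor of the leading monomial is that of weight 2m, so the
    coefficients of the translates are the slash translates of the coefficient. *)
Lemma lead_pos n v m q : invs n v -> fil m%:Z v -> Dg q = m%:Z -> mf G L m (v q).
Proof.
move=> iv fv qD; have hn := iv_wt iv.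
have E (r : SL) z : inH z -> pivg r v q z = slash (2 * m) (v q) (smx r) z.
  move=> zH; rewrite (lead_act r hn fv _ zH) ?qD //; congr (_ * _).
  rewrite /jfac hfM // !hfX // jOE // jiOE //.
  have sz : size (val q.2) = (size (val q.1) + m)%N by move: qD; rewrite /Dg; lia.
  rewrite sz mulnDr exprD mulrA -exprMn mulfV ?expr1n ?mul1r //; exact: jac_neq0 (smxP r) zH.
split; first exact: hval_holo.
  by move=> z zH g r gG /=; rewrite -[in LHS](E (smul g r)) // -E // (iv_linv iv).
by move=> r; apply: (qh_ext _ (iv_qh iv r q)) => z zH; exact: E.
Qed.

Definition w1 (q : PP) : V hfun := mono q 1.
Lemma w1_const q : dv dO (w1 q) = 0.
Proof. by rewrite /w1 (dv_mono dO_c) -(rmorph1 cO) dO_c mono0. Qed.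
Lemma w1_charge q : Dh cO dO bO (w1 q) = mu (Dg q)%:~R (w1 q).
Proof. by rewrite /w1 (Dh_mono dO_D dO_M dO_c dO_b) mu_mono. Qed.
Lemma w1_wt q : hv (wt q) (w1 q). Proof. exact: hv_mono. Qed.

Definition phiO : hfun := mkO (let: And3 h _ _ := qh_phi L0 in h).
Lemma phiOE z : inH z -> phiO z = phi z. Proof. exact: mkOE. Qed.

(** The invariant vector with lowest term f at q. In charge 0 the lift of phi is added to the
    monomial, and f will be a constant there. *)
Definition EL (q : PP) (f : hfun) : V hfun :=
  if Dg q == 0 then mu f (w1 q + Lft cO dO bO (wt q) 0 (Tv cO dO bO (w1 q)) phiO)
  else Lft cO dO bO (wt q) (dgn q).-1 (w1 q) f.

Section Pos.
Variables (q : PP) (m : nat).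
Hypothesis qm : Dg q = m.+1%:Z.
Lemma EL_pos f : EL q f = Lft cO dO bO (wt q) m (w1 q) f.
Proof. by rewrite /EL /dgn qm. Qed.
Lemma w1_chargeS : Dh cO dO bO (w1 q) = mu m.+1%:R (w1 q).
Proof. by rewrite w1_charge qm. Qed.
Lemma pivg_Lft g f : pivg g (Lft cO dO bO (wt q) m (w1 q) f) = Lft cO dO bO (wt q) m (w1 q) (sl (actg g) m.+1 f).
Proof. by rewrite /pivg (piv_Lft dO_D dO_M dO_c dO_b ker_dO (w1_const q) w1_chargeS (@w1_wt q)). Qed.
End Pos.

Lemma qh_iter i (f : hfun) : qh L f -> qh L (iter i dO f).
Proof.
move=> qf; elim: i => [|i IH]; first exact: qf.
by apply: (qh_ext _ (qh_der L0 IH)) => z zH; rewrite -[iter i.+1 dO f]/(dO (iter i dO f)) dOE.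
Qed.
Lemma qh_const (f : hfun) : dO f = 0 -> qh L f.
Proof. by move=> /ker_dO[k ->]; apply: (qh_ext _ (qh_cst L k)) => z zH; rewrite cOE. Qed.

Lemma qh_Lft n m (w : V hfun) (f : hfun) p : dv dO w = 0 -> Dh cO dO bO w = mu m.+1%:R w -> hv n w ->
  qh L f -> qh L (Lft cO dO bO n m w f p).
Proof.
move=> wc wd ww qf; rewrite /Lft fct_sumE.
have h j : qh L (mu (iter j dO f) (mj cO dO bO m w j) p).
  have [mc _ _ _] := mj_props dO_D dO_M dO_c dO_b wc wd ww j.
  have cj : dO (mj cO dO bO m w j p) = 0 by have := congr1 (fun u : V hfun => u p) mc.
  by apply: (qh_ext _ (qhM L0 (qh_iter j qf) (qh_const cj))) => z zH; rewrite mux hfM.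
apply: (qh_ext _ (qh_sum L0 (index_enum 'I_n.+2) (F := fun (j : 'I_n.+2) z => mu (iter j dO f) (mj cO dO bO m w j) p z) (fun j => h j))) => z zH.
by rewrite hf_sum.
Qed.

Lemma slE g m (f : hfun) z : inH z -> sl (actg g) m f z = slash (2 * m) f (smx g) z.
Proof. by move=> zH; rewrite /sl hfM // hfX // jiOE // sgOE. Qed.

Lemma mf_slash m (f : hfun) g : mf G L m f -> G (smx g) -> sl (actg g) m f = f.
Proof.
move=> mff gG; apply: hfun_ext => z zH; rewrite slE //.
by have := mf_inv mff zH s1 gG; rewrite smul1 slash_s1.
Qed.

Lemma invs_EL_pos q m (f : hfun) : Dg q = m.+1%:Z -> mf G L m.+1 f -> invs (wt q) (EL q f).
Proof.
move=> qm mff; rewrite (EL_pos qm); split=> [|g gG|r p].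
- exact: (hv_Lft dO_D dO_M dO_c dO_b (w1_const q) (w1_chargeS qm) (@w1_wt q)).
- by rewrite (pivg_Lft qm) mf_slash.
rewrite (pivg_Lft qm); apply: qh_Lft; [exact: w1_const|exact: w1_chargeS|exact: w1_wt|].
by apply: (qh_ext _ (mf_qh mff r)) => z zH; rewrite slE.
Qed.

(** The monomial changes by minus the lift of J'/J, and phi changes under the weight 2 action by
    exactly J'/J; so the sum is fixed by all of SL_2(Z). *)
Lemma invs_EL_0 q (f : hfun) : Dg q = 0 -> mf G L 0 f -> invs (wt q) (EL q f).
Proof.
move=> q0 mff; rewrite /EL q0 eqxx.
have [k hk] := mf_0cst L0 lvl mff.
have -> : f = cO k by apply: hfun_ext => z zH; rewrite hk // cOE.
have wd : Dh cO dO bO (w1 q) = 0 by rewrite w1_charge q0 mu0.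
have Tc := Tw_const dO_D dO_M dO_c dO_b (w1_const q).
have Td := Tw_charge dO_D dO_M dO_c dO_b wd.
have Tt : hv (wt q) (Tv cO dO bO (w1 q)) := @Tw_wt _ _ cO dO bO dO_D _ _ (@w1_wt q).
apply: invsZ; set LT := Lft cO dO bO (wt q) 0 (Tv cO dO bO (w1 q)).
have act g : pivg g (w1 q + LT phiO) = w1 q + LT (sl (actg g) 1 phiO - dO (jO g) * jiO g).
  rewrite (hopD (pivg_hop g)) /pivg (piv_w dO_D dO_M dO_c dO_b ker_dO (actg g) (w1_const q) wd (@w1_wt q)).
  rewrite (piv_Lft dO_D dO_M dO_c dO_b ker_dO Tc Td Tt) -/LT /=.
  have LB x y : LT (x - y) = LT x - LT y by rewrite /LT (LftD _ _ dO_D) (LftN _ dO_D dO_M dO_c).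
  by rewrite LB -addrA [- _ + _]addrC.
have fixp g : sl (actg g) 1 phiO - dO (jO g) * jiO g = phiO.
  apply: hfun_ext => z zH; rewrite hfD // hfN // slE // hfM // dO_j cOE // jiOE // phiOE // /slash muln1.
  by rewrite phiOE ?(qmod_all g zH) ?addrK //; exact: inH_mob (smxP g) zH.
split=> [|g gG|r p]; last 2 first.
- by rewrite act fixp.
- rewrite act fixp vx.
  have q1 : qh L (w1 q p).
    rewrite /w1 /mono; case: eqP => _; apply: qh_const; [rewrite -(rmorph1 cO)|rewrite -(rmorph0 cO)]; exact: dO_c.
  have q2 : qh L (LT phiO p).
    by apply: qh_Lft => //; apply: (qh_ext _ (qh_phi L0)) => z zH; rewrite phiOE.
  by apply: (qh_ext _ (qhD L0 q1 q2)) => z zH; rewrite hfD.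
move=> p pn; rewrite vx (@w1_wt q) // /LT (hv_Lft dO_D dO_M dO_c dO_b Tc Td Tt) // addr0 //.
Qed.

Lemma EL_D q f g : EL q (f + g) = EL q f + EL q g.
Proof. by rewrite /EL; case: eqP => _; [rewrite muDl|rewrite LftD //; exact: dO_D]. Qed.
Lemma EL_c q k f : EL q (cO k * f) = mu (cO k) (EL q f).
Proof. by rewrite /EL; case: eqP => _; [rewrite mu_mu|rewrite Lft_const ?dO_c //; exact: dO_M]. Qed.
Lemma EL_0 q : EL q 0 = 0.
Proof. by have := EL_c q 0 0; rewrite rmorph0 mulr0 mu0. Qed.

Lemma dgpE q : dgp q -> Dg q = (dgn q)%:Z.
Proof. by rewrite /dgp /dgn => h; rewrite gez0_abs. Qed.

(** Triangularity: up to the charge of q the vector has the single coefficient f at q. *)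
Lemma EL_lead q f p : dgp q -> Dg p <= Dg q -> EL q f p = if p == q then f else 0.
Proof.
move=> q0 pq; have wE : w1 q p = if p == q then 1 else 0 by [].
rewrite /EL; case: eqP => D0; last first.
  have [m qm] : exists m : nat, Dg q = m.+1%:Z.
    by have := dgpE q0; case: (dgn q) => [|m] e; [case: D0|exists m].
  rewrite /dgn qm absz_nat /= (Lft_lead dO_D dO_M dO_c dO_b (w1_const q) (w1_chargeS qm) (@w1_wt q)) -?qm //.
  by rewrite wE; case: eqP; rewrite ?mulr1 ?mulr0.
have wd : Dh cO dO bO (w1 q) = 0 by rewrite w1_charge D0 mu0.
have Tc := Tw_const dO_D dO_M dO_c dO_b (w1_const q).
have Td := Tw_charge dO_D dO_M dO_c dO_b wd.
have Tt : hv (wt q) (Tv cO dO bO (w1 q)) := @Tw_wt _ _ cO dO bO dO_D _ _ (@w1_wt q).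
rewrite mux vx (Lft_lead dO_D dO_M dO_c dO_b Tc Td Tt); last by apply: le_trans pq _; rewrite D0.
rewrite (@charge_eq0 _ _ _ _ _ dO_D dO_M dO_c dO_b 1 _ _ Td); last by apply/eqP => e; move: pq; rewrite D0 e.
by rewrite mulr0 addr0 wE; case: eqP; rewrite ?mulr1 ?mulr0.
Qed.

Definition ES n (f : PP -> hfun) : V hfun := \sum_(q <- pps n | dgp q) EL q (f q).
Definition okf (f : PP -> hfun) := forall q, dgp q -> mf G L (dgn q) (f q).

Lemma ES_D n f g : ES n (fun q => f q + g q) = ES n f + ES n g.
Proof. by rewrite /ES -big_split; apply: eq_bigr => q _; rewrite EL_D. Qed.

Lemma invs_EL q f : dgp q -> mf G L (dgn q) f -> invs (wt q) (EL q (toO f)).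
Proof.
move=> q0 mff; have hf := mf_holo mff.
have {}mff : mf G L (dgn q) (toO f).
  split; first exact: hval_holo.
    move=> z zH g r gG; have := mf_inv mff zH r gG; rewrite /slash !toOE //; exact: inH_mob (smxP _) zH.
  move=> r; apply: (qh_ext _ (mf_qh mff r)) => z zH; rewrite /slash toOE //; exact: inH_mob (smxP _) zH.
have := dgpE q0; case E : (dgn q) mff => [|m] mff e; first exact: invs_EL_0.
exact: invs_EL_pos e mff.
Qed.

Lemma invs_ES n f : okf f -> invs n (ES n f).
Proof.
move=> ok; rewrite /ES big_seq_cond; apply: invs_sum => q /andP[]; rewrite mem_pps => /eqP <- q0.
have := invs_EL q0 (ok q q0).
by have -> : toO (f q) = f q by apply: toO_eq => //; exact: hval_holo.
Qed.

Lemma ES_lead n f D q : (forall r, wt r = n -> dgp r -> Dg r < D -> f r = 0) -> Dg q <= D ->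
  ES n f q = if (wt q == n) && dgp q then f q else 0.
Proof.
move=> f0 qD; rewrite /ES fct_sumE big_seq_cond.
have t r : (r \in pps n) && dgp r -> EL r (f r) q = if q == r then f r else 0.
  rewrite mem_pps => /andP[/eqP rn r0]; have [rD|Dr] := ltP (Dg r) D.
    by rewrite (f0 r) // EL_0; case: ifP.
  by apply: EL_lead => //; apply: le_trans Dr.
rewrite (eq_bigr _ t) -big_seq_cond; case: ifP => [/andP[qn q0]|h].
  rewrite big_mkcond (bigD1_seq q) ?pps_uniq ?mem_pps //= q0 eqxx big1 ?addr0 // => r rq.
  by rewrite [q == r]eq_sym (negbTE rq) if_same.
rewrite big_seq_cond big1 // => r; rewrite mem_pps => hr; case: eqP => // qr.
by move: h; rewrite qr hr.
Qed.

Lemma ES_inj n f : ES n f = 0 -> forall q, wt q = n -> dgp q -> f q = 0.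
Proof.
move=> e q; have [k] := ubnP (dgn q); elim: k q => // k IH q; rewrite ltnS => qk qn q0.
have /= := congr1 (fun v : V hfun => v q) e; rewrite (@ES_lead n f (Dg q) q) //.
  by rewrite qn eqxx q0.
move=> r rn r0 rq; apply: IH => //; move: rq; rewrite (dgpE r0) (dgpE q0); lia.
Qed.

Lemma mfO0 m : mf G L m (0 : hfun).
Proof.
have -> : (0 : hfun) = (fun=> 0) :> fn by apply: funext => z; rewrite hf0.
exact: mf0.
Qed.
Lemma mfOD m (f g : hfun) : mf G L m f -> mf G L m g -> mf G L m (f + g).
Proof.
move=> mff mfg; have := mfD L0 mff mfg; congr mf; apply: funext => z.
have [zH|nz] := pselect (inH z); first by rewrite hfD.
by rewrite !hval_off // addr0.
Qed.

(** The lowest charge is removed step by step. Coefficients in negative charge vanish; in charge D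
    >= 0 they are modular forms, and subtracting their lifts raises the filtration. Above charge n
    there are no monomials of weight n. *)
Lemma ES_span n k D v : invs n v -> fil D v -> D + k%:Z = n.+1%:Z -> exists2 f, okf f & v = ES n f.
Proof.
elim: k D v => [|k IH] D v iv fv Dk.
  exists (fun=> 0); first by move=> q _; exact: mfO0.
  rewrite /ES big1 => [|q _]; last exact: EL_0.
  apply/funext => q; have [qn|qn] := eqVneq (wt q) n; last by rewrite (iv_wt iv).
  by rewrite fv //; have := Dg_le q; rewrite qn; lia.
have [D0|D0] := ltP D 0.
  apply: (IH (D + 1) v iv); last lia.
  move=> q qD; have [qe|qne] := eqVneq (Dg q) D; first exact: (lead_neg iv fv D0 qe).
  by apply: fv; move/eqP: qne; lia.
pose m := absz D; have mD : D = m%:Z by rewrite /m gez0_abs.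
pose f0 q : hfun := if Dg q == D then v q else 0.
have ok0 : okf f0.
  move=> q q0; rewrite /f0; case: eqP => [e|_]; last exact: mfO0.
  have -> : dgn q = m by rewrite /dgn e.
  by apply: (lead_pos iv); rewrite -?mD.
have iv' : invs n (v - ES n f0) by apply: invsD => //; apply: invsN; exact: invs_ES.
have [||f okf1 e] := IH (D + 1) _ iv'; last 2 first.
- lia.
- exists (fun q => f0 q + f q); first by move=> q q0; apply: mfOD; [exact: ok0|exact: okf1].
  by rewrite ES_D -e addrC subrK.
move=> q qD; rewrite !vx (@ES_lead n f0 D q); last lia.
  have [qe|qne] := eqVneq (Dg q) D; last first.
    have qv : v q = 0 by apply: fv; move/eqP: qne; lia.
    by rewrite qv /f0 (negbTE qne) if_same subr0.
  rewrite /f0 qe eqxx /dgp qe D0 andbT; case: eqVneq => [_|qn]; first by rewrite subrr.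
  by rewrite (iv_wt iv) // subr0.
by move=> r _ _ rD; rewrite /f0 lt_eqF.
Qed.

(** Charges in weight n lie between -n and n, hence 2n + 1 steps. *)
Lemma invs_span n v : invs n v -> exists2 f, okf f & v = ES n f.
Proof.
move=> iv; apply: (@ES_span n (2 * n).+1 (- n%:Z) v iv); last lia.
move=> q qD; apply: (iv_wt iv); apply/eqP => qn; move: qD; rewrite /Dg -qn /wt /wts /=.
have szw (l : Ptn) : (size (val l) <= sumn (val l))%N.
  case: l => l /= /andP[_]; elim: l => //= x l IH /andP[x0 /IH]; lia.
have := szw q.1; move: (size _) (size _) (sumn _) (sumn _) => a b c d; lia.
Qed.

Lemma hv_EL q f : dgp q -> hv (wt q) (EL q f).
Proof.
move=> q0; have := dgpE q0; case: (dgn q) => [|m] e; last first.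
  by rewrite (EL_pos e); exact: (hv_Lft dO_D dO_M dO_c dO_b (w1_const q) (w1_chargeS e) (@w1_wt q)).
have wd : Dh cO dO bO (w1 q) = 0 by rewrite w1_charge e mu0.
have Tc := Tw_const dO_D dO_M dO_c dO_b (w1_const q).
have Td := Tw_charge dO_D dO_M dO_c dO_b wd.
have Tt : hv (wt q) (Tv cO dO bO (w1 q)) := @Tw_wt _ _ cO dO bO dO_D _ _ (@w1_wt q).
rewrite /EL e eqxx => p pn; rewrite mux vx (@w1_wt q) // (hv_Lft dO_D dO_M dO_c dO_b Tc Td Tt) //.
by rewrite addr0 mulr0.
Qed.

Definition bl (cs : seq C) (bs : seq fn) : hfun := \sum_(cf <- zip cs bs) cO cf.1 * toO cf.2.

Definition isbasis (m : nat) (bs : seq fn) :=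
  [/\ forall i, (i < size bs)%N -> mf G L m (nth (fun=> 0) bs i),
      forall cs, size cs = size bs -> bl cs bs = 0 -> forall i, nth 0 cs i = 0 &
      forall f : hfun, mf G L m f -> exists2 cs, size cs = size bs & f = bl cs bs].

Lemma blE cs bs z : size cs = size bs -> (forall i, (i < size bs)%N -> holo (nth (fun=> 0) bs i)) -> inH z ->
  bl cs bs z = lincomb_fn cs bs z.
Proof.
move=> e hb zH; rewrite /bl hf_sum // /lincomb_fn.
elim: cs bs e hb => [|c cs IH] [|b bs] // e hb; first by rewrite !big_nil.
case: e => e; have hb0 : holo b by exact: (hb 0%N isT).
rewrite -[zip _ _]/((c, b) :: zip cs bs) big_cons [RHS]big_cons hfM // cOE // (toOE hb0 zH).
by rewrite (IH bs e (fun i ib => hb i.+1 ib)).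
Qed.

Lemma basis_ex m d : dim_fn (modform (2 * m) G) d -> exists bs, size bs = d /\ isbasis m bs.
Proof.
move=> [bs [sb mb ib gb]]; exists bs; split=> //.
have mb' i : (i < size bs)%N -> mf G L m (nth (fun=> 0) bs i).
  by rewrite sb => /mb /(modformP L0 lvl GS).
have hb i : (i < size bs)%N -> holo (nth (fun=> 0) bs i) by move=> /mb'/mf_holo.
split=> // [cs scs e|f mff].
  by apply: ib => [|z zH]; rewrite -?sb // -(blE scs hb zH) e hf0.
have [cs [scs e]] := gb f (proj2 (modformP L0 lvl GS m f) mff); rewrite -sb in scs.
by exists cs => //; apply: hfun_ext => z zH; rewrite (blE scs hb zH) e.
Qed.

(** * A basis of the invariants of weight n *)

Variables (n : nat) (B : nat -> seq fn).
Hypothesis hB : forall m, isbasis m (B m).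
Definition blk (q : PP) (bs : seq fn) : seq elt := [seq toelt n (EL q (toO f)) | f <- bs].
Definition vsq (qs : seq PP) : seq elt := flatten [seq blk q (B (dgn q)) | q <- qs].

Lemma lincomb_cat (c1 c2 : seq C) (v1 v2 : seq elt) : size c1 = size v1 ->
  lincomb (c1 ++ c2) (v1 ++ v2) = lincomb c1 v1 ++ lincomb c2 v2.
Proof. by move=> e; rewrite /lincomb zip_cat // map_cat flatten_cat. Qed.

Lemma wfe_toelt v : wfe (toelt n v).
Proof. exact: (proj1 (weight_eltP (toelt_weight n v))). Qed.

Lemma blk_sem q cs bs : wt q = n -> dgp q -> size cs = size bs ->
  wfe (lincomb cs (blk q bs)) /\ sem (lincomb cs (blk q bs)) = EL q (bl cs bs).
Proof.
move=> qn q0; elim: cs bs => [|c cs IH] [|b bs] //= e.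
  by split; [constructor|rewrite /bl big_nil EL_0 /sem big_nil].
case: e => e; have [w1' e1] := IH bs e; have [w2 e2] := tscale_sem (holo_cst c) (wfe_toelt (EL q (toO b))).
rewrite [lincomb _ _]/([seq tscale (fun _ => c) t | t <- toelt n (EL q (toO b))] ++ lincomb cs (blk q bs)).
split; first exact: wfe_cat.
rewrite sem_cat e1 e2 /bl big_cons EL_D EL_c toO_c toelt_sem //.
by rewrite -qn; exact: hv_EL.
Qed.

Definition good (qs : seq PP) := uniq qs /\ forall q, q \in qs -> wt q = n /\ dgp q.
Lemma good_cons q qs : good (q :: qs) -> [/\ wt q = n, dgp q, q \notin qs & good qs].
Proof.
move=> [/= /andP[h1 h2] h3]; have [h4 h5] := h3 q (mem_head _ _); split=> //; split=> // r rq.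
by apply: h3; rewrite inE rq orbT.
Qed.

Lemma vsq_sem qs : good qs -> forall cs, size cs = size (vsq qs) -> wfe (lincomb cs (vsq qs)) /\
  exists2 g : PP -> hfun, sem (lincomb cs (vsq qs)) = \sum_(q <- qs) EL q (g q) &
    (forall q, q \in qs -> g q = 0) -> forall i, nth 0 cs i = 0.
Proof.
elim: qs => [|q qs IH] gq cs.
  move=> /size0nil ->; split; first by constructor.
  by exists (fun=> 0); [rewrite big_nil /sem big_nil|move=> _ i; rewrite nth_nil].
have [qn q0 nq gqs] := good_cons gq; pose bs := B (dgn q).
rewrite [vsq _]/(blk q bs ++ vsq qs) size_cat => scs.
have sb : size (blk q bs) = size bs by rewrite size_map.
pose c1 := take (size bs) cs; pose c2 := drop (size bs) cs.
have cE : cs = c1 ++ c2 by rewrite cat_take_drop.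
have s1 : size c1 = size bs by rewrite size_takel // scs sb leq_addr.
have s2 : size c2 = size (vsq qs) by rewrite size_drop scs sb addKn.
have [wf2 [g eg hg]] := IH gqs c2 s2; have [wf1 e1] := blk_sem qn q0 s1.
rewrite cE lincomb_cat ?sb //; split; first exact: wfe_cat.
exists (fun p => if p == q then bl c1 bs else g p).
  rewrite sem_cat e1 eg big_cons eqxx; congr (_ + _); rewrite !big_seq; apply: eq_bigr => p pq.
  by case: eqP => // pe; move: nq; rewrite -pe pq.
move=> z i; have [_ ib _] := hB (dgn q).
have z1 : bl c1 bs = 0 by have := z q (mem_head _ _); rewrite eqxx.
have z2 j : nth 0 c2 j = 0.
  apply: hg => p pq; have := z p; rewrite inE pq orbT => /(_ isT).
  by case: eqP => // pe; move: nq; rewrite -pe pq.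
by rewrite nth_cat; case: ifP => _; rewrite ?z2 // (ib c1 s1 z1).
Qed.

Lemma vsq_span qs : good qs -> forall f : PP -> hfun, okf f ->
  exists2 cs, size cs = size (vsq qs) & sem (lincomb cs (vsq qs)) = \sum_(q <- qs) EL q (f q).
Proof.
elim: qs => [|q qs IH] gq f ok; first by exists [::] => //; rewrite big_nil /sem big_nil.
have [qn q0 nq gqs] := good_cons gq; have [cs2 s2 e2] := IH gqs f ok.
have [_ _ gb] := hB (dgn q); have [cs1 s1 e1] := gb _ (ok q q0).
have [_ es] := blk_sem qn q0 s1; exists (cs1 ++ cs2).
  by rewrite [vsq _]/(blk q (B (dgn q)) ++ vsq qs) !size_cat s2 s1 size_map.
rewrite [vsq _]/(blk q (B (dgn q)) ++ vsq qs) lincomb_cat ?size_map // sem_cat es e2 big_cons.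
by rewrite -e1.
Qed.

Lemma vsq_nth qs : good qs -> forall i, (i < size (vsq qs))%N -> Dch_inv G n (nth [::] (vsq qs) i).
Proof.
elim: qs => [|q qs IH] gq i //; have [qn q0 nq gqs] := good_cons gq.
rewrite [vsq _]/(blk q (B (dgn q)) ++ vsq qs) size_cat nth_cat => hi.
case: ltnP => ib; last by apply: IH => //; rewrite ltn_subLR.
rewrite size_map in ib; rewrite (nth_map (fun=> 0)) //; apply/Dch_invP; split; first exact: toelt_weight.
have [mb _ _] := hB (dgn q); have iv := invs_EL q0 (mb i ib); rewrite qn in iv.
by rewrite toelt_sem //; exact: iv_wt iv.
Qed.

(** The lifts of bases, one block for each monomial of charge at least 0, are independent by
    triangularity and span by [invs_span]. *)
Lemma Dch_dim : dim_elt (Dch_inv G n) (\sum_(q <- pps n | dgp q) size (B (dgn q)))%N.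
Proof.
pose qs := [seq q <- pps n | dgp q].
have gqs : good qs.
  split; first by rewrite filter_uniq // pps_uniq.
  by move=> q; rewrite mem_filter mem_pps => /andP[-> /eqP].
have dE : (\sum_(q <- pps n | dgp q) size (B (dgn q)))%N = size (vsq qs).
  by rewrite size_flatten /shape -map_comp sumnE big_map -big_filter; apply: eq_bigr => q _; rewrite /= size_map.
have ESE f : ES n f = \sum_(q <- qs) EL q (f q) by rewrite /ES big_filter.
rewrite dE; exists (vsq qs); split=> // [i|cs scs e|v iv].
- exact: vsq_nth.
- have [wf [g eg hg]] := vsq_sem gqs scs; apply: hg => q qq; have [qn q0] := gqs.2 q qq.
  apply: (@ES_inj n g _ q qn q0); rewrite ESE -eg.
  have wn : wfe [::] by constructor.
  by have /(eqvP wf wn) -> := e; rewrite /sem big_nil.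
have [wv /invs_span[f ok ev]] := proj1 (Dch_invP n v) iv.
have [cs scs es] := vsq_span gqs ok; exists cs; split=> //.
have [wf _] := vsq_sem gqs scs; have [fv _] := weight_eltP wv.
by apply/(eqvP fv wf); rewrite es ev ESE.
Qed.
End Invariants.

Theorem theorem1p1 (G : 'M[int]_2 -> Prop) (hG : congruence_subgroup G) :
  exists dM dD : nat -> nat,
    [/\ (forall m, dim_fn (modform (2 * m) G) (dM m)),
        (forall N, dim_elt (Dch_inv G N) (dD N)) &
        (forall N, (dD N)%:Z = \sum_(m < N.+1) \sum_(n < N.+1) (dM m)%:Z * gf_coef m n N)].
Proof.
have [GS G1 _ _ [L [L0 lvl]]] := hG.
have /choice[dM hM] := fun m => mf_dim L0 lvl GS m.
have /choice[B hB] := fun m => basis_ex L0 lvl GS (hM m).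
exists dM, (fun N => \sum_(q <- pps N | dgp q) dM (dgn q))%N; split=> // [N|N]; last exact: gf_sum.
have := Dch_dim L0 lvl GS G1 N (fun m => (hB m).2); congr dim_elt.
by apply: eq_bigr => q _; have [-> _] := hB (dgn q).
Qed.
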